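(* Let $G$ be a countably infinite group and let $(L,\lambda)$ and $(K,\kappa)$ be standard probability spaces with $L$ and $K$ finite. If $\mathrm{H}(L,\lambda)=\mathrm{H}(K,\kappa)$, then the Bernoulli shifts $G\curvearrowright(L^G,\lambda^G)$ and $G\curvearrowright(K^G,\kappa^G)$ are finitarily isomorphic.
   Context: For a standard probability space $(L,\lambda)$ and a countable group $G$, the Bernoulli shift over $G$ with base $(L,\lambda)$ is the product probability space $(L^G,\lambda^G)$ together with the left-shift action $(g\cdot x)(t)=x(g^{-1}t)$ for $g,t\in G$, $x\in L^G$. When $L$ is finite it carries the discrete topology and $L^G$ the product topology. The Shannon entropy of a finite probability space is $\mathrm{H}(L,\lambda)=\sum_{\ell\in L}-\lambda(\ell)\log\lambda(\ell)$ (convention $0\log 0=0$). A measure-preserving map $\phi:(X,\mu)\to(Y,\nu)$ between topological measure spaces is finitary if there is a conull set $X_0\subseteq X$ such that the restriction of $\phi$ to $X_0$ is continuous with respect to the subspace topology. Two probability-measure-preserving actions $G\curvearrowright(X,\mu)$ and $G\curvearrowright(Y,\nu)$ on topological measure spaces are finitarily isomorphic if there is a $G$-equivariant measure-space isomorphism $\phi:(X,\mu)\to(Y,\nu)$ (modulo null sets) such that both $\phi$ and $\phi^{-1}$ are finitary. *)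

(* Defs.v *)
From HB Require Import structures.
From mathcomp Require Import all_boot all_order all_algebra.
From mathcomp Require Import all_classical all_reals all_analysis.
Set Implicit Arguments.
Unset Strict Implicit.
Unset Printing Implicit Defensive.
Import Order.TTheory GRing.Theory Num.Theory.
Local Open Scope classical_set_scope.
Local Open Scope ring_scope.

#[short(type="topMeasurableType")]
HB.structure Definition TopMeasurable (d : measure_display) :=
  {T of Topological T & Measurable d T}.

(* L^I, with the product of the discrete topologies on L and the product
   sigma-algebra. The choice of topology on L is the intended one for finite L. *)
Definition config (I L : Type) : Type := I -> L.

Definition coord_sets (I : Type) d (L : measurableType d) :
    set (set (config I L)) :=
  [set (fun x : config I L => x i) @^-1` B | i in setT & B in measurable].
Arguments coord_sets : clear implicits.
Arguments coord_sets I {d} L.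

Definition config_display (d : measure_display) : measure_display.
Proof. exact: d. Qed.

Section config_instances.
Context (I : choiceType) (d : measure_display) (L : measurableType d).

HB.instance Definition _ := Pointed.copy (config I L)
  (prod_topology (fun _ : I => discrete_topology L)).
HB.instance Definition _ := Topological.copy (config I L)
  (prod_topology (fun _ : I => discrete_topology L)).
HB.instance Definition _ := @isMeasurable.Build (config_display d) (config I L)
  <<s coord_sets I L >>
  (@sigma_algebra0 _ setT (coord_sets I L))
  (@sigma_algebraC _ (coord_sets I L))
  (@sigma_algebra_bigcup _ setT (coord_sets I L)).

End config_instances.

Section product_probability.
Context (R : realType) (I : choiceType) (d : measure_display).
Context (L : measurableType d) (lambda : probability L R).

Definition is_product_probability (P : probability (config I L) R) : Prop :=
  forall (s : seq I) (B : I -> set L), uniq s -> (forall i, measurable (B i)) ->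
    P [set x | forall i, i \in s -> B i (x i)]
    = (\prod_(i <- s) fine (lambda (B i)))%:E.

(* The product measure lambda^I: it is unique on measurable sets whenever it
   exists (product_probability_unique), and it exists when I is countable and L
   is finite and discrete (product_probabilityP). *)
Definition product_probability : probability (config I L) R :=
  get is_product_probability.

End product_probability.

Definition bernoulli_shift (G : groupType) (L : Type) (g : G)
    (x : config G L) : config G L := fun t => x (g^-1 * t)%g.

Definition shannon_entropy (R : realType) (d : measure_display)
    (L : measurableType d) (lambda : probability L R) : R :=
  \sum_(l \in [set: L])
    - (fine (lambda [set l]) * ln (fine (lambda [set l]))).

Definition finitary (R : realType) (dX dY : measure_display)
    (X : topMeasurableType dX) (Y : topMeasurableType dY)
    (mu : probability X R) (phi : X -> Y) : Prop :=
  exists X0 : set X, mu.-negligible (~` X0) /\ {within X0, continuous phi}.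

(* psi is the inverse of phi modulo null sets. *)
Definition finitarily_isomorphic (R : realType) (dX dY : measure_display)
    (X : topMeasurableType dX) (Y : topMeasurableType dY) (G : Type)
    (actX : G -> X -> X) (mu : probability X R)
    (actY : G -> Y -> Y) (nu : probability Y R) : Prop :=
  exists (phi : {mfun X >-> Y}) (psi : {mfun Y >-> X}),
    [/\ (forall B, measurable B -> pushforward mu phi B = nu B) /\
        (forall A, measurable A -> pushforward nu psi A = mu A),
        {ae mu, forall x, psi (phi x) = x} /\
        {ae nu, forall y, phi (psi y) = y},
        (forall g, {ae mu, forall x, phi (actX g x) = actY g (phi x)}),
        finitary mu phi
      & finitary nu psi].

(* Existence of the product measure: integrating out the coordinates one at a
   time gives a content on the algebra of sets determined by finitely many
   coordinates of L^nat, which is sigma-additive by compactness; its extension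
   is then transported along an injection of I into nat. *)
Definition determined (L : Type) (n : nat) (U : Type) (u : (nat -> L) -> U) :=
  forall x y, (forall i, (i < n)%N -> x i = y i) -> u x = u y.

Lemma determinedW (L : Type) n m (U : Type) (u : (nat -> L) -> U) :
  (n <= m)%N -> determined n u -> determined m u.
Proof. by move=> nm du x y xy; apply: du => i /leq_trans/(_ nm); exact: xy. Qed.

Definition clopenT (L : Type) := nat -> L.

Section clopen_algebra.
Context (L : pointedType).

Definition clopen_sets : set (set (clopenT L)) :=
  [set A | exists n, determined n A].

Lemma clopen_sets0 : clopen_sets set0.
Proof. by exists 0%N. Qed.

Lemma clopen_setsC : setC_closed clopen_sets.
Proof. by move=> A [n dA]; exists n => x y xy; rewrite /setC/mkset (dA _ _ xy). Qed.

Lemma clopen_setsU : setU_closed clopen_sets.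
Proof.
move=> A B [n dA] [m dB]; exists (maxn n m) => x y xy.
have dA' := determinedW (leq_maxl n m) dA.
have dB' := determinedW (leq_maxr n m) dB.
by rewrite /setU/mkset (dA' _ _ xy) (dB' _ _ xy).
Qed.

HB.instance Definition _ := Pointed.copy (clopenT L) (nat -> L).
HB.instance Definition _ := @isAlgebraOfSets.Build default_measure_display
  (clopenT L) clopen_sets clopen_sets0 clopen_setsU clopen_setsC.

Lemma clopenP (A : set (clopenT L)) : measurable A -> exists n, determined n A.
Proof. by []. Qed.

End clopen_algebra.

Section iid_sequence.
Context (R : realType) d (L : measurableType d) (lambda : probability L R).
Context (finL : finite_set [set: L]) (discL : forall A : set L, measurable A).
Local Notation T := (clopenT L).
Local Open Scope ereal_scope.

Definition upd (x : T) n l : T := fun i => if i == n then l else x i.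

Definition expect n (u : T -> \bar R) : T -> \bar R :=
  fun x => \int[lambda]_l u (upd x n l).

Fixpoint mean n (u : T -> \bar R) : T -> \bar R :=
  if n is m.+1 then mean m (expect m u) else u.

Lemma mean_ge0 n u : (forall x, 0 <= u x) -> forall x, 0 <= mean n u x.
Proof.
elim: n u => //= n ih u u0; apply: ih => x; exact: integral_ge0.
Qed.

Lemma meanD n u v : (forall x, 0 <= u x) -> (forall x, 0 <= v x) ->
  mean n (u \+ v) = mean n u \+ mean n v.
Proof.
elim: n u v => //= n ih u v u0 v0.
rewrite -ih; [|by move=> x; exact: integral_ge0..].
by congr mean; apply/funext => x; rewrite /expect/= ge0_integralD.
Qed.

Lemma mean_determined n m u : (n <= m)%N -> determined n u ->
  mean m u = mean n u.
Proof.
move=> + du; elim: m => [|m ih]; first by rewrite leqn0 => /eqP ->.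
rewrite leq_eqVlt => /predU1P[->//|]; rewrite ltnS => nm /=.
rewrite -(ih nm); congr mean; apply/funext => x; rewrite /expect.
rewrite (eq_integral (cst (u x))) => [|l _].
  by rewrite integral_cst// [X in _ * X]probability_setT mule1.
by apply: du => i lim; rewrite /upd ltn_eqF// (leq_trans lim).
Qed.

Lemma mean_cylinder n (C : nat -> set L) (c : R) : (0 <= c)%R ->
  mean n (fun x => (c * \1_[set x : T | forall i, (i < n)%N -> C i (x i)] x)%:E)
  = cst (c * \prod_(i < n) fine (lambda (C i)))%:E.
Proof.
elim: n c => [|n ih] c c0 /=.
  apply/funext => x; rewrite big_ord0 /cst indicE mem_set//.
rewrite big_ord_recr/= [in RHS]mulrA [in RHS]mulrAC -ih ?mulr_ge0 ?fine_ge0//.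
congr mean; apply/funext => x; rewrite /expect.
set A := [set x | _]; set B := [set x | _].
rewrite (eq_integral (fun l => (c * \1_B x)%:E * (\1_(C n) l)%:E)); last first.
  move=> l _; rewrite -EFinM -mulrA; congr (_ * _)%:E.
  rewrite !indicE -natrM mulnb; congr (nat_of_bool _)%:R.
  apply/idP/idP.
    rewrite inE => Al; apply/andP; split; rewrite inE.
      move=> i lin; have := Al i (ltnW lin).
      by rewrite /upd ltn_eqF.
    by have := Al n (leqnn _); rewrite /upd eqxx.
  move=> /andP[]; rewrite !inE => Bx Cl i; rewrite ltnS leq_eqVlt /upd.
  by case: eqP => [->//|_ /=]; exact: Bx.
rewrite ge0_integralZl//.
- by rewrite integral_indic// setIT [in RHS]mulrAC [in RHS]EFinM fineK ?fin_num_measure.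
- by rewrite lee_fin mulr_ge0.
Qed.

Definition premeasure (A : set T) : \bar R :=
  mean (get [set n | determined n A]) (EFin \o \1_A) point.

Lemma determined_indic n (A : set T) : determined n A ->
  determined n (EFin \o (\1_A : T -> R)).
Proof.
move=> dA x y xy; have e := dA _ _ xy; rewrite /= !indicE.
by congr (nat_of_bool _)%:R%:E; apply/idP/idP; rewrite !inE e.
Qed.

Lemma premeasureE n (A : set T) : determined n A ->
  premeasure A = mean n (EFin \o \1_A) point.
Proof.
move=> dA; rewrite /premeasure; set m := get _.
have dm : determined m A by apply: (@getI _ [set n | determined n A] n).
have [mn|/ltnW nm] := leqP m n.
  by rewrite (mean_determined mn)//; exact: determined_indic.
by rewrite -(mean_determined nm)//; exact: determined_indic.
Qed.

Lemma premeasure_cylinder n (C : nat -> set L) :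
  premeasure [set x : T | forall i, (i < n)%N -> C i (x i)]
  = (\prod_(i < n) fine (lambda (C i)))%:E.
Proof.
rewrite (@premeasureE n).
  rewrite -[X in mean _ X](_ : (fun x => (1 * \1_[set x : T | forall i, (i < n)%N -> C i (x i)] x)%:E) = _).
    by rewrite mean_cylinder// mul1r.
  by apply/funext => x; rewrite mul1r.
move=> x y xy; apply/propext; split=> h i lin.
  by rewrite -xy//; exact: h.
by rewrite xy//; exact: h.
Qed.

Lemma premeasure_ge0 A : 0 <= premeasure A.
Proof. by apply: mean_ge0 => x; rewrite lee_fin. Qed.

Lemma premeasure0 : premeasure set0 = 0.
Proof. by rewrite (@premeasureE 0)//= indic0. Qed.

Lemma premeasureU (A B : set T) : measurable A -> measurable B ->
  A `&` B = set0 -> premeasure (A `|` B) = premeasure A + premeasure B.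
Proof.
move=> /clopenP[n dA] /clopenP[m dB] AB.
have {}dA := determinedW (leq_maxl n m) dA.
have {}dB := determinedW (leq_maxr n m) dB.
have dAB : determined (maxn n m) (A `|` B).
  by move=> x y xy; rewrite /setU/mkset (dA _ _ xy) (dB _ _ xy).
rewrite (premeasureE dA) (premeasureE dB) (premeasureE dAB).
rewrite -[RHS]/((mean _ _ \+ mean _ _) _) -meanD; last 2 first.
- by move=> x; rewrite lee_fin.
- by move=> x; rewrite lee_fin.
congr (mean _ _ _); apply/funext => x /=.
rewrite !indicE in_setU -EFinD; congr _%:E.
have [xA|] := boolP (x \in A); last by rewrite add0r.
have [xB|] := boolP (x \in B); last by rewrite addr0.
suff : set0 x by []; rewrite -AB; split; exact: set_mem.
Qed.

Lemma clopen_disjoint_finite (F : (set T)^nat) :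
  (forall i, measurable (F i)) -> trivIset setT F ->
  measurable (\bigcup_i F i) -> exists N, forall i, (N <= i)%N -> F i = set0.
Proof.
move=> mF tF mUF; pose X := config nat L.
have cX : compact [set: X].
  rewrite (_ : setT = [set f : X | forall i, [set: discrete_topology L] (f i)]).
    apply: (@tychonoff nat (fun=> discrete_topology L) (fun=> setT)) => i.
    exact: finite_compact.
  by apply/seteqP; split.
have oA (A : set T) : measurable A -> open (A : set X).
  move=> /clopenP[n dA]; rewrite openE => x Ax; rewrite /interior.
  have : nbhs (x : X) [set y : X | forall i, (i < n)%N -> x i = y i].
    elim: n {dA} => [|n ih].
      by apply: filterS (@filterT _ (nbhs (x : X)) _).
    have := @proj_continuous _ (fun=> discrete_topology L) n x _
      (discrete_set1 (x n : discrete_topology L)).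
    move=> h; apply: filterS2 ih h => y yn /= yE i.
    rewrite ltnS leq_eqVlt => /predU1P[->|]; last exact: yn.
    exact/esym.
  by apply: filterS => y xy; rewrite -(dA _ _ xy).
pose H i : set X := if i is j.+1 then F j else ~` (\bigcup_k F k).
have := cX; rewrite compact_cover => /(_ nat setT H).
case=> [[|i] _|x _|D _ TD].
- by apply: (oA (~` _)); exact: measurableC.
- exact: (oA _ (mF i)).
- have [[i _ Fx]|nFx] := pselect ((\bigcup_k F k) x); first by exists i.+1.
  by exists 0%N.
exists (\max_(i <- finmap.enum_fset D) i)%N => i Di; apply/seteqP; split=> // x Fx.
have [[|j] /= jD Hx] := TD x I; first by apply: Hx; exists i.
have ij : j = i by apply: tF => //; exists x.
have := @leq_bigmax_seq _ (finmap.enum_fset D) xpredT id j.+1 jD isT.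
by rewrite ij leqNgt ltnS Di.
Qed.

Lemma premeasure_sigma_additive : semi_sigma_additive premeasure.
Proof.
move=> F mF tF mUF.
have [N FN] := clopen_disjoint_finite mF tF mUF.
have fin n : \sum_(0 <= i < n) premeasure (F i) = premeasure (\big[setU/set0]_(i < n) F i).
  elim: n => [|n ih]; first by rewrite big_geq// big_ord0 premeasure0.
  rewrite big_nat_recr//= ih big_ord_recr/= premeasureU//.
    exact: bigsetU_measurable.
  rewrite -bigcup_mkord; apply/seteqP; split=> // x [[i /= lin Fi] Fn].
  have ein : i = n by apply: tF => //; exists x.
  by rewrite ein ltnn in lin.
rewrite (_ : \bigcup_i F i = \big[setU/set0]_(i < N) F i); last first.
  rewrite -bigcup_mkord; apply/seteqP; split=> x [i _ Fx]; exists i => //=.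
  by rewrite ltnNge; apply/negP => /FN F0; rewrite F0 in Fx.
apply: cvg_near_cst; exists N => // n /= Nn.
rewrite fin -(subnKC Nn) big_split_ord/= [X in _ `|` X]big1 ?setU0// => i _.
by rewrite FN// leq_addr.
Qed.

HB.instance Definition _ := isMeasure.Build _ _ _ premeasure
  premeasure0 premeasure_ge0 premeasure_sigma_additive.

Definition iid_space := g_sigma_algebraType (@measurable _ T).
HB.instance Definition _ := Measurable.on iid_space.

Definition iid : set iid_space -> \bar R := measure_extension premeasure.
HB.instance Definition _ := Measure.on iid.

Lemma iid_cylinder n (C : nat -> set L) :
  iid [set x : T | forall i, (i < n)%N -> C i (x i)]
  = (\prod_(i < n) fine (lambda (C i)))%:E.
Proof.
rewrite -premeasure_cylinder; apply: measurable_mu_extE.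
exists n => x y xy; apply/propext; split=> H i lin.
  by rewrite -xy//; exact: H.
by rewrite xy//; exact: H.
Qed.

Lemma iid_setT : iid setT = 1.
Proof.
have := iid_cylinder 0 (fun=> setT); rewrite big_ord0 => <-.
by congr iid; apply/seteqP; split.
Qed.

HB.instance Definition _ := Measure_isProbability.Build _ _ _ iid iid_setT.

Context (I : choiceType) (f : I -> nat).

Definition reindex (x : iid_space) : config I L := x \o f.

Lemma measurable_reindex : measurable_fun setT reindex.
Proof.
apply: (@measurability _ _ _ _ _ _ (coord_sets I L)) => //.
move=> _ [_ [i _ [B mB <-]] <-]; rewrite setTI; apply: sub_sigma_algebra.
by exists (f i).+1 => x y xy; rewrite /reindex /preimage /mkset /= xy.
Qed.

HB.instance Definition _ := isMeasurableFun.Build _ _ _ _ reindex measurable_reindex.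

Lemma iid_reindex : injective f ->
  is_product_probability lambda (distribution iid reindex).
Proof.
move=> finj s B us mB.
pose C n : set L := [set l | forall i, i \in s -> f i = n -> B i l].
have CB i : i \in s -> C (f i) = B i.
  move=> si; apply/seteqP; split=> l /=; first exact.
  by move=> Bl j _ /finj ->.
have C1 n : n \notin map f s -> fine (lambda (C n)) = 1%R.
  move=> /mapP ns; rewrite (_ : C n = setT) ?probability_setT//.
  apply/seteqP; split=> // l _ i si fi; exfalso; apply: ns; by exists i.
pose n := (\max_(i <- s) f i).+1.
have fn i : i \in s -> (f i < n)%N.
  by move=> si; rewrite ltnS; exact: leq_bigmax_seq.
transitivity (iid [set x : T | forall i, (i < n)%N -> C i (x i)]).
  congr iid; apply/seteqP; split=> x /=.
    by move=> Bx k _ i si fi; rewrite -fi; exact: Bx.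
  move=> Cx i si; exact: (Cx _ (fn _ si) i si erefl).
rewrite iid_cylinder; congr _%:E.
rewrite -(big_mkord xpredT (fun k => fine (lambda (C k)))).
rewrite (bigID (mem (map f s)))/= [X in (_ * X)%R]big1 ?mulr1//.
rewrite -big_filter (perm_big (map f s)); last first.
  apply: uniq_perm; rewrite ?filter_uniq ?iota_uniq ?map_inj_uniq//.
  move=> k; rewrite mem_filter mem_index_iota /=.
  by case: (boolP (k \in map f s)) => //= /mapP[i si ->]; rewrite fn.
rewrite big_map big_seq [RHS]big_seq; apply: eq_bigr => i si.
by rewrite CB.
Qed.

End iid_sequence.

Lemma product_probability_exists (R : realType) (I : choiceType) d
    (L : measurableType d) (lambda : probability L R) :
  countable [set: I] -> finite_set [set: L] ->
  (forall A : set L, measurable A) ->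
  exists P : probability (config I L) R, is_product_probability lambda P.
Proof.
move=> /countable_injP[f finj] finL discL.
eexists; apply: (iid_reindex lambda finL discL (f := f)).
by move=> i j; apply: finj; rewrite inE.
Qed.

Lemma product_probability_unique (R : realType) (I : choiceType) d
    (L : measurableType d) (lambda : probability L R)
    (P Q : probability (config I L) R) :
  is_product_probability lambda P -> is_product_probability lambda Q ->
  forall A, measurable A -> P A = Q A.
Proof.
move=> PP PQ A mA.
pose C : set (set (config I L)) := [set [set x | forall i, i \in sB.1 -> sB.2 i (x i)] |
  sB in [set sB : seq I * (I -> set L) | uniq sB.1 /\ forall i, measurable (sB.2 i)]].
apply: (measure_unique C (fun=> setT)) => //.
- apply/seteqP; split; apply: smallest_sub; try exact: smallest_sigma_algebra.
    move=> _ [i _ [B mB <-]]; apply: sub_sigma_algebra.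
    exists ([:: i], fun=> B) => //=.
    apply/seteqP; split=> x /=; first by apply; rewrite inE.
    by move=> Bx j; rewrite inE => /eqP ->.
  move=> _ [[s B] [/= us mB] <-].
  rewrite (_ : [set x | _] = \big[setI/setT]_(i <- s) (fun x : config I L => x i) @^-1` B i).
    apply: (@bigsetI_measurable _ (config I L)) => i _; apply: sub_sigma_algebra.
    by exists i => //; exists (B i).
  elim: s {us} => [|i s ih]; first by rewrite big_nil; apply/seteqP; split.
  rewrite big_cons -ih; apply/seteqP; split=> x /=.
    move=> h; split; first by apply: h; rewrite inE eqxx.
    by move=> j js; apply: h; rewrite inE js orbT.
  by move=> [Bi h] j; rewrite inE => /predU1P[->//|]; exact: h.
- move=> _ _ [[s B] [/= us mB] <-] [[t D] [/= ut mD] <-].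
  exists (undup (s ++ t), fun i => [set l | (i \in s -> B i l) /\ (i \in t -> D i l)]).
    split=> /=; first exact: undup_uniq.
    move=> i; case: (i \in s); case: (i \in t).
    + rewrite (_ : [set l | _] = B i `&` D i); first exact: measurableI.
      by apply/seteqP; split=> l /=; [move=> [a b]; split; [exact: a|exact: b]|move=> []].
    + rewrite (_ : [set l | _] = B i)//.
      by apply/seteqP; split=> l /=; [move=> [a _]; exact: a|].
    + rewrite (_ : [set l | _] = D i)//.
      by apply/seteqP; split=> l /=; [move=> [_ a]; exact: a|].
    + by rewrite (_ : [set l | _] = setT)//; apply/seteqP; split.
  apply/seteqP; split=> x /=.
    move=> h; split=> i ii.
      by have [|+ _] := h i; [rewrite mem_undup mem_cat ii|exact].
    by have [|_ +] := h i; [rewrite mem_undup mem_cat ii orbT|exact].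
  by move=> [hs ht] i _; split; [exact: hs|exact: ht].
- move=> _; exists ([::], fun=> setT); first by split=> //= i; exact: measurableT.
  by apply/seteqP; split.
- by rewrite bigcup_const.
- by move=> _ [[s B] [/= us mB] <-]; rewrite PP// PQ.
- by move=> _; rewrite [X in (X < _)%E]probability_setT ltry.
Qed.

Lemma product_probabilityP (R : realType) (I : choiceType) d
    (L : measurableType d) (lambda : probability L R) :
  countable [set: I] -> finite_set [set: L] ->
  (forall A : set L, measurable A) ->
  is_product_probability lambda (product_probability I lambda).
Proof. by move=> cI finL discL; apply: getPex; exact: product_probability_exists. Qed.

(* Main.v *)
(* Choose a word of equal probability in both alphabets whose occurrences at
   distinct sites either coincide, are incompatible, or use disjoint coordinates.
   By inclusion-exclusion its occurrence pattern has the same law on both sides, and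
   it is a finitary factor of each shift.  The sites not covered by occurrences split
   into finite isolated clusters; given the pattern their fillings are independent,
   and clusters of a given shape have the same conditional entropy on both sides.

   Clusters of the same shape are paired, by rules reading only the pattern, into
   blocks of doubling length.  Two unpaired blocks that could be
   translated onto each other cannot remain, since otherwise the group would contain
   infinitely many disjoint events of equal positive probability.  A coherent tower
   of couplings between the fillings of a block, each consisting of a matching of
   consecutive intervals, becomes asymptotically deterministic by equipartition, in
   the manner of Keane and Smorodinsky.  Mass transport turns the small proportion
   of undecoded positions of a block into a small probability of not decoding a site.
   The resulting map is finitary, its image law is dominated by, hence equal to, the
   target law, and the symmetric construction inverts it.

   Two alphabets of equal entropy are linked through intermediate alphabets with
   which they share the probability of a suitable word: the smallest letter when
   there are three or more letters, and words on [1, t, t ^+ 2] or on a Klein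
   four-group when there are two. *)

Require Import Defs.
From HB Require Import structures.
From mathcomp Require Import all_boot all_order all_algebra.
From mathcomp Require Import all_classical all_reals all_analysis.
From mathcomp Require Import ring lra zify.

Set Implicit Arguments.
Unset Strict Implicit.
Unset Printing Implicit Defensive.
Import Order.TTheory GRing.Theory Num.Theory.
Local Open Scope classical_set_scope.
Local Open Scope ring_scope.

(** * Couplings of finite distributions *)

(** A general group offers neither an order nor averages along intervals, so long words must be
    manufactured. A block is a finite list of translates of one cluster shape, and the order of the
    list replaces that of the integers. Both sides see the same pattern, so both compute the same
    blocks. Block lengths and tower lengths are powers of two: a block not shorter than a tower
    level is cut by it into exact segments, and merging never moves the cuts.

    Equal entropies leave no room for a coupling in which one side determines the other. The room
    comes from masking: part of each word stays hidden, which makes the entropy of the coupled data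
    strictly smaller than that of full words. The next level uncovers most of what was hidden,
    losing less entropy on the [false] side than on the [true] side, and this ordering lets each
    newly visible word determine the older coupling. A good word thus fixes only the coupling one
    level below, which is why two consecutive levels appear in [dec]. *)

Section Distributions.
Context {R : realType}.
Implicit Types X Y Z I U V T : finType.

Definition pmf X (p : X -> R) := (forall x, 0 <= p x) /\ \sum_x p x = 1.

Definition ent X (p : X -> R) : R := \sum_x - (p x * ln (p x)).

Definition push X Y (f : X -> Y) (p : X -> R) : Y -> R :=
  fun y => \sum_(x | f x == y) p x.

Definition prodw I X (p : I -> X -> R) : {ffun I -> X} -> R :=
  fun v => \prod_i p i (v i).

Lemma sum_push X Y (f : X -> Y) (p : X -> R) (A : pred Y) :
  \sum_(y | A y) push f p y = \sum_(x | A (f x)) p x.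
Proof.
rewrite [RHS](partition_big f A)//=; apply: eq_bigr => y Ay.
by apply: eq_bigl => x; case: eqP => [->|]; rewrite ?Ay ?andbF.
Qed.

Lemma pmf_push X Y (f : X -> Y) (p : X -> R) : pmf p -> pmf (push f p).
Proof.
by move=> [p0 p1]; split=> [y|]; [exact: sumr_ge0|rewrite sum_push].
Qed.

Lemma push_id X (p : X -> R) : push id p =1 p.
Proof. by move=> x; rewrite /push big_pred1_eq. Qed.

Lemma push_push X Y Z (f : X -> Y) (g : Y -> Z) (p : X -> R) :
  push g (push f p) =1 push (g \o f) p.
Proof. by move=> z; rewrite /push sum_push. Qed.

Lemma eq_push X Y (f g : X -> Y) (p q : X -> R) :
  f =1 g -> p =1 q -> push f p =1 push g q.
Proof. by move=> fg pq y; apply: eq_big => x; rewrite ?fg. Qed.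

Lemma eq_ent X (p q : X -> R) : p =1 q -> ent p = ent q.
Proof. by move=> pq; apply: eq_bigr => x _; rewrite pq. Qed.

Lemma pmf_le1 X (p : X -> R) x : pmf p -> p x <= 1.
Proof. by move=> [p0 <-]; rewrite (bigD1 x)//= lerDl sumr_ge0. Qed.

Lemma ln_pmf_le0 X (p : X -> R) x : pmf p -> ln (p x) <= 0.
Proof. by move=> hp; rewrite ln_le0// pmf_le1. Qed.

Lemma expect_prodw I X (p : I -> X -> R) (g : I -> X -> R) :
  \sum_v prodw p v * \prod_i g i (v i) = \prod_i \sum_x p i x * g i x.
Proof. by rewrite bigA_distr_bigA; apply: eq_bigr => v _; rewrite -big_split. Qed.

Lemma pmf_prodw I X (p : I -> X -> R) : (forall i, pmf (p i)) -> pmf (prodw p).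
Proof.
move=> hp; split=> [v|]; first by apply: prodr_ge0 => i _; case: (hp i).
transitivity (\sum_v prodw p v * \prod_i (fun _ _ => 1) i (v i)).
  by apply: eq_bigr => v _; rewrite big1_eq mulr1.
rewrite (expect_prodw p (fun _ _ => 1)) big1// => i _.
by rewrite -[RHS](hp i).2; apply: eq_bigr => x _; rewrite mulr1.
Qed.

Lemma expect1_prodw I X (p : I -> X -> R) i (g : X -> R) :
  (forall i, pmf (p i)) -> \sum_v prodw p v * g (v i) = \sum_x p i x * g x.
Proof.
move=> hp.
transitivity (\sum_v prodw p v * \prod_j (fun j x => if j == i then g x else 1) j (v j)).
  by apply: eq_bigr => v _; rewrite -big_mkcond big_pred1_eq.
rewrite (expect_prodw p (fun j x => if j == i then g x else 1)).
rewrite (bigD1 i)//= eqxx [X in _ * X]big1 ?mulr1// => j /negbTE ->.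
by rewrite -[RHS](hp j).2; apply: eq_bigr => x _; rewrite mulr1.
Qed.

Lemma expect2_prodw I X (p : I -> X -> R) i j (g h : X -> R) :
  (forall i, pmf (p i)) -> i != j -> \sum_v prodw p v * (g (v i) * h (v j)) =
  (\sum_x p i x * g x) * \sum_x p j x * h x.
Proof.
move=> hp ij; pose F k x := if k == i then g x else if k == j then h x else 1.
transitivity (\sum_v prodw p v * \prod_k F k (v k)).
  apply: eq_bigr => v _; rewrite (bigD1 i)// (bigD1 j) 1?eq_sym//=.
  rewrite /F eqxx [j == i]eq_sym (negbTE ij) eqxx big1 ?mulr1//.
  by move=> k /andP[/negbTE-> /negbTE->].
rewrite (expect_prodw p F) (bigD1 i)// (bigD1 j) 1?eq_sym//=.
rewrite [X in _ * (_ * X)]big1 ?mulr1.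
  by rewrite /F eqxx [j == i]eq_sym (negbTE ij) eqxx.
move=> k /andP[/negbTE ki /negbTE kj]; rewrite -[RHS](hp k).2.
by apply: eq_bigr => x _; rewrite /F ki kj mulr1.
Qed.

Lemma push_prodw I X Y (f : I -> X -> Y) (p : I -> X -> R) :
  push (fun v : {ffun I -> X} => [ffun i => f i (v i)]) (prodw p) =1
  prodw (fun i => push (f i) (p i)).
Proof.
move=> z; rewrite /push /prodw bigA_distr_big_dep/=; apply: eq_bigl => v.
apply/eqP/familyP => [<- i|h]; first by rewrite ffunE unfold_in.
by apply/ffunP => i; rewrite ffunE; apply/eqP; exact: h.
Qed.

Lemma prodw_gt0 I X (p : I -> X -> R) v : (forall i, pmf (p i)) ->
  0 < prodw p v -> forall i, 0 < p i (v i).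
Proof.
move=> hp Pv i; rewrite lt_neqAle (hp i).1 andbT eq_sym.
by apply: contraTneq Pv => pi0; rewrite /prodw (bigD1 i)//= pi0 mul0r ltxx.
Qed.

Lemma ln_prod I (F : I -> R) : (forall i, 0 < F i) ->
  ln (\prod_i F i) = \sum_i ln (F i).
Proof.
move=> F0; suff: 0 < \prod_i F i /\ ln (\prod_i F i) = \sum_i ln (F i) by case.
apply: (big_rec2 (fun x y => 0 < y /\ ln y = x)) => [|i y1 y2 _ [y0 <-]].
  by rewrite ln1.
by rewrite lnM ?posrE// mulr_gt0.
Qed.

Lemma ent_prodw I X (p : I -> X -> R) : (forall i, pmf (p i)) ->
  ent (prodw p) = \sum_i ent (p i).
Proof.
move=> hp.
transitivity (\sum_v \sum_i prodw p v * - ln (p i (v i))).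
  apply: eq_bigr => v _; rewrite -mulr_sumr -mulrN.
  have [->|/eqP Pv] := eqVneq (prodw p v) 0; first by rewrite !mul0r.
  have Pv0 : 0 < prodw p v by rewrite lt_neqAle (pmf_prodw hp).1 andbT eq_sym; apply/eqP.
  by rewrite /prodw ln_prod ?sumrN// => i; exact: prodw_gt0.
rewrite exchange_big/=; apply: eq_bigr => i _.
rewrite (expect1_prodw i (fun x => - ln (p i x)) hp).
by apply: eq_bigr => x _; rewrite mulrN.
Qed.

(** Chebyshev's inequality for a sum of independent centred variables [ln (p i x) + ent (p i)]: the
    cross terms vanish, so the variances add. Words of mass zero are excluded because [ln 0] is 0 by
    convention, which would break the additivity of [ln] on products. *)
Lemma aep I X (p : I -> X -> R) (W t : R) : (forall i, pmf (p i)) ->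
  (forall i, \sum_x p i x * (ln (p i x) + ent (p i)) ^+ 2 <= W) -> 0 < t ->
  \sum_(v | (0 < prodw p v) && (t <= `|ln (prodw p v) + \sum_i ent (p i)|))
     prodw p v <= #|I|%:R * W / t ^+ 2.
Proof.
move=> hp hW t0; pose f i x := ln (p i x) + ent (p i).
have f0 i : \sum_x p i x * f i x = 0.
  under eq_bigr do rewrite mulrDr.
  rewrite big_split/= -mulr_suml (hp i).2 mul1r /ent -big_split/=.
  by apply: big1 => x _; rewrite subrr.
have E2 : \sum_v prodw p v * (\sum_i f i (v i)) ^+ 2 <= #|I|%:R * W.
  under eq_bigr do rewrite expr2 mulr_sumr mulr_sumr.
  rewrite exchange_big/= mulr_natl -sumr_const; apply: ler_sum => i _.
  under eq_bigr do rewrite mulr_suml mulr_sumr.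
  rewrite exchange_big/= (bigD1 i)//= [X in _ + X]big1 ?addr0.
    by rewrite (expect1_prodw i (fun x => f i x * f i x) hp); exact: hW.
  by move=> j ji; rewrite (expect2_prodw (f j) (f i) hp ji) f0 mul0r.
rewrite ler_pdivlMr ?exprn_gt0// mulr_suml; apply: le_trans E2.
rewrite big_mkcond; apply: ler_sum => v _; have P0 := (pmf_prodw hp).1 v.
case: ifP => [/andP[Pv tv]|_]; last by rewrite mulr_ge0// sqr_ge0.
rewrite ler_wpM2l// -[leRHS]real_normK ?num_real//.
apply: lerXn2r; rewrite ?nnegrE ?(ltW t0)//; apply: (le_trans tv).
by rewrite /prodw ln_prod ?big_split//; exact: prodw_gt0.
Qed.

End Distributions.

(** * Matching two distributions laid out as intervals *)

Section Couplings.
Context {R : realType}.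
Implicit Types X Y Z I U V T : finType.

(** The length of the intersection of $[x,x']$ and $[y,y']$, written as a second difference of
    minima so that sums over consecutive intervals telescope. *)
Definition overlap (x x' y y' : R) : R :=
  (Num.min x' y' - Num.min x' y) - (Num.min x y' - Num.min x y).

Lemma overlapC (x x' y y' : R) : overlap x x' y y' = overlap y y' x x'.
Proof.
by rewrite /overlap [Num.min y' x']minC [Num.min y' x]minC [Num.min y x']minC
  [Num.min y x]minC; ring.
Qed.

Lemma overlap0l (x x' y y' : R) : x <= x' -> y <= y' -> x' <= y ->
  overlap x x' y y' = 0.
Proof.
by move=> xx yy xy; rewrite /overlap !min_l ?subrr ?(le_trans xx)// (le_trans xy).
Qed.

Lemma overlap_ge0 (x x' y y' : R) : x <= x' -> y <= y' -> 0 <= overlap x x' y y'.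
Proof.
move=> xx yy; rewrite /overlap /Num.min.
by case: (ltP x' y'); case: (ltP x' y); case: (ltP x y'); case: (ltP x y); lra.
Qed.

(** Intervals meeting in positive length, with no end of the first interior to the second, are
    nested: the second lies in the first. *)
Lemma overlap_full (x x' y y' : R) : x <= x' -> y <= y' -> 0 < overlap x x' y y' ->
  ~~ (y < x < y') -> ~~ (y < x' < y') -> overlap x x' y y' = y' - y.
Proof.
move=> xx yy + h1 h2; have [yx|xy] := ltP y x.
  rewrite yx/= -leNgt in h1; by rewrite overlapC overlap0l ?ltxx.
have [yx'|xy'] := ltP y x'; last by rewrite overlap0l ?ltxx.
rewrite yx'/= -leNgt in h2.
by rewrite /overlap [Num.min x' y']min_r// [Num.min x' y]min_r ?(ltW yx')//
  [Num.min x y']min_l ?(le_trans xy)// [Num.min x y]min_l// subrr subr0.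
Qed.

(** At [enum_rank u] this is the left end of the interval assigned to [u], and at its successor the
    right end. *)
Definition cumul U (a : U -> R) (k : nat) : R :=
  \sum_(u | (enum_rank u < k)%N) a u.

Lemma cumul0 U (a : U -> R) : cumul a 0 = 0.
Proof. by rewrite /cumul big1. Qed.

Lemma cumul_card U (a : U -> R) : cumul a #|U| = \sum_u a u.
Proof. by apply: eq_bigl => u; rewrite ltn_ord. Qed.

Lemma cumulS U (a : U -> R) u :
  cumul a (enum_rank u).+1 = cumul a (enum_rank u) + a u.
Proof.
rewrite /cumul (bigD1 u)//= addrC; congr (_ + _); apply: eq_bigl => v.
rewrite ltnS leq_eqVlt; case: (eqVneq v u) => [->|vu]; first by rewrite ltnn andbF.
rewrite andbT; case: eqP => [/val_inj/enum_rank_inj/eqP|//].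
by rewrite (negbTE vu).
Qed.

Lemma cumul_le U (a : U -> R) : (forall u, 0 <= a u) ->
  {homo cumul a : m n / (m <= n)%N >-> m <= n}.
Proof.
move=> a0 m n mn; rewrite [leRHS](bigID (fun u => enum_rank u < m)%N)/=.
rewrite [X in _ <= X + _](_ : _ = cumul a m) ?lerDl ?sumr_ge0// /cumul.
apply: eq_bigl => u; case: (ltnP _ m) => um; last by rewrite andbF.
by rewrite (leq_trans um mn).
Qed.

Lemma sum_overlap U (a : U -> R) y y' : 0 <= y -> y <= y' -> y' <= \sum_u a u ->
  \sum_(u : U) overlap (cumul a (enum_rank u)) (cumul a (enum_rank u).+1) y y' = y' - y.
Proof.
move=> y0 yy ya; pose f k := Num.min (cumul a k) y' - Num.min (cumul a k) y.
rewrite (reindex (@enum_val U U))/=; last first.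
  by apply: onW_bij; exact: enum_val_bij.
under eq_bigr do rewrite enum_valK.
rewrite -(big_mkord xpredT (fun k => f k.+1 - f k)) telescope_sumr//.
have y'0 := le_trans y0 yy.
rewrite /f cumul0 cumul_card [Num.min (\sum_u _) _]min_r//.
by rewrite [Num.min (\sum_u _) _]min_r ?(le_trans yy)// !min_l// subrr subr0.
Qed.

(* Both families are laid out as consecutive intervals and matched by overlap. *)
Lemma interval_coupling U V (a : U -> R) (b : V -> R) :
  (forall u, 0 <= a u) -> (forall v, 0 <= b v) -> \sum_u a u = \sum_v b v ->
  exists c : U -> V -> R, [/\ forall u v, 0 <= c u v,
    forall u, \sum_v c u v = a u, forall v, \sum_u c u v = b v &
    forall u, exists v1 v2 : option V, forall v, 0 < c u v ->
      Some v != v1 -> Some v != v2 -> c u v = b v].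
Proof.
move=> a0 b0 ab.
have aS (u : U) : cumul a (enum_rank u) <= cumul a (enum_rank u).+1.
  by rewrite cumulS lerDl.
have bS (v : V) : cumul b (enum_rank v) <= cumul b (enum_rank v).+1.
  by rewrite cumulS lerDl.
have c0 (W : finType) (d : W -> R) k : (forall w, 0 <= d w) -> 0 <= cumul d k.
  by move=> d0; apply: sumr_ge0.
have c1 (W : finType) (d : W -> R) (w : W) : (forall w, 0 <= d w) ->
    cumul d (enum_rank w).+1 <= \sum_w d w.
  by move=> d0; rewrite -cumul_card; apply: cumul_le.
exists (fun (u : U) (v : V) => overlap (cumul a (enum_rank u)) (cumul a (enum_rank u).+1)
    (cumul b (enum_rank v)) (cumul b (enum_rank v).+1)); split.
- by move=> u v; rewrite overlap_ge0.
- move=> u; under eq_bigr do rewrite overlapC.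
  by rewrite sum_overlap ?c0// -?ab ?c1// cumulS addrC addKr.
- by move=> v; rewrite sum_overlap ?c0// ?ab ?c1// cumulS addrC addKr.
move=> u.
(* A [v] coupled with [u] whose interval is not swallowed by that of [u] has an end of the latter in
   its interior; each of the two ends selects at most one such [v]. *)
pose cut z := [pick v : V | cumul b (enum_rank v) < z < cumul b (enum_rank v).+1].
have cutE z (v : V) : cumul b (enum_rank v) < z < cumul b (enum_rank v).+1 ->
    Some v = cut z.
  rewrite /cut => /andP[z1 z2]; case: pickP => [w /andP[w1 w2]|/(_ v)]; last by rewrite z1 z2.
  congr Some; apply: enum_rank_inj; apply: ord_inj; apply/eqP.
  have lt_cut (v1 v2 : V) : cumul b (enum_rank v1) < z -> z < cumul b (enum_rank v2).+1 ->
      (enum_rank v1 <= enum_rank v2)%N.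
    move=> h1 h2; rewrite leqNgt; apply/negP => /(cumul_le b0) h.
    by have := lt_trans h1 (lt_le_trans h2 h); rewrite ltxx.
  by rewrite eqn_leq !lt_cut.
exists (cut (cumul a (enum_rank u))), (cut (cumul a (enum_rank u).+1)) => v.
move=> c_gt0 n1 n2; rewrite overlap_full//; first by rewrite cumulS addrC addKr.
  by apply: contra n1 => /cutE ->.
by apply: contra n2 => /cutE ->.
Qed.

End Couplings.

(** * Couplings over a common factor, their atypical pairs and their entropy *)

Section RelativeCoupling.
Context {R : realType}.
Implicit Types X Y Z I U V T : finType.

Lemma push_fst U V (c : U * V -> R) u : push fst c u = \sum_v c (u, v).
Proof.
rewrite /push (reindex_onto (fun v => (u, v)) snd)/=.
  by apply: eq_bigl => v; rewrite !eqxx.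
by case=> u' v /= /eqP ->.
Qed.

Lemma push_snd U V (c : U * V -> R) v : push snd c v = \sum_u c (u, v).
Proof.
rewrite /push (reindex_onto (fun u => (u, v)) fst)/=.
  by apply: eq_bigl => u; rewrite !eqxx.
by case=> u v' /= /eqP ->.
Qed.

(** In a tight coupling [c uv <= b uv.2], so at such a pair the mass of [v] is shared between
    several elements [u]. *)
Definition atypical U V (b : V -> R) (c : U * V -> R) : pred (U * V) :=
  fun uv => (0 < c uv) && (c uv != b uv.2).

(* At most two of the [v] coupled with a given [u] are coupled with anything else. *)
Definition tight_coupling U V (a : U -> R) (b : V -> R) (c : U * V -> R) :=
  [/\ forall uv, 0 <= c uv, push fst c =1 a, push snd c =1 b &
      forall u, exists v1 v2 : option V, forall v, 0 < c (u, v) ->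
      Some v != v1 -> Some v != v2 -> c (u, v) = b v].

(** The two laws have the same image on [T], so over each [t] their restrictions, extended by zero,
    have equal total mass and can be matched as intervals; the matchings are then glued along
    [t = tU u]. *)
Lemma relative_coupling U V T (tU : U -> T) (tV : V -> T) (a : U -> R) (b : V -> R) :
  (forall u, 0 <= a u) -> (forall v, 0 <= b v) -> push tU a =1 push tV b ->
  exists c, tight_coupling a b c /\ forall uv, 0 < c uv -> tU uv.1 = tV uv.2.
Proof.
move=> a0 b0 ab.
have /choice[f hf] (t : T) : exists c : U -> V -> R, [/\ forall u v, 0 <= c u v,
    forall u, \sum_v c u v = if tU u == t then a u else 0,
    forall v, \sum_u c u v = if tV v == t then b v else 0 &
    forall u, exists v1 v2 : option V, forall v, 0 < c u v ->
      Some v != v1 -> Some v != v2 -> c u v = if tV v == t then b v else 0].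
  apply: interval_coupling; first by move=> u; case: ifP.
    by move=> v; case: ifP.
  by rewrite -!big_mkcond; exact: ab.
have f0 t u v : tU u != t -> f t u v = 0.
  move=> ut; have [h /(_ u) + _ _] := hf t; rewrite (negbTE ut).
  by move=> e; apply: (psumr_eq0P (fun v _ => h u v) e).
have g0 t u v : tV v != t -> f t u v = 0.
  move=> vt; have [h _ /(_ v) + _] := hf t; rewrite (negbTE vt).
by move=> e; apply: (psumr_eq0P (fun u _ => h u v) e).
exists (fun uv => f (tU uv.1) uv.1 uv.2); split; last first.
  move=> [u v] /= c0; apply/eqP; move: c0; apply: contraTT => uv.
  by rewrite g0 ?ltxx// eq_sym.
split=> [[u v]|u|v|u] /=; first by case: (hf (tU u)).
- by rewrite push_fst/=; case: (hf (tU u)) => _ -> _ _; rewrite eqxx.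
- rewrite push_snd/=; case: (hf (tV v)) => _ _ /(_ v) + _; rewrite eqxx => <-.
  apply: eq_bigr => u _; have [->//|uv] := eqVneq (tU u) (tV v).
  by rewrite g0 1?eq_sym// f0.
case: (hf (tU u)) => _ _ _ /(_ u)[v1 [v2 h]]; exists v1, v2 => v c0 n1 n2.
rewrite (h v)// ifT//; move: c0; apply: contraTT => uv.
by rewrite g0 ?ltxx.
Qed.

Section tight.
Context {U V : finType} (a : U -> R) (b : V -> R) (c : U * V -> R).
Hypotheses (pa : pmf a) (pb : pmf b) (tc : tight_coupling a b c).

Lemma tight_pmf : pmf c.
Proof.
have [c0 ca _ _] := tc; split=> //; rewrite -pa.2.
by rewrite -(eq_bigr _ (fun u _ => ca u)) (sum_push _ _ xpredT).
Qed.

Lemma tight_le uv : c uv <= b uv.2.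
Proof.
have [c0 _ cb _] := tc; rewrite -(cb uv.2) /push (bigD1 uv)//= lerDl.
exact: sumr_ge0.
Qed.

(** A typical pair already carries the whole mass of [v]. *)
Lemma tight_typical_unique u u' v :
  0 < c (u, v) -> ~~ atypical b c (u, v) -> 0 < c (u', v) -> u' = u.
Proof.
have [c0 _ cb _] := tc; rewrite /atypical => cu; rewrite cu/= negbK => /eqP cE cu'.
apply/eqP; apply: contraTT cu' => uu; rewrite -leNgt.
have := cb v; rewrite push_snd (bigD1 u)//= cE (bigD1 u')//=.
have : 0 <= \sum_(i | (i != u) && (i != u')) c (i, v) by apply: sumr_ge0.
by move=> ?; lra.
Qed.

(** Pairs with a heavy [v] or a light [u] are charged to the first two sums. At most $1/s$ elements
    [u] remain, each with at most two atypical partners of mass at most [M]. *)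
Lemma tight_atypical M s : 0 <= M -> 0 < s ->
  \sum_(uv | atypical b c uv) c uv <=
  \sum_(v | M < b v) b v + \sum_(u | a u < s) a u + 2 * M / s.
Proof.
move=> M0 s0; have [c0 ca cb h] := tc.
have key u : s <= a u ->
    \sum_(v | atypical b c (u, v) && (b v <= M)) c (u, v) <= 2 * M.
  move=> sa; have [v1 [v2 hu]] := h u.
  rewrite (@le_trans _ _ (\sum_(v | (Some v == v1) || (Some v == v2))
      (if b v <= M then c (u, v) else 0)))//.
    rewrite big_mkcond [leRHS]big_mkcond; apply: ler_sum => v _.
    rewrite /atypical /=; case: (leP (b v) M) => bM; last by rewrite andbF; case: ifP.
    rewrite andbT; case: ifP => [/andP[cuv ne]|_]; last by case: ifP.
    by case: eqVneq => //= n1; case: eqVneq => //= n2; rewrite hu ?eqxx in ne.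
  have one (w : option V) :
      \sum_(v | Some v == w) (if b v <= M then c (u, v) else 0) <= M.
    case: w => [w|]; last by rewrite big1.
    rewrite (big_pred1 w)//; case: ifP => // bM.
    by rewrite (le_trans (tight_le (u, w))).
  rewrite (bigID (fun v => Some v == v1))/= mulr2n mulrDl !mul1r lerD//.
    by apply: le_trans (one v1); rewrite big_mkcondl; apply: ler_sum => v vE;
      rewrite vE.
  apply: le_trans (one v2); rewrite big_mkcond [leRHS]big_mkcond.
  apply: ler_sum => v _; case: (Some v == v1) => /=; rewrite ?andbT ?andbF//.
  by case: (Some v == v2) => //; case: ifP.
pose P1 (uv : U * V) := M < b uv.2; pose P2 (uv : U * V) := a uv.1 < s.
rewrite (bigID P1)/= -addrA lerD//.
  apply: (@le_trans _ _ (\sum_(uv : U * V | P1 uv) c uv)).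
    by rewrite big_mkcondl; apply: ler_sum => uv _; case: ifP.
  rewrite [leRHS](_ : _ = \sum_(v | M < b v) push snd c v).
    by rewrite sum_push.
  by apply: eq_bigr => v _; rewrite cb.
rewrite (bigID P2)/= lerD//.
  apply: (@le_trans _ _ (\sum_(uv : U * V | P2 uv) c uv)).
    by rewrite big_mkcondl; apply: ler_sum => uv _; case: ifP.
  rewrite [leRHS](_ : _ = \sum_(u | a u < s) push fst c u).
    by rewrite sum_push.
  by apply: eq_bigr => u _; rewrite ca.
apply: (@le_trans _ _ (\sum_(u | s <= a u) 2 * M)); last first.
  rewrite -[leRHS]mulr1 -[X in _ <= _ * X]pa.2 mulr_sumr big_mkcond; apply: ler_sum => u _.
  case: ifP => [sa|_]; last first.
    by rewrite mulr_ge0 ?pa.1// divr_ge0 ?(ltW s0)// mulr_ge0.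
  by rewrite -mulrA ler_peMr ?mulr_ge0// mulrC ler_pdivlMr// mul1r.
rewrite (eq_big (fun uv => (s <= a uv.1) && (atypical b c (uv.1, uv.2) && (b uv.2 <= M)))
  (fun uv => c (uv.1, uv.2))); [|by case=> u v; rewrite /P1 /P2/= -!leNgt andbC -andbA andbCA andbA andbC|by case].
  rewrite -(pair_big_dep (fun u => s <= a u)
    (fun u v => atypical b c (u, v) && (b v <= M)) (fun u v => c (u, v)))/=.
  by apply: ler_sum => u; exact: key.
Qed.

(** Typical pairs are determined by [v] and contribute at most [ent b]. On atypical ones $-c\ln c\le
    c\ln N+1/N$, where $N$ is the number of all pairs; the terms $1/N$ add up to at most 1. *)
Lemma tight_ent : ent c <= ent b +
  (\sum_(uv | atypical b c uv) c uv) * ln (#|U| * #|V|)%:R + 1.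
Proof.
have [c0 ca cb h] := tc; have cp := tight_pmf.
rewrite /ent (bigID (atypical b c))/= addrC -addrA lerD//.
  rewrite (@le_trans _ _ (\sum_v \sum_(u | (0 < c (u, v)) && ~~ atypical b c (u, v))
      - (b v * ln (b v))))//.
    under [leRHS]eq_bigr do rewrite big_mkcond.
    rewrite exchange_big pair_bigA/= big_mkcond/=.
    apply: ler_sum => -[u v] _ /=; have [c00|cn] := eqVneq (c (u, v)) 0.
      by rewrite c00 mul0r oppr0 ltxx/=; case: ifP.
    have -> : 0 < c (u, v) by rewrite lt_neqAle eq_sym cn c0.
    rewrite /=; case: ifP => //; rewrite /atypical lt_neqAle eq_sym cn c0/= negbK.
    by move=> /eqP ->.
  apply: ler_sum => v _.
  have bln : 0 <= - (b v * ln (b v)).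
    by rewrite -mulrN mulr_ge0 ?pb.1// oppr_ge0 ln_pmf_le0.
  case: (pickP (fun u => (0 < c (u, v)) && ~~ atypical b c (u, v))) => [u uP|e].
    rewrite (big_pred1 u)// => u'; apply/idP/eqP => [|->//].
    case/andP: uP => uP1 uP2 /andP[u1 _]; exact: (tight_typical_unique uP1 uP2 u1).
  by rewrite big_pred0.
set N := (#|U| * #|V|)%N.
have cN uv : atypical b c uv -> - (c uv * ln (c uv)) <= c uv * ln N%:R + N%:R^-1.
  move=> /andP[cuv _]; have N0 : 0 < N%:R :> R.
    rewrite ltr0n muln_gt0; apply/andP.
    by split; apply/card_gt0P; [exists uv.1|exists uv.2].
  have Nc : 0 < (N%:R * c uv)^-1 by rewrite invr_gt0 mulr_gt0.
  (* This is $\ln t\le t-1$ at $t=1/(Nc)$. *)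
  have := le_ln1Dx (x := (N%:R * c uv)^-1 - 1); rewrite addrCA subrr addr0.
  rewrite ltrBDl subrr => /(_ Nc).
  rewrite lnV ?posrE ?mulr_gt0// lnM ?posrE// invfM => h1.
  have := ler_wpM2l (ltW cuv) h1; rewrite mulrBr mulrCA divff ?gt_eqF// !mulr1.
  by move=> ?; lra.
apply: (@le_trans _ _ (\sum_(uv | atypical b c uv) (c uv * ln N%:R + N%:R^-1))).
  exact: ler_sum.
rewrite big_split/= -mulr_suml lerD2l sumr_const.
rewrite -[leLHS]mulr_natl; have [N0|N0] := posnP N; first by rewrite N0 invr0 mulr0.
rewrite ler_pdivrMr ?ltr0n// mul1r ler_nat /N -card_prod.
exact: max_card.
Qed.
End tight.
End RelativeCoupling.

(** * A coherent tower of couplings *)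

Section Levels.
Context {R : realType}.
Implicit Types X Y Z I U V T : finType.

Lemma aep_low I X (p : I -> X -> R) (W t mu : R) : (forall i, pmf (p i)) ->
  (forall i, \sum_x p i x * (ln (p i x) + ent (p i)) ^+ 2 <= W) -> 0 < t ->
  mu = \sum_i ent (p i) ->
  \sum_(v | prodw p v < expR (- (mu + t))) prodw p v <= #|I|%:R * W / t ^+ 2.
Proof.
move=> hp hW t0 ->; apply: le_trans (aep hp hW t0).
rewrite big_mkcond [leRHS]big_mkcond; apply: ler_sum => v _.
have P0 := (pmf_prodw hp).1 v; case: ifP => [h|_]; last by case: ifP.
have [P1|P1] := ltP 0 (prodw p v) => /=; last by rewrite (le_trans P1).
rewrite ifT//; move: h; rewrite -ltr_ln ?posrE ?expR_gt0// expRK => h.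
by rewrite ler0_norm; lra.
Qed.

Lemma aep_high I X (p : I -> X -> R) (W t mu : R) : (forall i, pmf (p i)) ->
  (forall i, \sum_x p i x * (ln (p i x) + ent (p i)) ^+ 2 <= W) -> 0 < t ->
  mu = \sum_i ent (p i) ->
  \sum_(v | expR (- (mu - t)) < prodw p v) prodw p v <= #|I|%:R * W / t ^+ 2.
Proof.
move=> hp hW t0 ->; apply: le_trans (aep hp hW t0).
rewrite big_mkcond [leRHS]big_mkcond; apply: ler_sum => v _.
have P0 := (pmf_prodw hp).1 v; case: ifP => [h|_]; last by case: ifP.
have P1 : 0 < prodw p v by apply: lt_trans h; exact: expR_gt0.
rewrite P1/= ifT//; move: h; rewrite -ltr_ln ?posrE ?expR_gt0// expRK => h.
by rewrite ger0_norm; lra.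
Qed.

(** A [v] without typical partner carries all its mass on atypical pairs. *)
Lemma tight_not_good U V (a : U -> R) (b : V -> R) (c : U * V -> R) (good : pred V) :
  tight_coupling a b c ->
  (forall u v, 0 < c (u, v) -> ~~ atypical b c (u, v) -> good v) ->
  \sum_(v | ~~ good v) b v <= \sum_(uv | atypical b c uv) c uv.
Proof.
move=> [c0 ca cb _] h.
apply: (@le_trans _ _ (\sum_(v | ~~ good v) push snd c v)).
  by apply: ler_sum => v _; rewrite cb.
rewrite sum_push big_mkcond [leRHS]big_mkcond; apply: ler_sum => -[u v] _ /=.
have := c0 (u, v); rewrite le_eqVlt => /predU1P[<-|cuv].
  by case: ifP; case: ifP.
by case: ifP => // gv; case: ifP => // /negbT /(h _ _ cuv); rewrite (negbTE gv).
Qed.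

(** On side [b], words live in [lX b] with law [lp], and [lmk] erases their hidden positions. The
    coupling is the law [lr] on [lE]; a coupling word is seen from side [b] as the masked word
    [lev]. *)
Record level := Level { lX : bool -> finType; lE : finType;
  lp : forall b, lX b -> R; lmk : forall b, lX b -> lX b;
  lr : lE -> R; lev : forall b, lE -> lX b }.

(** A new word consists of [m] old ones: the first [h b] keep their mask, the others become fully
    visible. A new coupling word records the [m] old coupling words together with the newly visible
    words of both sides. *)
Definition next (l : level) (m : nat) (h : bool -> nat)
    (r : ({ffun 'I_m -> lE l} * {ffun 'I_m -> lX l true}) *
         {ffun 'I_m -> lX l false} -> R) : level :=
  @Level (fun b => {ffun 'I_m -> lX l b})
    (({ffun 'I_m -> lE l} * {ffun 'I_m -> lX l true}) * {ffun 'I_m -> lX l false})%type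
    (fun b => prodw (fun _ => @lp l b))
    (fun b x => [ffun s : 'I_m => if (s < h b)%N then lmk (x s) else x s]) r
    (fun b => if b return _ -> {ffun 'I_m -> lX l b} then fun e => e.1.2 else fun e => e.2).

Definition parent (l : level) m h r (e : lE (@next l m h r)) : {ffun 'I_m -> lE l} := e.1.1.

(** The strict inequalities are the slack consumed by the next step: the coupling and the visible
    words have less entropy than full words. *)
Definition valid (c : R) (l : level) :=
  [/\ (forall b, pmf (@lp l b)) /\ pmf (@lr l),
    forall b, push (@lev l b) (@lr l) =1 push (@lmk l b) (@lp l b),
    forall b (x : lX l b), lmk (lmk x) = lmk x,
    forall b, ent (@lp l b) = c &
    ent (@lr l) < c /\ forall b, ent (push (@lmk l b) (@lp l b)) < c].

(** The visible part of [x] determines the old coupling words underneath; it need not determine the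
    new one. *)
Definition good (l : level) m h r b (x : lX (@next l m h r) b) : bool :=
  [exists e0, [&& 0 < lr e0, lev b e0 == lmk x &
    [forall e, (0 < lr e) && (lev b e == lmk x) ==> (parent e == parent e0)]]].

Definition refines (e : R) (l : level) m h r (l' := @next l m h r) :=
  [/\ forall b, (h b)%:R <= e * m%:R :> R,
    push (@parent l m h r) (@lr l') =1 prodw (fun _ => @lr l),
    forall x : lE l', 0 < lr x -> forall b s, lmk (lev b x s) = lev b (parent x s) &
    forall b, \sum_(x | ~~ @good l m h r b x) @lp l' b x <= e].

Lemma small_pow (y : R) : 0 < y -> exists a, (2^-1 : R) ^+ a <= y.
Proof.
move=> y0; exists (Num.truncn y^-1).+1; rewrite exprVn -[leRHS]invrK.
rewrite lef_pV2 ?posrE ?exprn_gt0 ?invr_gt0// -natrX.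
apply: (le_trans (ltW (truncnS_gt _))); rewrite ler_nat.
by apply/ltnW/ltn_expl.
Qed.

Lemma sum_if_lt (m h : nat) (x y : R) : (h <= m)%N ->
  \sum_(s < m) (if (s < h)%N then x else y) = h%:R * x + (m%:R - h%:R) * y.
Proof.
move=> hm; rewrite -(big_mkord xpredT (fun s => if (s < h)%N then x else y)).
rewrite (@big_cat_nat _ _ _ h)//= big_nat (eq_bigr (fun=> x)); last by move=> i /andP[_ ->].
rewrite -big_nat sumr_const_nat subn0 mulr_natl; congr (_ + _).
rewrite big_nat (eq_bigr (fun=> y)); last by move=> i /andP[hi _]; rewrite ltnNge hi.
by rewrite -big_nat sumr_const_nat -natrB// mulr_natl.
Qed.


Definition moment X (p : X -> R) := \sum_x p x * (ln (p x) + ent p) ^+ 2.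

Lemma moment_ge0 X (p : X -> R) : pmf p -> 0 <= moment p.
Proof. by move=> hp; apply: sumr_ge0 => x _; rewrite mulr_ge0 ?sqr_ge0 ?hp.1. Qed.

Lemma eq_moment X (p q : X -> R) : p =1 q -> moment p = moment q.
Proof. by move=> pq; apply: eq_bigr => x _; rewrite pq (eq_ent pq). Qed.

(** For large [m] the entropies of the old coupling, of the visible [true] words and of the visible
    [false] words are far apart compared with their fluctuations. The poorer side then has the
    heavier atoms, so most intervals of the richer side fall inside a single atom of the poorer one.
    This is used twice: old coupling words are matched with [true] words, and the resulting pairs
    with [false] words. *)
Lemma step c l eps : valid c l -> 0 < eps -> exists j m h r,
  [/\ m = (2 ^ j)%N, valid (m%:R * c) (@next l m h r) & @refines eps l m h r].
Proof.
move=> [[pX pE] compat idem entX [entE entT]] eps0.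
pose T b := push (@lmk l b) (@lp l b).
pose H b := ent (T b); pose g b := c - H b.
have pT b : pmf (T b) by exact: pmf_push.
have g0 b : 0 < g b by rewrite subr_gt0; exact: entT.
pose eE := ent (@lr l); have ce0 : 0 < c - eE by rewrite subr_gt0.
(* The fractions of blocks left masked, [al] for [true] and [be] for [false], are powers of one
   half, so that they become integers once [m] is a large power of two. They are chosen to make the
   rates [eE], [c - al * g true], [c - be * g false] increase. *)
have [a] : exists a, (2^-1 : R) ^+ a <= Num.min eps ((c - eE) / 4 / g true).
  by apply: small_pow; rewrite lt_min eps0 !divr_gt0.
set al := _ ^+ a; rewrite le_min ler_pdivlMr// => /andP[al_eps al_g].
have al0 : 0 < al by rewrite exprn_gt0// invr_gt0.
have [d] : exists d, (2^-1 : R) ^+ d <= Num.min eps (al * g true / 2 / g false).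
  by apply: small_pow; rewrite lt_min eps0 !(divr_gt0, mulr_gt0).
set be := _ ^+ d; rewrite le_min ler_pdivlMr// => /andP[be_eps be_g].
have be0 : 0 < be by rewrite exprn_gt0// invr_gt0.
(* Consecutive rates differ by at least [3 * del]: one [del] for the fluctuation of each side, and
   one that makes the ratio of atoms at most [expR (- (m%:R * del))]. *)
pose del := Num.min ((c - eE) / 4) (al * g true / 8).
have del0 : 0 < del by rewrite lt_min !(divr_gt0, mulr_gt0).
have [del1 del2] : del <= (c - eE) / 4 /\ del <= al * g true / 8.
  by split; rewrite ge_min lexx ?orbT.
pose W := moment (@lr l) + (moment (@lp l true) + moment (@lp l false)) +
  (moment (T true) + moment (T false)).
have [m1 m2 m3 m4 m5] : [/\ 0 <= moment (@lr l), 0 <= moment (@lp l true),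
   0 <= moment (@lp l false), 0 <= moment (T true) & 0 <= moment (T false)].
  by split; exact: moment_ge0.
have W0 : 0 <= W by rewrite /W; lra.
(* [C1 / m] will bound the atypical mass of the second coupling, and [C1 * Lam + 1] the excess of
   its entropy over that of the visible [false] words. *)
pose C1 := 4 * W / del ^+ 2 + 4 / del.
have C10 : 0 <= C1 by rewrite addr_ge0 ?divr_ge0 ?mulr_ge0 ?sqr_ge0 ?(ltW del0) ?W0.
pose Lam := `|ln ((#|lE l| * #|lX l true|) * #|lX l false|)%:R : R|.
(* Since [j < 2 ^ j], every summand of [j] is also a lower bound for [m]. *)
pose j := (a + d + (Num.truncn (C1 / eps)).+1 +
           (Num.truncn ((C1 * Lam + 1) / (be * g false))).+1)%N.
have [aj dj] : (a <= j)%N /\ (d <= j)%N.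
  by split; rewrite /j -!addnA ?leq_addr// addnCA leq_addr.
have [m mE] : exists m, m = (2 ^ j)%N by exists (2 ^ j)%N.
have jm : (j < m)%N by rewrite mE ltn_expl.
have m0 : 0 < m%:R :> R by rewrite mE ltr0n expn_gt0.
have mC : C1 <= eps * m%:R.
  rewrite mulrC -ler_pdivrMr//; apply/ltW/(lt_le_trans (truncnS_gt _)).
  by rewrite ler_nat (leq_trans _ (ltnW jm))// /j -addnA addnCA leq_addr.
have mL : C1 * Lam + 1 < m%:R * (be * g false).
  rewrite -ltr_pdivrMr ?mulr_gt0//; apply/(lt_le_trans (truncnS_gt _)).
  by rewrite ler_nat (leq_trans _ (ltnW jm))// /j leq_addl.
pose h b := (if b then 2 ^ (j - a) else 2 ^ (j - d))%N.
have hE k : (k <= j)%N -> (2 ^ (j - k))%:R = (2^-1 : R) ^+ k * m%:R.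
  move=> kj; have -> : m%:R = (2 ^ (j - k))%:R * (2 ^+ k : R).
    by rewrite -natrX -natrM -expnD subnK// mE.
  by rewrite exprVn mulrCA mulVf ?mulr1// expf_neq0// pnatr_eq0.
have hm b : (h b <= m)%N by rewrite /h mE; case: b; rewrite leq_exp2l// leq_subr.
pose fr b := if b then al else be.
have hR b : (h b)%:R = fr b * m%:R by rewrite /h /fr; case: b; rewrite hE.
pose Us (_ : 'I_m) := @lr l.
pose f b (s : 'I_m) (x : lX l b) := if (s < h b)%N then lmk x else x.
pose Vs b (s : 'I_m) := push (f b s) (@lp l b).
have pV b s : pmf (Vs b s) by exact: pmf_push.
have VsE b s : Vs b s =1 if (s < h b)%N then T b else @lp l b.
  by rewrite /Vs /f; case: ifP => // _; exact: push_id.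
have entV b s : ent (Vs b s) = if (s < h b)%N then H b else c.
  by rewrite (eq_ent (VsE b s)); case: ifP.
have mu b : m%:R * (c - fr b * g b) = \sum_s ent (Vs b s).
  by under eq_bigr do rewrite entV; rewrite sum_if_lt// hR /g; ring.
have muU : m%:R * eE = \sum_s ent (Us s).
  by rewrite /Us sumr_const card_ord mulr_natl.
have WU s : moment (Us s) <= W by rewrite /W; lra.
have WV b s : moment (Vs b s) <= W.
  by rewrite (eq_moment (VsE b s)) /W; case: b; case: ifP => _; lra.
pose A := prodw Us; pose B b := prodw (Vs b).
have pA : pmf A by exact: pmf_prodw.
have pB b : pmf (B b) by exact: pmf_prodw.
pose tU b (u : {ffun 'I_m -> lE l}) := [ffun s => lev b (u s)].
pose tV b (v : {ffun 'I_m -> lX l b}) := [ffun s => lmk (v s)].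
have UV b : push (tU b) A =1 push (tV b) (B b).
  move=> z; rewrite (push_prodw (fun=> @lev l b)) (push_prodw (fun=> @lmk l b)).
  apply: eq_bigr => s _; rewrite compat push_push; apply: eq_push => // x /=.
  by rewrite /f; case: ifP => //; rewrite idem.
(* First coupling: old coupling words against the newly visible [true] words, over the old masked
   [true] words. *)
have [c1 [tc1 sup1]] := relative_coupling pA.1 (pB true).1 (UV true).
have pc1 := tight_pmf pA tc1.
have UV2 : push (tU false \o fst) c1 =1 push (tV false) (B false).
  by case: tc1 => _ ca _ _ z; rewrite -UV -push_push; exact: eq_push.
(* Second coupling: the pairs so obtained against the newly visible [false] words, over the old
   masked [false] words. *)
have [r [tc2 sup2]] := relative_coupling pc1.1 (pB false).1 UV2.
have pr := tight_pmf pc1 tc2.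
pose kap := W / (m%:R * del ^+ 2).
have kapE : #|'I_m|%:R * W / (m%:R * del) ^+ 2 = kap.
  have gen (x y : R) : x != 0 -> y != 0 -> x * W / (x * y) ^+ 2 = W / (x * y ^+ 2).
    by move=> x0 y0; field; rewrite x0 y0.
  by rewrite card_ord gen ?gt_eqF.
have mdel : 0 < m%:R * del by exact: mulr_gt0.
pose ex := expR (- (m%:R * del)).
have ex_le : ex <= (m%:R * del)^-1.
  rewrite /ex expRN lef_pV2 ?posrE ?expR_gt0//.
  by have := expR_ge1Dx (m%:R * del); lra.
have total : 4 * kap + 4 * ex <= C1 / m%:R.
  have -> : C1 / m%:R = 4 * kap + 4 * (m%:R * del)^-1.
    by rewrite /C1 /kap mulrDl !invfM; ring.
  by rewrite lerD2l ler_pM2l.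
have ratio (x y : R) : x + 3 * del <= y ->
    2 * expR (- (m%:R * y - m%:R * del)) / expR (- (m%:R * x + m%:R * del)) <= 2 * ex.
  move=> xy; rewrite -mulrA -expRN -expRD ler_pM2l// ler_expR.
  by have := ler_wpM2l (ltW m0) xy; clear; rewrite mulrDr; lra.
have kap0 : 0 <= kap by rewrite divr_ge0// mulr_ge0 ?sqr_ge0// ltW.
have ex0 : 0 < ex by exact: expR_gt0.
set s1 := expR (- (m%:R * eE + m%:R * del)).
have low1 : \sum_(u | A u < s1) A u <= kap.
  by rewrite -kapE; exact: (aep_low (fun=> pE) WU mdel muU).
pose M b := expR (- (m%:R * (c - fr b * g b) - m%:R * del)).
have high b : \sum_(v | M b < B b v) B b v <= kap.
  by rewrite -kapE; exact: (aep_high (pV b) (WV b) mdel (mu b)).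
set s2 := expR (- (m%:R * (c - fr true * g true) + m%:R * del)).
have low2 : \sum_(v | B true v < s2) B true v <= kap.
  by rewrite -kapE; exact: (aep_low (pV true) (WV true) mdel (mu true)).
have bad1 : \sum_(uv | atypical (B true) c1 uv) c1 uv <= 2 * kap + 2 * ex.
  have := tight_atypical pA tc1 (ltW (expR_gt0 _) : 0 <= M true) (expR_gt0 _ : 0 < s1).
  have := ratio eE (c - fr true * g true).
  rewrite -/(M true) -/s1 /fr => h1 h2; apply: (le_trans h2).
  have /h1 : eE + 3 * del <= c - al * g true.
    by move: del1 del2 al_g ce0; clear; lra.
  move: (high true) low1; clear; lra.
(* A pair of positive mass is either atypical or has mass [B true v], which is then light itself. *)
have low3 : \sum_(uv | c1 uv < s2) c1 uv <= 3 * kap + 2 * ex.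
  apply: (@le_trans _ _ (\sum_(uv | atypical (B true) c1 uv) c1 uv +
      \sum_(v | B true v < s2) push snd c1 v)); last first.
    have -> : \sum_(v | B true v < s2) push snd c1 v = \sum_(v | B true v < s2) B true v.
      by case: tc1 => _ _ cb _; apply: eq_bigr => v _; rewrite cb.
    by move: bad1 low2; clear; lra.
  rewrite sum_push big_mkcond [X in X + _]big_mkcond [X in _ + X]big_mkcond -big_split.
  apply: ler_sum => uv _ /=; have c10 := pc1.1 uv; rewrite /atypical.
  have [cuv|cuv] := ltP 0 (c1 uv) => /=; last first.
    by rewrite add0r (le_trans (y := 0))//; case: ifP.
  case: eqP => [->|_] /=; first by rewrite add0r.
  by case: ifP => _; case: ifP => _; rewrite ?addr0 ?lerDl ?addr_ge0.
have bad2 : \sum_(uv | atypical (B false) r uv) r uv <= 4 * kap + 4 * ex.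
  have := tight_atypical pc1 tc2 (ltW (expR_gt0 _) : 0 <= M false) (expR_gt0 _ : 0 < s2).
  have := ratio (c - fr true * g true) (c - fr false * g false).
  rewrite -/(M false) -/s2 /fr => h1 h2; apply: (le_trans h2).
  have /h1 : c - al * g true + 3 * del <= c - be * g false.
    by move: del2 be_g al0 (g0 true) (mulr_gt0 al0 (g0 true)); clear; lra.
  move: (high false) low3; clear; lra.
have bad_eps : 4 * kap + 4 * ex <= eps.
  by apply: le_trans total _; rewrite ler_pdivrMr.
exists j, m, h, r.
have push_tm b : push (@lmk (@next l m h r) b) (@lp (@next l m h r) b) =1 B b.
  exact: push_prodw (f b) (fun=> @lp l b).
have compat' b : push (@lev (@next l m h r) b) r =1 B b.
  case: b => z; last by case: tc2 => _ _ ->.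
  transitivity (push snd (push fst r) z); first by rewrite push_push.
  have [_ ca _ _] := tc2; rewrite (eq_push (g := snd) (q := c1))//.
  by case: tc1 => _ _ ->.
have supp b x : 0 < r x -> forall s, lmk (@lev (@next l m h r) b x s) = lev b (@parent l m h r x s).
  have [c20 ca cb _] := tc2; move=> rx s; case: b.
    have c1x : 0 < c1 x.1.
      rewrite -ca push_fst; apply: lt_le_trans rx _; case: x => xa xb /=.
      by rewrite (bigD1 xb)//= lerDl sumr_ge0.
    by have /ffunP/(_ s) := sup1 _ c1x; rewrite !ffunE.
  by have /ffunP/(_ s) := sup2 _ rx; rewrite !ffunE.
split=> //.
  split=> //.
  - by split=> // b; exact: pmf_prodw.
  - by move=> b z; rewrite compat' push_tm.
  - move=> b x; apply/ffunP => s; rewrite !ffunE.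
    by case: (s < h b)%N => //; exact: idem.
  - move=> b; rewrite (ent_prodw (fun=> pX b)) (eq_bigr _ (fun _ _ => entX b)).
    by rewrite sumr_const card_ord mulr_natl.
  have entB b : ent (B b) = m%:R * (c - fr b * g b) by rewrite mu ent_prodw.
  split; last first.
    move=> b; rewrite (eq_ent (push_tm b)) entB ltr_pM2l// ltrBlDr ltrDl.
    by rewrite mulr_gt0// /fr; case: (b).
  (* The atypical mass is $O(1/m)$ and the logarithm of the number of pairs is $O(m)$, so the excess
     entropy stays bounded while the slack [m%:R * (be * g false)] grows. *)
  apply: (le_lt_trans (tight_ent pc1 (pB false) tc2)).
  rewrite entB /fr.
  suff lnL : ln (#|{: {ffun 'I_m -> lE l} * {ffun 'I_m -> lX l true}}| *
      #|{ffun 'I_m -> lX l false}|)%:R <= m%:R * Lam.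
    have bad0 : 0 <= \sum_(uv | atypical (B false) r uv) r uv.
      by apply: sumr_ge0 => uv _; exact: pr.1.
    have h1 := ler_wpM2l bad0 lnL.
    have h2 := ler_wpM2r (mulr_ge0 (ltW m0) (normr_ge0 _ : 0 <= Lam)) (le_trans bad2 total).
    have h3 : C1 / m%:R * (m%:R * Lam) = C1 * Lam by rewrite mulrA divfK ?gt_eqF.
    rewrite h3 in h2; move: h1 h2 mL; clear; rewrite mulrBr; lra.
  rewrite !card_prod !card_ffun card_ord -!expnMn natrX.
  have [N0|N0] := posnP (#|lE l| * #|lX l true| * #|lX l false|)%N.
    rewrite N0 expr0n mE expn_eq0/= -mE ln0//.
    by apply: mulr_ge0; [exact: ltW|exact: normr_ge0].
  by rewrite lnXn ?ltr0n// -[leLHS]mulr_natl ler_pM2l// ler_norm.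
split.
- by move=> b; rewrite hR ler_pM2r// /fr; case: (b).
- case: tc2 => _ ca _ _ z; rewrite -(push_push fst fst).
  by rewrite (eq_push (g := fst) (q := c1))//; case: tc1 => _ ->.
- by move=> x rx b s; exact: supp.
have goodE b (gv : pred {ffun 'I_m -> lX l b}) :
    (forall x, gv (lmk (x : lX (@next l m h r) b)) -> @good l m h r b x) ->
    \sum_(v | ~~ gv v) B b v <= 4 * kap + 4 * ex ->
    \sum_(x | ~~ @good l m h r b x) @lp (@next l m h r) b x <= eps.
  move=> gvP hB; apply: le_trans bad_eps; apply: le_trans hB.
  have -> : \sum_(v | ~~ gv v) B b v =
      \sum_(v | ~~ gv v) push (@lmk (@next l m h r) b) (@lp (@next l m h r) b) v.
    by apply: eq_bigr => v _; rewrite push_tm.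
  rewrite sum_push big_mkcond [leRHS]big_mkcond; apply: ler_sum => x _ /=.
  have p0 := (pmf_prodw (fun _ : 'I_m => pX b)).1 x.
  by case: ifP => [/negP h1|_]; case: ifP => // /negbFE /gvP.
case.
(* A [true] word with a typical partner in the first coupling has only one possible parent, whatever
   the [false] component of the coupling word. *)
- apply: (@goodE true (fun v => [exists u, (0 < c1 (u, v)) && ~~ atypical (B true) c1 (u, v)])).
    move=> x /existsP[u /andP[c1u nat]].
    have [y ry] : exists y, 0 < r ((u, lmk x), y).
      apply/existsP; apply: contraLR c1u; rewrite negb_exists => /forallP ry.
      case: tc2 => _ <- _ _; rewrite push_fst big1 ?ltxx// => y _.
      by apply/eqP; rewrite eq_le (pr.1 _) leNgt ry.
    apply/existsP; exists ((u, lmk x), y); rewrite ry eqxx/=.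
    apply/forallP => -[[u' v'] y']; apply/implyP => /andP[/= ry' /eqP vE].
    subst v'; apply/eqP; rewrite /parent/=; apply: (tight_typical_unique tc1 c1u nat).
    case: tc2 => _ ca _ _; rewrite -ca push_fst (bigD1 y')//=.
    by apply: ltr_wpDr => //; apply: sumr_ge0 => ? _; exact: pr.1.
  apply: (le_trans (tight_not_good tc1 _)); last by move: bad1 kap0 ex0; clear; lra.
  by move=> u v h1 h2; apply/existsP; exists u; rewrite h1.
apply: (@goodE false (fun v => [exists u, (0 < r (u, v)) && ~~ atypical (B false) r (u, v)])).
  move=> x /existsP[u /andP[ru nat]].
  apply/existsP; exists (u, lmk x); rewrite ru eqxx/=.
  apply/forallP => -[u' v']; apply/implyP => /andP[/= ru' /eqP vE].
  by subst v'; rewrite /parent/= (tight_typical_unique tc2 ru nat ru').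
apply: (le_trans (tight_not_good tc2 _)); last exact: bad2.
by move=> u v h1 h2; apply/existsP; exists u; rewrite h1.
Qed.

End Levels.

(** * Words, masks and decoding along the iterated construction *)

Section Tower.
Context {R : realType} (A : bool -> finType) (alpha : forall b, A b -> R).
Context (a0 : forall b, A b).

(** Everything is hidden: the mask is constant and the coupling trivial, so the initial slack is the
    whole entropy of a letter. *)
Definition base : level :=
  @Level R A unit alpha (fun b _ => a0 b) (fun _ => 1) (fun b _ => a0 b).

Definition step_data (l : @level R) := {m : nat & {h : bool -> nat &
  (({ffun 'I_m -> lE l} * {ffun 'I_m -> lX l true}) * {ffun 'I_m -> lX l false} -> R)}}.

Definition step_level (l : level) (d : step_data l) : level :=
  @next R l (projT1 d) (projT1 (projT2 d)) (projT2 (projT2 d)).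

(** Stated for arbitrary levels, so that the recursion defining [lv] carries no proof of validity; a
    level valid for no [c] receives dummy data. *)
Lemma next_level_exists (l : level) (J : nat) : exists d : step_data l,
  forall c, valid c l -> [/\ exists j, projT1 d = (2 ^ j)%N,
    valid ((projT1 d)%:R * c) (step_level d) &
    @refines R (2^-1 ^+ J) l (projT1 d) (projT1 (projT2 d)) (projT2 (projT2 d))].
Proof.
have [[c vl]|nv] := pselect (exists c, valid c l); last first.
  exists (existT _ 0%N (existT _ (fun=> 0%N) (fun=> 0))) => c vl.
  by exfalso; apply: nv; exists c.
have e0 : 0 < 2^-1 ^+ J :> R by rewrite exprn_gt0// invr_gt0.
have [j [m [h [r [mE vl' rf]]]]] := step vl e0.
exists (existT _ m (existT _ h r)) => c' vl2; split=> //; first by exists j.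
suff -> : c' = c by [].
by have [_ _ _ /(_ true) <- _] := vl2; have [_ _ _ /(_ true) -> _] := vl.
Qed.

Definition choose_step l J : step_data l := projT1 (cid (next_level_exists l J)).

Fixpoint lv (J : nat) : level :=
  if J is J'.+1 then step_level (choose_step (lv J') J') else base.

Definition mm J := projT1 (choose_step (lv J) J).
Definition hh J := projT1 (projT2 (choose_step (lv J) J)).
Definition par J (e : lE (lv J.+1)) : {ffun 'I_(mm J) -> lE (lv J)} := e.1.1.
Definition gd J b (x : lX (lv J.+1) b) : bool :=
  @good R (lv J) (mm J) (hh J) (projT2 (projT2 (choose_step (lv J) J))) b x.
Arguments gd J b x : clear implicits.

Fixpoint len (J : nat) : nat := if J is J'.+1 then (mm J' * len J')%N else 1%N.

Fixpoint rd J b (v : nat -> A b) : lX (lv J) b :=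
  match J return lX (lv J) b with
  | J'.+1 => [ffun s : 'I_(mm J') => rd J' (fun i => v (s * len J' + i)%N)]
  | 0 => v 0%N
  end.

Fixpoint lab J b : lX (lv J) b -> nat -> A b :=
  match J return lX (lv J) b -> nat -> A b with
  | J'.+1 => fun x i => if insub (i %/ len J')%N is Some s
                        then lab (x s) (i %% len J') else a0 b
  | 0 => fun x _ => x
  end.

(** A position is revealed once, at some level up to [J], its sub-block lies beyond the masked
    initial part. At level 0 nothing is revealed. *)
Fixpoint rev J b (i : nat) : bool :=
  if J is J'.+1 then (hh J' b <= i %/ len J')%N || rev J' b (i %% len J') else false.

Hypothesis alpha_pmf : forall b, pmf (@alpha b).
Hypothesis ent_pos : 0 < ent (@alpha true).
Hypothesis ent_eq : ent (@alpha true) = ent (@alpha false).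

Lemma ent_dirac (X : finType) (x0 : X) (p : X -> R) :
  (forall x, p x = (x0 == x)%:R) -> ent p = 0.
Proof.
move=> pE; apply: big1 => x _; rewrite pE.
by case: eqP => _; rewrite ?ln1 ?mulr0 ?mul0r oppr0.
Qed.

Lemma push_cst (X Y : finType) (y0 : Y) (p : X -> R) y : pmf p ->
  push (fun=> y0) p y = (y0 == y)%:R.
Proof. by move=> [_ p1]; rewrite /push; case: eqP => _; rewrite ?p1 ?big_pred0_eq. Qed.

Lemma base_valid : valid (ent (@alpha true)) base.
Proof.
have p1 : pmf (fun _ : unit => 1 : R) by split=> //; rewrite big_const card_unit/= addr0.
split=> //=.
- by move=> b z; rewrite (push_cst _ _ p1) (push_cst _ _ (alpha_pmf b)).
- by case.
split; first by rewrite (@ent_dirac _ tt)//; case.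
by move=> b; rewrite (@ent_dirac _ (a0 b))// => x; rewrite (push_cst _ _ (alpha_pmf b)).
Qed.

Lemma lv_valid J : exists c, valid c (lv J).
Proof.
elim: J => [|J [c vJ]]; first by exists (ent (@alpha true)); exact: base_valid.
exists ((mm J)%:R * c); rewrite /mm /= /choose_step.
by case: cid => d /= /(_ c vJ)[].
Qed.

Lemma lv_refines J :
  @refines R (2^-1 ^+ J) (lv J) (mm J) (hh J) (projT2 (projT2 (choose_step (lv J) J))).
Proof.
have [c vJ] := lv_valid J; rewrite /mm /hh /choose_step.
by case: cid => d /= /(_ c vJ)[].
Qed.

Lemma mm_pow J : exists j, mm J = (2 ^ j)%N.
Proof.
have [c vJ] := lv_valid J; rewrite /mm /choose_step.
by case: cid => d /= /(_ c vJ)[].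
Qed.

Lemma len_pow J : exists k, len J = (2 ^ k)%N.
Proof.
elim: J => [|J [k kE]]; first by exists 0%N.
by have [j jE] := mm_pow J; exists (j + k)%N; rewrite /= kE jE expnD.
Qed.

Lemma len_gt0 J : (0 < len J)%N.
Proof. by have [k ->] := len_pow J; rewrite expn_gt0. Qed.

Lemma lp_pmf J b : pmf (@lp R (lv J) b).
Proof. by have [c [[h _] _ _ _ _]] := lv_valid J. Qed.

Lemma lr_pmf J : pmf (@lr R (lv J)).
Proof. by have [c [[_ h] _ _ _ _]] := lv_valid J. Qed.

Lemma push_lev J b : push (@lev R (lv J) b) (@lr R (lv J)) =1
  push (@lmk R (lv J) b) (@lp R (lv J) b).
Proof. by have [c [_ h _ _ _]] := lv_valid J. Qed.

Lemma lmk_idem J b (x : lX (lv J) b) : lmk (lmk x) = lmk x.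
Proof. by have [c [_ _ h _ _]] := lv_valid J. Qed.

Lemma eq_rd J b (v w : nat -> A b) :
  (forall i, (i < len J)%N -> v i = w i) -> rd J v = rd J w.
Proof.
elim: J v w => [|J ih] v w vw; first exact: vw.
apply/ffunP => s; rewrite !ffunE; apply: ih => i iJ; apply: vw => /=.
by rewrite (@leq_trans (s * len J + len J)) ?ltn_add2l// -mulSnr leq_mul2r ltn_ord orbT.
Qed.

Lemma lab_next J b (x : lX (lv J.+1) b) (s : 'I_(mm J)) i : (i < len J)%N ->
  lab x (s * len J + i) = lab (x s) i.
Proof.
move=> iJ /=; rewrite divnMDl ?len_gt0// divn_small// addn0 modnMDl modn_small//.
by rewrite insubT// => sm; congr (lab (x _) i); exact: val_inj.
Qed.

Lemma rev_next J b s i : (i < len J)%N ->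
  rev J.+1 b (s * len J + i) = (hh J b <= s)%N || rev J b i.
Proof.
by move=> iJ /=; rewrite divnMDl ?len_gt0// divn_small// addn0 modnMDl modn_small.
Qed.

Lemma split_index J i : (i < len J.+1)%N ->
  exists (s : 'I_(mm J)) k, (k < len J)%N /\ i = (s * len J + k)%N.
Proof.
move=> iJ; have s1 : (i %/ len J < mm J)%N by rewrite ltn_divLR ?len_gt0.
by exists (Ordinal s1), (i %% len J)%N; rewrite ltn_mod len_gt0 -divn_eq.
Qed.

Lemma lab_rd J b (v : nat -> A b) i : (i < len J)%N -> lab (rd J v) i = v i.
Proof.
elim: J v i => [v [|]//|J ih v i /split_index[s [k [kJ ->]]]].
by rewrite lab_next// ffunE ih.
Qed.

Lemma lab_inj J b (x y : lX (lv J) b) :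
  (forall i, (i < len J)%N -> lab x i = lab y i) -> x = y.
Proof.
elim: J x y => [x y /(_ 0%N)|J ih x y h]; first exact.
apply/ffunP => s; apply: ih => k kJ; rewrite -!lab_next//; apply: h => /=.
by rewrite (@leq_trans (s * len J + len J)) ?ltn_add2l// -mulSnr leq_mul2r ltn_ord orbT.
Qed.

Lemma lmk_next J b (x : lX (lv J.+1) b) (s : 'I_(mm J)) :
  (lmk x : lX (lv J.+1) b) s = if (s < hh J b)%N then lmk (x s) else x s.
Proof. by rewrite ffunE. Qed.

(** With its companion [mask_lab], this identifies a masked word with the family of letters at the
    revealed positions. *)
Lemma lab_mask J b (x : lX (lv J) b) i : (i < len J)%N -> rev J b i ->
  lab (lmk x) i = lab x i.
Proof.
elim: J x i => [//|J ih x i /split_index[s [k [kJ ->]]]].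
rewrite rev_next// !lab_next// lmk_next leqNgt; case: ifP => //= _.
exact: ih.
Qed.

Lemma mask_lab J b (x y : lX (lv J) b) :
  (forall i, (i < len J)%N -> rev J b i -> lab x i = lab y i) -> lmk x = lmk y.
Proof.
elim: J x y => [//|J ih x y h]; apply/ffunP => s; rewrite !lmk_next.
have sJ k : (k < len J)%N -> (s * len J + k < len J.+1)%N.
  move=> kJ; rewrite (@leq_trans (s * len J + len J)) ?ltn_add2l//.
  by rewrite -mulSnr leq_mul2r ltn_ord orbT.
case: ifP => sh.
  apply: ih => k kJ kr; rewrite -!lab_next//; apply: h; first exact: sJ.
  by rewrite rev_next// kr orbT.
apply: lab_inj => k kJ; rewrite -!lab_next//; apply: h; first exact: sJ.
by rewrite rev_next// leqNgt sh.
Qed.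

Lemma parent_pos J (e : lE (lv J.+1)) : 0 < lr e -> forall s, 0 < lr (par e s).
Proof.
move=> re s; have [_ h _ _] := lv_refines J.
apply: (prodw_gt0 (fun=> lr_pmf J)); rewrite -h.
apply: lt_le_trans re _; rewrite /push (bigD1 e)//= lerDl.
by apply: sumr_ge0 => *; exact: (lr_pmf J.+1).1.
Qed.

Lemma lev_parent J (e : lE (lv J.+1)) b s : 0 < lr e ->
  lmk ((lev b e : lX (lv J.+1) b) s) = lev b (par e s).
Proof. by move=> re; have [_ _ h _] := lv_refines J; exact: h. Qed.

Lemma lev_support J (e : lE (lv J)) b : 0 < lr e ->
  exists2 x, 0 < lp x & lmk x = lev b e.
Proof.
move=> re; have : 0 < push (@lmk R (lv J) b) (@lp R (lv J) b) (lev b e).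
  rewrite -push_lev; apply: lt_le_trans re _; rewrite /push (bigD1 e)//= lerDl.
  by apply: sumr_ge0 => *; exact: (lr_pmf J).1.
rewrite /push; apply: contraPP => h; rewrite big1 ?ltxx// => x /eqP xe.
apply/eqP; rewrite eq_le (lp_pmf J b).1 andbT leNgt; apply/negP => x0.
by apply: h; exists x.
Qed.

Lemma lev_masked J (e : lE (lv J)) b : 0 < lr e -> lmk (lev b e) = lev b e.
Proof. by move=> /lev_support -/(_ b)[x _ <-]; rewrite lmk_idem. Qed.

Lemma lab_parent J (e : lE (lv J.+1)) b (s : 'I_(mm J)) k : 0 < lr e -> (k < len J)%N ->
  rev J b k -> lab (lev b e) (s * len J + k) = lab (lev b (par e s)) k.
Proof.
by move=> re kJ kr; rewrite -lev_parent// lab_mask// lab_next.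
Qed.

Definition over J (b : bool) (v : nat -> A b) (e : lE (lv J)) := lev b e = lmk (rd J v).

Lemma over_parent J b (v : nat -> A b) (e : lE (lv J.+1)) (s : 'I_(mm J)) : 0 < lr e -> over v e ->
  over (fun i => v (s * len J + i)%N) (par e s).
Proof.
rewrite /over => re ve; rewrite -lev_parent// ve lmk_next.
by case: ifP => _; rewrite /= ffunE ?lmk_idem.
Qed.

Lemma len_dvd K K' : (K <= K')%N -> (len K %| len K')%N.
Proof.
elim: K' => [|K' ih]; first by rewrite leqn0 => /eqP ->.
by rewrite leq_eqVlt => /predU1P[->//|/ih]; exact: dvdn_mull.
Qed.

Lemma index_step K K' t : (K <= K')%N -> (t.+1 * len K <= len K'.+1)%N ->
  exists (s : 'I_(mm K')) t', (t'.+1 * len K <= len K')%N /\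
    forall i, (t * len K + i = s * len K' + (t' * len K + i))%N.
Proof.
move=> /len_dvd/dvdnP[q lq] tK.
have q0 : (0 < q)%N by have := len_gt0 K'; rewrite lq; case: (q).
have sm : (t %/ q < mm K')%N.
  rewrite ltn_divLR// -(ltn_pmul2r (len_gt0 K)) -mulnA -lq.
  by apply: leq_trans tK; rewrite ltn_pmul2r ?len_gt0.
exists (Ordinal sm), (t %% q)%N; split; first by rewrite lq leq_mul2r ltn_mod q0 orbT.
by move=> i; rewrite /= lq mulnA addnA -mulnDl -divn_eq.
Qed.

Lemma sub_lt (t l l' i : nat) : (t.+1 * l <= l')%N -> (i < l)%N -> (t * l + i < l')%N.
Proof. by move=> tl il; rewrite (leq_trans _ tl)// mulSnr ltn_add2l. Qed.

Lemma top_index K t : (t.+1 * len K <= len K)%N -> t = 0%N.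
Proof.
case: t => // t; rewrite mulSn -[X in (_ <= X)%N]addn0 leq_add2l leqn0.
by rewrite muln_eq0 [len K == _]gtn_eqF ?len_gt0.
Qed.

Lemma rev_lift K K' t b i : (K <= K')%N -> (t.+1 * len K <= len K')%N ->
  (i < len K)%N -> rev K b i -> rev K' b (t * len K + i).
Proof.
elim: K' t => [|K' ih] t.
  by rewrite leqn0 => /eqP -> /top_index ->; rewrite mul0n.
rewrite leq_eqVlt => /predU1P[->|]; first by move=> /top_index ->; rewrite mul0n.
rewrite ltnS => KK /(index_step KK)[s [t' [tK ->]]] iK ir.
by rewrite rev_next ?(sub_lt tK)// ih// orbT.
Qed.

(** Iterating [par] finds, in each aligned sub-block of a coupling word, a coupling word of the
    lower level. Later levels only uncover further positions, so letters revealed below do not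
    change. *)
Lemma descend K K' t (e' : lE (lv K')) : (K <= K')%N -> 0 < lr e' ->
  (t.+1 * len K <= len K')%N -> exists e : lE (lv K), [/\ 0 < lr e,
    forall b (v : nat -> A b), over v e' -> over (fun i : nat => v (t * len K + i)%N : A b) e &
    forall b i, (i < len K)%N -> rev K b i ->
      lab (lev b e') (t * len K + i) = lab (lev b e) i].
Proof.
have top t1 (e1 : lE (lv K)) : 0 < lr e1 -> (t1.+1 * len K <= len K)%N -> exists e : lE (lv K), [/\ 0 < lr e,
    forall b (v : nat -> A b), over v e1 -> over (fun i : nat => v (t1 * len K + i)%N : A b) e &
    forall b i, (i < len K)%N -> rev K b i ->
      lab (lev b e1) (t1 * len K + i) = lab (lev b e) i].
  by move=> re /top_index ->; exists e1; rewrite mul0n.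
elim: K' t e' => [|K' ih] t e'.
  by rewrite leqn0 => /eqP K0; subst K; exact: top.
rewrite leq_eqVlt => /predU1P[K0|]; first by subst K; exact: top.
rewrite ltnS => KK re' /(index_step KK)[s [t' [tK tE]]].
have [e [re eo el]] := ih _ _ KK (parent_pos re' s) tK.
exists e; split=> // [b v ve'|b i iK ir].
  have := eo b _ (over_parent s re' ve'); congr over.
  by apply/funext => i; rewrite -tE.
by rewrite tE -el// -lab_parent ?(sub_lt tK)// (rev_lift KK).
Qed.

(* Reading the [b]-word [v] of length [len J.+1], the [b']-letter at [i] is [a]. *)
Definition dec J (b b' : bool) (v : nat -> A b) (i : nat) (a : A b') :=
  [/\ gd J b (rd J.+1 v), (i < len J.+1)%N, rev J b' (i %% len J) &
    exists e : lE (lv J.+1), [/\ 0 < lr e, over v e & lab (lev b' e) i = a]].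

Arguments dec : clear implicits.

Lemma good_over J (b : bool) (v : nat -> A b) : gd J b (rd J.+1 v) ->
  exists e : lE (lv J.+1), 0 < lr e /\ over v e.
Proof. by move=> /existsP[e /and3P[re /eqP ve _]]; exists e. Qed.

Lemma good_parent J (b : bool) (v : nat -> A b) (e e' : lE (lv J.+1)) : gd J b (rd J.+1 v) ->
  0 < lr e -> over v e -> 0 < lr e' -> over v e' -> par e = par e'.
Proof.
move=> /existsP[e0 /and3P[_ _ /forallP h]] re ve re' ve'.
have /implyP := h e; rewrite re ve eqxx => /(_ isT)/eqP.
have /implyP := h e'; rewrite re' ve' eqxx => /(_ isT)/eqP.
by rewrite /par /parent => -> ->.
Qed.

(** A letter revealed inside its level [J] sub-block is already carried by the parent, which a good
    word determines. *)
Lemma good_label J (b b' : bool) (v : nat -> A b) (e e' : lE (lv J.+1)) i : gd J b (rd J.+1 v) ->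
  (i < len J.+1)%N -> rev J b' (i %% len J) ->
  0 < lr e -> over v e -> 0 < lr e' -> over v e' -> lab (lev b' e) i = lab (lev b' e') i.
Proof.
move=> gv /split_index[s [k [kJ ->]]]; rewrite modnMDl modn_small// => kr re ve re' ve'.
by rewrite !lab_parent// (good_parent gv re ve re' ve').
Qed.

Lemma rev_mod J b i : rev J b (i %% len J) -> rev J.+1 b i.
Proof. by move=> /= ->; rewrite orbT. Qed.

Lemma dec_exists J (b b' : bool) (v : nat -> A b) i : gd J b (rd J.+1 v) -> (i < len J.+1)%N ->
  rev J b' (i %% len J) -> exists a, dec J b b' v i a.
Proof.
move=> gv iJ ir; have [e [re ve]] := good_over gv.
by exists (lab (lev b' e) i); split=> //; exists e.
Qed.

(** Descending from the higher level gives a coupling word over the sub-block, and all coupling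
    words over a good sub-block agree on the letter by [good_label]. *)
Lemma dec_coherent J J' t (b b' : bool) (v : nat -> A b) i a a' : (J <= J')%N ->
  (t.+1 * len J.+1 <= len J'.+1)%N ->
  dec J b b' (fun i => v (t * len J.+1 + i)%N) i a ->
  dec J' b b' v (t * len J.+1 + i) a' -> a = a'.
Proof.
rewrite -ltnS => JJ tJ [gv iJ ir [e [re ve <-]]] [gv' _ _ [e' [re' ve' <-]]].
have [e0 [re0 eo el]] := descend JJ re' tJ.
by rewrite (el b' i) ?rev_mod//; exact: (good_label gv _ _ re ve re0 (eo _ _ ve')).
Qed.

(** A parent [p] of a coupling word over [v] is also over [w], because [w] was decoded from it at
    every revealed position. Descending from [p] to level [J.+1] gives a coupling word over both
    sub-blocks. Goodness on the [w] side makes the decoded letter the one read there, and that is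
    the letter of [v]. *)
Lemma dec_inverse J J' t (b b' : bool) (v : nat -> A b) (w : nat -> A b') i a : (J < J')%N ->
  (t.+1 * len J.+1 <= len J'.+1)%N -> gd J' b (rd J'.+1 v) ->
  (forall i a, dec J' b b' v i a -> w i = a) ->
  dec J b' b (fun i => w (t * len J.+1 + i)%N) i a -> v (t * len J.+1 + i)%N = a.
Proof.
move=> JJ tJ gv wP [gw iJ ir [e0 [re0 ve0 <-]]].
have [e' [re' ve']] := good_over gv.
move: tJ => /(index_step JJ)[s [t' [tK tE]]].
set p := par e' s; have rp : 0 < lr p by exact: parent_pos.
have ovv : over (fun i => v (s * len J' + i)%N) p by exact: over_parent.
have ovw : over (fun i => w (s * len J' + i)%N) p.
  rewrite /over -(lev_masked b' rp); apply: mask_lab => k kJ kr.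
  rewrite lab_rd//; apply/esym; apply: wP; split=> //.
  - by rewrite /= (sub_lt _ kJ)// leq_mul2r ltn_ord orbT.
  - by rewrite modnMDl modn_small.
  - by exists e'; split=> //; rewrite lab_parent.
have [e [re eo el]] := descend JJ rp tK.
have ow := eo _ _ ovw; have ov := eo _ _ ovv.
have wE : (fun i => w (s * len J' + (t' * len J.+1 + i))%N) = (fun i => w (t * len J.+1 + i)%N).
  by apply/funext => k; rewrite -tE.
rewrite wE in ow; rewrite (good_label gw iJ ir re0 ve0 re ow).
rewrite -(lev_masked b re) lab_mask ?rev_mod// ov lab_mask ?rev_mod// lab_rd//.
by rewrite tE.
Qed.

Lemma eq_dec J (b b' : bool) (v w : nat -> A b) i a :
  (forall i, (i < len J.+1)%N -> v i = w i) -> dec J b b' v i a -> dec J b b' w i a.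
Proof. by move=> vw; rewrite /dec /over (eq_rd vw). Qed.

Lemma lp_pos J b (x : lX (lv J) b) i : 0 < lp x -> (i < len J)%N -> 0 < alpha (lab x i).
Proof.
elim: J x i => [//|J ih x i x0 /split_index[s [k [kJ ->]]]].
by rewrite lab_next//; apply: ih => //; exact: (prodw_gt0 (fun=> lp_pmf J b) x0).
Qed.

Lemma dec_pos J b b' v i a : dec J b b' v i a -> 0 < alpha a.
Proof.
move=> [_ iJ ir [e [re ve <-]]].
have [x x0 xe] := lev_support b' re.
by rewrite -xe lab_mask ?rev_mod//; exact: lp_pos.
Qed.

Lemma good_prob J b : \sum_(x | ~~ gd J b x) @lp R (lv J.+1) b x <= 2^-1 ^+ J.
Proof. by have [_ _ _ h] := lv_refines J; exact: h. Qed.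

(* A good word determines the coupling of its blocks, so it decodes to an event of
   the other side with at most the probability of that event. *)
Lemma dec_prob J (b b' : bool) (V : nat -> pred (A b')) :
  \sum_(x : lX (lv J.+1) b | gd J b x && [exists e : lE (lv J.+1),
     [&& 0 < lr e, lev b e == lmk x & [forall i : 'I_(len J.+1),
        rev J b' (i %% len J) ==> V i (lab (lev b' e) i)]]]) lp x <=
  \sum_(y : lX (lv J.+1) b' | [forall i : 'I_(len J.+1),
     rev J b' (i %% len J) ==> V i (lab y i)]) lp y.
Proof.
pose D (z : lX (lv J.+1) b') := [forall i : 'I_(len J.+1),
  rev J b' (i %% len J) ==> V i (lab z i)].
(* The event reads only letters revealed at level [J], so it can be tested on [msk y] for a word and
   on [par' e] for a coupling word; these two have the same law by [mskE]. *)
pose par' (e : lE (lv J.+1)) : lX (lv J.+1) b' := [ffun s => lev b' (par e s)].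
pose msk (y : lX (lv J.+1) b') : lX (lv J.+1) b' := [ffun s => lmk ((y : {ffun _ -> _}) s)].
have D_ext y z : (forall i, (i < len J.+1)%N -> rev J b' (i %% len J) ->
    lab y i = lab z i) -> D y = D z.
  move=> yz; apply: eq_forallb => i.
  case: (boolP (rev J b' _)) => // ir; congr (_ ==> V i _).
  by apply: yz.
have Dmask y : D (msk y) = D y.
  apply: D_ext => i /split_index[s [k [kJ ->]]]; rewrite modnMDl modn_small// => kr.
  by rewrite !lab_next// ffunE lab_mask.
have Dpar e : 0 < lr e -> D (lev b' e) = D (par' e).
  move=> re; apply: D_ext => i /split_index[s [k [kJ ->]]].
  by rewrite modnMDl modn_small// => kr; rewrite lab_parent// lab_next// ffunE.
have -> : \sum_(y | D y) lp y = \sum_(y | D (msk y)) lp y.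
  by apply: eq_bigl => y; rewrite Dmask.
have mskE : push msk (@lp R (lv J.+1) b') =1 push par' (@lr R (lv J.+1)).
  move=> z; rewrite (push_prodw (fun=> @lmk R (lv J) b')).
  have -> : push par' (@lr R (lv J.+1)) z =
      push (fun u : {ffun 'I_(mm J) -> lE (lv J)} => [ffun s => lev b' (u s)])
        (push (@par J) (@lr R (lv J.+1))) z by rewrite push_push.
  have [_ h _ _] := lv_refines J; rewrite (eq_push (fun=> erefl) h).
  rewrite (push_prodw (fun=> @lev R (lv J) b')).
  by apply: eq_bigr => s _; rewrite push_lev.
rewrite -(sum_push msk _ D) (eq_bigr _ (fun z _ => mskE z)) sum_push.
(* [g] depends on the masked word alone, which lets [push_lev] move the sum from source words to
   coupling words. There uniqueness of the parent replaces the existential witness by the summation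
   variable. *)
pose g (z : lX (lv J.+1) b) := [exists e : lE (lv J.+1), [&& 0 < lr e, lev b e == z & D (lev b' e)]]
  && [forall e : lE (lv J.+1), forall e' : lE (lv J.+1),
    [&& 0 < lr e, lev b e == z, 0 < lr e' & lev b e' == z] ==> (par e == par e')].
apply: (@le_trans _ _ (\sum_(x | g (lmk x)) @lp R (lv J.+1) b x)).
  rewrite big_mkcond [leRHS]big_mkcond; apply: ler_sum => x _.
  have x0 := (lp_pmf J.+1 b).1 x.
  case: ifP => [/andP[gx ex]|_]; last by case: ifP.
  rewrite ifT//; apply/andP; split=> //.
  apply/forallP => e; apply/forallP => e'; apply/implyP => /and4P[e0 /eqP ee e'0 /eqP ee'].
  have /existsP[f /and3P[_ _ /forallP h]] := gx.
  have /implyP := h e; rewrite e0 ee eqxx => /(_ isT)/eqP.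
  have /implyP := h e'; rewrite e'0 ee' eqxx => /(_ isT)/eqP.
  by rewrite /par /parent => -> ->.
rewrite -(sum_push (@lmk R (lv J.+1) b) _ g).
rewrite (eq_bigr _ (fun z _ => esym (@push_lev J.+1 b z))) sum_push.
rewrite big_mkcond [leRHS]big_mkcond; apply: ler_sum => e _.
have := (lr_pmf J.+1).1 e; rewrite le_eqVlt => /predU1P[<-|e0].
  by case: ifP; case: ifP.
case: ifP => [/andP[/existsP[e1 /and3P[e10 ee1 De1]] /forallP/(_ e)/forallP/(_ e1)]|_]; last first.
  by case: ifP => // _; exact: ltW.
rewrite e0 e10 ee1 eqxx/= => /eqP pe.
by move: De1; rewrite Dpar// /par' -pe => ->.
Qed.

Definition hid J b : nat := (\sum_(i < len J) ~~ rev J b i)%N.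

Lemma sum_blocks m n (F : nat -> nat) :
  (\sum_(i < m * n) F i = \sum_(s < m) \sum_(k < n) F (s * n + k))%N.
Proof.
elim: m => [|m ih]; first by rewrite !big_ord0.
rewrite -(big_mkord xpredT F) mulSnr (@big_cat_nat _ _ _ (m * n))//= ?leq_addr//.
rewrite big_mkord ih [RHS]big_ord_recr/=; congr addn.
by rewrite -{1}[(m * n)%N]add0n big_addn addKn big_mkord; apply: eq_bigr => k _; rewrite addnC.
Qed.

(** All positions hidden at level [J.+1] lie in the first [hh J b] sub-blocks. *)
Lemma hid_bound J b : (hid J.+1 b)%:R <= 2^-1 ^+ J * (len J.+1)%:R :> R.
Proof.
have [/(_ b) hE _ _ _] := lv_refines J.
suff hidJ : (hid J.+1 b <= hh J b * len J)%N.
  apply: (@le_trans _ _ (hh J b * len J)%:R); first by rewrite ler_nat.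
  by rewrite /= !natrM mulrA ler_wpM2r.
have -> : hid J.+1 b =
    (\sum_(s < mm J) \sum_(k < len J) ~~ rev J.+1 b (s * len J + k))%N.
  exact: (sum_blocks _ _ (fun i => ~~ rev J.+1 b i : nat)).
apply: (@leq_trans (\sum_(s < mm J) if s < hh J b then len J else 0)%N).
  apply: leq_sum => s _; case: ifP => sh.
    rewrite -[leqRHS]muln1 -[X in (_ <= X * _)%N]card_ord -sum_nat_const.
    by apply: leq_sum => k _; case: (rev _ _ _).
  by rewrite big1// => k _; rewrite rev_next// leqNgt sh.
rewrite -big_mkcond/= sum_nat_const leq_mul2r; apply/orP; right.
rewrite cardE size_filter -(count_map val (fun s => s < hh J b)%N).
rewrite /index_enum -enumT val_enum_ord.
rewrite -size_filter; apply: (@leq_trans (size (iota 0 (hh J b)))); last by rewrite size_iota.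
apply: uniq_leq_size; first by rewrite filter_uniq ?iota_uniq.
by move=> k; rewrite mem_filter !mem_iota => /andP[->].
Qed.

End Tower.

Definition letter (n : nat) : Type := 'I_n.+1.

HB.instance Definition _ n := Finite.on (letter n).
HB.instance Definition _ n := isPointed.Build (letter n) ord0.
HB.instance Definition _ n := @isMeasurable.Build default_measure_display
  (letter n) discrete_measurable discrete_measurable0
  discrete_measurableC discrete_measurableU.

Lemma letter_finite n : finite_set [set: letter n].
Proof. exact: finite_finset. Qed.

(** * Words and their occurrence patterns *)

Section Windows.
Context {R : realType} {G : groupType}.
Hypothesis countG : countable [set: G].
Context {n : nat} (mu : probability (letter n) R).
Local Notation X := (config G (letter n)).
Implicit Types (E F : set X) (s t u : seq G) (x y : X) (l : letter n).

Definition Pr E : R := fine (product_probability G mu E).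
Definition wt l : R := fine (mu [set l]).

Definition depends s E := forall x y, (forall g, g \in s -> x g = y g) -> E x -> E y.

Lemma dependsE s E x y : depends s E -> (forall g, g \in s -> x g = y g) -> E x = E y.
Proof.
move=> dE xy; apply/propext; split; apply: dE => // g gs.
by rewrite xy.
Qed.

Lemma depends_sub s t E : {subset s <= t} -> depends s E -> depends t E.
Proof. by move=> st dE x y xy; apply: dE => g /st; exact: xy. Qed.

Lemma dependsC s E : depends s E -> depends s (~` E).
Proof. by move=> dE x y xy; rewrite /setC/= (dependsE dE xy). Qed.

Lemma dependsI s E F : depends s E -> depends s F -> depends s (E `&` F).
Proof. by move=> dE dF x y xy [/(dE _ _ xy) ? /(dF _ _ xy)]. Qed.

(** Freezing one coordinate shortens the list on which an event depends; this drives the inductions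
    on that list. *)
Definition slice g l E : set X := [set x | E (fun h => if h == g then l else x h)].

Lemma sliceE g l E : [set x | x g = l] `&` E = [set x | x g = l] `&` slice g l E.
Proof.
apply/seteqP; split=> x [/= xg Ex]; split=> //; move: Ex; rewrite /slice /=;
by congr E; apply/funext => h; case: eqP => // ->.
Qed.

Lemma depends_slice g l s E : depends (g :: s) E -> depends s (slice g l E).
Proof.
move=> dE x y xy; apply: dE => h; rewrite inE.
by case: eqVneq => //= _; exact: xy.
Qed.

Lemma measurable_coord g l : measurable [set x : X | x g = l].
Proof. by apply: sub_sigma_algebra; exists g => //; exists [set l]. Qed.

Lemma coord_partition g E : E = \big[setU/set0]_(l < n.+1) ([set x : X | x g = l] `&` E).
Proof.
apply/seteqP; split=> x.
  by move=> Ex; rewrite (bigD1 (x g))//=; left.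
by rewrite -bigcup_mkord_ord => -[i _ [_]].
Qed.

Lemma depends_measurable s E : depends s E -> measurable E.
Proof.
elim: s E => [|g s ih] E dE.
  have [[x Ex]|nE] := pselect (exists x, E x).
    rewrite (_ : E = setT)//; apply/seteqP; split=> // y _; exact: dE Ex.
  by rewrite (_ : E = set0)//; apply/seteqP; split=> // y Ey; apply: nE; exists y.
rewrite (coord_partition g E); apply: bigsetU_measurable => l _.
by rewrite sliceE; apply: measurableI; [exact: measurable_coord|by apply: ih; exact: depends_slice dE].
Qed.

Lemma Pr_EFin E : measurable E -> product_probability G mu E = (Pr E)%:E.
Proof. by move=> mE; rewrite /Pr fineK// fin_num_measure. Qed.

Lemma Pr_ge0 E : 0 <= Pr E.
Proof. by rewrite fine_ge0. Qed.

Lemma Pr_setT : Pr setT = 1.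
Proof. by rewrite /Pr probability_setT. Qed.

Lemma Pr_set0 : Pr set0 = 0.
Proof. by rewrite /Pr measure0. Qed.

Lemma Pr_le E F : measurable E -> measurable F -> E `<=` F -> Pr E <= Pr F.
Proof.
by move=> mE mF EF; rewrite -lee_fin -!Pr_EFin//; apply: le_measure; rewrite ?inE.
Qed.

Lemma Pr_le1 E : measurable E -> Pr E <= 1.
Proof. by move=> mE; rewrite -Pr_setT; exact: Pr_le. Qed.

Lemma Pr_partition g E : measurable E -> Pr E = \sum_l Pr ([set x | x g = l] `&` E).
Proof.
move=> mE; have mI (l : letter n) : measurable ([set x : X | x g = l] `&` E).
  by apply: measurableI => //; exact: measurable_coord.
apply: EFin_inj; rewrite -sumEFin -Pr_EFin// {1}(coord_partition g E).
rewrite [RHS](eq_bigr (fun l => product_probability G mu ([set x | x g = l] `&` E)));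
  last by move=> l _; rewrite Pr_EFin.
apply: measure_semi_additive_ord => //; last exact: bigsetU_measurable.
by move=> l l' _ _ [x [[/= <- _] [/= <- _]]].
Qed.

Lemma Pr_cylinder s (w : G -> letter n) : uniq s ->
  Pr [set x | forall g, g \in s -> x g = w g] = \prod_(g <- s) wt (w g).
Proof.
move=> us; have := product_probabilityP mu countG (letter_finite n) (fun=> I).
by move=> /(_ s (fun g => [set w g]) us (fun=> I)) h; rewrite /Pr h.
Qed.

Lemma Pr_cylinderI u E s (w : G -> letter n) : uniq u -> depends u E -> uniq s ->
  (forall g, g \in s -> g \notin u) ->
  Pr ([set x | forall g, g \in s -> x g = w g] `&` E) = (\prod_(g <- s) wt (w g)) * Pr E.
Proof.
elim: u E s w => [|h u ih] E s w uu dE us su.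
  have [[x Ex]|nE] := pselect (exists x, E x).
    rewrite (_ : E = setT) ?setIT ?Pr_setT ?mulr1 ?Pr_cylinder//.
    by apply/seteqP; split=> // y _; exact: dE Ex.
  rewrite (_ : E = set0) ?setI0 ?Pr_set0 ?mulr0//.
  by apply/seteqP; split=> // y Ey; apply: nE; exists y.
have mE := depends_measurable dE; have mC : measurable [set x : X | forall g, g \in s -> x g = w g].
  apply: (@depends_measurable s) => x y xy xw g gs.
  by rewrite -xy// xw.
have /andP[hu uu'] := uu.
have hs : h \notin s by apply: contraL (mem_head h u) => /su.
have key s' w' : uniq s' -> h \notin s' -> (forall g, g \in s' -> g \notin u) -> forall l,
    Pr ([set x | forall g, g \in s' -> x g = w' g] `&` ([set x | x h = l] `&` E)) =
    (\prod_(g <- s') wt (w' g)) * (wt l * Pr (slice h l E)).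
  move=> us' hs' su' l; rewrite sliceE setIA.
  pose w2 g := if g == h then l else w' g.
  have -> : [set x : X | forall g, g \in s' -> x g = w' g] `&` [set x | x h = l] =
      [set x | forall g, g \in h :: s' -> x g = w2 g].
    apply/seteqP; split=> x /=.
      move=> [xs xh] g; rewrite inE /w2; case: eqVneq => [->//|_ /=]; exact: xs.
    move=> xw; split=> [g gs|]; last by rewrite xw ?mem_head// /w2 eqxx.
    rewrite xw ?inE ?gs ?orbT// /w2; case: eqVneq => // gh.
    by rewrite gh (negbTE hs') in gs.
  rewrite ih//=; first last.
  - by move=> g; rewrite inE => /predU1P[->//|]; exact: su'.
  - by rewrite hs'.
  - exact: depends_slice.
  rewrite big_cons /w2 eqxx [RHS]mulrCA -mulrA; congr (_ * (_ * _)).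
  by apply: eq_big_seq => g gs; case: eqVneq => // gh; rewrite gh (negbTE hs') in gs.
have su' g : g \in s -> g \notin u by move=> /su; rewrite inE negb_or => /andP[].
rewrite (Pr_partition h) ?(Pr_partition h mE); last exact: measurableI.
rewrite mulr_sumr; apply: eq_bigr => l _; rewrite setICA key//.
have nil_u g : g \in [::] -> g \notin u by [].
have := @key [::] w isT isT nil_u l.
rewrite big_nil mul1r => <-; congr (_ * Pr _).
rewrite [X in X `&` _](_ : _ = setT) ?setTI//.
by apply/seteqP; split.
Qed.

Lemma Pr_coordI g l u E : depends u E -> g \notin u ->
  Pr ([set x | x g = l] `&` E) = wt l * Pr E.
Proof.
move=> dE gu; have := @Pr_cylinderI (undup u) E [:: g] (fun=> l).
rewrite undup_uniq big_seq1 => <-//.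
- congr (Pr (_ `&` _)); apply/seteqP; split=> x /=; first by move=> xg h; rewrite inE => /eqP ->.
  by apply; rewrite mem_head.
- by apply: depends_sub dE => h; rewrite mem_undup.
- by move=> h; rewrite inE mem_undup => /eqP ->.
Qed.

(** Induction on [s]: the event is split along one coordinate at a time, whose weight [Pr_coordI]
    pulls out on both sides. *)
Lemma Pr_indep s t E F : depends s E -> depends t F ->
  (forall g, g \in s -> g \notin t) -> Pr (E `&` F) = Pr E * Pr F.
Proof.
move=> + dF; have mF := depends_measurable dF.
wlog us : s E / uniq s.
  move=> h dE st; apply: (h (undup s)); rewrite ?undup_uniq//.
    by apply: depends_sub dE => g; rewrite mem_undup.
  by move=> g; rewrite mem_undup; exact: st.
elim: s E us => [|g s ih] E us dE st.
  have [[x Ex]|nE] := pselect (exists x, E x).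
    rewrite (_ : E = setT) ?setTI ?Pr_setT ?mul1r//.
    by apply/seteqP; split=> // y _; exact: dE Ex.
  rewrite (_ : E = set0) ?set0I ?Pr_set0 ?mul0r//.
  by apply/seteqP; split=> // y Ey; apply: nE; exists y.
have mE := depends_measurable dE; have /andP[gs us'] := us.
have gt : g \notin t by apply: st; rewrite mem_head.
rewrite (Pr_partition g (measurableI _ _ mE mF)) (Pr_partition g mE) mulr_suml.
apply: eq_bigr => l _; rewrite setIA sliceE -setIA.
have dS : depends s (slice g l E) by exact: depends_slice.
rewrite (@Pr_coordI g l (s ++ t)); last by rewrite mem_cat negb_or gs.
  rewrite (@Pr_coordI g l s)// ih ?mulrA// => h hs; apply: st.
  by rewrite inE hs orbT.
apply: dependsI; [apply: depends_sub dS|apply: depends_sub dF] => h hs.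
  by rewrite mem_cat hs.
by rewrite mem_cat hs orbT.
Qed.

(** This is [bernoulli_shift g^-1]: it brings the site [g] to the identity. It is used for
    configurations and for occurrence patterns alike. *)
Definition tr (T : Type) g (x : G -> T) : G -> T := fun h => x (g * h)%g.

Lemma measurable_tr g : measurable_fun setT (tr g : X -> X).
Proof.
apply: (@measurability _ _ _ _ _ _ (coord_sets G (letter n))) => //.
move=> _ [_ [i _ [B mB <-]] <-]; rewrite setTI; apply: sub_sigma_algebra.
by exists (g * i)%g => //; exists B.
Qed.

HB.instance Definition _ g :=
  isMeasurableFun.Build _ _ X X (tr g : X -> X) (measurable_tr g).

Lemma Pr_tr g E : measurable E -> Pr [set x | E (tr g x)] = Pr E.
Proof.
move=> mE; pose P := product_probability G mu.
have PP := product_probabilityP mu countG (letter_finite n) (fun=> I).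
congr fine; apply: (@product_probability_unique _ _ _ _ mu
  (distribution P (tr g : X -> X)) P _ PP E mE).
move=> s B us mB; pose s' := [seq (g * h)%g | h <- s].
have us' : uniq s' by rewrite map_inj_uniq// => a b; exact: mulgI.
have := PP s' (fun j => B (g^-1 * j)%g) us' (fun j => mB _).
rewrite big_map (eq_bigr (fun i => fine (mu (B i)))); last by move=> i _; rewrite mulKg.
move=> <-; rewrite /distribution /pushforward; congr (P _).
apply/seteqP; split=> x /= h i.
  by move=> /mapP[j js ->]; rewrite mulKg; exact: h.
by move=> si; have := h (g * i)%g (map_f _ si); rewrite mulKg.
Qed.

Lemma depends_tr g s E : depends s E -> depends [seq (g * h)%g | h <- s] [set x | E (tr g x)].
Proof. by move=> dE x y xy; apply: dE => h hs; apply: xy; exact: map_f. Qed.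

End Windows.

(* Two finite alphabets, indexed by [bool], with words [pword b] on a common finite
   shape whose translates never overlap compatibly and which have equal probability. *)
Record pattern_pair (R : realType) (G : groupType) := PatternPair {
  psize : bool -> nat;
  pmu : forall b, probability (letter (psize b)) R;
  pshape : seq G;
  pword : forall b, G -> letter (psize b);
  p_countable : countable [set: G];
  p_infinite : infinite_set [set: G];
  pshape_uniq : uniq pshape;
  pshape1 : 1%g \in pshape;
  p_pos : forall b l, 0 < wt (pmu b) l;
  p_separated : forall b g f f', g != 1%g -> f \in pshape -> f' \in pshape ->
    (g * f)%g = f' -> exists f1 f2, [/\ f1 \in pshape, f2 \in pshape,
      (g * f1)%g = f2 & pword b f1 != pword b f2];
  p_weight : \prod_(f <- pshape) wt (pmu true) (pword true f) =
    \prod_(f <- pshape) wt (pmu false) (pword false f);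
  p_entropy : ent (wt (pmu true)) = ent (wt (pmu false));
  p_free : forall b, exists c c', [/\ c != c', has (fun f => pword b f != c) pshape &
    has (fun f => pword b f != c') pshape] }.

(** * The joint law of the occurrences *)

Section Patterns.
Context {R : realType} {G : groupType} (S : pattern_pair R G).
Local Notation n := (psize S).
Local Notation mu := (pmu S).
Local Notation F := (pshape S).
Local Notation w := (@pword R G S).
Local Notation countG := (p_countable S).
Local Notation F_uniq := (pshape_uniq S).
Local Notation w_separated := (@p_separated R G S).
Local Notation Cfg b := (config G (letter (n b))).
Local Notation Prb b := (@Pr R G (n b) (mu b)).
Local Notation p b := (@wt R (n b) (mu b)).
Implicit Types (b : bool) (g h : G) (C Q s t ds ps W : seq G) (D : G -> bool).

Definition occ b (x : G -> letter (n b)) g := all (fun f => x (g * f)%g == w b f) F.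

Arguments occ : clear implicits.

Lemma occ_tr b x g h : occ b (tr g x) h = occ b x (g * h).
Proof. by apply: eq_all => f; rewrite /tr mulgA. Qed.

Lemma occ_local b (x y : Cfg b) g : (forall f, f \in F -> x (g * f)%g = y (g * f)%g) ->
  occ b x g = occ b y g.
Proof. by move=> xy; apply: eq_in_all => f fF; rewrite xy. Qed.

(** If two occurrences shared a site, separation would provide a site of the overlap where they
    require different letters. *)
Lemma occ_disjoint b x g g' f f' : occ b x g -> occ b x g' -> g != g' ->
  f \in F -> f' \in F -> (g * f)%g != (g' * f')%g.
Proof.
move=> /allP og /allP og' gg fF f'F; apply/eqP => e.
have [f1 [f2 [f1F f2F e12]]] : exists f1 f2, [/\ f1 \in F, f2 \in F,
    ((g'^-1 * g) * f1)%g = f2 & w b f1 != w b f2].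
  apply: (w_separated b (f := f) (f' := f')) => //; last by rewrite -mulgA e mulKg.
  by apply: contra gg => /eqP h; rewrite -[g](mulVKg g') h mulg1.
have /eqP := og _ f1F; have /eqP := og' _ f2F.
by rewrite -e12 -mulgA mulVKg => -> ->; rewrite eqxx.
Qed.

Definition occ_at b ds : set (Cfg b) := [set x | all (occ b x) ds].
Definition no_at b ps : set (Cfg b) := [set x | all (fun g => ~~ occ b x g) ps].
Arguments occ_at : clear implicits.
Arguments no_at : clear implicits.
Definition cover ds : seq G := [seq (d * f)%g | d <- ds, f <- F].

Lemma mem_cover ds d f : d \in ds -> f \in F -> (d * f)%g \in cover ds.
Proof. by move=> dd fF; apply/allpairsP; exists (d, f). Qed.

Lemma occ_at_depends b ds : depends (cover ds) (occ_at b ds).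
Proof.
move=> x y xy /allP ox; apply/allP => d dd; rewrite -(@occ_local b x y d) ?ox// => f fF.
by apply: xy; exact: mem_cover.
Qed.

Lemma no_at_depends b ps : depends (cover ps) (no_at b ps).
Proof.
move=> x y xy /allP ox; apply/allP => d dd; rewrite -(@occ_local b x y d) ?ox// => f fF.
by apply: xy; exact: mem_cover.
Qed.

Definition dens b : R := \prod_(f <- F) p b (w b f).

Lemma Pr_occ1 b d : Prb b (occ_at b [:: d]) = dens b.
Proof.
have := @Pr_cylinder R G countG _ (mu b) [seq (d * f)%g | f <- F] (fun h => w b (d^-1 * h)).
rewrite map_inj_uniq => [|f f' /mulgI//]; move=> /(_ F_uniq).
rewrite big_map (eq_bigr (fun f => p b (w b f))) => [|f _]; last by rewrite mulKg.
rewrite -/(dens b) => <-; congr (Prb b _); apply/seteqP; split=> x; rewrite /occ_at /= andbT.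
  by move=> /allP h g /mapP[f fF ->]; rewrite mulKg; apply/eqP/h.
by move=> h; apply/allP => f fF; rewrite h ?map_f// mulKg.
Qed.

Definition meets g h := has (fun f => has (fun f' => (g * f == h * f')%g) F) F.

Lemma meetsP g h : reflect (exists f f', [/\ f \in F, f' \in F & (g * f = h * f')%g]) (meets g h).
Proof.
apply: (iffP hasP) => [[f fF /hasP[f' f'F /eqP e]]|[f [f' [fF f'F e]]]].
  by exists f, f'.
by exists f => //; apply/hasP; exists f' => //; apply/eqP.
Qed.

Lemma occ_at_cons b d ds : occ_at b (d :: ds) = occ_at b [:: d] `&` occ_at b ds.
Proof.
apply/seteqP; split=> x; rewrite /occ_at/= andbT; first by move=> /andP[].
by move=> [/= -> ->].
Qed.

(** Which case arises is decided by the shape alone, hence simultaneously for both alphabets; this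
    is why the occurrences have a common law. *)
Lemma occ_at_cases d ds :
  [\/ forall b, occ_at b (d :: ds) = occ_at b ds, forall b, occ_at b (d :: ds) = set0 |
      forall f, f \in F -> (d * f)%g \notin cover ds].
Proof.
have [dd|nd] := boolP (d \in ds).
  apply: Or31 => b; rewrite occ_at_cons; apply/seteqP; split=> x; first by case.
  by move=> ox; split=> //; rewrite /occ_at/= andbT; apply: (allP ox).
have [/hasP[d' dd' /meetsP[f [f' [fF f'F e]]]]|/hasPn nm] := boolP (has (meets d) ds).
  apply: Or32 => b; apply/seteqP; split=> // x /andP[od /allP/(_ _ dd') od'].
  have dn : d != d' by apply: contraNneq nd => ->.
  by have := occ_disjoint od od' dn fF f'F; rewrite e eqxx.
apply: Or33 => f fF; apply/allpairsP => -[[d' f'] [/= dd' f'F e]].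
by have /meetsP := nm _ dd'; apply; exists f, f'.
Qed.

Lemma Pr_occ_indep b d ds E : (forall f, f \in F -> (d * f)%g \notin cover ds) ->
  forall s, depends s E -> (forall f, f \in F -> (d * f)%g \notin s) ->
  Prb b (occ_at b (d :: ds) `&` E) = dens b * Prb b (occ_at b ds `&` E).
Proof.
move=> dds s dE ds'; rewrite occ_at_cons -setIA -(Pr_occ1 b d).
apply: (Pr_indep countG (mu b) (t := cover ds ++ s) (@occ_at_depends b [:: d])).
  apply: dependsI; [apply: depends_sub (@occ_at_depends b ds)|apply: depends_sub dE] => h hh.
    by rewrite mem_cat hh.
  by rewrite mem_cat hh orbT.
move=> g /allpairsP[[d' f] [/= + fF ->]]; rewrite inE => /eqP ->.
by rewrite mem_cat negb_or dds// ds'.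
Qed.

Lemma depends0 b : depends [::] [set: Cfg b].
Proof. by []. Qed.

Lemma occ_at_nil b : occ_at b [::] = setT.
Proof. by apply/seteqP; split. Qed.

Lemma no_at_nil b : no_at b [::] = setT.
Proof. by apply/seteqP; split. Qed.

Lemma dens_eq : dens true = dens false.
Proof. exact: p_weight. Qed.

Lemma Pr_occ ds : Prb true (occ_at true ds) = Prb false (occ_at false ds).
Proof.
elim: ds => [|d ds ih]; first by rewrite !occ_at_nil !Pr_setT.
have [h|h|h] := occ_at_cases d ds; rewrite ?(h true) ?(h false) ?Pr_set0//.
have e b := Pr_occ_indep h (@depends0 b) (fun _ _ => isT).
by have := e true; have := e false; rewrite !setIT => -> ->; rewrite ih dens_eq.
Qed.

Lemma Pr_split b (E B : set (Cfg b)) : measurable E -> measurable B ->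
  Prb b E = Prb b (E `&` B) + Prb b (E `\` B).
Proof.
move=> mE mB; have mI := measurableI _ _ mE mB; have mD := measurableD mE mB.
by apply: EFin_inj; rewrite EFinD -!Pr_EFin// addeC; exact: measureDI.
Qed.

Lemma no_at_cons b ds d ps : occ_at b ds `&` no_at b (d :: ps) =
  (occ_at b ds `&` no_at b ps) `\` (occ_at b (d :: ds) `&` no_at b ps).
Proof.
apply/seteqP; split=> x; rewrite /occ_at/no_at /=.
  by move=> [h /andP[nd h']]; split=> // -[/andP[od]]; rewrite od in nd.
by move=> [[h h'] k]; split=> //; rewrite h' andbT; apply/negP => od; apply: k; rewrite od h.
Qed.

Lemma occ_no_measurable b ds ps : measurable (occ_at b ds `&` no_at b ps).
Proof.
by apply: measurableI; apply: depends_measurable; [exact: occ_at_depends|exact: no_at_depends].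
Qed.

(** Stated for additive functionals because it serves twice, for the probability and for the
    expected information. The predicate [K] keeps the sites inside the window on which the latter
    can be compared. *)
Lemma inclusion_exclusion (Phi : forall b, set (Cfg b) -> R) (K : pred G) :
  (forall b E B, measurable E -> measurable B ->
    Phi b E = Phi b (E `&` B) + Phi b (E `\` B)) ->
  (forall ds, all K ds -> Phi true (occ_at true ds) = Phi false (occ_at false ds)) ->
  forall ps ds, all K ds -> all K ps -> Phi true (occ_at true ds `&` no_at true ps) =
    Phi false (occ_at false ds `&` no_at false ps).
Proof.
move=> add eq0; elim=> [|d ps ih] ds Kds.
  by rewrite !no_at_nil !setIT eq0.
move=> /= /andP[Kd Kps]; rewrite !no_at_cons.
have h b : Phi b ((occ_at b ds `&` no_at b ps) `\` (occ_at b (d :: ds) `&` no_at b ps)) =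
    Phi b (occ_at b ds `&` no_at b ps) - Phi b (occ_at b (d :: ds) `&` no_at b ps).
  rewrite (@add b (occ_at b ds `&` no_at b ps) (occ_at b (d :: ds) `&` no_at b ps)); try exact: occ_no_measurable.
  rewrite addrAC [X in Phi b X - _](_ : _ = occ_at b (d :: ds) `&` no_at b ps) ?subrr ?add0r//.
  rewrite occ_at_cons; apply/seteqP; split=> x; first by case.
  by move=> [[a c] e]; split.
by rewrite !h !ih//= Kd.
Qed.

Lemma Pr_occ_no ds ps : Prb true (occ_at true ds `&` no_at true ps) =
  Prb false (occ_at false ds `&` no_at false ps).
Proof.
apply: (@inclusion_exclusion (fun b => Prb b) xpredT) => //; try exact: all_predT.
  exact: Pr_split.
by move=> ds' _; exact: Pr_occ.
Qed.

End Patterns.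

(** * Isolated clusters and their conditional law *)

Section Clusters.
Context {R : realType} {G : groupType} (S : pattern_pair R G).
Local Notation n := (psize S).
Local Notation mu := (pmu S).
Local Notation F := (pshape S).
Local Notation w b := (@pword R G S b).
Local Notation countG := (p_countable S).
Local Notation Cfg b := (config G (letter (n b))).
Local Notation Prb b := (@Pr R G (n b) (mu b)).
Local Notation p b := (@wt R (n b) (mu b)).
Local Notation occ b := (@occ R G S b).
Local Notation occ_at b := (@occ_at R G S b).
Local Notation no_at b := (@no_at R G S b).
Local Notation cover := (@cover R G S).
Local Notation dens := (@dens R G S).
Implicit Types (b : bool) (g h : G) (C Q s t ds ps W : seq G) (D : G -> bool).

Lemma wt_pmf b : pmf (p b).
Proof.
split=> [l|]; first by rewrite fine_ge0.
have := Pr_setT (mu b) (G := G).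
rewrite (Pr_partition _ 1%g measurableT) => e; rewrite -[RHS]e.
apply: eq_bigr => l _; have := @Pr_coordI R G countG _ (mu b) 1%g l [::] setT (fun _ _ _ => id).
by move=> /(_ isT) ->; rewrite Pr_setT mulr1.
Qed.

Definition info b l : R := - ln (p b l).
Arguments info : clear implicits.

(* Expected information of the letters on [C], on the event [E]. *)
Definition einfo b C (E : set (Cfg b)) : R :=
  \sum_(g <- C) \sum_l info b l * Prb b ([set x | x g = l] `&` E).

Arguments einfo : clear implicits.

Lemma einfo_split C b (E B : set (Cfg b)) : measurable E -> measurable B ->
  einfo b C E = einfo b C (E `&` B) + einfo b C (E `\` B).
Proof.
move=> mE mB; rewrite -big_split/=; apply: eq_bigr => g _; rewrite -big_split/=.
apply: eq_bigr => l _; rewrite -mulrDr setIA; congr (_ * _).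
rewrite (@Pr_split _ _ S b _ B)//; first by rewrite setIDA.
by apply: measurableI => //; exact: measurable_coord.
Qed.

Lemma einfo0 C b : einfo b C set0 = 0.
Proof. by apply: big1 => g _; apply: big1 => l _; rewrite setI0 Pr_set0 mulr0. Qed.

Lemma depends_coord b g (l : letter (n b)) : depends [:: g] [set x : Cfg b | x g = l].
Proof. by move=> x y xy /= <-; rewrite xy ?mem_head. Qed.

(** A new disjoint occurrence fixes the letters on its coordinates, whose total information
    [- ln dens] is the same on both sides, and is independent of the rest. Each coordinate left free
    contributes the entropy of a letter, again common. *)
Lemma einfo_occ ds : forall C, uniq C -> {subset cover ds <= C} ->
  einfo true C (occ_at true ds) = einfo false C (occ_at false ds).
Proof.
elim: ds => [|d ds ih] C uC dsC.
  have e b : einfo b C (occ_at b [::]) = (size C)%:R * ent (p b).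
    rewrite /einfo (eq_bigr (fun=> ent (p b))); first by rewrite big_const_seq count_predT iter_addr_0 mulr_natl.
    move=> g _; apply: eq_bigr => l _; rewrite occ_at_nil.
    by rewrite (@Pr_coordI R G countG _ (mu b) g l [::])// Pr_setT mulr1 /info mulNr mulrC.
  by rewrite !e p_entropy.
have dsC' : {subset cover ds <= C} by move=> z zd; apply: dsC; rewrite /cover allpairs_cons mem_cat zd orbT.
have dC f : f \in F -> (d * f)%g \in C.
  by move=> fF; apply: dsC; apply: mem_cover => //; exact: mem_head.
have [h|h|h] := occ_at_cases S d ds; rewrite ?(h true) ?(h false) ?einfo0//.
  exact: ih.
pose dF := [seq (d * f)%g | f <- F]; pose C' := [seq z <- C | z \notin dF].
have udF : uniq dF by rewrite map_inj_uniq ?pshape_uniq// => ? ? /mulgI.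
have pC : perm_eq C (dF ++ C').
  apply: uniq_perm => //.
    rewrite cat_uniq udF filter_uniq//= andbT; apply/hasPn => z.
    by rewrite mem_filter => /andP[].
  move=> z; rewrite mem_cat mem_filter; case: (boolP (z \in dF)) => //= /mapP[f fF ->].
  exact: dC.
have e b : einfo b C (occ_at b (d :: ds)) = (\sum_(f <- F) info b (w b f)) *
    Prb b (occ_at b (d :: ds)) + dens b * einfo b C' (occ_at b ds).
  rewrite /einfo (perm_big _ pC)/= big_cat/= big_map mulr_suml mulr_sumr; congr (_ + _).
    apply: eq_big_seq => f fF; rewrite (bigD1 (w b f))//= big1 ?addr0.
      congr (_ * Prb b _); apply/seteqP; split=> x; first by case.
      by move=> ox; split=> //=; case/andP: ox => /allP/(_ _ fF)/eqP.
    move=> l lw; rewrite [X in Prb b X](_ : _ = set0) ?Pr_set0 ?mulr0//.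
    apply/seteqP; split=> // x [/= xl /andP[/allP/(_ _ fF)/eqP]].
    by rewrite xl => /eqP; rewrite (negbTE lw).
  rewrite !big_seq; apply: eq_bigr => z; rewrite mem_filter => /andP[zd zC].
  have zds f : f \in F -> (d * f)%g \notin [:: z].
    by move=> fF; rewrite inE; apply: contra zd => /eqP <-; exact: map_f.
  rewrite mulr_sumr; apply: eq_bigr => l _; rewrite mulrCA; congr (_ * _).
  have h1 := Pr_occ_indep h (@depends_coord b z l) zds.
  rewrite (setIC _ (occ_at b (d :: ds))) (setIC _ (occ_at b ds)).
  exact: h1.
rewrite !e dens_eq (Pr_occ S (d :: ds)) (ih C'); last 2 first.
- exact: filter_uniq.
- move=> z zd; rewrite mem_filter dsC' // andbT; apply: contraL zd => /mapP[f fF ->].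
  exact: h.
congr (_ * _ + _); rewrite /info !sumrN; congr (- _).
have lnS b : \sum_(f <- F) ln (p b (w b f)) = ln (dens b).
  suff: 0 < dens b /\ ln (dens b) = \sum_(f <- F) ln (p b (w b f)) by case.
  rewrite /dens; apply: (big_rec2 (fun x y => 0 < y /\ ln y = x)) => [|f y1 y2 _ [y0 <-]].
    by rewrite ln1.
  by rewrite lnM ?posrE ?mulr_gt0 ?p_pos.
by rewrite !lnS dens_eq.
Qed.

Definition inside Q h := all (fun f => (h * f)%g \in Q) F.

Definition sites Q := [seq h <- [seq (z * f^-1)%g | z <- Q, f <- F] | inside Q h].

Definition avoid b Q (x : G -> letter (n b)) := all (fun h => ~~ occ b x h) (sites Q).

Arguments avoid : clear implicits.

Definition avoids b Q : set (Cfg b) := [set x | avoid b Q x].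

Arguments avoids : clear implicits.

Lemma mem_sites Q h : (h \in sites Q) = inside Q h.
Proof.
rewrite mem_filter andb_idr// => /allP hQ; apply/allpairsP; exists (h, 1%g) => /=.
by rewrite invg1 mulg1 pshape1; split=> //; have := hQ _ (pshape1 S); rewrite mulg1.
Qed.

Lemma avoids_depends b Q : depends Q (avoids b Q).
Proof.
move=> x y xy; rewrite /avoids /avoid /= => /allP ax; apply/allP => h hQ.
rewrite -(@occ_local R G S b x y)// ?ax// => f fF; apply: xy.
by move: hQ; rewrite mem_sites => /allP; exact.
Qed.

Lemma Pr_avoids Q : Prb true (avoids true Q) = Prb false (avoids false Q).
Proof. by have := Pr_occ_no S [::] (sites Q); rewrite !occ_at_nil !setTI. Qed.

Lemma einfo_avoids Q : uniq Q ->
  einfo true Q (avoids true Q) = einfo false Q (avoids false Q).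
Proof.
move=> uQ; have := @inclusion_exclusion R G S (fun b => einfo b Q)
  (inside Q) (@einfo_split Q) _ (sites Q) [::] isT.
rewrite !occ_at_nil !setTI; apply; last by apply/allP => h; rewrite mem_sites.
move=> ds /allP dQ; apply: einfo_occ => // z /allpairsP[[d f] [/= dd fF ->]].
exact: (allP (dQ _ dd)).
Qed.

Definition hit D z := has (fun f => D (z * f^-1)%g) F.

(** Every placement of the word covering a point of [Q] is absent and either lies inside [Q] or
    overlaps an occurrence. In the latter case [occ_disjoint] excludes it anyway, so the pattern
    constrains the letters of [Q] only through placements inside [Q]. *)
Definition isolated D Q := all (fun z => all (fun f => ~~ D (z * f^-1)%g &&
  (inside Q (z * f^-1) || has (fun f' => hit D (z * f^-1 * f')) F)) F) Q.

Lemma isolatedP D Q : reflect (forall z f, z \in Q -> f \in F -> ~~ D (z * f^-1)%g /\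
  (inside Q (z * f^-1) \/ exists2 f', f' \in F & hit D (z * f^-1 * f'))) (isolated D Q).
Proof.
apply: (iffP allP) => [h z f zQ fF|h z zQ].
  have /allP/(_ _ fF)/andP[-> /orP[->|/hasP[f' f'F h']]] := h z zQ; split=> //; first by left.
  by right; exists f'.
apply/allP => f fF; have [-> [->//|[f' f'F h']]] := h z f zQ fF.
by rewrite /=; apply/orP; right; apply/hasP; exists f'.
Qed.

(** The positions of the pattern that [isolated] inspects around [C]. *)
Definition halo C := [seq (z * f^-1)%g | z <- C, f <- F] ++
  [seq (u * f^-1)%g | u <- [seq (u * f)%g | u <- [seq (z * f^-1)%g | z <- C, f <- F], f <- F], f <- F].

Definition same_pattern b D W : set (Cfg b) := [set x | forall g, g \in W -> occ b x g = D g].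

Arguments same_pattern : clear implicits.

(* Given the occurrences near an isolated [C], the letters on [C] are only
   constrained to avoid occurrences inside [C]. *)
Lemma cluster_factor D W C : isolated D C -> {subset halo C <= W} ->
  exists2 c, 0 <= c & forall b E, depends C E ->
    Prb b (same_pattern b D W `&` E) = c * Prb b (avoids b C `&` E).
Proof.
move=> /isolatedP isoC haloW.
pose ds := [seq g <- W | D g].
(* Only empty sites whose placement misses [C] are kept here. The remaining ones are excluded either
   by avoidance inside [C] or by overlap with an occurrence of [ds]. *)
pose ps := [seq g <- W | ~~ D g & all (fun f => (g * f)%g \notin C) F].
exists (Prb true (occ_at true ds `&` no_at true ps)); first exact: Pr_ge0.
move=> b E dE.
have -> : Prb true (occ_at true ds `&` no_at true ps) =
    Prb b (occ_at b ds `&` no_at b ps) by case: b {E dE}; rewrite ?Pr_occ_no.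
rewrite -(Pr_indep countG (mu b) (s := cover ds ++ cover ps) (t := C)); first last.
- move=> z; rewrite mem_cat => /orP[] /allpairsP[[d f] [/= + fF ->]]; rewrite mem_filter.
    move=> /andP[Dd _]; apply/negP => dC; have [+ _] := isoC _ _ dC fF.
    by rewrite mulgK Dd.
  by move=> /andP[/andP[_ /allP/(_ _ fF)]].
- by apply: dependsI => //; exact: avoids_depends.
- apply: dependsI; [apply: depends_sub (@occ_at_depends _ _ S b ds)|
    apply: depends_sub (@no_at_depends _ _ S b ps)] => h hh; by rewrite mem_cat hh ?orbT.
congr (Prb b _); apply/seteqP; split=> x.
  move=> [/= sx Ex]; split; last split=> //.
    split; apply/allP => g; rewrite mem_filter.
      by move=> /andP[Dg gW]; rewrite sx.
    by move=> /andP[/andP[Dg _] gW]; rewrite sx.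
  apply/allP => h; rewrite mem_sites => hC.
  have h1 : (h \in [seq (z * f^-1)%g | z <- C, f <- F]).
    apply/allpairsP; exists ((h * 1)%g, 1%g); rewrite /= invg1 !mulg1 pshape1.
    by split=> //; have := allP hC _ (pshape1 S); rewrite mulg1.
  rewrite sx ?haloW ?mem_cat ?h1//.
  by have /allpairsP[[z f] [/= zC fF ->]] := h1; have [] := isoC _ _ zC fF.
move=> [[/allP ods /allP nps] [/= /allP av Ex]]; split=> //= g gW.
case: (boolP (D g)) => Dg; first by apply: ods; rewrite mem_filter Dg.
apply/negbTE; have [gC|] := boolP (all (fun f => (g * f)%g \notin C) F).
  by apply: nps; rewrite mem_filter Dg gC.
move=> /allPn[f fF]; rewrite negbK => gfC.
have [_ []] := isoC _ _ gfC fF; rewrite mulgK; first by move=> gi; apply: av; rewrite mem_sites.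
move=> [f' f'F /hasP[f2 f2F D2]].
have og2 : occ b x (g * f' * f2^-1)%g.
  apply: ods; rewrite mem_filter D2 haloW// mem_cat; apply/orP; right.
  apply/allpairsP; exists ((g * f')%g, f2); split=> //=.
  apply/allpairsP; exists (g, f'); split=> //=.
  by apply/allpairsP; exists ((g * f)%g, f); rewrite /= mulgK.
apply/negP => og; have gn : g != (g * f' * f2^-1)%g by apply: contraNneq Dg => ->.
by have := occ_disjoint og og2 gn f'F f2F; rewrite mulgVK eqxx.
Qed.

End Clusters.

(** * Clusters as letters of a larger alphabet *)

Section ClusterLetters.
Context {R : realType} {G : groupType} (S : pattern_pair R G).
Local Notation n := (psize S).
Local Notation mu := (pmu S).
Local Notation F := (pshape S).
Local Notation w b := (@pword R G S b).
Local Notation countG := (p_countable S).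
Local Notation Cfg b := (config G (letter (n b))).
Local Notation Prb b := (@Pr R G (n b) (mu b)).
Local Notation p b := (@wt R (n b) (mu b)).
Local Notation occ b := (@occ R G S b).
Local Notation avoid b := (@avoid R G S b).
Local Notation avoids b := (@avoids R G S b).
Local Notation einfo b := (@einfo R G S b).
Local Notation info b := (@info R G S b).
Local Notation isolated := (@isolated R G S).
Local Notation sites := (@sites R G S).
Implicit Types (b : bool) (g h : G) (C Q W : seq G) (D : G -> bool).

Lemma avoidsE b Q x : avoids b Q x = (avoid b Q x : Prop).
Proof. by []. Qed.

Lemma einfoE b C E : einfo b C E =
  \sum_(g <- C) \sum_l info b l * Prb b ([set x | x g = l] `&` E).
Proof. by []. Qed.

Lemma Pr_partition_fin b (T : finType) (f : Cfg b -> T) E : measurable E ->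
  (forall t, measurable [set x | f x = t]) -> Prb b E = \sum_t Prb b (E `&` [set x | f x = t]).
Proof.
move=> mE mf; pose A (i : 'I_#|T|) := E `&` [set x | f x = enum_val i].
have mA i : measurable (A i) by exact: measurableI.
have EA : E = \big[setU/set0]_(i < #|T|) A i.
  apply/seteqP; split=> x.
    by move=> Ex; rewrite (bigD1 (enum_rank (f x)))//=; left; split=> //=; rewrite enum_rankK.
  by elim/big_ind: _ => // [B B' h h' [/h|/h']//|i _ []].
have e : product_probability G (mu b) E = (\sum_(i < #|T|) product_probability G (mu b) (A i))%E.
  rewrite {1}EA; apply: measure_semi_additive_ord => //.
    by move=> i j _ _ [x [[_ /= fi] [_ /=]]]; rewrite fi => /enum_val_inj.
  exact: bigsetU_measurable.
rewrite [RHS](reindex (@enum_val T T))/=; last by apply: onW_bij; exact: enum_val_bij.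
apply: EFin_inj; rewrite -Pr_EFin// e -sumEFin; apply: eq_bigr => i _.
by rewrite Pr_EFin.
Qed.

Lemma Pr_indep_family b (m : nat) (E : nat -> set (Cfg b)) (C : nat -> seq G) :
  (forall i, (i < m)%N -> depends (C i) (E i)) ->
  (forall i j g, (i < j)%N -> (j < m)%N -> g \in C i -> g \notin C j) ->
  depends (flatten [seq C i | i <- iota 0 m]) [set x | forall i, (i < m)%N -> E i x] /\
  Prb b [set x | forall i, (i < m)%N -> E i x] = \prod_(i < m) Prb b (E i).
Proof.
elim: m => [|m ih] dE dC.
  rewrite big_ord0 (_ : [set x | _] = setT) ?Pr_setT//.
  by apply/seteqP; split.
have [dI PI] := ih (fun i im => dE _ (ltnW im)) (fun i j g ij jm => dC _ _ _ ij (ltnW jm)).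
have -> : [set x | forall i, (i < m.+1)%N -> E i x] =
    [set x | forall i, (i < m)%N -> E i x] `&` E m.
  apply/seteqP; split=> x /=; first by move=> h; split; [move=> i im; exact/h/ltnW|exact: h].
  by move=> [h hm] i; rewrite ltnS leq_eqVlt => /predU1P[->//|]; exact: h.
have iotaE : flatten [seq C i | i <- iota 0 m.+1] = flatten [seq C i | i <- iota 0 m] ++ C m.
  by rewrite -addn1 iotaD map_cat flatten_cat/= cats0.
split; first rewrite iotaE.
  apply: dependsI; [apply: depends_sub dI|apply: depends_sub (dE m (leqnn _))] => h hh;
  by rewrite mem_cat hh ?orbT.
rewrite big_ord_recr/= (Pr_indep countG (mu b) dI (dE m (leqnn _))) ?PI// => g.
move=> /flattenP[c /mapP[i]]; rewrite mem_iota => /andP[_ im] -> gi.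
exact: (dC i m).
Qed.

(* The letters on a translate of [Q], read as one letter of a larger alphabet. *)
Definition cletter Q b : finType := (size Q).-tuple (letter (n b)).

Definition lett Q b (x : G -> letter (n b)) : cletter Q b :=
  [tuple of map x (in_tuple Q)].

Definition unlett Q b (a : cletter Q b) : G -> letter (n b) :=
  fun z => nth ord0 a (index z Q).

Lemma lettK Q b (x : G -> letter (n b)) z : z \in Q -> unlett (lett Q x) z = x z.
Proof. by move=> zQ; rewrite /unlett/= (nth_map 1%g) ?index_mem// nth_index. Qed.

Lemma unlettK Q b (a : cletter Q b) : uniq Q -> lett Q (unlett a) = a.
Proof.
move=> uQ; apply: val_inj => /=; apply: (@eq_from_nth _ ord0).
  by rewrite size_map size_tuple.
move=> i; rewrite size_map => iQ; rewrite (nth_map 1%g)// /unlett.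
by rewrite index_uniq.
Qed.

Lemma lett_eq Q b (x y : G -> letter (n b)) :
  lett Q x = lett Q y <-> forall z, z \in Q -> x z = y z.
Proof.
split=> [e z zQ|e]; first by rewrite -(lettK x zQ) e lettK.
by apply: val_inj => /=; apply/eq_in_map => z; exact: e.
Qed.

Lemma lett_depends Q b a : depends Q [set x : Cfg b | lett Q x = a].
Proof. by move=> x y xy /= <-; apply/lett_eq => z zQ; rewrite xy. Qed.

Definition zav Q b := Prb b (avoids b Q).

(** The law fed to the tower: by [cluster_factor], it is how an isolated translate of [Q] is filled
    once the pattern around it is given. *)
Definition alpha Q b (a : cletter Q b) : R :=
  Prb b (avoids b Q `&` [set x | lett Q x = a]) / zav Q b.

Arguments alpha : clear implicits.

Definition cweight Q b (a : cletter Q b) : R := \prod_(z <- Q) p b (unlett a z).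

Lemma cweight_gt0 Q b (a : cletter Q b) : 0 < cweight a.
Proof. by apply: prodr_gt0 => z _; exact: p_pos. Qed.

Lemma Pr_lett Q b (a : cletter Q b) : uniq Q -> Prb b [set x | lett Q x = a] = cweight a.
Proof.
move=> uQ; rewrite /cweight -(Pr_cylinder countG (mu b) _ uQ); congr (Prb b _).
apply/seteqP; split=> x /=.
  by move=> <- z zQ; rewrite lettK.
by move=> h; rewrite -[RHS](unlettK _ uQ); apply/lett_eq.
Qed.

Lemma avoid_lett Q b (x : G -> letter (n b)) : avoid b Q (unlett (lett Q x)) = avoid b Q x.
Proof.
apply: eq_in_all => h; rewrite mem_sites => /allP hQ.
by congr (~~ _); apply: occ_local => f fF; rewrite lettK// hQ.
Qed.

Lemma Pr_avoid_lett Q b (a : cletter Q b) : uniq Q ->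
  Prb b (avoids b Q `&` [set x | lett Q x = a]) = (avoid b Q (unlett a))%:R * cweight a.
Proof.
move=> uQ; rewrite -(Pr_lett _ uQ).
case: (boolP (avoid b Q (unlett a))) => av; last first.
  rewrite mul0r [X in Prb b X](_ : _ = set0) ?Pr_set0//; apply/seteqP; split=> // x [/= ax xa].
  by move: av; rewrite -xa avoid_lett (ax : is_true (avoid b Q x)).
rewrite mul1r; congr (Prb b _); apply/seteqP; split=> x; first by case.
by move=> /= xa; split=> //; move: av; rewrite -xa avoid_lett.
Qed.

Lemma const_avoid Q b (c : letter (n b)) : has (fun f => w b f != c) F ->
  avoid b Q (fun=> c).
Proof.
move=> /hasP[f fF fc]; apply/allP => h _; apply: contra fc => /allP/(_ _ fF).
by rewrite eq_sym.
Qed.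

Lemma zav_gt0 Q b : uniq Q -> 0 < zav Q b.
Proof.
move=> uQ; have [c [_ [_ hc _]]] := p_free S b.
have mA := depends_measurable (@avoids_depends _ _ S b Q).
apply: (@lt_le_trans _ _ (Prb b (avoids b Q `&` [set x | lett Q x = lett Q (fun=> c)]))).
  by rewrite Pr_avoid_lett// avoid_lett const_avoid// mul1r cweight_gt0.
have mI : measurable (avoids b Q `&` [set x | lett Q x = lett Q (fun=> c)]).
  by apply: measurableI => //; exact: (depends_measurable (@lett_depends Q b _)).
by apply: Pr_le => // x [].
Qed.

Lemma zav_eq Q : zav Q true = zav Q false.
Proof. exact: Pr_avoids. Qed.

Lemma alpha_pmf Q b : uniq Q -> pmf (alpha Q b).
Proof.
move=> uQ; split=> [a|]; first by rewrite divr_ge0//; exact: Pr_ge0.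
rewrite -mulr_suml -Pr_partition_fin ?divff ?gt_eqF ?zav_gt0//.
  exact: (depends_measurable (@avoids_depends _ _ S b Q)).
by move=> t; exact: (depends_measurable (@lett_depends Q b t)).
Qed.

Lemma ln_prod_seq (I : Type) (r : seq I) (f : I -> R) : (forall i, 0 < f i) ->
  ln (\prod_(i <- r) f i) = \sum_(i <- r) ln (f i).
Proof.
move=> f0; suff: 0 < \prod_(i <- r) f i /\ ln (\prod_(i <- r) f i) = \sum_(i <- r) ln (f i) by case.
apply: (big_rec2 (fun x y => 0 < y /\ ln y = x)) => [|i y1 y2 _ [y0 <-]].
  by rewrite ln1.
by rewrite lnM ?posrE// mulr_gt0.
Qed.

(** Allowed fillings have mass [cweight a / zav Q b], so each entropy term splits into the logarithm
    of the normalisation and the information of the letters. Both parts agree on the two sides, by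
    [zav_eq] and [einfo_avoids]. *)
Lemma ent_alpha Q b : uniq Q ->
  ent (alpha Q b) = ln (zav Q b) + einfo b Q (avoids b Q) / zav Q b.
Proof.
move=> uQ; have Z0 := zav_gt0 b uQ.
pose v (a : cletter Q b) : R := (avoid b Q (unlett a))%:R * cweight a.
have mA : measurable (avoids b Q) by exact: (depends_measurable (@avoids_depends _ _ S b Q)).
have mL t : measurable [set x : Cfg b | lett Q x = t] by exact: (depends_measurable (@lett_depends Q b t)).
have vE a : v a = Prb b (avoids b Q `&` [set x | lett Q x = a]) by rewrite Pr_avoid_lett.
have -> : einfo b Q (avoids b Q) = \sum_a v a * - ln (cweight a).
  transitivity (\sum_(z <- Q) \sum_a v a * info b (unlett a z)).
    rewrite einfoE big_seq [RHS]big_seq; apply: eq_bigr => z zQ.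
    rewrite [RHS](eq_bigr (fun a => \sum_l info b l *
        Prb b ([set x | x z = l] `&` avoids b Q `&` [set x | lett Q x = a]))).
      rewrite exchange_big; apply: eq_bigr => l _; rewrite -mulr_sumr -Pr_partition_fin//.
      by apply: measurableI => //; exact: measurable_coord.
    move=> a _; rewrite (bigD1 (unlett a z))//= big1 ?addr0.
      rewrite mulrC vE; congr (_ * Prb b _); apply/seteqP; split=> x /=; last by case=> -[].
      by move=> [ax xa]; split=> //; split=> //; rewrite -xa lettK.
    move=> l lz; rewrite [X in Prb b X](_ : _ = set0) ?Pr_set0 ?mulr0//.
    apply/seteqP; split=> // x [[/= xl _] xa].
    by move: lz; rewrite -xl -xa lettK// eqxx.
  rewrite exchange_big; apply: eq_bigr => a _; rewrite -mulr_sumr; congr (_ * _).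
  by rewrite ln_prod_seq => [|z]; [rewrite -sumrN|exact: p_pos].
have sv : \sum_a v a = zav Q b by rewrite (eq_bigr _ (fun a _ => vE a)) -Pr_partition_fin.
have -> : ln (zav Q b) = (\sum_a v a * ln (zav Q b)) / zav Q b.
  by rewrite -mulr_suml sv mulrAC divff ?mul1r// gt_eqF.
rewrite -mulrDl -big_split/= mulr_suml; apply: eq_bigr => a _; rewrite /alpha -vE /v.
case: (avoid b Q _); last by rewrite !mul0r addr0 oppr0 mul0r.
rewrite mul1r ln_div ?posrE ?cweight_gt0//.
by field; rewrite gt_eqF.
Qed.

Lemma ent_alpha_eq Q : uniq Q -> ent (alpha Q true) = ent (alpha Q false).
Proof. by move=> uQ; rewrite !ent_alpha// einfo_avoids// zav_eq. Qed.

Lemma ent_gt0 (X : finType) (q : X -> R) x y : pmf q -> x != y -> 0 < q x -> 0 < q y ->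
  0 < ent q.
Proof.
move=> pq xy qx qy; rewrite /ent (bigD1 x)//=; apply: ltr_wpDr.
  apply: sumr_ge0 => z _; rewrite oppr_ge0 mulr_ge0_le0 ?pq.1//.
  exact: ln_pmf_le0.
have q1 : q x < 1.
  rewrite -pq.2 (bigD1 x)//= (bigD1 y) 1?eq_sym//= ltrDl; apply: ltr_wpDr => //.
  by apply: sumr_ge0 => z _; exact: pq.1.
by rewrite oppr_gt0 pmulr_rlt0// ln_lt0 ?qx.
Qed.

(** Two constant fillings avoid the word by [p_free], so the law has two atoms. *)
Lemma ent_alpha_gt0 Q b : uniq Q -> Q != [::] -> 0 < ent (alpha Q b).
Proof.
move=> uQ Q0; have [c [c' [cc hc hc']]] := p_free S b.
have pos d : has (fun f => w b f != d) F -> 0 < alpha Q b (lett Q (fun=> d)).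
  move=> hd; rewrite /alpha divr_gt0 ?zav_gt0// Pr_avoid_lett// avoid_lett.
  by rewrite const_avoid// mul1r cweight_gt0.
apply: (ent_gt0 (alpha_pmf b uQ) _ (pos _ hc) (pos _ hc')).
apply: contra cc => /eqP/lett_eq h; case: Q Q0 {uQ pos} h => // z Q _ h.
by rewrite (h z) ?mem_head.
Qed.

Lemma alpha_avoid Q b a : uniq Q -> 0 < alpha Q b a -> avoid b Q (unlett a).
Proof.
move=> uQ; rewrite /alpha Pr_avoid_lett//.
by case: (avoid b Q _) => //; rewrite !mul0r ltxx.
Qed.

Definition shiftq g Q := [seq (g * q)%g | q <- Q].

Lemma sites_shift g Q h : ((g * h)%g \in sites (shiftq g Q)) = (h \in sites Q).
Proof.
rewrite !mem_sites; apply: eq_all => f; rewrite -mulgA mem_map//.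
exact: mulgI.
Qed.

Lemma avoid_shift g Q b (x : G -> letter (n b)) :
  avoid b (shiftq g Q) x = avoid b Q (tr g x).
Proof.
apply/allP/allP => h k.
  by move=> kQ; rewrite occ_tr; apply: h; rewrite sites_shift.
by rewrite -[k](mulVKg g) sites_shift => kQ; rewrite -occ_tr; exact: h.
Qed.

(** A placement inside the union cannot straddle two clusters: isolation would make it meet a site
    covered by an occurrence, yet no point of a cluster is covered. *)
Lemma avoid_flatten D (Cs : seq (seq G)) b (x : G -> letter (n b)) :
  (forall C, C \in Cs -> isolated D C) ->
  avoid b (flatten Cs) x = all (fun C => avoid b C x) Cs.
Proof.
move=> iso; apply/allP/allP => [h C CC|h k].
  apply/allP => k; rewrite mem_sites => /allP kC; apply: h; rewrite mem_sites.
  by apply/allP => f fF; apply/flattenP; exists C => //; exact: kC.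
rewrite mem_sites => /allP kC.
have /flattenP[C CC kC1] := kC _ (pshape1 S).
have /isolatedP iC := iso _ CC; apply: (allP (h _ CC)); rewrite mem_sites.
have [_ []] := iC _ _ kC1 (pshape1 S); rewrite invg1 !mulg1//.
move=> [f fF /hasP[f' f'F Dk]].
have /flattenP[C' CC' kC'] := kC _ fF.
by have /isolatedP/(_ _ _ kC' f'F)[] := iso _ CC'; rewrite Dk.
Qed.

Section tower.
Context (Q : seq G) (uQ : uniq Q) (Q0 : Q != [::]).

Definition letter0 b : cletter Q b := lett Q (fun=> ord0).
Definition tower := lv (alpha Q) letter0.
Definition tlen := len (alpha Q) letter0.

Let hpmf b := alpha_pmf b uQ.
Let hpos := ent_alpha_gt0 true uQ Q0.
Let heq := ent_alpha_eq uQ.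

Lemma tlen_gt0 J : (0 < tlen J)%N.
Proof. exact: (len_gt0 letter0 hpmf hpos heq). Qed.

Definition spells J b (pos : nat -> G) (z : lX (tower J) b) : set (Cfg b) :=
  [set x | (forall i, (i < tlen J)%N -> avoid b Q (tr (pos i) x)) /\
    rd (alpha Q) letter0 J (fun i => lett Q (tr (pos i) x)) = z].

Definition footprint J (pos : nat -> G) := flatten [seq shiftq (pos i) Q | i <- iota 0 (tlen J)].

Lemma mem_footprint J pos z : reflect (exists2 i, (i < tlen J)%N & z \in shiftq (pos i) Q)
  (z \in footprint J pos).
Proof.
apply: (iffP flattenP) => [[C /mapP[i]]|[i iJ zi]].
  by rewrite mem_iota => /andP[_ iJ] -> zi; exists i.
by exists (shiftq (pos i) Q) => //; apply: map_f; rewrite mem_iota.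
Qed.

Definition separated J (pos : nat -> G) := forall i j h, (i < j)%N -> (j < tlen J)%N ->
  h \in shiftq (pos i) Q -> h \notin shiftq (pos j) Q.

(** The translates of [Q] are disjoint, so their fillings are independent; each contributes a factor
    [zav Q b] for avoidance and a letter of law [alpha]. *)
Lemma block_law J b (pos : nat -> G) (z : lX (tower J) b) : separated J pos ->
  depends (footprint J pos) (spells pos z) /\
  Prb b (spells pos z) = zav Q b ^+ tlen J * lp z.
Proof.
elim: J pos z => [|J ih] pos z dpos.
  have EE : spells pos z = [set x | (avoids b Q `&` [set x | lett Q x = z]) (tr (pos 0%N) x)].
    apply/seteqP; split=> x; rewrite /spells/=; first by move=> [h <-]; split=> //; exact: (h 0%N).
    by move=> [h hz]; split=> // -[].
  have dA : depends Q (avoids b Q `&` [set x | lett Q x = z]).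
    by apply: dependsI; [exact: avoids_depends|exact: lett_depends].
  rewrite EE; split; first by have := depends_tr (g := pos 0%N) dA; rewrite /footprint/= cats0.
  rewrite (Pr_tr countG); last exact: (depends_measurable dA).
  by rewrite [tlen 0]/= expr1/= /alpha mulrCA divff ?mulr1 ?gt_eqF ?zav_gt0.
pose m := mm (alpha Q) letter0 J; pose l := tlen J.
pose pos' (s i : nat) := pos (s * l + i)%N.
have lt_m s i : (s < m)%N -> (i < l)%N -> (s * l + i < tlen J.+1)%N.
  move=> sm il; rewrite (@leq_trans (s * l + l))// ?ltn_add2l// -mulSnr.
  by rewrite /tlen/= leq_mul2r sm orbT.
have sep s : (s < m)%N -> separated J (pos' s).
  by move=> sm i j h ij jl; apply: dpos; rewrite ?ltn_add2l//; exact: lt_m.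
pose E (s : nat) : set (Cfg b) := if insub s is Some o then spells (pos' s) (z o) else setT.
have EO (o : 'I_m) : E o = spells (pos' o) (z o) by rewrite /E valK.
have EE : spells pos z = [set x | forall s, (s < m)%N -> E s x].
  apply/seteqP; split=> x /=.
    move=> [av zE] s sm; rewrite (EO (Ordinal sm)); split=> [i il|].
      by apply: av; exact: lt_m.
    by rewrite -zE/= ffunE.
  move=> h; split=> [i|].
    move=> /(split_index hpmf hpos heq)[s [k [kl ->]]].
    have := h s (ltn_ord s); rewrite EO => -[+ _]; exact.
  apply/ffunP => s; rewrite ffunE.
  by have := h s (ltn_ord s); rewrite EO => -[_].
have [dF PF] : depends (flatten [seq footprint J (pos' s) | s <- iota 0 m])
    [set x | forall s, (s < m)%N -> E s x] /\
    Prb b [set x | forall s, (s < m)%N -> E s x] = \prod_(s < m) Prb b (E s).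
  apply: Pr_indep_family => [s sm|s s' g ss sm].
    by rewrite (EO (Ordinal sm)); have [] := ih (pos' s) (z (Ordinal sm)) (sep s sm).
  move=> /mem_footprint[i il gi]; apply/negP => /mem_footprint[j jl].
  apply/negP; apply: dpos gi; last exact: lt_m.
  rewrite (@leq_trans (s * l + l))// ?ltn_add2l// -mulSnr.
  by rewrite (leq_trans _ (leq_addr _ _))// leq_mul2r ss orbT.
rewrite EE; split.
  apply: depends_sub dF => g /flattenP[C /mapP[s]]; rewrite mem_iota => /andP[_ sm] ->.
  by move=> /mem_footprint[i il gi]; apply/mem_footprint; exists (s * l + i)%N => //; exact: lt_m.
rewrite PF (eq_bigr (fun s => zav Q b ^+ l * lp (z s))); last first.
  by move=> s _; rewrite EO; have [] := ih (pos' s) (z s) (sep s (ltn_ord s)).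
by rewrite big_split/= prodr_const card_ord -exprM mulnC.
Qed.

Lemma spells_depends J b pos (V : pred (lX (tower J) b)) : separated J pos ->
  depends (footprint J pos) [set x : Cfg b | (forall i, (i < tlen J)%N -> avoid b Q (tr (pos i) x)) /\
    V (rd (alpha Q) letter0 J (fun i => lett Q (tr (pos i) x)))].
Proof.
move=> sp x y xy [av Vx]; have [d _] := @block_law J b pos (rd (alpha Q) letter0 J (fun i => lett Q (tr (pos i) x))) sp.
by have [av' e] := d x y xy (conj av erefl); split=> //; rewrite e.
Qed.

Lemma spells_prob J b pos (V : pred (lX (tower J) b)) : separated J pos ->
  Prb b [set x : Cfg b | (forall i, (i < tlen J)%N -> avoid b Q (tr (pos i) x)) /\
    V (rd (alpha Q) letter0 J (fun i => lett Q (tr (pos i) x)))] =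
  zav Q b ^+ tlen J * \sum_(z | V z) lp z.
Proof.
move=> sp; have dV := @spells_depends J b pos V sp.
pose f (x : Cfg b) := rd (alpha Q) letter0 J (fun i => lett Q (tr (pos i) x)).
have mf z : measurable [set x | f x = z].
  apply: (@depends_measurable _ _ (footprint J pos)) => x y xy /= <-.
  apply: eq_rd => i iJ; apply/lett_eq => q qQ.
  by rewrite /tr xy//; apply/mem_footprint; exists i => //; exact: map_f.
rewrite (Pr_partition_fin (f := f) (depends_measurable dV) mf) mulr_sumr big_mkcond [RHS]big_mkcond/=.
rewrite [RHS]big_mkcond/=; apply: eq_bigr => z _; case: ifP => Vz; last first.
  rewrite [X in Prb b X](_ : _ = set0) ?Pr_set0//; apply/seteqP; split=> // x [/= [_ +] fx].
  by rewrite -[rd _ _ _ _]/(f x) fx Vz.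
have [_ <-] := @block_law J b pos z sp; congr (Prb b _); apply/seteqP; split=> x /=.
  by move=> [[av _] fx].
by move=> [av fx]; split=> //; split=> //; rewrite fx.
Qed.

End tower.
End ClusterLetters.

(** * Merging clusters into blocks *)

Section Structure.
Context {R : realType} {G : groupType} (S : pattern_pair R G).
Local Notation F := (pshape S).
Local Notation isolated := (@isolated R G S).
Local Notation halo := (@halo R G S).
Local Notation cover := (@cover R G S).
Implicit Types (g h c z u v : G) (Q W r : seq G) (D E : G -> bool).

(** The value at [k] is decoded from the 2-adic valuation of [k], and every valuation occurs
    infinitely often. *)
Lemma frequent_enumeration (T : choiceType) (t0 : T) (code : T -> nat) : injective code ->
  exists s : nat -> T, forall t N, exists2 k, (N <= k)%N & s k = t.
Proof.
move=> code_inj; pose dec k := xget t0 [set t | code t = k].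
exists (fun k => dec (logn 2 k)) => t N; exists (2 ^ code t * N.*2.+1)%N.
  by rewrite (@leq_trans N.*2.+1)// ?leq_pmull ?expn_gt0// -addnn; lia.
rewrite lognM ?expn_gt0// pfactorK// logn_coprime ?coprime2n/= ?odd_double// addn0.
by apply: code_inj; apply: (@xgetPex _ t0 [set t' | code t' = code t]); exists t.
Qed.

(** An operation [(Q, None)] starts clusters of shape [Q], and [(Q, Some k)] merges pairs of blocks
    made of [2 ^ k] such clusters. *)
Lemma op_enumeration : exists s : nat -> seq G * option nat,
  forall o N, exists2 k, (N <= k)%N & s k = o.
Proof.
have /countable_injP[f finj] := p_countable S.
apply: (@frequent_enumeration (seq G * option nat)%type ([::], None) (fun o => pickle (map f o.1, o.2))).
move=> [Q a] [Q' a'] /(pcan_inj pickleK)[+ ->] => /inj_map -> //.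
by move=> g h; apply: finj; rewrite inE.
Qed.

Definition ops := projT1 (cid op_enumeration).

Lemma opsP o N : exists2 k, (N <= k)%N & ops k = o.
Proof. exact: (projT2 (cid op_enumeration)). Qed.

Lemma fresh_exists (s : seq G) : exists g, g \notin s.
Proof.
apply: contrapT => h; apply: (p_infinite S); apply: (sub_finite_set _ (finite_seq s)) => g _ /=.
by apply: contrapT => gs; apply: h; exists g; apply/negP.
Qed.

Definition fresh s := projT1 (cid (fresh_exists s)).

Lemma freshP s : fresh s \notin s.
Proof. exact: (projT2 (cid (fresh_exists s))). Qed.

Definition diffs Q := [seq (q * q'^-1)%g | q <- Q, q' <- Q].
Definition avail_win Q W := [seq (q * h)%g | q <- Q, h <- W] ++ halo Q.

(** At this site the word uses no coordinate read through the window, so its presence is an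
    independent coin. When clusters are started, the translates of the site by [diffs] must enjoy
    the same property. *)
Definition mark (o : seq G * option nat) W : G :=
  if o.2 is None then
    fresh [seq (yc * f^-1)%g | yc <- [seq (y^-1 * c)%g | y <- 1%g :: diffs o.1,
      c <- cover (avail_win o.1 W)], f <- F]
  else fresh [seq (c * f^-1)%g | c <- cover W, f <- F].

(** A displacement so large that the window and mark around a centre and those around the displaced
    centre use disjoint coordinates; the two candidates for a merger are then independent. *)
Definition link (o : seq G * option nat) W : G :=
  fresh [seq (a * b^-1)%g | a <- cover (mark o W :: W), b <- cover (mark o W :: W)].

(** The view from the identity in the pattern: whether this site is claimed and, if it is the centre
    of a block, the shape and the relative positions of the clusters. The view from [g] is obtained
    at [tr g D], which makes the construction equivariant. *)
Definition state := (G -> bool) -> bool * option (seq G * seq G).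

(** The last two conditions break ties: the centres of two overlapping translates of [Q] differ by
    an element of [diffs Q], and then they cannot both pass the test. *)
Definition new Q v (s : state) E :=
  [&& 1%g \in Q, uniq Q, all (fun q => ~~ (s (tr q E)).1) Q, isolated E Q, E v &
    all (fun y => (y == 1%g) || ~~ E (y * v)%g) (diffs Q)].

(** The mark has to be absent at the source and present at the target, so no block is source and
    target of the same operation. *)
Definition merged Q k u v (s : state) E : option (seq G) :=
  if ((s E).2, (s (tr u E)).2) is (Some (Q1, r1), Some (Q2, r2)) then
    if [&& Q1 == Q, Q2 == Q, size r1 == 2 ^ k, size r2 == 2 ^ k, ~~ E v & E (u * v)%g]%N
    then Some (r1 ++ [seq (u * h)%g | h <- r2]) else None
  else None.

Definition step_state (o : seq G * option nat) W (s : state) : state := fun D =>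
  match o with
  | (Q, None) => let act := new Q (mark o W) s in
    ((s D).1 || has (fun q => act (tr q^-1 D)) Q,
     if act D then Some (Q, [:: 1%g]) else (s D).2)
  | (Q, Some k) => let src := merged Q k (link o W) (mark o W) s in
    ((s D).1, if src D is Some r then Some (Q, r) else
              if src (tr (link o W)^-1 D) is Some _ then None else (s D).2)
  end.

Definition new_win Q v W := avail_win Q W ++ v :: [seq (y * v)%g | y <- diffs Q].
Definition merge_win u v W := W ++ [seq (u * h)%g | h <- W] ++ [:: v; (u * v)%g].

Definition next_win (o : seq G * option nat) W : seq G :=
  let v := mark o W in let u := link o W in
  let A := if o.2 is None then new_win o.1 v W else merge_win u v W in
  W ++ A ++ [seq (q^-1 * h)%g | q <- u :: o.1, h <- A].

Fixpoint win k := if k is k'.+1 then next_win (ops k') (win k') else [::].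
Fixpoint st k : state := if k is k'.+1 then step_state (ops k') (win k') (st k')
                         else fun=> (false, None).

Lemma tr_tr (T : Type) g h (x : G -> T) : tr g (tr h x) = tr (h * g)%g x.
Proof. by apply/funext => z; rewrite /tr mulgA. Qed.

Lemma tr1 (T : Type) (x : G -> T) : tr 1%g x = x.
Proof. by apply/funext => z; rewrite /tr mul1g. Qed.

Lemma eq_isolated D E Q : (forall h, h \in halo Q -> D h = E h) ->
  isolated D Q = isolated E Q.
Proof.
move=> DE; apply: eq_in_all => z zQ; apply: eq_in_all => f fF; congr (~~ _ && (_ || _)).
  by apply: DE; rewrite mem_cat; apply/orP; left; apply/allpairsP; exists (z, f).
apply: eq_in_has => f' f'F; apply: eq_in_has => f2 f2F; apply: DE.
rewrite mem_cat; apply/orP; right; apply/allpairsP; exists ((z * f^-1 * f')%g, f2); split=> //.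
apply/allpairsP; exists ((z * f^-1)%g, f'); split=> //.
by apply/allpairsP; exists (z, f).
Qed.

Lemma eq_new Q v W (s : state) D E :
  (forall D E, (forall h, h \in W -> D h = E h) -> s D = s E) ->
  (forall h, h \in new_win Q v W -> D h = E h) -> new Q v s D = new Q v s E.
Proof.
move=> sW DE; rewrite /new; congr [&& _, _, _, _, _ & _].
- apply: eq_in_all => q qQ; congr (~~ _.1); apply: sW => h hW; apply: DE.
  by rewrite !mem_cat; apply/orP; left; apply/orP; left; apply/allpairsP; exists (q, h).
- by apply: eq_isolated => h hQ; apply: DE; rewrite mem_cat; apply/orP; left; rewrite /avail_win mem_cat hQ orbT.
- by apply: DE; rewrite mem_cat inE eqxx orbT.
- apply: eq_in_all => y yQ; congr (_ || ~~ _); apply: DE.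
  rewrite mem_cat inE; apply/orP; right; apply/orP; right.
  by apply/mapP; exists y.
Qed.

Lemma eq_merged Q k u v W (s : state) D E :
  (forall D E, (forall h, h \in W -> D h = E h) -> s D = s E) ->
  (forall h, h \in merge_win u v W -> D h = E h) -> merged Q k u v s D = merged Q k u v s E.
Proof.
move=> sW DE; rewrite /merged (sW D E) => [|h hW]; last by apply: DE; rewrite mem_cat hW.
rewrite (sW (tr u D) (tr u E)) => [|h hW]; last first.
  apply: DE; rewrite !mem_cat; apply/orP; right; apply/orP; left.
  by apply/mapP; exists h.
by rewrite !DE// !mem_cat !inE eqxx ?orbT.
Qed.

Lemma mem_catl (A B : seq G) h : h \in A -> h \in A ++ B.
Proof. by rewrite mem_cat => ->. Qed.

Lemma mem_catr (A B : seq G) h : h \in B -> h \in A ++ B.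
Proof. by rewrite mem_cat orbC => ->. Qed.

Lemma st_local k D E : (forall h, h \in win k -> D h = E h) -> st k D = st k E.
Proof.
elim: k D E => //= k ih D E DE; rewrite /step_state.
case o: (ops k) => [Q [j|]].
  set u := link _ _; set v := mark _ _.
  have DE1 h : h \in merge_win u v (win k) -> D h = E h.
    by move=> hW; apply: DE; rewrite /next_win o; exact/mem_catr/mem_catl.
  have DE2 h : h \in merge_win u v (win k) -> tr u^-1 D h = tr u^-1 E h.
    move=> hW; apply: DE; rewrite /next_win o; apply: mem_catr; apply: mem_catr.
    by apply/allpairsP; exists (u, h); rewrite mem_head.
  rewrite (eq_merged Q j ih DE1) (eq_merged Q j ih DE2) (ih D E)// => h hW.
  by apply: DE; exact: mem_catl.
set v := mark _ _.
have DE1 h : h \in new_win Q v (win k) -> D h = E h.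
  by move=> hW; apply: DE; rewrite /next_win o; exact/mem_catr/mem_catl.
rewrite (eq_new ih DE1) (ih D E); last by move=> h hW; apply: DE; exact: mem_catl.
congr (_ || _, _); apply: eq_in_has => q qQ; apply: (eq_new ih) => h hW; apply: DE.
rewrite /next_win o; apply: mem_catr; apply: mem_catr.
by apply/allpairsP; exists (q, h); rewrite inE qQ orbT.
Qed.

Definition claimed k D z := (st k (tr z D)).1.
Definition owner k D c := (st k (tr c D)).2.

Lemma claimed_tr k D g z : claimed k (tr g D) z = claimed k D (g * z).
Proof. by rewrite /claimed tr_tr. Qed.

Lemma own_tr k D g c : owner k (tr g D) c = owner k D (g * c).
Proof. by rewrite /owner tr_tr. Qed.

(** The invariant of the construction. The condition that the first relative position is 1 makes a
    centre a member of its own block, hence claimed. *)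
Definition well_formed k D :=
  [/\ (forall c Q r, owner k D c = Some (Q, r) ->
        [/\ uniq Q, 1%g \in Q, (exists j, size r = (2 ^ j)%N), nth 1%g r 0 = 1%g &
            forall i, (i < size r)%N -> isolated (tr (c * nth 1%g r i) D) Q]),
      (forall z, claimed k D z <->
        exists c Q r i, owner k D c = Some (Q, r) /\ (i < size r)%N /\ z \in shiftq (c * nth 1%g r i) Q) &
      forall c Q r i c' Q' r' i' z, owner k D c = Some (Q, r) -> owner k D c' = Some (Q', r') ->
        (i < size r)%N -> (i' < size r')%N ->
        z \in shiftq (c * nth 1%g r i) Q -> z \in shiftq (c' * nth 1%g r' i') Q' ->
        c = c' /\ i = i'].

Lemma mem_shiftq z g Q : (z \in shiftq g Q) = ((g^-1 * z)%g \in Q).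
Proof.
apply/mapP/idP => [[q qQ ->]|zQ]; first by rewrite mulKg.
by exists (g^-1 * z)%g => //; rewrite mulVKg.
Qed.

Lemma well_formed_act k Q D : ops k = (Q, None) -> well_formed k D -> well_formed k.+1 D.
Proof.
move=> ok [wo wc wu].
set v := mark (ops k) (win k); pose nw c := new Q v (st k) (tr c D).
have ownE c : owner k.+1 D c = if nw c then Some (Q, [:: 1%g]) else owner k D c.
  by rewrite /owner /= /step_state /nw /v ok.
have clE z : claimed k.+1 D z = claimed k D z || has (fun q => nw (z * q^-1)%g) Q.
  by rewrite /claimed /= /step_state /v ok/=; congr (_ || _); apply: eq_has => q; rewrite /nw tr_tr /v ok.
have nwP c : nw c -> [/\ 1%g \in Q, uniq Q, forall q, q \in Q -> ~~ claimed k D (c * q),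
    isolated (tr c D) Q & D (c * v)%g /\ forall y, y \in diffs Q -> y != 1%g -> ~~ D (c * y * v)%g].
  move=> /and5P[h1 h2 /allP h3 h4 /andP[h5 /allP h6]]; split=> //.
    by move=> q /h3; rewrite /claimed tr_tr.
  split=> // y yQ y1; by have := h6 y yQ; rewrite (negbTE y1) /tr mulgA.
have old_claimed c Q' r i z : owner k D c = Some (Q', r) -> (i < size r)%N ->
    z \in shiftq (c * nth 1%g r i) Q' -> claimed k D z.
  by move=> h1 h2 h3; apply/wc; exists c, Q', r, i.
(* A centre is itself claimed, so it cannot start a new cluster. *)
have keep c Q' r : owner k D c = Some (Q', r) -> owner k.+1 D c = Some (Q', r).
  move=> owc; rewrite ownE; case: ifP => // /nwP[Q1 _ /(_ _ Q1) + _ _].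
  have [_ Q'1 [j sr] r0 _] := wo _ _ _ owc.
  rewrite mulg1 (old_claimed c Q' r 0%N)// ?sr ?expn_gt0//.
  by rewrite r0 mulg1 mem_shiftq mulVg.
split.
- move=> c Q' r; rewrite ownE; case: ifP => [/nwP[Q1 uQ _ iQ _] [<- <-]|_]; last exact: wo.
  by split=> //; [exists 0%N|case=> // _; rewrite mulg1].
- move=> z; rewrite clE; split.
    move=> /orP[/wc[c [Q' [r [i [ owc [ir zi]]]]]]|/hasP[q qQ nq]].
      by exists c, Q', r, i; rewrite (keep _ _ _ owc).
    exists (z * q^-1)%g, Q, [:: 1%g], 0%N; rewrite ownE nq/= mulg1; split=> //; split=> //.
    by apply/mapP; exists q => //; rewrite mulgVK.
  move=> [c [Q' [r [i []]]]]; rewrite ownE; case: ifP => [nc [<- <-] []|_ owc [ir zi]].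
    case: i => // _ /=; rewrite mulg1 => /mapP[q qQ ->]; apply/orP; right; apply/hasP.
    by exists q => //; rewrite mulgK.
  by rewrite (old_claimed _ _ _ _ _ owc ir zi).
move=> c Q1 r1 i1 c' Q2 r2 i2 z; rewrite !ownE.
case: ifP => nc; case: ifP => nc'; last exact: wu.
- move=> [<- <-] [<- <-]; case: i1 => // _; case: i2 => // _ /=.
  rewrite !mulg1 => /mapP[q qQ ->] /mapP[q' q'Q e]; split=> //.
  have cE : c' = (c * (q * q'^-1))%g by rewrite mulgA e mulgK.
  have [yq|y1] := eqVneq (q * q'^-1)%g 1%g; first by rewrite cE yq mulg1.
  have [_ _ _ _ [_ /(_ (q * q'^-1)%g)]] := nwP _ nc.
  have [_ _ _ _ [+ _]] := nwP _ nc'; rewrite cE => -> /(_ _ y1) h.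
  by have := h (allpairs_f _ qQ q'Q).
- move=> [<- <-] owc'; case: i1 => // _ i2r /=; rewrite mulg1 => /mapP[q qQ ->] zi.
  by have [_ _ /(_ _ qQ) + _ _] := nwP _ nc; rewrite (old_claimed _ _ _ _ _ owc' i2r zi).
move=> owc [<- <-] i1r; case: i2 => // _ zi /=; rewrite mulg1 => /mapP[q qQ zE].
by have [_ _ /(_ _ qQ) + _ _] := nwP _ nc'; rewrite -zE (old_claimed _ _ _ _ _ owc i1r zi).
Qed.

Section Merge.
Context (k j : nat) (Q : seq G) (D : G -> bool).
Hypothesis opk : ops k = (Q, Some j).
Let u := link (ops k) (win k).
Let v := mark (ops k) (win k).
Let src c := merged Q j u v (st k) (tr c D).

Lemma srcP c r : src c = Some r -> exists r1 r2,
  [/\ owner k D c = Some (Q, r1), owner k D (c * u) = Some (Q, r2),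
      size r1 = (2 ^ j)%N /\ size r2 = (2 ^ j)%N, ~~ D (c * v)%g /\ D (c * u * v)%g &
      r = r1 ++ [seq (u * h)%g | h <- r2]].
Proof.
rewrite /src /merged tr_tr -/(owner k D c) -/(owner k D (c * u)).
case: (owner k D c) => [[Q1 r1]|]//; case: (owner k D (c * u)) => [[Q2 r2]|]//.
case: ifP => // /and5P[/eqP-> /eqP-> /eqP s1 /eqP s2 /andP[Dv Duv]] [<-].
by exists r1, r2; split=> //; split=> //; rewrite -mulgA.
Qed.

Lemma own_merge c : owner k.+1 D c = if src c is Some r then Some (Q, r)
  else if src (c * u^-1) is Some _ then None else owner k D c.
Proof. by rewrite /owner /= /step_state /src /u /v opk tr_tr. Qed.

Lemma src_target c : src c -> src (c * u^-1) = None.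
Proof.
case e: (src c) => [r|]// _; case e': (src (c * u^-1)) => [r'|]//.
have [_ [_ [_ _ _ [nD _] _]]] := srcP e; have [_ [_ [_ _ _ [_ D'] _]]] := srcP e'.
by rewrite mulgVK (negbTE nD) in D'.
Qed.

Lemma origin_merge c Q' r i : owner k.+1 D c = Some (Q', r) -> (i < size r)%N ->
  exists c0 r0 i0, [/\ owner k D c0 = Some (Q', r0), (i0 < size r0)%N,
    (c * nth 1 r i = c0 * nth 1 r0 i0)%g &
    [/\ c0 = c, i0 = i & src (c * u^-1) = None] \/ [/\ c0 = (c * u)%g, i = (2 ^ j + i0)%N & src c]].
Proof.
rewrite own_merge; case e: (src c) => [r'|].
  move=> [<- <-]; have [r1 [r2 [ow1 ow2 [s1 s2] _ ->]]] := srcP e.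
  have nt : src (c * u^-1) = None by apply: src_target; rewrite e.
  rewrite size_cat size_map s1 s2 nth_cat s1 => ir; case: ltnP => ij.
    by exists c, r1, i; rewrite s1; split=> //; left.
  have ij2 : (i - 2 ^ j < 2 ^ j)%N by rewrite ltn_subLR.
  exists (c * u)%g, r2, (i - 2 ^ j)%N; rewrite s2; split=> //; last by right; rewrite subnKC.
  by rewrite (nth_map 1%g) ?s2// mulgA.
case e': (src (c * u^-1)) => [//|] owc ir.
by exists c, r, i; split=> //; left.
Qed.

(** An old block survives as a segment starting at a multiple of its own size; this alignment keeps
    the cuts made by the tower in place. *)
Lemma grow_merge c Q' r : owner k D c = Some (Q', r) -> exists c' r' s t,
  [/\ owner k.+1 D c' = Some (Q', r'), size r' = (t * size r)%N, (s < t)%N,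
      forall i, (i < size r)%N -> (c' * nth 1 r' (s * size r + i) = c * nth 1 r i)%g &
      owner k.+1 D c <> Some (Q', r) -> t = 2].
Proof.
move=> owc; case e: (src c) => [r'|].
  have [r1 [r2 [+ ow2 [s1 s2] _ r'E]]] := srcP e; rewrite owc => -[QE] r1E.
  exists c, r', 0%N, 2; rewrite own_merge e QE r1E; split=> //.
    by rewrite r'E size_cat size_map s1 s2 mul2n addnn.
  by move=> i ir; rewrite mul0n add0n r'E nth_cat ir.
case e': (src (c * u^-1)) => [r'|].
  have [r1 [r2 [ow1 + [s1 s2] _ r'E]]] := srcP e'; rewrite mulgVK owc => -[QE] r2E.
  exists (c * u^-1)%g, r', 1%N, 2; rewrite own_merge e' QE r2E; split=> //.
    by rewrite r'E size_cat size_map s1 s2 mul2n addnn.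
  move=> i ir; rewrite mul1n r'E nth_cat s1 s2 ltnNge leq_addr/= addKn (nth_map 1%g)//.
  by rewrite mulgA mulgVK.
exists c, r, 0%N, 1%N; rewrite own_merge e e'; split=> //; by rewrite mul1n.
Qed.

Lemma well_formed_merge : well_formed k D -> well_formed k.+1 D.
Proof.
move=> [wo wc wu]; split.
- move=> c Q' r owc; have iso i : (i < size r)%N -> isolated (tr (c * nth 1%g r i) D) Q'.
    move=> ir; have [c0 [r0 [i0 [ow0 i0r -> _]]]] := origin_merge owc ir.
    by have [_ _ _ _] := wo _ _ _ ow0; exact.
  move: owc; rewrite own_merge; case e: (src c) => [r'|].
    have [r1 [r2 [ow1 _ [s1 s2] _ r'E]]] := srcP e => -[QE rE].
    have [uQ Q1 _ r0 _] := wo _ _ _ ow1; rewrite -QE; split=> //; last by rewrite QE.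
      by exists j.+1; rewrite -rE r'E size_cat size_map s1 s2 addnn -mul2n expnS.
    by rewrite -rE r'E nth_cat s1 expn_gt0.
  by case: (src _) => // /wo[].
- move=> z; have -> : claimed k.+1 D z = claimed k D z by rewrite /claimed /= /step_state opk.
  split=> [/wc[c [Q' [r [i [ owc [ir zi]]]]]]|[c [Q' [r [i [ owc [ir zi]]]]]]].
    have [c' [r' [s [t [ow' r's st h _]]]]] := grow_merge owc.
    exists c', Q', r', (s * size r + i)%N; split=> //; split; last by rewrite h.
    by rewrite r's (@leq_trans (s * size r + size r)%N) ?ltn_add2l// -mulSnr leq_mul2r st orbT.
  have [c0 [r0 [i0 [ow0 i0r e _]]]] := origin_merge owc ir.
  by apply/wc; exists c0, Q', r0, i0; rewrite -e.
move=> c Q1 r1 i1 c' Q2 r2 i2 z ow1 ow2 l1 l2.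
have [c0 [r0 [i0 [q1 q2 -> q3]]]] := origin_merge ow1 l1.
have [d0 [t0 [j0 [q4 q5 -> q6]]]] := origin_merge ow2 l2 => z1 z2.
have [cE iE] := wu _ _ _ _ _ _ _ _ _ q1 q4 q2 q5 z1 z2.
case: q3 => -[a1 a2 h]; case: q6 => -[a3 a4 h'].
- by rewrite -a1 -a2 -a3 -a4.
- by move: h h'; rewrite -a1 cE a3 mulgK => ->.
- by move: h' h; rewrite -a3 -cE a1 mulgK => ->.
- split; first by apply: (@mulIg _ u); rewrite -a1 -a3.
  by rewrite a2 a4 iE.
Qed.

End Merge.

Lemma st_wf k D : well_formed k D.
Proof.
elim: k => [|k ih].
  by split=> // z; split=> // -[c [Q [r [i []]]]].
case op: (ops k) => [Q [j|]]; [exact: (well_formed_merge op)|exact: (well_formed_act op)].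
Qed.

Lemma own_ok k D c Q r : owner k D c = Some (Q, r) ->
  [/\ uniq Q, 1%g \in Q, exists j, size r = (2 ^ j)%N, nth 1%g r 0 = 1%g &
    forall i, (i < size r)%N -> isolated (tr (c * nth 1%g r i) D) Q].
Proof. by have [h _ _] := st_wf k D; exact: h. Qed.

Lemma claimedP k D z : claimed k D z <-> exists c Q r i, owner k D c = Some (Q, r) /\
  (i < size r)%N /\ z \in shiftq (c * nth 1%g r i) Q.
Proof. by have [_ h _] := st_wf k D. Qed.

Lemma own_uniq k D c Q r i c' Q' r' i' z : owner k D c = Some (Q, r) ->
  owner k D c' = Some (Q', r') -> (i < size r)%N -> (i' < size r')%N ->
  z \in shiftq (c * nth 1%g r i) Q -> z \in shiftq (c' * nth 1%g r' i') Q' -> c = c' /\ i = i'.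
Proof. by have [_ _ h] := st_wf k D; exact: h. Qed.

Lemma own_claimed k D c Q r : owner k D c = Some (Q, r) -> claimed k D c.
Proof.
move=> owc; have [_ Q1 [j sr] r0 _] := own_ok owc.
apply/claimedP; exists c, Q, r, 0%N; split=> //; split; first by rewrite sr expn_gt0.
by rewrite r0 mulg1 mem_shiftq mulVg.
Qed.

Lemma own_act k Q D c : ops k = (Q, None) -> owner k.+1 D c =
  if new Q (mark (ops k) (win k)) (st k) (tr c D) then Some (Q, [:: 1%g]) else owner k D c.
Proof. by move=> ok; rewrite /owner /= /step_state ok. Qed.

Lemma new_unclaimed Q v k D c : new Q v (st k) (tr c D) -> ~~ claimed k D c.
Proof.
move=> /and5P[Q1 _ /allP/(_ _ Q1) + _ _].
by rewrite tr_tr mulg1.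
Qed.

Lemma claimed_step k D z : claimed k D z -> claimed k.+1 D z.
Proof.
rewrite /claimed /= /step_state; case: (ops k) => [Q [j|]]//=.
by move=> ->.
Qed.

Lemma claimed_mono k k' D z : (k <= k')%N -> claimed k D z -> claimed k' D z.
Proof.
elim: k' => [|k' ih]; first by rewrite leqn0 => /eqP ->.
by rewrite leq_eqVlt => /predU1P[->//|/ih h /h]; exact: claimed_step.
Qed.

Lemma grow_step k D c Q r : owner k D c = Some (Q, r) -> exists c' r' s t,
  [/\ owner k.+1 D c' = Some (Q, r'), size r' = (t * size r)%N, (s < t)%N,
      forall i, (i < size r)%N -> (c' * nth 1 r' (s * size r + i) = c * nth 1 r i)%g &
      owner k.+1 D c <> Some (Q, r) -> t = 2].
Proof.
move=> owc; case op: (ops k) => [Q' [j|]]; first exact: (grow_merge op).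
have : owner k.+1 D c = Some (Q, r).
  rewrite (own_act _ _ op); case: ifP => // /new_unclaimed.
  by rewrite (own_claimed owc).
by move=> owc'; exists c, r, 0%N, 1%N; split=> //; rewrite mul1n.
Qed.

Lemma grow k k' D c Q r : (k <= k')%N -> owner k D c = Some (Q, r) -> exists c' r' s t,
  [/\ owner k' D c' = Some (Q, r'), size r' = (t * size r)%N, (s < t)%N &
      forall i, (i < size r)%N -> (c' * nth 1 r' (s * size r + i) = c * nth 1 r i)%g].
Proof.
move=> + owc; elim: k' => [|k' ih].
  rewrite leqn0 => /eqP k0; rewrite k0 in owc.
  by exists c, r, 0%N, 1%N; split=> //; rewrite mul1n.
rewrite leq_eqVlt => /orP[/eqP <-|]; first by exists c, r, 0%N, 1%N; split=> //; rewrite mul1n.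
move=> /ih[c1 [r1 [s1 [t1 [ow1 sr1 st1 h1]]]]].
have [c2 [r2 [s2 [t2 [ow2 sr2 st2 h2 _]]]]] := grow_step ow1.
exists c2, r2, (s2 * t1 + s1)%N, (t2 * t1)%N; split=> //; first by rewrite sr2 sr1 mulnA.
  by rewrite (@leq_trans (s2 * t1 + t1)%N) ?ltn_add2l// -mulSnr leq_mul2r st2 orbT.
move=> i ir; rewrite -h1// -h2; last first.
  by rewrite sr1 (@leq_trans (s1 * size r + size r)%N) ?ltn_add2l// -mulSnr leq_mul2r st1 orbT.
by rewrite sr1 mulnDl mulnA addnA.
Qed.

(** Mergers need an existing centre and new clusters need an unclaimed one, so a claimed site that
    has lost its block never becomes a centre again. *)
Lemma own_none k k' D c : (k <= k')%N -> claimed k D c -> owner k D c = None -> owner k' D c = None.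
Proof.
move=> + cl on; elim: k' => [|k' ih]; first by rewrite leqn0 => /eqP <-.
rewrite leq_eqVlt ltnS => /predU1P[<-//|kk']; have {ih}on' := ih kk'.
case op: (ops k') => [Q [j|]].
  rewrite (own_merge _ op); case e: (merged _ _ _ _ _ _) => [r|]; last by rewrite on'; case: (merged _ _ _ _ _ _).
  by have [? [? [+ _ _ _ _]]] := srcP e; rewrite on'.
rewrite (own_act _ _ op); case: ifP => // /new_unclaimed.
by rewrite (claimed_mono kk' cl).
Qed.

(** A finite list, independent of the pattern, of all relative positions a block can have at stage
    [k]; it bounds the windows used later. *)
Fixpoint entries k : seq G := if k is k'.+1 then
  1%g :: entries k' ++ [seq (link (ops k') (win k') * h)%g | h <- entries k'] else [::].

Lemma own_entries k D c Q r : owner k D c = Some (Q, r) -> {subset r <= entries k}.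
Proof.
elim: k c Q r => // k ih c Q r; case op: (ops k) => [Q' [j|]].
  rewrite (own_merge _ op); case e: (merged _ _ _ _ _ _) => [r'|].
    have [r1 [r2 [ow1 ow2 _ _ ->]]] := srcP e => -[_ <-] h /=.
    rewrite inE !mem_cat => /orP[/(ih _ _ _ ow1) ->|/mapP[h' hr ->]]; first by rewrite orbT.
    by apply/orP; right; apply/orP; right; apply: map_f; apply: ih hr; exact: ow2.
  case: (merged _ _ _ _ _ _) => // /ih h z /h zk /=.
  by rewrite inE mem_cat zk orbT.
rewrite (own_act _ _ op); case: ifP => _.
  by move=> [_ <-] z; rewrite !inE => /eqP ->; rewrite eqxx.
by move=> /ih h z /h zk /=; rewrite inE mem_cat zk orbT.
Qed.

End Structure.

Lemma negligible_exists (R : realType) d (X : measurableType d) (mu : {measure set X -> \bar R})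
    (T : Type) (code : T -> nat) (E : T -> set X) : injective code ->
  (forall t, mu.-negligible (E t)) -> mu.-negligible [set x | exists t, E t x].
Proof.
move=> code_inj nE; pose F k := [set x | exists2 t, code t = k & E t x].
apply: (@negligibleS _ _ _ mu (\bigcup_k F k)) => [x [t Et]|]; first by exists (code t) => //; exists t.
apply: negligible_bigcup => k; have [[t tk]|nt] := pselect (exists t, code t = k).
  by apply: negligibleS (nE t) => x [t' t'k]; rewrite (code_inj t' t)// t'k.
apply: (@negligibleS _ _ _ mu set0); last exact: negligible_set0.
by move=> x [t tk _]; apply: nt; exists t.
Qed.

(** * Null events of the product measure *)

Section Null.
Context {R : realType} {G : groupType}.
Hypothesis countG : countable [set: G].
Context {n : nat} (mu : probability (letter n) R).
Local Notation X := (config G (letter n)).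
Implicit Types (E : set X).

Definition null E := (product_probability G mu).-negligible E.

Lemma null_sub E E' : E `<=` E' -> null E' -> null E.
Proof. exact: negligibleS. Qed.

Lemma null_eps E : (forall e : R, 0 < e -> exists2 B, measurable B & E `<=` B /\ Pr mu B <= e) ->
  null E.
Proof.
move=> small; pose B k := projT1 (cid2 (small (k.+1%:R^-1) (ltac:(by [])))).
have mB k : measurable (B k) by rewrite /B; case: cid2.
have EB k : E `<=` B k by rewrite /B; case: cid2 => ? ? [].
have PB k : Pr mu (B k) <= k.+1%:R^-1 by rewrite /B; case: cid2 => ? ? [].
exists (\bigcap_k B k); split; first exact: bigcapT_measurable.
  apply/eqP; rewrite eq_le measure_ge0 andbT; apply/lee_addgt0Pr => e e0; rewrite add0e.
  have [k] := ltr_add_invr e0; rewrite add0r => ke.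
  have mI : measurable (\bigcap_k B k) by exact: bigcapT_measurable.
  rewrite Pr_EFin// lee_fin (le_trans _ (ltW ke))// (le_trans _ (PB k))//.
  by apply: Pr_le => // x; exact.
by move=> x Ex k _; exact: EB.
Qed.

Lemma null_tr g E : null E -> null [set x | E (tr g x)].
Proof.
move=> [B [mB B0 EB]]; exists [set x | B (tr g x)]; split.
- by rewrite -[X in measurable X]setTI; exact: (measurable_tr g measurableT mB).
- have mB' : measurable [set x : X | B (tr g x)].
    by rewrite -[X in measurable X]setTI; exact: (measurable_tr g measurableT mB).
  by rewrite Pr_EFin// Pr_tr// /Pr B0.
- by move=> x /EB.
Qed.

Lemma null_exists (T : Type) (code : T -> nat) (E : T -> set X) : injective code ->
  (forall t, null (E t)) -> null [set x | exists t, E t x].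
Proof. exact: negligible_exists. Qed.

Lemma Pr_setC E : measurable E -> Pr mu (~` E) = 1 - Pr mu E.
Proof.
move=> mE; apply: EFin_inj; rewrite -Pr_EFin; last exact: measurableC.
by rewrite probability_setC// EFinB -Pr_EFin.
Qed.

Lemma Pr_setU E E' : measurable E -> measurable E' -> E `&` E' = set0 ->
  Pr mu (E `|` E') = Pr mu E + Pr mu E'.
Proof.
move=> mE mE' EE'; apply: EFin_inj; rewrite EFinD -!Pr_EFin//; last exact: measurableU.
by rewrite measureU.
Qed.

Lemma Pr_disjoint (T : eqType) (s : seq T) (E : T -> set X) : uniq s ->
  (forall t, measurable (E t)) ->
  (forall t t' x, t \in s -> t' \in s -> E t x -> E t' x -> t = t') ->
  \sum_(t <- s) Pr mu (E t) <= 1.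
Proof.
move=> us mE dE; pose U (s : seq T) := [set x | exists2 t, t \in s & E t x].
suff [mU <-] : measurable (U s) /\ Pr mu (U s) = \sum_(t <- s) Pr mu (E t) by exact: Pr_le1.
elim: s us dE => [|t s ih] /=.
  by move=> _ _; rewrite big_nil (_ : U [::] = set0) ?Pr_set0//; apply/seteqP; split=> // x [].
move=> /andP[ts us] dE; have [|mU PU] := ih us.
  by move=> t1 t2 x h1 h2; apply: dE; rewrite inE ?h1 ?h2 orbT.
have UE : U (t :: s) = E t `|` U s.
  apply/seteqP; split=> x; first by move=> [t']; rewrite inE => /predU1P[->|]; [left|right; exists t'].
  by move=> [Et|[t' t's Et']]; [exists t => //; rewrite mem_head|exists t' => //; rewrite inE t's orbT].
rewrite UE big_cons -PU; split; first exact: measurableU.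
rewrite Pr_setU//; apply/seteqP; split=> // x [Et [t' t's Et']].
by move: ts; rewrite (dE t t' x) ?mem_head ?inE ?t's ?orbT.
Qed.

(** More than $1/e$ of these events would exceed the total mass. *)
Lemma infinitely_disjoint (e : R) (E : nat -> set X) : (forall k, measurable (E k)) ->
  (forall j k x, (j < k)%N -> E j x -> E k x -> False) ->
  (forall N, exists2 k, (N <= k)%N & e <= Pr mu (E k)) -> e <= 0.
Proof.
move=> mE dE inf.
have pick N : exists s, [/\ uniq s, size s = N & \sum_(k <- s) e <= \sum_(k <- s) Pr mu (E k)].
  elim: N => [|N [s [us sN h]]]; first by exists [::]; rewrite !big_nil.
  have [k sk ek] := inf (\max_(i <- s) i.+1)%N.
  exists (k :: s); rewrite /= us sN !big_cons lerD// andbT; split=> //.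
  by apply/negP => ks; have := @leq_bigmax_seq _ s xpredT (fun i => i.+1) k ks isT; rewrite leqNgt ltnS sk.
rewrite leNgt; apply/negP => e0; have [s [us sN h]] := pick (Num.truncn e^-1).+1.
have : \sum_(k <- s) Pr mu (E k) <= 1.
  apply: Pr_disjoint => // j k x _ _ Ej Ek.
  by have [/dE|/dE|//] := ltngtP j k; [move=> /(_ x Ej Ek)|move=> /(_ x Ek Ej)].
apply/negP; rewrite -ltNge (lt_le_trans _ h)// big_const_seq count_predT sN iter_addr_0.
by rewrite -mulr_natl -ltr_pdivrMr// mul1r truncnS_gt.
Qed.

End Null.

(** * Almost every uncovered site enters arbitrarily long blocks *)

Section Generation.
Context {R : realType} {G : groupType} (S : pattern_pair R G) (b : bool).
Local Notation n := (psize S).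
Local Notation mu := (pmu S).
Local Notation F := (pshape S).
Local Notation w b := (@pword R G S b).
Local Notation countG := (p_countable S).
Local Notation Cfg b := (config G (letter (n b))).
Local Notation Prb b := (@Pr R G (n b) (mu b)).
Local Notation p b := (@wt R (n b) (mu b)).
Local Notation occ b := (@occ R G S b).
Local Notation occ_at b := (@occ_at R G S b).
Local Notation cover := (@cover R G S).
Local Notation dens := (@dens R G S).
Local Notation isolated := (@isolated R G S).
Local Notation halo := (@halo R G S).
Local Notation hit := (@hit R G S).
Local Notation win := (win S).
Local Notation st := (@st R G S).
Local Notation own := (@owner R G S).
Local Notation claimed := (@claimed R G S).
Local Notation ops := (ops S).
Local Notation mark := (mark S).
Local Notation link := (link S).
Local Notation null := (@null R G (n b) (mu b)).
Implicit Types (x : Cfg b) (Q W : seq G).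

Lemma occ_trE x g : occ b (tr g x) = tr g (occ b x).
Proof. by apply/funext => h; exact: occ_tr. Qed.

Lemma pattern_depends W (V : (G -> bool) -> Prop) :
  (forall D E, (forall h, h \in W -> D h = E h) -> V D -> V E) ->
  depends (cover W) [set x | V (occ b x)].
Proof.
move=> VW x y xy; apply: VW => h hW; apply: occ_local => f fF.
by apply: xy; exact: mem_cover.
Qed.

Lemma dens_gt0 : 0 < dens b.
Proof. by apply: prodr_gt0 => f _; exact: p_pos. Qed.

Lemma dens_lt1 : dens b < 1.
Proof.
have [c [_ [_ /hasP[f fF wf] _]]] := p_free S b.
have : p b c <= 1 - dens b.
  have mO : measurable (occ_at b [:: 1%g]) by exact: (depends_measurable (@occ_at_depends R G S b [:: 1%g])).
  rewrite -(Pr_occ1 S b 1%g) -Pr_setC//.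
  have := @Pr_cylinder R G countG _ (mu b) [:: f] (fun=> c) isT; rewrite big_seq1 => <-.
  apply: Pr_le; last first.
  - move=> x /= /(_ f (mem_head _ _)) xf /andP[/allP/(_ _ fF) + _]; rewrite mul1g xf eq_sym.
    by rewrite (negbTE wf).
  - exact: measurableC.
  - apply: (@depends_measurable _ _ [:: f]) => x y xy xc g gf; rewrite -xy//; exact: xc.
have := @p_pos _ _ S b c; lra.
Qed.

Definition owned Q k N : set (Cfg b) :=
  [set x | exists r, (st N (occ b x)).2 = Some (Q, r) /\ size r = (2 ^ k)%N].

Lemma owned_depends Q k N : depends (cover (win N)) (owned Q k N).
Proof.
apply: (@pattern_depends _ (fun D => exists r, (st N D).2 = Some (Q, r) /\ size r = (2 ^ k)%N)).
by move=> D E DE; rewrite (@st_local R G S N D E DE).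
Qed.

Lemma mark_merge o W f : o.2 != None -> f \in F -> (mark o W * f)%g \notin cover W.
Proof.
rewrite /mark; case: o.2 => // k _ fF; set s := [seq _ | _ <- _, _ <- _].
apply: contra (freshP S s) => h; apply/allpairsP; exists (fresh S s * f, f)%g.
by rewrite mulgK.
Qed.

Lemma link_fresh o W z : z \in cover (mark o W :: W) ->
  (link o W * z)%g \notin cover (mark o W :: W).
Proof.
move=> zW; rewrite /link; set s := [seq _ | _ <- _, _ <- _].
by apply: contra (freshP S s) => h; apply/allpairsP; exists (fresh S s * z, z)%g; rewrite mulgK.
Qed.

Definition merges Q k N : set (Cfg b) :=
  [set x | isSome (merged Q k (link (ops N) (win N)) (mark (ops N) (win N)) (st N) (occ b x))].

(** Ownership at both ends and the two conditions on the mark use disjoint sets of coordinates, by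
    the choice of [mark] and [link]. *)
Lemma merge_prob Q k N : ops N = (Q, Some k) ->
  Prb b (merges Q k N) = Prb b (owned Q k N) ^+ 2 * (dens b * (1 - dens b)).
Proof.
move=> op; set u := link (ops N) (win N); set v := mark (ops N) (win N); set W := win N.
have dO := @owned_depends Q k N; have mO := depends_measurable dO.
have dv : depends (cover [:: v]) (occ_at b [:: v]) by exact: occ_at_depends.
have mv := depends_measurable dv.
have vW g : g \in cover W -> g \notin cover [:: v].
  apply: contraL => /allpairsP[[d f] [/= + fF ->]]; rewrite inE => /eqP ->.
  by apply: mark_merge; rewrite ?op.
have s1 : {subset cover W <= cover (v :: W)}.
  by move=> z /allpairsP[[d f] [/= dW fF ->]]; apply: mem_cover => //; rewrite inE dW orbT.
have s2 : {subset cover [:: v] <= cover (v :: W)}.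
  move=> z /allpairsP[[d f] [/= + fF ->]]; rewrite inE => /eqP ->; apply: mem_cover => //.
  exact: mem_head.
have -> : merges Q k N = (owned Q k N `&` ~` occ_at b [:: v]) `&`
    [set x | (owned Q k N `&` occ_at b [:: v]) (tr u x)].
  apply/seteqP; split=> x.
    rewrite /merges /= /merged -occ_trE; case e1: (st N (occ b x)).2 => [[Q1 r1]|]//.
    case e2: (st N (occ b (tr u x))).2 => [[Q2 r2]|]//.
    case: ifP => // /and5P[/eqP Q1E /eqP Q2E /eqP s1' /eqP s2' /andP[nv uv]] _.
    split; split.
    - by exists r1; rewrite e1 Q1E.
    - by move=> /andP[ov _]; rewrite ov in nv.
    - by exists r2; rewrite e2 Q2E.
    - by apply/andP; split; rewrite // occ_tr.
  move=> [[[r1 [e1 z1]] nv] [[r2 [e2 z2]] /andP[+ _]]]; rewrite occ_tr => uv.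
  rewrite /merges /= /merged -occ_trE e1 e2 !eqxx z1 z2 !eqxx uv andbT/=.
  by case: (boolP (occ b x v)) => // ov; case: nv; apply/andP.
have dA := dependsI (depends_sub s1 dO) (dependsC (depends_sub s2 dv)).
have dB := dependsI (depends_sub s1 dO) (depends_sub s2 dv).
rewrite (Pr_indep countG (mu b) dA (depends_tr (g := u) dB)); last first.
  move=> g gW; apply/mapP => -[h hW gE].
  by have := link_fresh hW; rewrite -gE gW.
rewrite (Pr_tr countG)//; last exact: measurableI.
rewrite (Pr_indep countG (mu b) dO (dependsC dv) vW) (Pr_indep countG (mu b) dO dv vW).
by rewrite Pr_setC// Pr_occ1; ring.
Qed.

Lemma merges_measurable Q k N : measurable (merges Q k N).
Proof.
pose s := cover (merge_win (link (ops N) (win N)) (mark (ops N) (win N)) (win N)).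
apply: (@depends_measurable _ _ s); apply: (@pattern_depends _ (fun D => isSome (merged Q k
  (link (ops N) (win N)) (mark (ops N) (win N)) (st N) D))) => D E DE.
by rewrite (@eq_merged G Q k _ _ (win N) (st N) D E (@st_local R G S N) DE).
Qed.

(** Otherwise each later merger of this kind would absorb the block of the identity with probability
    bounded below, while these absorptions are disjoint by [own_none]. *)
Lemma owned_vanish Q k N (e : R) : 0 < e -> exists2 m, (N <= m)%N & Prb b (owned Q k m) <= e.
Proof.
move=> e0; apply: contrapT => none.
have large m : (N <= m)%N -> e < Prb b (owned Q k m).
  by move=> Nm; rewrite ltNge; apply/negP => h; apply: none; exists m.
(* The event that the block centred at the identity is the target of the merger performed at stage
   [m]. *)
pose T m : set (Cfg b) := if ops m == (Q, Some k) then
  [set x | merges Q k m (tr (link (ops m) (win m))^-1 x)] else set0.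
have d0 := dens_gt0; have d1 := dens_lt1.
have c0 : 0 < e ^+ 2 * (dens b * (1 - dens b)).
  by rewrite mulr_gt0 ?exprn_gt0// mulr_gt0// subr_gt0.
have := c0; rewrite ltNge => /negP; apply; apply: (@infinitely_disjoint R G _ (mu b) _ T).
- move=> m; rewrite /T; case: ifP => // _.
  rewrite -[X in measurable X]setTI; apply: (measurable_tr _ measurableT).
  exact: merges_measurable.
- move=> i j x ij; rewrite /T; case: eqP => // opi; case: eqP => // opj.
  set ui := link (ops i) _; set uj := link (ops j) _ => /= Ti Tj.
  have {}Ti : merged Q k ui (mark (ops i) (win i)) (st i) (tr ui^-1 (occ b x)) by rewrite -occ_trE.
  have {}Tj : merged Q k uj (mark (ops j) (win j)) (st j) (tr uj^-1 (occ b x)) by rewrite -occ_trE.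
  have claim : claimed i (occ b x) 1.
    case e1: (merged _ _ _ _ _ _) Ti => [r|]// _.
    have [r1 [r2 [_ + _ _ _]]] := srcP e1; rewrite mulVg => ow; exact: own_claimed ow.
  have none1 : own i.+1 (occ b x) 1 = None.
    rewrite (own_merge _ opi) mul1g.
    have := @src_target _ _ S i k Q (occ b x) (ui^-1)%g Ti.
    case e1: (merged _ _ _ _ _ (tr 1%g _)) => [r|]; last by case: (merged _ _ _ _ _ _) Ti.
    have := @src_target _ _ S i k Q (occ b x) 1%g; rewrite e1 mul1g => /(_ isT) h.
    by move: Ti; rewrite h.
  case e1: (merged _ _ _ _ _ _) Tj => [r|]// _.
  have [r1 [r2 [_ + _ _ _]]] := srcP e1; rewrite mulVg.
  by rewrite (own_none ij (claimed_step claim) none1).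
move=> M; have [m Mm op] := opsP S (Q, Some k) (maxn N M).
exists m; first by rewrite (leq_trans (leq_maxr N M)).
have Nm : (N <= m)%N by rewrite (leq_trans (leq_maxl N M)).
rewrite /T op eqxx (Pr_tr countG)//; last exact: merges_measurable.
rewrite (merge_prob op) ler_pM2r; last by rewrite mulr_gt0// subr_gt0.
by rewrite lerXn2r ?nnegrE ?Pr_ge0 ?(ltW e0)//; exact/ltW/large.
Qed.

Definition avail Q N : set (Cfg b) := [set x | [&& 1%g \in Q, uniq Q,
  all (fun q => ~~ (st N (tr q (occ b x))).1) Q & isolated (occ b x) Q]].

Lemma avail_depends Q N : depends (cover (avail_win S Q (win N))) (avail Q N).
Proof.
apply: (@pattern_depends _ (fun D => [&& 1%g \in Q, uniq Q,
  all (fun q => ~~ (st N (tr q D)).1) Q & isolated D Q])) => D E DE.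
rewrite (_ : all _ Q = all (fun q => ~~ (st N (tr q E)).1) Q); last first.
  apply: eq_in_all => q qQ; congr (~~ _.1); apply: st_local => h hW; apply: DE.
  by apply: mem_catl; apply/allpairsP; exists (q, h).
rewrite (@eq_isolated R G S D E Q)// => h hQ.
by apply: DE; exact: mem_catr.
Qed.

Definition marked Q v : set (Cfg b) :=
  [set x | occ b x v && all (fun y => (y == 1%g) || ~~ occ b x (y * v)%g) (diffs Q)].

Local Notation vwin Q v := (v :: [seq (y * v)%g | y <- diffs Q]).

Lemma mem_vwin Q v y : y \in diffs Q -> (y * v)%g \in vwin Q v.
Proof. by move=> yQ; rewrite inE; apply/orP; right; apply/mapP; exists y. Qed.

Lemma marked_depends Q v : depends (cover (vwin Q v)) (marked Q v).
Proof.
apply: (@pattern_depends _ (fun D => D v && all (fun y => (y == 1%g) || ~~ D (y * v)%g) (diffs Q))).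
move=> D E DE; rewrite DE ?mem_head// (_ : all _ _ = all (fun y => (y == 1%g) || ~~ E (y * v)%g) (diffs Q))//.
by apply: eq_in_all => y yQ; rewrite DE// mem_vwin.
Qed.

Lemma wt_le1 l : p b l <= 1.
Proof. exact: (pmf_le1 l (wt_pmf S b)). Qed.

(** Put the word at [v] and a letter [c], missed by some letter of the word, on the rest of the
    window. A second occurrence there would overlap the first one or meet a letter [c] where the
    word differs from it. The cost of this prescription does not depend on [v]. *)
Lemma marked_bound Q : exists2 c : R, 0 < c & forall v, c <= Prb b (marked Q v).
Proof.
pose p0 := \prod_l p b l; have p00 : 0 < p0 by apply: prodr_gt0 => l _; exact: p_pos.
have p0p l : p0 <= p b l.
  rewrite /p0 (bigD1 l)//=; apply: ler_piMr; first exact/ltW/p_pos.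
  by apply: prodr_ile1 => l' _; rewrite wt_le1 ltW//; exact: p_pos.
exists (p0 ^+ ((size (diffs Q)).+1 * size F)); first by rewrite exprn_gt0.
move=> v; have [c [_ [_ /hasP[f fF wf] _]]] := p_free S b.
pose C := undup (cover (vwin Q v)); pose om z := if (v^-1 * z)%g \in F then w b (v^-1 * z) else c.
apply: (@le_trans _ _ (\prod_(g <- C) p b (om g))).
  apply: (@le_trans _ _ (p0 ^+ size C)).
    rewrite ler_wiXn2l ?(ltW p00)// ?(le_trans (p0p ord0)) ?wt_le1//.
    by rewrite (leq_trans (size_undup _))// size_allpairs/= size_map.
  apply: (@le_trans _ _ (\prod_(g <- C) p0)).
    by rewrite big_const_seq count_predT iter_mulr_1.
  by apply: ler_prod => z _; rewrite (ltW p00) p0p.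
rewrite -(@Pr_cylinder R G countG _ (mu b) C om (undup_uniq _)).
apply: Pr_le; last first.
- move=> x /= xC; have xE z : z \in cover (vwin Q v) -> x z = om z.
    by move=> zC; apply: xC; rewrite mem_undup.
  have ov : occ b x v.
    apply/allP => f' f'F; rewrite xE; last by apply: mem_cover => //; rewrite mem_head.
    by rewrite /om mulKg f'F.
  rewrite /marked /= ov /=; apply/allP => y yQ; case: eqVneq => //= y1; apply/negP => oy.
  have /eqP := allP oy _ fF; rewrite xE; last by apply: mem_cover => //; exact: mem_vwin.
  rewrite /om; case: ifP => [zF _|_ e]; last by rewrite e eqxx in wf.
  have yv : v != (y * v)%g.
    by apply: contra y1 => /eqP e; apply/eqP/(@mulIg _ v); rewrite mul1g -e.
  by have := occ_disjoint ov oy yv zF fF; rewrite mulVKg eqxx.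
- exact: (depends_measurable (@marked_depends Q v)).
- by apply: (@depends_measurable _ _ C) => x y xy xC g gC; rewrite -xy// xC.
Qed.

Definition arrives Q N : set (Cfg b) :=
  [set x | new S Q (mark (ops N) (win N)) (st N) (occ b x)].

Lemma arrivesE Q N : arrives Q N = avail Q N `&` marked Q (mark (ops N) (win N)).
Proof.
apply/seteqP; split=> x; rewrite /arrives /avail /marked /new /=.
  by move=> /and5P[-> -> -> -> /andP[-> ->]].
by move=> [/and4P[-> -> -> ->] /andP[-> ->]].
Qed.

Lemma mark_act Q W y f : y \in 1%g :: diffs Q -> f \in F ->
  (y * mark (Q, None) W * f)%g \notin cover (avail_win S Q W).
Proof.
move=> yQ fF; pose s := [seq (yc * f^-1)%g | yc <- [seq (y^-1 * c)%g | y <- 1%g :: diffs Q,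
  c <- cover (avail_win S Q W)], f <- F].
have -> : mark (Q, None) W = fresh S s by [].
apply: contra (freshP S s) => h; apply/allpairsP.
exists (y^-1 * (y * fresh S s * f), f)%g; split=> //.
  by apply/allpairsP; exists (y, y * fresh S s * f)%g.
by rewrite [fst _]/= [snd _]/= -[(y * _ * f)%g]mulgA mulKg mulgK.
Qed.

Lemma arrives_prob Q N : ops N = (Q, None) ->
  Prb b (arrives Q N) = Prb b (avail Q N) * Prb b (marked Q (mark (ops N) (win N))).
Proof.
move=> op; rewrite arrivesE (Pr_indep countG (mu b) (@avail_depends Q N) (@marked_depends Q _))//.
move=> g; apply: contraL => /allpairsP[[d f] [/= + fF ->]]; rewrite op inE => /predU1P[->|].
  by rewrite -[mark _ _]mul1g; apply: mark_act => //; rewrite mem_head.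
by move=> /mapP[y yQ ->]; apply: mark_act => //; rewrite inE yQ orbT.
Qed.

Lemma arrives_measurable Q N : measurable (arrives Q N).
Proof.
rewrite arrivesE; apply: measurableI.
  exact: (depends_measurable (@avail_depends Q N)).
exact: (depends_measurable (@marked_depends Q _)).
Qed.

(** Starting a cluster claims the identity, so these events at different stages are disjoint; by
    independence of the mark each has at least a fixed fraction of the probability of
    availability. *)
Lemma avail_vanish Q (e : R) : 0 < e -> exists m, Prb b (avail Q m) <= e.
Proof.
move=> e0; apply: contrapT => none.
have large m : e < Prb b (avail Q m).
  by rewrite ltNge; apply/negP => h; apply: none; exists m.
have [c c0 cb] := marked_bound Q.
pose T m : set (Cfg b) := if ops m == (Q, None) then arrives Q m else set0.
have := mulr_gt0 e0 c0; rewrite ltNge => /negP; apply.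
apply: (@infinitely_disjoint R G _ (mu b) _ T).
- by move=> m; rewrite /T; case: ifP => // _; exact: arrives_measurable.
- move=> i j x ij; rewrite /T; case: eqP => // opi; case: eqP => // opj; rewrite /arrives /= => Ti Tj.
  have cl : claimed i.+1 (occ b x) 1.
    have : own i.+1 (occ b x) 1 = Some (Q, [:: 1%g]) by rewrite (own_act _ _ opi) tr1 Ti.
    exact: own_claimed.
  have := @new_unclaimed _ _ S Q (mark (ops j) (win j)) j (occ b x) 1%g; rewrite tr1 => /(_ Tj).
  by rewrite (claimed_mono ij cl).
move=> M; have [m Mm op] := opsP S (Q, None) M; exists m => //.
by rewrite /T op eqxx arrives_prob// ler_pM// ?ltW.
Qed.

Definition island_failure : set (Cfg b) :=
  [set x | ~~ hit (occ b x) 1 /\ forall Q, 1%g \in Q -> ~~ isolated (occ b x) Q].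

Definition reach k m D z := exists c Q r i, [/\ own k D c = Some (Q, r), (i < size r)%N,
  z \in shiftq (c * nth 1%g r i) Q & (2 ^ m <= size r)%N].

Lemma isolated_tr D g Q : isolated D (shiftq g Q) = isolated (tr g D) Q.
Proof.
rewrite /isolated all_map; apply: eq_all => z /=; apply: eq_all => f.
congr (~~ _ && (_ || _)); first by rewrite /tr mulgA.
  by rewrite /inside; apply: eq_all => f'; rewrite -2!mulgA mem_map; [rewrite mulgA|exact: mulgI].
by apply: eq_has => f'; apply: eq_has => f2; rewrite /tr !mulgA.
Qed.

Lemma hit_tr D g z : hit (tr g D) z = hit D (g * z).
Proof. by apply: eq_has => f; rewrite /tr mulgA. Qed.

Lemma claimed_isolated k D z : claimed k D z -> exists2 Q, z \in Q &
  isolated D Q /\ forall z', z' \in Q -> claimed k D z'.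
Proof.
move=> /claimedP[c [Q [r [i [ow [ir zi]]]]]]; exists (shiftq (c * nth 1%g r i) Q) => //.
have [_ _ _ _ iso] := own_ok ow; split; first by rewrite isolated_tr; exact: iso.
by move=> z' z'i; apply/claimedP; exists c, Q, r, i.
Qed.

(** The never claimed points of [Q] again form an isolated set. A placement through one of them that
    meets a claimed point either lies in the isolated claimed set around that point, which would
    claim [z] too, or overlaps an occurrence. Such a set is available at every stage, which almost
    never happens. *)
Lemma eventually_claimed D Q : isolated D Q -> 1%g \in Q -> (forall k, ~~ claimed k D 1) ->
  exists Q0, [/\ uniq Q0, 1%g \in Q0, isolated D Q0 & forall q k, q \in Q0 -> ~~ claimed k D q].
Proof.
move=> /isolatedP iso Q1 un.
pose Q0 := [seq q <- undup Q | `[< forall k, ~~ claimed k D q >]].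
have Q0P q : (q \in Q0) = `[< forall k, ~~ claimed k D q >] && (q \in Q) by rewrite mem_filter mem_undup.
exists Q0; rewrite filter_uniq ?undup_uniq// Q0P Q1 andbT; split=> //; first exact/asboolP.
  apply/isolatedP => z f; rewrite Q0P => /andP[/asboolP zu zQ] fF.
  have [nD ins] := iso _ _ zQ fF; split=> //; case: ins => [ins|]; last by right.
  have [|/allPn[f' f'F]] := boolP (inside S Q0 (z * f^-1)); first by left.
  rewrite Q0P (allP ins _ f'F) andbT => /asboolP nu; right.
  have [k kc] : exists k, claimed k D (z * f^-1 * f').
    by apply: contrapT => no; apply: nu => k; apply/negP => h; apply: no; exists k.
  have [C hC [/isolatedP iC clC]] := claimed_isolated kc.
  have [_] := iC _ _ hC f'F; rewrite mulgK => -[/allP inC|//].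
  by have := zu k; rewrite clC// -[z](mulgVK f) inC.
by move=> q k; rewrite Q0P => /andP[/asboolP].
Qed.

Lemma code_exists : exists code : G -> nat, injective code.
Proof. by have /countable_injP[f finj] := countG; exists f => g h; apply: finj; rewrite inE. Qed.

(** Outside null events every uncovered site lies in an isolated set, no set stays available for
    ever and no block keeps its size for ever. So each uncovered site is claimed, and its block
    doubles again and again. *)
Lemma blocks_grow : null island_failure ->
  null [set x | ~ forall z m, hit (occ b x) z \/ exists k, reach k m (occ b x) z].
Proof.
move=> nI; have [code code_inj] := code_exists.
have map_inj : injective (map code) by exact: inj_map.
pose stuck (t : G * seq G * nat * nat) : set (Cfg b) :=
  [set x | forall m, (t.2 <= m)%N -> owned t.1.1.2 t.1.2 m (tr t.1.1.1 x)].
pose wait (t : G * seq G) : set (Cfg b) := [set x | forall m, avail t.2 m (tr t.1 x)].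
have nS : null [set x | exists t, stuck t x].
  apply: (@null_exists _ _ _ _ _ (fun t => pickle (code t.1.1.1, map code t.1.1.2, t.1.2, t.2))).
    move=> [[[g Q] j] m] [[[g' Q'] j'] m'] /(pcan_inj pickleK)[].
    by move=> /code_inj -> /map_inj -> -> ->.
  move=> [[[g Q] j] N]; apply: (@null_tr _ _ countG _ _ g [set x | forall m, (N <= m)%N -> owned Q j m x]).
  apply: null_eps => e e0; have [m Nm le] := @owned_vanish Q j N e e0.
  exists (owned Q j m); first exact: (depends_measurable (@owned_depends Q j m)).
  by split=> // x /(_ m Nm).
have nW : null [set x | exists t, wait t x].
  apply: (@null_exists _ _ _ _ _ (fun t => pickle (code t.1, map code t.2))).
    by move=> [g Q] [g' Q'] /(pcan_inj pickleK)[] /code_inj -> /map_inj ->.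
  move=> [g Q]; apply: (@null_tr _ _ countG _ _ g [set x | forall m, avail Q m x]).
  apply: null_eps => e e0; have [m le] := @avail_vanish Q e e0.
  exists (avail Q m); first exact: (depends_measurable (@avail_depends Q m)).
  by split=> // x /(_ m).
have nF : null [set x | exists g, island_failure (tr g x)].
  by apply: (@null_exists _ _ _ _ _ code _ code_inj) => g; exact: (@null_tr _ _ countG _ _ g island_failure).
apply: null_sub (negligibleU (negligibleU nS nW) nF) => x; apply: contra_notP => /not_orP[/not_orP[xS xW] xF].
move=> z; have [|nh] := boolP (hit (occ b x) z); first by left.
move=> m; right; set D := occ b x.
have [k kc] : exists k, claimed k D z.
  apply: contrapT => no; have un k : ~~ claimed k (tr z D) 1.
    by rewrite claimed_tr mulg1; apply/negP => h; apply: no; exists k.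
  have [Q Q1 iso] : exists2 Q, 1%g \in Q & isolated (tr z D) Q.
    apply: contrapT => noQ; apply: xF; exists z; split; first by rewrite occ_trE hit_tr mulg1.
    by move=> Q Q1; rewrite occ_trE; apply/negP => h; apply: noQ; exists Q.
  have [Q0 [uQ Q01 iQ nQ]] := eventually_claimed iso Q1 un.
  apply: xW; exists (z, Q0) => j; rewrite /avail /= occ_trE Q01 uQ iQ andbT.
  by apply/allP => q qQ; exact: nQ.
elim: m => [|m [k' [c [Q [r [i [ow ir zi rm]]]]]]].
  have /claimedP[c [Q [r [i [ow [ir zi]]]]]] := kc.
  by exists k, c, Q, r, i; split=> //; rewrite expn0 (leq_ltn_trans _ ir).
have [_ _ [j rj] _ _] := own_ok ow.
apply: contrapT => no; apply: xS; exists (c, Q, j, k') => N k'N /=.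
suff : own N D c = Some (Q, r) by rewrite /own /owned /= occ_trE => ->; exists r.
elim: N k'N => [|N ih]; first by rewrite leqn0 => /eqP k0; rewrite -k0.
rewrite leq_eqVlt ltnS => /predU1P[<-//|/ih owN].
apply: contrapT => ne; apply: no.
have [c' [r' [s [t [ow' r's st' h t2]]]]] := grow_step owN.
rewrite (t2 ne) in r's st'.
exists N.+1, c', Q, r', (s * size r + i)%N; split=> //; last first.
- by rewrite r's expnS leq_mul2l rm orbT.
- by rewrite h.
- by rewrite r's (@leq_trans (s * size r + size r)%N) ?ltn_add2l// -mulSnr leq_mul2r st' orbT.
Qed.

End Generation.

(** * Measurability and continuity of the measure from finite windows *)

Section Local.
Context {R : realType} {G : groupType}.
Hypothesis countG : countable [set: G].
Context {n : nat} (mu : probability (letter n) R).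
Local Notation X := (config G (letter n)).

(** Such a set is the union, over the countably many finite windows, of events depending on one
    window. *)
Lemma open_measurable_config (E : set X) :
  (forall x, E x -> exists s : seq G, forall y, (forall h, h \in s -> x h = y h) -> E y) ->
  measurable E.
Proof.
move=> oE; have /countable_injP[code cinj] := countG.
have code_inj : injective code by move=> g h; apply: cinj; rewrite inE.
pose E0 (s : seq G) : set X := [set x | forall y, (forall h, h \in s -> x h = y h) -> E y].
pose T k : set X := [set x | exists2 s, pickle (map code s) = k & E0 s x].
have -> : E = \bigcup_k T k.
  apply/seteqP; split=> x; last by move=> [k _ [s _]]; apply.
  by move=> /oE[s sE]; exists (pickle (map code s)) => //; exists s.
apply: bigcupT_measurable => k.
have [[s sk]|ns] := pselect (exists s : seq G, pickle (map code s) = k).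
  apply: (@depends_measurable _ _ s) => x y xy [s' s'k E's]; exists s => // z yz.
  have ss' : s' = s by apply: (inj_map code_inj); apply: (pcan_inj pickleK); rewrite s'k sk.
  by apply: E's => h; rewrite ss' => hs; rewrite xy// yz.
rewrite (_ : T k = set0)//; apply/seteqP; split=> // x [s sk _].
by apply: ns; exists s.
Qed.

Lemma Pr_decreasing (E : nat -> set X) : (forall k, measurable (E k)) ->
  (forall j k, (j <= k)%N -> E k `<=` E j) -> null mu (\bigcap_k E k) ->
  forall e : R, 0 < e -> exists k, Pr mu (E k) <= e.
Proof.
move=> mE dE nE e e0; apply: contrapT => none.
have large k : e < Pr mu (E k) by rewrite ltNge; apply/negP => h; apply: none; exists k.
have mI : measurable (\bigcap_k E k) by exact: bigcapT_measurable.
have I0 : product_probability G mu (\bigcap_k E k) = 0%E.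
  have [B [mB B0 EB]] := nE; apply/eqP; rewrite eq_le measure_ge0 andbT -B0.
  by apply: le_measure; rewrite ?inE.
have fin0 : (product_probability G mu (E 0%N) < +oo)%E.
  by rewrite (le_lt_trans (probability_le1 _ _))// ltry.
have mono : nonincreasing_seq E by move=> j k jk; apply/subsetPset; exact: dE.
have cv := @nonincreasing_cvg_mu _ _ _ (product_probability G mu) E fin0 mE mI mono.
have : (e%:E <= 0)%E.
  apply: (@le_trans _ _ (lim (product_probability G mu \o E @ \oo))).
    apply: lime_ge; first by apply/cvg_ex; eexists; exact: cv.
    by apply: nearW => k /=; rewrite Pr_EFin// lee_fin ltW.
  by rewrite (cvg_lim _ cv)// -I0.
by rewrite lee_fin leNgt e0.
Qed.

End Local.

Section Coding.
Context {G : groupType} {n n' : nat}.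
Hypothesis countG : countable [set: G].
Local Notation X := (config G (letter n)).
Local Notation Y := (config G (letter n')).
Context (Phi : X -> G -> letter n' -> Prop).
Hypothesis Phi_local : forall x g l, Phi x g l ->
  exists s : seq G, forall y, (forall h, h \in s -> x h = y h) -> Phi y g l.
Hypothesis Phi_fun : forall x g l l', Phi x g l -> Phi x g l' -> l = l'.

Definition coding (x : X) : Y := fun g => xget ord0 [set l | Phi x g l].

Lemma codingE x g l : Phi x g l -> coding x g = l.
Proof.
move=> Pl; apply: (Phi_fun _ Pl).
by apply: (@xgetPex _ ord0 [set l | Phi x g l]); exists l.
Qed.

Lemma measurable_Phi g l : measurable [set x | Phi x g l].
Proof. by apply: (open_measurable_config countG) => x; exact: Phi_local. Qed.

Lemma measurable_coding : measurable_fun setT coding.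
Proof.
apply: (@measurability _ _ _ _ _ _ (coord_sets G (letter n'))) => //.
move=> _ [_ [g _ [B _ <-]] <-]; rewrite setTI.
rewrite (_ : _ @^-1` _ = \bigcup_(l in B) [set x | coding x g = l]); last first.
  by apply/seteqP; split=> [x Bx|x [l Bl /= xl]]; [exists (coding x g)|rewrite /preimage /= xl].
apply: fin_bigcup_measurable; first exact: finite_finset.
(* The letter [ord0] is also the default value, hence the additional piece where no letter is
   determined. *)
move=> l _; have -> : [set x | coding x g = l] = [set x | Phi x g l] `|`
    (if l == ord0 then ~` (\bigcup_l' [set x | Phi x g l']) else set0).
  apply/seteqP; split=> x /=.
    move=> <-; have [[l' Pl']|none] := pselect (exists l', Phi x g l').
      by left; rewrite (codingE Pl').
    right; have -> : coding x g = ord0.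
      by rewrite /coding; case: xgetP => // l' _ Pl'; case: none; exists l'.
    by rewrite eqxx => -[l' _ Pl']; apply: none; exists l'.
  case=> [Pl|]; first exact: codingE Pl.
  case: eqP => // -> none; rewrite /coding.
  by case: xgetP => // l' _ Pl'; exfalso; apply: none; exists l'.
apply: measurableU; first exact: measurable_Phi.
case: ifP => // _; apply: measurableC; apply: fin_bigcup_measurable; first exact: finite_finset.
by move=> l' _; exact: measurable_Phi.
Qed.

End Coding.

(** * Conditioning on a finite part of the pattern *)

Section Compare.
Context {R : realType} {G : groupType} (S : pattern_pair R G).
Local Notation n := (psize S).
Local Notation mu := (pmu S).
Local Notation Cfg b := (config G (letter (n b))).
Local Notation Prb b := (@Pr R G (n b) (mu b)).
Local Notation occ b := (@occ R G S b).
Local Notation same_pattern b := (@same_pattern R G S b).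
Implicit Types (W : seq G).

Definition trace W b (x : Cfg b) : {ffun 'I_(size W) -> bool} :=
  [ffun i : 'I_(size W) => occ b x (nth 1%g W i)].

Definition pat W (t : {ffun 'I_(size W) -> bool}) g : bool :=
  if insub (index g W) is Some i then t i else false.

Lemma trace_pat W b (t : {ffun 'I_(size W) -> bool}) : uniq W ->
  [set x : Cfg b | trace W x = t] = same_pattern b (pat t) W.
Proof.
move=> uW; apply/seteqP; split=> x /=.
  move=> <- g gW; rewrite /pat; case: insubP => [i _ iE|]; last by rewrite index_mem gW.
  by rewrite ffunE iE nth_index.
move=> xt; apply/ffunP => i; rewrite ffunE xt ?mem_nth// /pat index_uniq//.
by rewrite insubT//= => ii; congr (t _); exact: val_inj.
Qed.

Lemma same_pattern_measurable b D W : measurable (same_pattern b D W).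
Proof.
apply: (@depends_measurable _ _ (@cover R G S W)).
apply: (@pattern_depends _ _ S b W (fun E => forall g, g \in W -> E g = D g)).
by move=> E E' EE h g gW; rewrite -EE// h.
Qed.

Lemma pattern_sum W b (E : set (Cfg b)) : measurable E ->
  Prb b E = \sum_t Prb b (same_pattern b (@pat (undup W) t) W `&` E).
Proof.
move=> mE; have sE D : same_pattern b D W = same_pattern b D (undup W).
  by apply/seteqP; split=> x hx g gW; apply: hx; rewrite ?mem_undup// in gW *.
rewrite (@Pr_partition_fin _ _ _ _ _ (@trace (undup W) b) E)//; last first.
  by move=> t; rewrite trace_pat ?undup_uniq//; exact: same_pattern_measurable.
by apply: eq_bigr => t _; rewrite trace_pat ?undup_uniq// -sE setIC.
Qed.

(** The patterns on [W] partition both spaces with the same labels, so inequalities valid for each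
    pattern add up. The family [I] is there for the mass transport, where only sums can be
    compared. *)
Lemma pattern_compare W b b' (I : Type) (s : seq I) (E : I -> set (Cfg b))
    (E' : I -> set (Cfg b')) (c : R) :
  (forall i, measurable (E i)) -> (forall i, measurable (E' i)) ->
  (forall D, \sum_(i <- s) Prb b (same_pattern b D W `&` E i) <=
             c * \sum_(i <- s) Prb b' (same_pattern b' D W `&` E' i)) ->
  \sum_(i <- s) Prb b (E i) <= c * \sum_(i <- s) Prb b' (E' i).
Proof.
move=> mE mE' h.
rewrite (eq_bigr _ (fun i _ => @pattern_sum W b (E i) (mE i))).
rewrite [in leRHS](eq_bigr _ (fun i _ => @pattern_sum W b' (E' i) (mE' i))).
rewrite exchange_big [in leRHS]exchange_big/= mulr_sumr; apply: ler_sum => t _; exact: h.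
Qed.

End Compare.

(** * Decoding *)

Section Decoding.
Context {R : realType} {G : groupType} (S : pattern_pair R G).
Local Notation n := (psize S).
Local Notation mu := (pmu S).
Local Notation F := (pshape S).
Local Notation w b := (@pword R G S b).
Local Notation countG := (p_countable S).
Local Notation Cfg b := (config G (letter (n b))).
Local Notation occ b := (@occ R G S b).
Local Notation avoid b := (@avoid R G S b).
Local Notation hit := (@hit R G S).
Local Notation own := (@owner R G S).
Local Notation cletter := (@cletter R G S).
Local Notation lett Q := (@lett R G S Q _).
Local Notation unlett Q := (@unlett R G S Q _).

Local Notation tl := (tlen S).
Local Notation rd Q J b := (@rd R (cletter Q) (@alpha R G S Q) (letter0 S Q) J b).
Local Notation gd Q J b := (@gd R (cletter Q) (@alpha R G S Q) (letter0 S Q) J b).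
Local Notation rev Q J b := (@rev R (cletter Q) (@alpha R G S Q) (letter0 S Q) J b).
Local Notation dec Q J b b' := (@dec R (cletter Q) (@alpha R G S Q) (letter0 S Q) J b b').
Implicit Types (Q r : seq G) (D : G -> bool) (g h z c : G).

Lemma own_nonempty k D c Q r : own k D c = Some (Q, r) -> Q != [::].
Proof. by move=> /own_ok[_ + _ _ _]; case: Q. Qed.

(** Both lengths are powers of two. *)
Lemma tl_dvd Q J k D c r : own k D c = Some (Q, r) -> (tl Q J <= size r)%N -> (tl Q J %| size r)%N.
Proof.
move=> owc; have [uQ _ [j ->] _ _] := own_ok owc; have Q0 := own_nonempty owc.
have [m] := len_pow (letter0 S Q) (fun b => alpha_pmf S b uQ) (ent_alpha_gt0 S true uQ Q0)
  (ent_alpha_eq S uQ) J.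
rewrite -/(tl Q J) => ->; rewrite leq_exp2l//; exact: dvdn_exp2l.
Qed.

Definition block_word b Q c r t (x : Cfg b) : nat -> cletter Q b :=
  fun i => lett Q (tr (c * nth 1%g r (t + i))%g x).

Arguments block_word [b] Q c r t x.

(** The block is cut into segments of length [tl Q J.+1], and the segment containing position [i] is
    the word to decode. *)
Definition block_decodes b b' Q c r i J (x : Cfg b) (a : cletter Q b') :=
  (tl Q J.+1 <= size r)%N /\
  dec Q J b b' (block_word Q c r (i %/ tl Q J.+1 * tl Q J.+1) x) (i %% tl Q J.+1) a.

Arguments block_decodes [b b'] Q c r i J x a.

Definition decodes b b' k J (x : Cfg b) z (l : letter (n b')) := exists c Q r i a,
  [/\ own k (occ b x) c = Some (Q, r), (i < size r)%N, z \in shiftq (c * nth 1%g r i) Q,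
      block_decodes Q c r i J x a & l = unlett Q a ((c * nth 1%g r i)^-1 * z)%g].

Lemma mod_index i L m : (0 < L)%N -> (L %| m)%N -> (i < m)%N -> forall j, (j < L)%N ->
  (i %/ L * L + j < m)%N.
Proof.
move=> L0 /dvdnP[q ->] iq j jL; have iLq : (i %/ L < q)%N by rewrite ltn_divLR.
by rewrite (@leq_trans (i %/ L * L + L)%N) ?ltn_add2l// -mulSnr leq_mul2r iLq orbT.
Qed.

Lemma tl_pos Q J k D c r : own k D c = Some (Q, r) -> (0 < tl Q J)%N.
Proof.
by move=> owc; have [uQ _ _ _ _] := own_ok owc; apply: tlen_gt0 => //; exact: own_nonempty owc.
Qed.

(** Merging places the old block at a multiple of its size, hence of the segment length, so the
    segment around the site is still the same word. *)
Lemma decodes_mono b b' k k' J (x : Cfg b) z (l : letter (n b')) : (k <= k')%N ->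
  decodes k J x z l -> decodes k' J x z l.
Proof.
move=> kk' [c [Q [r [i [a [owc ir zi [Lr da] lE]]]]]].
have [c' [r' [s [t [ow' r's st h]]]]] := grow kk' owc.
have dL := tl_dvd owc Lr; have L0 := tl_pos J.+1 owc.
have sE : (s * size r = s * (size r %/ tl Q J.+1) * tl Q J.+1)%N by rewrite -mulnA divnK.
have i'r : (s * size r + i < size r')%N.
  by rewrite r's (@leq_trans (s * size r + size r)%N) ?ltn_add2l// -mulSnr leq_mul2r st orbT.
exists c', Q, r', (s * size r + i)%N, a; rewrite h//; split=> //; split.
  by rewrite r's (leq_trans Lr)// leq_pmull// (leq_ltn_trans _ st).
rewrite {2}sE modnMDl {1}sE divnMDl// mulnDl -sE.
apply: eq_dec da => j jL; rewrite /block_word -addnA h//.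
exact: (mod_index L0 dL ir jL).
Qed.

(** Segment lengths divide each other, so the shorter segment is an aligned sub-block of the longer
    one and [dec_coherent] applies. *)
Lemma decodes_coherent b b' k J J' (x : Cfg b) z (l l' : letter (n b')) : (J <= J')%N ->
  decodes k J x z l -> decodes k J' x z l' -> l = l'.
Proof.
move=> JJ [c [Q [r [i [a [owc ir zi [Lr da] ->]]]]]] [c' [Q' [r' [i' [a' [ow' ir' zi' [Lr' da'] ->]]]]]].
have [cE iE] := own_uniq owc ow' ir ir' zi zi'.
move: ow' ir' zi' Lr' da'; rewrite -cE -iE owc => -[QE rE].
move: a'; rewrite -QE -rE => a' _ _ Lr' da'.
have [uQ _ _ _ _] := own_ok owc; have Q0 := own_nonempty owc.
have hpmf := fun b => alpha_pmf S b uQ; have hpos := ent_alpha_gt0 S true uQ Q0.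
have heq := ent_alpha_eq S uQ; have L0 := tl_pos J.+1 owc; have L0' := tl_pos J'.+1 owc.
have LL : (tl Q J.+1 %| tl Q J'.+1)%N by apply: len_dvd.
set L := tl Q J.+1 in Lr da L0 LL *; set L' := tl Q J'.+1 in Lr' da' L0' LL *.
pose t := (i %% L' %/ L)%N.
have tE : (i %% L' = t * L + i %% L)%N by rewrite /t -(modn_dvdm i LL) -divn_eq.
have iLE : (i %/ L * L = i %/ L' * L' + t * L)%N.
  have := divn_eq i L; rewrite {1}(divn_eq i L') tE addnA => /eqP; rewrite eqn_add2r.
  by move=> /eqP ->.
have tL : (t.+1 * L <= L')%N.
  have := ltn_pmod i L0'; rewrite {1}tE; case/dvdnP: LL => q ->.
  have t1 : (t * L <= t * L + i %% L)%N by rewrite leq_addr.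
  by move=> /(leq_ltn_trans t1); rewrite ltn_pmul2r// => tq; rewrite leq_mul2r tq orbT.
suff -> : a = a' by [].
apply: (dec_coherent hpmf hpos heq JJ tL (a := a) (a' := a') (i := i %% L)%N _ _); last first.
  by move: da'; rewrite tE; exact.
by apply: eq_dec da => j jL; rewrite /block_word iLE addnA.
Qed.

Lemma decodes_fun b b' k k' J J' (x : Cfg b) z (l l' : letter (n b')) :
  decodes k J x z l -> decodes k' J' x z l' -> l = l'.
Proof.
move=> /(decodes_mono (leq_maxl k k')) h /(decodes_mono (leq_maxr k k')) h'.
have [JJ|/ltnW JJ] := leqP J J'; first exact: decodes_coherent JJ h h'.
by apply/esym; exact: decodes_coherent JJ h' h.
Qed.

Lemma own_local b k (x y : Cfg b) c :
  (forall h, h \in shiftq c (@cover R G S (win S k)) -> x h = y h) ->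
  own k (occ b x) c = own k (occ b y) c.
Proof.
move=> xy; rewrite /own (@st_local R G S k (tr c (occ b x)) (tr c (occ b y)))// => h hW.
apply: occ_local => f fF; apply: xy; rewrite mem_shiftq mulgA mulKg.
exact: mem_cover.
Qed.

Lemma decodes_local b b' k J (x : Cfg b) z (l : letter (n b')) : decodes k J x z l ->
  exists s : seq G, forall y, (forall h, h \in s -> x h = y h) -> decodes k J y z l.
Proof.
move=> [c [Q [r [i [a [owc ir zi [Lr da] lE]]]]]].
exists (shiftq c (@cover R G S (win S k)) ++ flatten [seq shiftq (c * e) Q | e <- r]) => y xy.
exists c, Q, r, i, a; split=> //.
  by rewrite -owc; apply/esym/own_local => h hs; apply: xy; exact: mem_catl.
split=> //; apply: eq_dec da => j jL; apply/lett_eq => q qQ; apply: xy; apply: mem_catr.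
apply/flattenP; exists (shiftq (c * nth 1%g r (i %/ tl Q J.+1 * tl Q J.+1 + j)) Q).
  by apply: map_f; apply: mem_nth; apply: mod_index => //; [exact: tl_pos owc|exact: tl_dvd owc Lr].
by rewrite mem_shiftq mulKg.
Qed.

Lemma shift_back g c e z : ((g * c * e)^-1 * (g * z) = (c * e)^-1 * z)%g.
Proof. by apply: (@mulgI _ (g * c * e)%g); rewrite mulVKg -[(g * c * e)%g]mulgA -mulgA mulVKg. Qed.

Lemma decodes_untr b b' k J (x : Cfg b) g z (l : letter (n b')) :
  decodes k J (tr g x) z l -> decodes k J x (g * z) l.
Proof.
move=> [c [Q [r [i [a [owc ir zi [Lr da] lE]]]]]].
have wE t : block_word Q c r t (tr g x) = block_word Q (g * c) r t x.
  by apply/funext => j; rewrite /block_word tr_tr mulgA.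
exists (g * c)%g, Q, r, i, a; move: owc; rewrite occ_trE own_tr => owc; split=> //.
- by rewrite mem_shiftq shift_back -mem_shiftq.
- by split=> //; rewrite -wE.
- by rewrite shift_back.
Qed.

Lemma decodes_tr b b' k J (x : Cfg b) g z (l : letter (n b')) :
  decodes k J (tr g x) z l <-> decodes k J x (g * z) l.
Proof.
split; first exact: decodes_untr.
by move=> h; rewrite -[z](mulKg g); apply: decodes_untr; rewrite tr_tr mulgV tr1.
Qed.

Lemma decodes_unhit b b' k J (x : Cfg b) z (l : letter (n b')) :
  decodes k J x z l -> ~~ hit (occ b x) z.
Proof.
move=> [c [Q [r [i [a [owc ir zi _ _]]]]]].
have [_ _ _ _ iso] := own_ok owc; have := iso _ ir; rewrite -isolated_tr => /isolatedP h.
by apply/hasPn => f fF; have [] := h _ _ zi fF.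
Qed.

Definition resolves b b' (x : Cfg b) z (l : letter (n b')) :=
  (exists2 f, f \in F & occ b x (z * f^-1)%g /\ l = w b' f) \/ exists k J, decodes k J x z l.

Lemma resolves_fun b b' (x : Cfg b) z (l l' : letter (n b')) :
  resolves x z l -> resolves x z l' -> l = l'.
Proof.
have no f k J (l1 : letter (n b')) : f \in F -> occ b x (z * f^-1)%g -> ~ decodes k J x z l1.
  by move=> fF of_ /decodes_unhit/hasPn/(_ _ fF)/negP.
move=> [[f fF [of_ ->]]|[k [J d]]] [[f' f'F [of' ->]]|[k' [J' d']]].
- have [<-//|ff'] := eqVneq f f'.
  have ne : (z * f^-1)%g != (z * f'^-1)%g by apply: contra ff' => /eqP/mulgI/invg_inj ->.
  by have := occ_disjoint of_ of' ne fF f'F; rewrite !mulgVK eqxx.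
- by case: (no _ _ _ _ fF of_ d').
- by case: (no _ _ _ _ f'F of' d).
- exact: decodes_fun d d'.
Qed.

Lemma resolves_local b b' (x : Cfg b) z (l : letter (n b')) : resolves x z l ->
  exists s : seq G, forall y, (forall h, h \in s -> x h = y h) -> resolves y z l.
Proof.
move=> [[f fF [of_ lE]]|[k [J /decodes_local[s h]]]]; last first.
  by exists s => y /h d; right; exists k, J.
exists [seq (z * f^-1 * f')%g | f' <- F] => y xy; left; exists f => //; split=> //.
by rewrite -(@occ_local R G S b x y)// => f' f'F; apply: xy; apply/mapP; exists f'.
Qed.

Lemma resolves_tr b b' (x : Cfg b) g z (l : letter (n b')) :
  resolves (tr g x) z l <-> resolves x (g * z) l.
Proof.
split=> -[[f fF [of_ lE]]|[k [J d]]].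
- by left; exists f => //; move: of_; rewrite occ_tr mulgA.
- by right; exists k, J; apply/decodes_tr.
- by left; exists f => //; rewrite occ_tr mulgA.
- by right; exists k, J; apply/decodes_tr.
Qed.

End Decoding.

(** * The conditional law of a block and the frequency of decoding failures *)

Section Blocks.
Context {R : realType} {G : groupType} (S : pattern_pair R G).
Local Notation n := (psize S).
Local Notation mu := (pmu S).
Local Notation F := (pshape S).
Local Notation w b := (@pword R G S b).
Local Notation countG := (p_countable S).
Local Notation Cfg b := (config G (letter (n b))).
Local Notation Prb b := (@Pr R G (n b) (mu b)).
Local Notation occ b := (@occ R G S b).
Local Notation avoid b := (@avoid R G S b).
Local Notation avoids b := (@avoids R G S b).
Local Notation hit := (@hit R G S).
Local Notation isolated := (@isolated R G S).
Local Notation halo := (@halo R G S).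
Local Notation same_pattern b := (@same_pattern R G S b).
Local Notation own := (@owner R G S).
Local Notation cletter := (@cletter R G S).
Local Notation tl := (tlen S).
Local Notation rd Q J b := (@rd R (cletter Q) (@alpha R G S Q) (letter0 S Q) J b).
Local Notation gd Q J b := (@gd R (cletter Q) (@alpha R G S Q) (letter0 S Q) J b).
Local Notation rev Q J b := (@rev R (cletter Q) (@alpha R G S Q) (letter0 S Q) J b).
Local Notation word Q := (@block_word R G S _ Q).
Implicit Types (Q r W C : seq G) (D : G -> bool) (g h z c : G).

Lemma isolated_flatten D (Cs : seq (seq G)) :
  (forall C, C \in Cs -> isolated D C) -> isolated D (flatten Cs).
Proof.
move=> iso; apply/isolatedP => z f /flattenP[C CC zC] fF.
have /isolatedP/(_ _ _ zC fF)[nD ins] := iso _ CC; split=> //.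
case: ins => [/allP ins|]; last by right.
by left; apply/allP => f' f'F; apply/flattenP; exists C => //; exact: ins.
Qed.

Lemma halo_sub C C' : {subset C <= C'} -> {subset halo C <= halo C'}.
Proof.
move=> CC z; rewrite /halo !mem_cat => /orP[/allpairsP[[a f] [/= aC fF ->]]|].
  by apply/orP; left; apply/allpairsP; exists (a, f); split=> //; exact: CC.
move=> /allpairsP[[a f] [/= /allpairsP[[a1 f1] [/= /allpairsP[[a2 f2] [/= aC f2F ->]] f1F ->]] fF ->]].
apply/orP; right; apply/allpairsP; exists (a2 * f2^-1 * f1, f)%g; split=> //=.
apply/allpairsP; exists (a2 * f2^-1, f1)%g; split=> //=.
by apply/allpairsP; exists (a2, f2); split=> //=; exact: CC.
Qed.

Lemma same_avoid b D W C (x : Cfg b) : isolated D C -> {subset halo C <= W} ->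
  same_pattern b D W x -> avoid b C x.
Proof.
move=> /isolatedP iso haloW sx; apply/allP => h; rewrite mem_sites => /allP hC.
have := hC _ (pshape1 S); rewrite mulg1 => hC1.
have [+ _] := iso _ _ hC1 (pshape1 S); rewrite invg1 mulg1 => nD.
rewrite sx//; apply: haloW; rewrite /halo mem_cat; apply/orP; left.
by apply/allpairsP; exists (h, 1%g); rewrite invg1 mulg1; split=> //; exact: pshape1.
Qed.

Section OneBlock.
Context (k : nat) (D : G -> bool) (c : G) (Q r : seq G) (J t : nat).
Hypothesis owc : own k D c = Some (Q, r).
Hypothesis tr_ : (t + tl Q J <= size r)%N.
Let pos j := (c * nth 1 r (t + j))%g.

Lemma block_bounds j : (j < tl Q J)%N -> (t + j < size r)%N.
Proof. by move=> jJ; rewrite (leq_trans _ tr_)// ltn_add2l. Qed.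

Lemma block_separated : @separated R G S Q J pos.
Proof.
move=> i j h ij jJ hi; apply/negP => hj.
have [_] := own_uniq owc owc (block_bounds (ltn_trans ij jJ)) (block_bounds jJ) hi hj.
by move=> /eqP; rewrite eqn_add2l ltn_eqF.
Qed.

Lemma block_clusters C : C \in [seq shiftq (pos i) Q | i <- iota 0 (tl Q J)] -> isolated D C.
Proof.
have [_ _ _ _ iso] := own_ok owc.
move=> /mapP[i]; rewrite mem_iota => /andP[_ iJ] ->.
by rewrite isolated_tr; apply: iso; exact: block_bounds.
Qed.

Lemma block_isolated : isolated D (footprint S Q J pos).
Proof. exact: (isolated_flatten block_clusters). Qed.

Lemma block_avoid b (x : Cfg b) : reflect (forall i, (i < tl Q J)%N -> avoid b Q (tr (pos i) x))
  (avoid b (footprint S Q J pos) x).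
Proof.
rewrite /footprint (avoid_flatten _ block_clusters) all_map.
apply: (iffP allP) => h i; last first.
  by rewrite mem_iota => /andP[_ iJ]; rewrite /preim/= avoid_shift; exact: h.
by move=> iJ; rewrite -avoid_shift; apply: (h i); rewrite mem_iota.
Qed.

(** Given the pattern, the clusters of the block are isolated and disjoint, so the word read on it
    has law [lp], up to a factor depending neither on the word nor on the side. *)
Lemma block_prob W : {subset halo (footprint S Q J pos) <= W} ->
  exists2 a, 0 <= a & forall b (V : pred (lX (tower S Q J) b)),
    Prb b (same_pattern b D W `&` [set x | V (rd Q J b (word Q c r t x))]) =
    a * \sum_(z | V z) lp z.
Proof.
move=> hW; have [uQ _ _ _ _] := own_ok owc; have Q0 := own_nonempty owc.
have [a a0 aE] := cluster_factor block_isolated hW.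
exists (a * zav S Q true ^+ tl Q J); first by rewrite mulr_ge0// exprn_ge0// ltW// zav_gt0.
move=> b1 V1; rewrite -mulrA -[zav S Q true](_ : zav S Q b1 = _); last by case: b1 {V1}; rewrite // zav_eq.
rewrite -(spells_prob uQ Q0 V1 block_separated).
set E := [set x | _ /\ _]; have dE : depends (footprint S Q J pos) E by exact: spells_depends block_separated.
rewrite -[E in RHS](_ : avoids b1 (footprint S Q J pos) `&` E = E).
  rewrite -aE//; congr (Prb _ _); apply/seteqP; split=> x [sx Ex]; split=> //.
    by split=> //; apply/block_avoid; exact: same_avoid block_isolated hW sx.
  by case: Ex.
by apply/seteqP; split=> x; [case|move=> Ex; split=> //; apply/block_avoid; case: Ex].
Qed.

End OneBlock.

Lemma block_good_prob k D c Q r J t W b : own k D c = Some (Q, r) ->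
  (t + tl Q J.+1 <= size r)%N ->
  {subset halo (footprint S Q J.+1 (fun j => (c * nth 1 r (t + j))%g)) <= W} ->
  Prb b (same_pattern b D W `&` [set x | ~~ gd Q J b (rd Q J.+1 b (word Q c r t x))]) <=
  2^-1 ^+ J * Prb b (same_pattern b D W).
Proof.
move=> owc tr_ hW; have [uQ _ _ _ _] := own_ok owc; have Q0 := own_nonempty owc.
have hpmf := fun b => alpha_pmf S b uQ; have hpos := ent_alpha_gt0 S true uQ Q0.
have heq := ent_alpha_eq S uQ.
have [a a0 aE] := block_prob owc tr_ hW.
rewrite (aE b (fun v => ~~ gd Q J b v)).
rewrite -[same_pattern b D W in leRHS]setIT; have := aE b xpredT.
rewrite (_ : [set x | _] = setT); last by apply/seteqP; split.
move=> ->; rewrite (lp_pmf (letter0 S Q) hpmf hpos heq J.+1 b).2 mulr1 mulrC ler_wpM2r//.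
exact: (good_prob (letter0 S Q) hpmf hpos heq).
Qed.

Definition in_big_block J k D c z := exists Q r i, [/\ own k D c = Some (Q, r),
  (i < size r)%N, z \in shiftq (c * nth 1%g r i) Q & (tl Q J.+1 <= size r)%N].

Definition in_bad_block b b' J k (x : Cfg b) c z := exists Q r i, [/\ own k (occ b x) c = Some (Q, r),
  (i < size r)%N, z \in shiftq (c * nth 1%g r i) Q, (tl Q J.+1 <= size r)%N &
  ~~ (gd Q J b (rd Q J.+1 b (word Q c r (i %/ tl Q J.+1 * tl Q J.+1) x)) &&
      rev Q J b' (i %% tl Q J.+1 %% tl Q J))].

Lemma in_big_block_tr J k D g c z : in_big_block J k (tr g D) c z <-> in_big_block J k D (g * c) (g * z).
Proof.
by split=> -[Q [r [i [owc ir zi Lr]]]]; exists Q, r, i; move: owc; rewrite own_tr => owc; split=> //;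
  move: zi; rewrite !mem_shiftq shift_back.
Qed.

Lemma in_bad_block_tr b b' J k (x : Cfg b) g c z :
  in_bad_block b' J k (tr g x) c z <-> in_bad_block b' J k x (g * c) (g * z).
Proof.
have wE Q r t : word Q c r t (tr g x) = word Q (g * c) r t x.
  by apply/funext => j; rewrite /block_word tr_tr mulgA.
by split=> -[Q [r [i [owc ir zi Lr bad]]]]; exists Q, r, i; move: owc bad;
  rewrite occ_trE own_tr wE => owc bad; split=> //; move: zi; rewrite !mem_shiftq shift_back.
Qed.

Lemma big_block_measurable b J k c z : measurable [set x : Cfg b | in_big_block J k (occ b x) c z].
Proof.
apply: (open_measurable_config countG) => x [Q [r [i [owc ir zi Lr]]]].
exists (shiftq c (@cover R G S (win S k))) => y xy; exists Q, r, i; split=> //.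
by rewrite -owc; apply/esym/own_local.
Qed.

Lemma word_local b k D c Q r J i (x y : Cfg b) : own k D c = Some (Q, r) -> (i < size r)%N ->
  (tl Q J <= size r)%N ->
  (forall h, h \in flatten [seq shiftq (c * e) Q | e <- r] -> x h = y h) ->
  rd Q J b (word Q c r (i %/ tl Q J * tl Q J) x) = rd Q J b (word Q c r (i %/ tl Q J * tl Q J) y).
Proof.
move=> owc ir Lr xy; apply: eq_rd => j jL; apply/lett_eq => q qQ; apply: xy.
apply/flattenP; exists (shiftq (c * nth 1%g r (i %/ tl Q J * tl Q J + j)) Q).
  by apply: map_f; apply: mem_nth; apply: mod_index => //; [exact: tl_pos owc|exact: tl_dvd owc Lr].
by rewrite mem_shiftq mulKg.
Qed.

Lemma bad_block_measurable b b' J k c z : measurable [set x : Cfg b | in_bad_block b' J k x c z].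
Proof.
apply: (open_measurable_config countG) => x [Q [r [i [owc ir zi Lr bad]]]].
exists (shiftq c (@cover R G S (win S k)) ++ flatten [seq shiftq (c * e) Q | e <- r]) => y xy.
exists Q, r, i; split; [|exact: ir|exact: zi|exact: Lr|].
  by rewrite -owc; apply/esym/own_local => h hs; apply: xy; exact: mem_catl.
by rewrite -(word_local owc ir Lr (x := x))// => h hs; apply: xy; exact: mem_catr.
Qed.

Definition types k : seq (seq G) := [seq (ops S i).1 | i <- iota 0 k].

Lemma own_type k D c Q r : own k D c = Some (Q, r) -> Q \in types k.
Proof.
elim: k c Q r => // k ih c Q r.
rewrite [types _](_ : _ = types k ++ [:: (ops S k).1]); last by rewrite /types -addn1 iotaD map_cat add0n.
rewrite mem_cat inE; case op: (ops S k) => [Q' [j|]].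
  rewrite (own_merge _ op); case e: (merged _ _ _ _ _ _) => [r'|]; first by move=> [-> _]; rewrite eqxx orbT.
  by case: (merged _ _ _ _ _ _) => // /ih ->.
rewrite (own_act _ _ op); case: ifP => _; first by move=> [-> _]; rewrite eqxx orbT.
by move=> /ih ->.
Qed.

Definition block_range k : seq G :=
  undup [seq (e * q)%g | e <- entries S k, q <- flatten (types k)].

Lemma mem_block_range k D c Q r i z : own k D c = Some (Q, r) -> (i < size r)%N ->
  z \in shiftq (c * nth 1%g r i) Q -> (c^-1 * z)%g \in block_range k.
Proof.
move=> owc ir /mapP[q qQ ->]; rewrite mem_undup; apply/allpairsP; exists (nth 1%g r i, q).
split; first by apply: (own_entries owc); exact: mem_nth.
  by apply/flattenP; exists Q => //; exact: own_type owc.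
by rewrite /= -mulgA mulKg.
Qed.

Lemma block_uniq k D c Q r : own k D c = Some (Q, r) ->
  uniq [seq (nth 1 r i * q)%g | i <- iota 0 (size r), q <- Q].
Proof.
move=> owc; have [uQ _ _ _ _] := own_ok owc.
apply: allpairs_uniq => //; first exact: iota_uniq.
move=> [i q] [i' q'] /allpairsP[[i1 q1] [/= + h2 [-> ->]]] /allpairsP[[i2 q2] [/= + h4 [-> ->]]] e.
rewrite !mem_iota !add0n /= => h1 h3; rewrite /= in e.
have z1 : (c * (nth 1 r i1 * q1))%g \in shiftq (c * nth 1%g r i1)%g Q.
  by apply/mapP; exists q1 => //; rewrite mulgA.
have z2 : (c * (nth 1 r i1 * q1))%g \in shiftq (c * nth 1%g r i2)%g Q.
  by rewrite e; apply/mapP; exists q2 => //; rewrite mulgA.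
have [_ iE] := own_uniq owc owc h1 h3 z1 z2.
by move: e; rewrite iE => /mulgI ->.
Qed.

(** Two failures are counted: a segment that is not good, of conditional probability at most
    [2^-1 ^+ J.+1], and a hidden position, of frequency at most [2^-1 ^+ J]. Levels start at [J.+1]
    since at level 0 every position is hidden. *)
Lemma bad_positions k D Q r J W b b' : own k D 1 = Some (Q, r) -> (tl Q J.+2 <= size r)%N ->
  {subset halo [seq (e * q)%g | e <- r, q <- Q] <= W} ->
  \sum_(i <- iota 0 (size r)) Prb b (same_pattern b D W `&`
     [set x | ~~ (gd Q J.+1 b (rd Q J.+2 b (word Q 1 r (i %/ tl Q J.+2 * tl Q J.+2) x)) &&
        rev Q J.+1 b' (i %% tl Q J.+2 %% tl Q J.+1))]) <=
  2 * 2^-1 ^+ J * \sum_(i <- iota 0 (size r)) Prb b (same_pattern b D W).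
Proof.
move=> ow Lr hW; have [uQ _ _ _ _] := own_ok ow; have Q0 := own_nonempty ow.
have hpmf := fun b => alpha_pmf S b uQ; have hpos := ent_alpha_gt0 S true uQ Q0.
have heq := ent_alpha_eq S uQ.
set L := tl Q J.+2; set L0 := tl Q J.+1; set P := Prb b (same_pattern b D W).
have L_gt0 : (0 < L)%N by exact: tl_pos ow.
have dL : (L %| size r)%N by exact: tl_dvd ow Lr.
have dL0 : (L0 %| L)%N by apply: len_dvd.
have mS : measurable (same_pattern b D W) by exact: same_pattern_measurable.
have mgd i : (i < size r)%N -> measurable [set x : Cfg b | gd Q J.+1 b (rd Q J.+2 b (word Q 1 r (i %/ L * L) x))].
  move=> ir; apply: (@depends_measurable _ _ (flatten [seq shiftq (1 * e) Q | e <- r])) => x y xy.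
  have e : rd Q J.+2 b (word Q 1 r (i %/ L * L) x) = rd Q J.+2 b (word Q 1 r (i %/ L * L) y).
    exact: word_local ow ir Lr xy.
  by rewrite /mkset e.
have P0 : 0 <= P by exact: Pr_ge0.
apply: (@le_trans _ _ (\sum_(i <- iota 0 (size r)) (2^-1 ^+ J.+1 * P + (~~ rev Q J.+1 b' (i %% L0))%:R * P))).
  rewrite big_seq [leRHS]big_seq; apply: ler_sum => i; rewrite mem_iota add0n => /andP[_ ir].
  rewrite (modn_dvdm _ dL0); case: (rev Q J.+1 b' (i %% L0)); rewrite [~~ _]/=; last first.
    rewrite mulr1n mul1r; apply: (@le_trans _ _ P); last by rewrite lerDr mulr_ge0// exprn_ge0.
    apply: Pr_le; [|exact: mS|exact: subIsetl].
    apply: measurableI => //; rewrite (_ : [set x | _] = setT)//.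
    by apply/seteqP; split=> // x _; rewrite /mkset andbF.
  rewrite mulr0n mul0r addr0.
  have -> : [set x : Cfg b | ~~ (gd Q J.+1 b (rd Q J.+2 b (word Q 1 r (i %/ L * L) x)) && true)] =
      [set x | ~~ gd Q J.+1 b (rd Q J.+2 b (word Q 1 r (i %/ L * L) x))].
    by apply/seteqP; split=> x; rewrite /mkset andbT.
  have key := @block_good_prob k D 1%g Q r J.+1 (i %/ L * L)%N W b ow.
  apply: key.
    by have := mod_index L_gt0 dL ir (j := L.-1); rewrite ltn_predL => /(_ L_gt0); lia.
  move=> z hz; apply: hW; apply: halo_sub hz => y /mem_footprint[j jL].
  rewrite mem_shiftq mul1g => yQ; apply/allpairsP.
  exists (nth 1%g r (i %/ L * L + j), (nth 1 r (i %/ L * L + j))^-1 * y)%g; split=> //=; last by rewrite mulVKg.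
  by apply: mem_nth; exact: mod_index.
have sconst (x : R) : \sum_(i <- iota 0 (size r)) x = (size r)%:R * x.
  by rewrite big_const_seq count_predT size_iota iter_addr_0 mulr_natl.
have ssplit (f : nat -> R) (x p : R) : \sum_(i <- iota 0 (size r)) (x * p + f i * p) =
    (size r)%:R * (x * p) + (\sum_(i <- iota 0 (size r)) f i) * p.
  by rewrite big_split/= sconst mulr_suml.
rewrite ssplit sconst.
have hidE : \sum_(i <- iota 0 (size r)) (~~ rev Q J.+1 b' (i %% L0))%:R <= 2^-1 ^+ J * (size r)%:R :> R.
  have [q sq] := dvdnP (dvdn_trans dL0 dL).
  rewrite -natr_sum -{1}[size r]subn0 -/(index_iota 0 (size r)) big_mkord sq.
  rewrite (sum_blocks q L0 (fun i => ~~ rev Q J.+1 b' (i %% L0) : nat)).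
  rewrite (eq_bigr (fun=> @hid R (cletter Q) (@alpha R G S Q) (letter0 S Q) J.+1 b')); last first.
    by move=> s _; apply: eq_bigr => j _; rewrite modnMDl modn_small.
  rewrite sum_nat_const card_ord natrM [in leRHS]natrM mulrCA; apply: ler_wpM2l => //.
  exact: (hid_bound (letter0 S Q) hpmf hpos heq).
have := ler_wpM2r P0 hidE; rewrite exprS.
have : 0 <= 2^-1 ^+ J * P * (size r)%:R by rewrite !mulr_ge0// exprn_ge0.
move: (\sum_(i <- _) _) (2^-1 ^+ J) (size r)%:R P P0; clear => s e m p _ h1 h2; nra.
Qed.

Lemma Pr_union b (s : seq G) (E : set (Cfg b)) (E' : G -> set (Cfg b)) : measurable E ->
  (forall g, measurable (E' g)) -> (forall x, E x -> exists2 g, g \in s & E' g x) ->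
  Prb b E <= \sum_(g <- s) Prb b (E' g).
Proof.
move=> mE mE'; elim: s E mE => [|g s ih] E mE EE'.
  rewrite big_nil (_ : E = set0) ?Pr_set0//; apply/seteqP; split=> // x /EE'[g].
  by rewrite in_nil.
rewrite big_cons (_ : E = (E `&` E' g) `|` (E `\` E' g)); last by rewrite setUIDK.
rewrite Pr_setU; first last.
- by apply/seteqP; split=> // x [[_ h] [_]].
- exact: measurableD.
- exact: measurableI.
apply: lerD; first by apply: Pr_le; [exact: measurableI|exact: mE'|exact: subIsetr].
apply: ih; first exact: measurableD.
move=> x [Ex nE]; have [g' + E'x] := EE' _ Ex.
by rewrite inE => /predU1P[gE|gs]; [rewrite gE in E'x|exists g'].
Qed.

(* Mass transport: the centre of a block spreads its mass evenly over the block. *)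
Lemma bad_block_prob b b' J k :
  Prb b [set x | exists c, in_bad_block b' J.+1 k x c 1] <= 2 * 2^-1 ^+ J.
Proof.
pose A := block_range k.
have mU : measurable [set x : Cfg b | exists c, in_bad_block b' J.+1 k x c 1].
  rewrite (_ : [set x | _] = \big[setU/set0]_(g <- A) [set x | in_bad_block b' J.+1 k x g^-1 1]).
    apply: bigsetU_measurable => g _; exact: bad_block_measurable.
  rewrite -bigcup_seq; apply/seteqP; split=> x /=; last by move=> [g _ h]; exists g^-1%g.
  move=> [c h]; exists c^-1%g; rewrite /= ?invgK//.
  by have [Q [r [i [owc ir zi _ _]]]] := h; rewrite -[c^-1%g]mulg1; exact: mem_block_range owc ir zi.
apply: (@le_trans _ _ (\sum_(g <- A) Prb b [set x | in_bad_block b' J.+1 k x g^-1 1])).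
  apply: Pr_union => // [g|x [c h]]; first exact: bad_block_measurable.
  exists c^-1%g; rewrite ?invgK//; have [Q [r [i [owc ir zi _ _]]]] := h.
  by rewrite -[c^-1%g]mulg1; exact: mem_block_range owc ir zi.
(* Shift invariance exchanges a block centred at [g^-1] seen from the identity for a block centred
   at the identity seen from [g]. *)
have shiftE (E : Cfg b -> G -> G -> Prop) g : (forall x, E (tr g^-1 x) 1%g g <-> E x g^-1%g 1%g) ->
    measurable [set x | E x 1%g g] -> Prb b [set x | E x g^-1%g 1%g] = Prb b [set x | E x 1%g g].
  move=> Etr mE; rewrite -(Pr_tr countG (mu b) g^-1 mE); congr (Prb b _).
  by apply/seteqP; split=> x /= /Etr.
rewrite (eq_bigr (fun g => Prb b [set x | in_bad_block b' J.+1 k x 1 g])); last first.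
  move=> g _; apply: (shiftE (in_bad_block b' J.+1 k)); last exact: bad_block_measurable.
  by move=> x; rewrite in_bad_block_tr mulg1 mulVg.
pose big (x : Cfg b) := in_big_block J.+1 k (occ b x).
apply: (@le_trans _ _ (2 * 2^-1 ^+ J * \sum_(g <- A) Prb b [set x | big x 1%g g])); last first.
  rewrite -[leRHS]mulr1 ler_wpM2l ?mulr_ge0 ?exprn_ge0//.
  rewrite (eq_bigr (fun g => Prb b [set x | big x g^-1%g 1%g])); last first.
    move=> g _; apply/esym/shiftE; last exact: big_block_measurable.
    by move=> x; rewrite /big occ_trE in_big_block_tr mulg1 mulVg.
  (* Different [g] mean different centres [g^-1], and the identity belongs to at most one block. *)
  apply: Pr_disjoint; [exact: undup_uniq|move=> g; exact: big_block_measurable|].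
  move=> g g' x _ _ [Q [r [i [ow ir zi _]]]] [Q' [r' [i' [ow' ir' zi' _]]]].
  by have [/invg_inj] := own_uniq ow ow' ir ir' zi zi'.
pose Y := [seq (e * q)%g | e <- entries S k, q <- flatten (types k)].
apply: (@pattern_compare R G S (win S k ++ halo Y)).
- by move=> g; exact: bad_block_measurable.
- by move=> g; exact: big_block_measurable.
move=> D; set W := win S k ++ halo Y.
have sown x : same_pattern b D W x -> own k (occ b x) 1 = own k D 1.
  move=> sx; rewrite /owner !tr1 (@st_local R G S k (occ b x) D)// => h hW.
  by apply: sx; exact: mem_catl.
have [[[Q r] [ow Lr]]|no] := pselect (exists Qr, own k D 1 = Some Qr /\ (tl Qr.1 J.+2 <= size Qr.2)%N); last first.
  rewrite big1 => [|g _].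
    by apply: mulr_ge0; [rewrite mulr_ge0// exprn_ge0|apply: sumr_ge0 => g _; exact: Pr_ge0].
  rewrite [X in Prb b X](_ : _ = set0) ?Pr_set0//; apply/seteqP; split=> // x [/sown sx].
  by move=> [Q [r [i [ow _ _ Lr _]]]]; apply: no; exists (Q, r); rewrite -sx.
pose B := [seq (nth 1 r i * q)%g | i <- iota 0 (size r), q <- Q].
have uB : uniq B by exact: block_uniq ow.
have BA : {subset B <= A}.
  move=> z /allpairsP[[i q] [/= + qQ ->]]; rewrite mem_iota add0n => /= ir.
  rewrite -[(_ * _)%g]mul1g -{1}[1%g]invg1; apply: (mem_block_range ow ir).
  by apply/mapP; exists q; rewrite // mul1g.
(* Once the pattern is given, only the sites of the block centred at the identity contribute; they
   are indexed by a cluster [i] and an element [q] of the shape. *)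
have reduce (f : G -> R) : (forall g, g \notin B -> f g = 0) ->
    \sum_(g <- A) f g = \sum_(i <- iota 0 (size r)) \sum_(q <- Q) f (nth 1 r i * q)%g.
  move=> f0; rewrite (bigID (mem B))/= [X in _ + X]big1 ?addr0; last by move=> g /f0.
  rewrite -big_filter (perm_big B); first by rewrite /B big_allpairs_dep.
  apply: uniq_perm; rewrite ?filter_uniq ?undup_uniq// => g.
  by rewrite mem_filter andb_idr//; exact: BA.
have notB x g E : same_pattern b D W x -> g \notin B ->
    (exists Q r i, [/\ own k (occ b x) 1 = Some (Q, r), (i < size r)%N & g \in shiftq (1 * nth 1%g r i) Q] /\ E Q r i) -> False.
  move=> /sown sx /negP gB [Q1 [r1 [i [[]]]]]; rewrite sx ow => -[<- <-] ir /mapP[q qQ gE] _.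
  apply: gB; rewrite gE mul1g; apply/allpairsP; exists (i, q); split=> //.
  by rewrite mem_iota add0n.
rewrite !reduce; first last.
- move=> g gB; rewrite [X in Prb b X](_ : _ = set0) ?Pr_set0//; apply/seteqP; split=> // x [sx].
  move=> [Q1 [r1 [i [h1 h2 h3 h4 h5]]]]; apply: (notB x g (fun _ _ _ => True) sx gB).
  by exists Q1, r1, i.
- move=> g gB; rewrite [X in Prb b X](_ : _ = set0) ?Pr_set0//; apply/seteqP; split=> // x [sx].
  move=> [Q1 [r1 [i [h1 h2 h3 h4]]]]; apply: (notB x g (fun _ _ _ => True) sx gB).
  by exists Q1, r1, i.
(* For a fixed [q], the average over the clusters of the block is the one estimated in
   [bad_positions]. *)
rewrite exchange_big [in leRHS]exchange_big/= mulr_sumr big_seq [leRHS]big_seq.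
apply: ler_sum => q qQ.
have hW : {subset halo [seq (e * q)%g | e <- r, q <- Q] <= W}.
  move=> z hz; apply: mem_catr; apply: halo_sub hz => y /allpairsP[[e q'] [/= er q'Q ->]].
  apply/allpairsP; exists (e, q'); split=> //; first exact: own_entries ow _ er.
  by apply/flattenP; exists Q => //; exact: own_type ow.
have at_ i x : (i < size r)%N -> same_pattern b D W x ->
    [/\ own k (occ b x) 1 = Some (Q, r), (i < size r)%N & (nth 1 r i * q)%g \in shiftq (1 * nth 1%g r i) Q].
  by move=> ir /sown ->; split=> //; apply/mapP; exists q; rewrite // mul1g.
have big_all i : (i < size r)%N -> same_pattern b D W `&` [set x | big x 1%g (nth 1 r i * q)%g] =
    same_pattern b D W.
  move=> ir; apply/seteqP; split=> x; first by case.
  by move=> sx; split=> //; have [h1 h2 h3] := at_ i x ir sx; exists Q, r, i.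
have -> : \sum_(i <- iota 0 (size r)) Prb b (same_pattern b D W `&` [set x | big x 1%g (nth 1 r i * q)%g]) =
    \sum_(i <- iota 0 (size r)) Prb b (same_pattern b D W).
  rewrite big_seq [RHS]big_seq; apply: eq_bigr => i.
  by rewrite mem_iota add0n => /andP[_ ir]; rewrite big_all.
apply: le_trans (@bad_positions k D Q r J W b b' ow Lr hW).
rewrite big_seq [leRHS]big_seq; apply: ler_sum => i; rewrite mem_iota add0n => /andP[_ ir].
have dS : measurable (same_pattern b D W) by exact: same_pattern_measurable.
have mB := @bad_block_measurable b b' J.+1 k 1%g (nth 1 r i * q)%g.
rewrite [X in Prb b X <= _](_ : _ = same_pattern b D W `&`
   [set x | ~~ (gd Q J.+1 b (rd Q J.+2 b (word Q 1 r (i %/ tl Q J.+2 * tl Q J.+2) x)) &&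
        rev Q J.+1 b' (i %% tl Q J.+2 %% tl Q J.+1))])//.
apply/seteqP; split=> x [sx]; last first.
  by move=> bad; split=> //; have [h1 h2 h3] := at_ i x ir sx; exists Q, r, i.
move=> [Q1 [r1 [i1 [h1 h2 h3 h4 h5]]]]; split=> //; have [h6 _ h7] := at_ i x ir sx.
move: h1 h2 h3 h4 h5; rewrite h6 => -[<- <-] h2 h3 h4.
by have [_ <-] := own_uniq h6 h6 ir h2 h7 h3.
Qed.

End Blocks.

(** * Domination of the image law by the target law *)

Section Law.
Context {R : realType} {G : groupType} (S : pattern_pair R G).
Local Notation n := (psize S).
Local Notation mu := (pmu S).
Local Notation F := (pshape S).
Local Notation w b := (@pword R G S b).
Local Notation countG := (p_countable S).
Local Notation Cfg b := (config G (letter (n b))).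
Local Notation Prb b := (@Pr R G (n b) (mu b)).
Local Notation occ b := (@occ R G S b).
Local Notation avoid b := (@avoid R G S b).
Local Notation avoids b := (@avoids R G S b).
Local Notation hit := (@hit R G S).
Local Notation isolated := (@isolated R G S).
Local Notation halo := (@halo R G S).
Local Notation same_pattern b := (@same_pattern R G S b).
Local Notation own := (@owner R G S).
Local Notation win := (win S).
Local Notation cover := (@cover R G S).
Local Notation cletter := (@cletter R G S).
Local Notation tl := (tlen S).
Local Notation lv Q J := (lv (@alpha R G S Q) (letter0 S Q) J).
Local Notation rd Q J b := (@rd R (cletter Q) (@alpha R G S Q) (letter0 S Q) J b).
Local Notation gd Q J b := (@gd R (cletter Q) (@alpha R G S Q) (letter0 S Q) J b).
Local Notation rev Q J b := (@rev R (cletter Q) (@alpha R G S Q) (letter0 S Q) J b).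
Local Notation dec Q J b b' := (@dec R (cletter Q) (@alpha R G S Q) (letter0 S Q) J b b').
Local Notation word Q := (@block_word R G S _ Q).
Implicit Types (Q r W C : seq G) (D : G -> bool) (g h z c : G).

Definition undecided b b' J k (x : Cfg b) z :=
  ~~ hit (occ b x) z /\ ~ exists l : letter (n b'), decodes k J x z l.

Lemma hit_measurable b z : measurable [set x : Cfg b | hit (occ b x) z].
Proof.
apply: (@depends_measurable _ _ (cover [seq (z * f^-1)%g | f <- F])).
apply: (@pattern_depends _ _ S b _ (fun D => hit D z)) => D E DE.
rewrite (_ : hit D z = hit E z)//; apply: eq_in_has => f fF; apply: DE.
by apply/mapP; exists f.
Qed.

Lemma decodable_measurable b b' J k z :
  measurable [set x : Cfg b | exists l : letter (n b'), decodes k J x z l].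
Proof.
apply: (open_measurable_config countG) => x [l /decodes_local[s h]].
by exists s => y /h d; exists l.
Qed.

Lemma undecided_measurable b b' J k z : measurable [set x : Cfg b | undecided b' J k x z].
Proof.
rewrite (_ : [set x | _] = ~` [set x : Cfg b | hit (occ b x) z] `&`
    ~` [set x : Cfg b | exists l : letter (n b'), decodes k J x z l]).
  by apply: measurableI; apply: measurableC; [exact: hit_measurable|exact: decodable_measurable].
by apply/seteqP; split=> x [nh nd]; split=> //; exact/negP.
Qed.

Lemma undecided_tr b b' J k (x : Cfg b) g z :
  undecided b' J k (tr g x) z <-> undecided b' J k x (g * z).
Proof.
rewrite /undecided occ_trE hit_tr; split=> -[nh nd]; split=> // -[l d]; apply: nd; exists l;
  exact/decodes_tr.
Qed.

(** An uncovered site that is not decoded either lies in no block of the required length or sits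
    badly in such a block. The second event is small uniformly in the stage by [bad_block_prob], so
    [J] is fixed first; the first then becomes small at late stages by [blocks_grow]. *)
Lemma undecided_vanish b b' (e : R) J0 : null (mu b) (@island_failure R G S b) -> 0 < e ->
  exists J k, (J0 <= J)%N /\ Prb b [set x | undecided b' J k x 1] <= e.
Proof.
move=> nI e0; have [J1 eJ1] : exists J1 : nat, 4 / e < 2 ^+ J1 :> R.
  exists (Num.truncn (4 / e)).+1; apply: (lt_trans (truncnS_gt _)).
  by rewrite -natrX ltr_nat ltn_expl.
pose J2 := maxn J0 J1; pose J := J2.+1.
pose small k : set (Cfg b) := [set x | ~~ hit (occ b x) 1 /\
  ~ exists c, in_big_block S J k (occ b x) c 1].
have mbig k : measurable [set x : Cfg b | exists c, in_big_block S J k (occ b x) c 1].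
  apply: (open_measurable_config countG) => x [c [Q [r [i [owc ir zi Lr]]]]].
  exists (shiftq c (cover (win k))) => y xy; exists c, Q, r, i; split=> //.
  by rewrite -owc; apply/esym/own_local.
have msmall k : measurable (small k).
  rewrite (_ : small k = ~` [set x : Cfg b | hit (occ b x) 1] `&`
      ~` [set x : Cfg b | exists c, in_big_block S J k (occ b x) c 1]).
    by apply: measurableI; apply: measurableC; [exact: hit_measurable|exact: mbig].
  by apply/seteqP; split=> x [nh nd]; split=> //; exact/negP.
have grow_big k k' D c : (k <= k')%N -> in_big_block S J k D c 1 -> exists c', in_big_block S J k' D c' 1.
  move=> kk' [Q [r [i [owc ir zi Lr]]]]; have [c' [r' [s [t [ow' r's st h]]]]] := grow kk' owc.
  exists c', Q, r', (s * size r + i)%N; rewrite h//; split=> //.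
    by rewrite r's (@leq_trans (s * size r + size r)%N) ?ltn_add2l// -mulSnr leq_mul2r st orbT.
  by rewrite r's (leq_trans Lr)// leq_pmull// (leq_ltn_trans _ st).
have [k ke] : exists k, Prb b (small k) <= e / 2.
  apply: (@Pr_decreasing _ _ _ (mu b) small) => //; last by rewrite divr_gt0.
    by move=> j k jk x [nh ns]; split=> // -[c /(grow_big _ _ _ _ jk)].
  apply: null_sub (blocks_grow nI) => x xs g; have [nh _] := xs 0%N I.
  (* The shape [Q] has to be known before the length [tl Q J.+1] to be exceeded, hence two calls:
     the first finds the block of the site, the second makes it long enough, as [2 ^ L > L]. *)
  have [|[k0 [c0 [Q [r0 [i0 [ow0 ir0 zi0 _]]]]]]] := g 1%g 0%N; first by rewrite (negbTE nh).
  have [|[k1 [c1 [Q1 [r1 [i1 [ow1 ir1 zi1 L1]]]]]]] := g 1%g (tl Q J.+1); first by rewrite (negbTE nh).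
  have [_] := xs (maxn k0 k1) I; apply.
  have [c2 [r2 [s2 [t2 [ow2 r2s st2 h2]]]]] := grow (leq_maxl k0 k1) ow0.
  have [c3 [r3 [s3 [t3 [ow3 r3s st3 h3]]]]] := grow (leq_maxr k0 k1) ow1.
  have b2 : (s2 * size r0 + i0 < size r2)%N.
    by rewrite r2s (@leq_trans (s2 * size r0 + size r0)%N) ?ltn_add2l// -mulSnr leq_mul2r st2 orbT.
  have b3 : (s3 * size r1 + i1 < size r3)%N.
    by rewrite r3s (@leq_trans (s3 * size r1 + size r1)%N) ?ltn_add2l// -mulSnr leq_mul2r st3 orbT.
  have z2 := zi0; rewrite -(h2 _ ir0) in z2; have z3 := zi1; rewrite -(h3 _ ir1) in z3.
  have [cE iE] := own_uniq ow2 ow3 b2 b3 z2 z3.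
  move: ow3; rewrite -cE ow2 => -[QE rE].
  exists c2, Q, r2, (s2 * size r0 + i0)%N; split=> //.
  rewrite rE r3s (leq_trans (ltnW (ltn_expl (tl Q J.+1) (ltnSn 1))))// (leq_trans L1)//.
  by rewrite leq_pmull// (leq_ltn_trans _ st3).
exists J, k; split; first by rewrite (leq_trans (leq_maxl J0 J1)).
pose bad : set (Cfg b) := [set x | exists c, in_bad_block b' J k x c 1].
have mbad : measurable bad.
  apply: (open_measurable_config countG) => x [c [Q [r [i [owc ir zi Lr bd]]]]].
  exists (shiftq c (cover (win k)) ++ flatten [seq shiftq (c * q) Q | q <- r]) => y xy.
  exists c, Q, r, i; split; [|exact: ir|exact: zi|exact: Lr|].
    by rewrite -owc; apply/esym/own_local => h hs; apply: xy; exact: mem_catl.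
  by rewrite -(word_local owc ir Lr (x := x))// => h hs; apply: xy; exact: mem_catr.
apply: (@le_trans _ _ (Prb b (small k) + Prb b bad)); last first.
  have := @bad_block_prob R G S b b' J2 k; rewrite -/J -/bad => hb.
  have : 2 * 2^-1 ^+ J2 <= e / 2.
    rewrite exprVn ler_pdivrMr ?exprn_gt0// mulrAC ler_pdivlMr// -ler_pdivrMl//.
    rewrite -natrM mulrC (le_trans (ltW eJ1))// ler_weXn2l ?leq_maxr//; by rewrite ler1n.
  move=> h1; move: (lerD ke (le_trans hb h1)); rewrite -[X in _ <= X -> _](splitr e).
  exact.
apply: (@le_trans _ _ (Prb b (small k `|` bad))).
  apply: Pr_le; [exact: undecided_measurable|exact: measurableU|].
  move=> x [nh nd]; have [[c bg]|no] := pselect (exists c, in_big_block S J k (occ b x) c 1); last by left.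
  right; apply: contrapT => nb; apply: nd.
  have [Q [r [i [owc ir zi Lr]]]] := bg.
  have [/andP[gv rv]|bd] := boolP (gd Q J b (rd Q J.+1 b (word Q c r (i %/ tl Q J.+1 * tl Q J.+1) x)) &&
      rev Q J b' (i %% tl Q J.+1 %% tl Q J)); last by case: nb; exists c, Q, r, i.
  have iL : (i %% tl Q J.+1 < tl Q J.+1)%N by rewrite ltn_pmod//; exact: tl_pos owc.
  have [a da] := dec_exists gv iL rv.
  by exists (unlett a ((c * nth 1%g r i)^-1 * 1)%g), c, Q, r, i, a; split.
rewrite (_ : small k `|` bad = small k `|` (bad `\` small k)); last first.
  apply/seteqP; split=> x; last by move=> [|[]]; [left|right].
  by move=> [|bx]; [left|have [sx|nx] := pselect (small k x); [left|right]].
rewrite Pr_setU//; last by rewrite setDE setICA setICr setI0.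
  rewrite lerD2l; apply: Pr_le => //; exact: measurableD.
exact: measurableD.
Qed.

(** A constraint in [cons] is a position in the segment, an element of the shape and a letter. [E]
    asks for a good source word whose coupling words can spell the constraints, [E'] for a target
    word that spells them at the revealed positions; [dec_prob] compares them, since the avoidance
    factors agree. *)
Lemma block_transfer k D c Q r J t b b' (cons : seq (nat * G * letter (n b'))) :
  own k D c = Some (Q, r) -> (t + tl Q J.+1 <= size r)%N -> cons != [::] ->
  let pos j := (c * nth 1 r (t + j))%g in let fp := footprint S Q J.+1 pos in
  exists (E : set (Cfg b)) (E' : set (Cfg b')),
  [/\ depends fp E /\ depends fp E', Prb b E <= Prb b' E',
      forall x, avoid b fp x -> (forall s, s \in cons -> exists a,
        dec Q J b b' (word Q c r t x) s.1.1 a /\ s.2 = unlett a s.1.2) -> E x,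
      (forall x, E x -> avoid b fp x) /\ (forall y, E' y -> avoid b' fp y) &
      forall y, E' y -> forall s, s \in cons -> (s.1.1 < tl Q J.+1)%N ->
        rev Q J b' (s.1.1 %% tl Q J) -> s.1.2 \in Q -> y (pos s.1.1 * s.1.2)%g = s.2].
Proof.
move=> owc tr_ c0 pos fp; have [uQ _ _ _ _] := own_ok owc; have Q0 := own_nonempty owc.
have hpmf := fun b => alpha_pmf S b uQ; have hpos := ent_alpha_gt0 S true uQ Q0.
have heq := ent_alpha_eq S uQ; have sep := block_separated owc tr_.
pose V j (a : cletter Q b') := all (fun s => (s.1.1 == j) ==> (unlett a s.1.2 == s.2)) cons.
pose P (x : lX (lv Q J.+1) b) := gd Q J b x && [exists e : lE (lv Q J.+1),
  [&& 0 < lr e, lev b e == lmk x & [forall i : 'I_(tl Q J.+1),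
     rev Q J b' (i %% tl Q J) ==> V i (lab (lev b' e) i)]]].
pose P' (y : lX (lv Q J.+1) b') := [forall i : 'I_(tl Q J.+1),
  rev Q J b' (i %% tl Q J) ==> V i (lab y i)].
pose E a (V : pred (lX (lv Q J.+1) a)) : set (Cfg a) := [set x |
  (forall i, (i < tl Q J.+1)%N -> avoid a Q (tr (pos i) x)) /\
  V (rd Q J.+1 a (fun i => lett Q (tr (pos i) x)))].
exists (E b P), (E b' P'); split.
- by split; apply: (spells_depends uQ Q0 sep).
- rewrite (spells_prob uQ Q0 P sep) (spells_prob uQ Q0 P' sep).
  have -> : zav S Q b = zav S Q b' by case: (b) (b') => -[]//; rewrite zav_eq.
  apply: ler_wpM2l; first by rewrite exprn_ge0// ltW// zav_gt0.
  exact: (dec_prob (letter0 S Q) hpmf hpos heq J b V).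
- move=> x ax dx; split; first exact/(block_avoid owc tr_).
  have [s0 s0c] : exists s, s \in cons by case: (cons) c0 => // s l _; exists s; rewrite mem_head.
  have [a0 [[gv i0 r0 [e [e0 ov _]]] _]] := dx _ s0c.
  rewrite /P; apply/andP; split; first exact: gv.
  apply/existsP; exists e; apply/and3P; split=> //; first exact/eqP.
  apply/forallP => i; apply/implyP => ri; apply/allP => s sc; apply/implyP => /eqP si.
  have [a [[_ _ _ [e' [e'0 ov' la]]] ->]] := dx _ sc.
  apply/eqP; congr (unlett _ _); rewrite -la si.
  exact: (good_label hpmf hpos heq gv (ltn_ord i) ri e0 ov e'0 ov').
- by split=> x [ax _]; apply/(block_avoid owc tr_).
- move=> y [_ /forallP h] s sc iL rv sQ.
  have /implyP/(_ rv)/allP/(_ _ sc)/implyP/(_ (eqxx _))/eqP <- := h (Ordinal iL).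
  have -> : nat_of_ord (Ordinal iL) = s.1.1 by [].
  by rewrite (lab_rd hpmf hpos heq _ iL) lettK.
Qed.


(* The blocks met by [T] are independent given the occurrences, and in each of
   them the decoded letters are no more likely to spell [om] than the letters
   of the second alphabet. *)
Lemma law_bound b b' (T : seq G) (om : G -> letter (n b')) k J :
  Prb b [set x : Cfg b | forall z, z \in T -> (exists2 f, f \in F & occ b x (z * f^-1)%g /\ om z = w b' f) \/
    decodes k J x z (om z)] <= Prb b' [set y : Cfg b' | forall z, z \in T -> y z = om z].
Proof.
set E : set (Cfg b) := [set x | _]; set E' : set (Cfg b') := [set y | _].
have mE : measurable E.
  rewrite (_ : E = \big[setI/setT]_(z <- T) [set x : Cfg b |
      (exists2 f, f \in F & occ b x (z * f^-1)%g /\ om z = w b' f) \/ decodes k J x z (om z)]).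
    apply: (@bigsetI_measurable _ (Cfg b)) => z _.
    apply: (open_measurable_config countG) => x [[f fF [of_ e]]|/decodes_local[s h]].
      exists [seq (z * f^-1 * f')%g | f' <- F] => y xy; left; exists f => //; split=> //.
      by rewrite -(@occ_local R G S b x y)// => f' f'F; apply: xy; apply/mapP; exists f'.
    by exists s => y /h d; right.
  rewrite /E; elim: (T) => [|z s ih]; first by rewrite big_nil; apply/seteqP; split.
  rewrite big_cons -ih; apply/seteqP; split=> x /=.
    by move=> h; split=> [|z' z's]; apply: h; rewrite inE ?eqxx ?z's ?orbT.
  by move=> [h1 h2] z'; rewrite inE => /predU1P[->|/h2].
have mE' : measurable E'.
  by apply: (@depends_measurable _ _ T) => x y xy Ex z zT; rewrite -xy// Ex.
pose Cn := [seq (z * g^-1)%g | z <- T, g <- block_range S k].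
pose Y := [seq (e * q)%g | e <- entries S k, q <- flatten (types S k)].
pose Ball := [seq (c * g)%g | c <- Cn, g <- Y].
(* The window decides which sites of [T] are covered, what every possible centre near [T] owns, and
   the isolation of every block such a centre can have. *)
pose W := [seq (z * f^-1)%g | z <- T, f <- F] ++ flatten [seq shiftq c (win k) | c <- Cn] ++ halo Ball.
suff : \sum_(i <- [:: tt]) Prb b E <= 1 * \sum_(i <- [:: tt]) Prb b' E' by rewrite !big_seq1 mul1r.
apply: (@pattern_compare R G S W b b' unit [:: tt] (fun=> E) (fun=> E') 1) => // D.
rewrite !big_seq1 mul1r.
(* A pattern incompatible with the event contributes nothing. Otherwise [x0] shows that each site of
   [T] is covered with the right letter or sits at a decodable position of a block. *)
have [[x0 [sx0 Ex0]]|none] := pselect (exists x0, (same_pattern b D W `&` E) x0); last first.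
  rewrite [X in Prb b X](_ : _ = set0) ?Pr_set0 ?Pr_ge0//.
  by apply/seteqP; split=> // x h; apply: none; exists x.
have sown a (x : Cfg a) c : c \in Cn -> same_pattern a D W x -> own k (occ a x) c = own k D c.
  move=> cC sx; rewrite /owner (@st_local R G S k (tr c (occ a x)) (tr c D))// => h hW.
  apply: sx; apply: mem_catr; apply: mem_catl; apply/flattenP.
  by exists (shiftq c (win k)); [exact: map_f|rewrite mem_shiftq mulKg].
have center a (x : Cfg a) c Q r i z : own k (occ a x) c = Some (Q, r) -> (i < size r)%N -> z \in T ->
    z \in shiftq (c * nth 1%g r i) Q -> c \in Cn.
  move=> owc ir zT zi; apply/allpairsP; exists (z, c^-1 * z)%g; split=> //=.
    exact: mem_block_range owc ir zi.
  by apply: (@mulIg _ (c^-1 * z)%g); rewrite mulgVK mulVKg.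
pose in_block z := exists s : G * seq G * seq G * nat, let: (c, Q, r, i) := s in
  [/\ c \in Cn, own k D c = Some (Q, r), (i < size r)%N, z \in shiftq (c * nth 1%g r i) Q &
      (tl Q J.+1 <= size r)%N /\ rev Q J b' (i %% tl Q J.+1 %% tl Q J)].
have cases z : z \in T -> (exists2 f, f \in F & D (z * f^-1)%g /\ om z = w b' f) \/ in_block z.
  move=> zT; have [[f fF [of_ e]]|[c [Q [r [i [a [owc ir zi [Lr [gv iL rv ee]] e]]]]]]] := Ex0 z zT.
    left; exists f => //; rewrite -(sx0 (z * f^-1)%g)//; apply: mem_catl.
    by apply/allpairsP; exists (z, f).
  have cC := center _ _ _ _ _ _ _ owc ir zT zi.
  by right; exists (c, Q, r, i); rewrite -(sown b x0).
pose T2 := [seq z <- T | `[< in_block z >]].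
have T2P z : z \in T2 -> in_block z by rewrite mem_filter => /andP[/asboolP].
have [bk bkP] : exists bk : G -> G * seq G * seq G * nat, forall z, z \in T2 -> let: (c, Q, r, i) := bk z in
  [/\ c \in Cn, own k D c = Some (Q, r), (i < size r)%N, z \in shiftq (c * nth 1%g r i) Q &
      (tl Q J.+1 <= size r)%N /\ rev Q J b' (i %% tl Q J.+1 %% tl Q J)].
  exists (fun z => if pselect (in_block z) is left h then projT1 (cid h) else (1%g, [::], [::], 0%N)).
  by move=> z /T2P ib; case: pselect => // h; case: cid.
pose cc z := (bk z).1.1.1; pose QQ z := (bk z).1.1.2; pose rr z := (bk z).1.2; pose ii z := (bk z).2.
pose LL z := tl (QQ z) J.+1; pose tt z := (ii z %/ LL z * LL z)%N.
have bP z : z \in T2 -> [/\ cc z \in Cn, own k D (cc z) = Some (QQ z, rr z), (ii z < size (rr z))%N,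
    z \in shiftq (cc z * nth 1%g (rr z) (ii z)) (QQ z) &
    (LL z <= size (rr z))%N /\ rev (QQ z) J b' (ii z %% LL z %% tl (QQ z) J)].
  by move=> /bkP; rewrite /LL /cc /QQ /rr /ii; case: (bk z) => -[[c Q] r] i.
pose key z := (cc z, tt z); pose ks := undup (map key T2).
pose rep s := nth 1%g T2 (index s (map key T2)).
have repP s : s \in ks -> rep s \in T2 /\ key (rep s) = s.
  rewrite mem_undup => sT; rewrite /rep; have := sT; rewrite -index_mem size_map => h.
  by rewrite mem_nth// -[key _](nth_map 1%g s)// nth_index.
pose fp z := footprint S (QQ z) J.+1 (fun j => (cc z * nth 1 (rr z) (tt z + j))%g).
pose con s := [seq ((ii z %% LL z)%N, ((cc z * nth 1 (rr z) (ii z))^-1 * z)%g, om z) | z <- [seq z <- T2 | key z == s]].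
have ttr z : z \in T2 -> (tt z + LL z <= size (rr z))%N.
  move=> zT; have [_ ow ir _ [Lr _]] := bP z zT.
  have L0 : (0 < LL z)%N by exact: tl_pos ow.
  have := mod_index L0 (tl_dvd ow Lr) ir (j := (LL z).-1); rewrite ltn_predL => /(_ L0).
  by rewrite -/(tt z); lia.
have con0 s : s \in ks -> con s != [::].
  move=> /repP[zT /eqP ze]; apply/eqP => /(congr1 size); rewrite size_map.
  have : rep s \in [seq z <- T2 | key z == s] by rewrite mem_filter ze zT.
  by case: [seq z <- T2 | key z == s].
have same_key z z' : z \in T2 -> z' \in T2 -> key z = key z' ->
    [/\ cc z = cc z', QQ z = QQ z', rr z = rr z', LL z = LL z' & tt z = tt z'].
  move=> zT z'T [cE tE]; have [_ ow _ _ _] := bP z zT; have [_ ow' _ _ _] := bP z' z'T.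
  by move: ow'; rewrite -cE ow => -[QE rE]; rewrite /LL QE.
have tr_block s : s \in ks -> exists EE : set (Cfg b) * set (Cfg b'), let z := rep s in
  [/\ depends (fp z) EE.1 /\ depends (fp z) EE.2, Prb b EE.1 <= Prb b' EE.2,
      forall x, avoid b (fp z) x -> (forall s', s' \in con s -> exists a,
        dec (QQ z) J b b' (word (QQ z) (cc z) (rr z) (tt z) x) s'.1.1 a /\ s'.2 = unlett a s'.1.2) -> EE.1 x,
      (forall x, EE.1 x -> avoid b (fp z) x) /\ (forall y, EE.2 y -> avoid b' (fp z) y) &
      forall y, EE.2 y -> forall s', s' \in con s -> (s'.1.1 < LL z)%N ->
        rev (QQ z) J b' (s'.1.1 %% tl (QQ z) J) -> s'.1.2 \in QQ z ->
        y (cc z * nth 1 (rr z) (tt z + s'.1.1) * s'.1.2)%g = s'.2].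
  move=> sk; have [zT _] := repP s sk; have [_ ow _ _ _] := bP _ zT.
  have [E1 [E2 h]] := block_transfer b ow (ttr _ zT) (con0 _ sk).
  by exists (E1, E2).
have [EE EEP] : exists EE : G * nat -> set (Cfg b) * set (Cfg b'), forall s, s \in ks -> let z := rep s in
  [/\ depends (fp z) (EE s).1 /\ depends (fp z) (EE s).2, Prb b (EE s).1 <= Prb b' (EE s).2,
      forall x, avoid b (fp z) x -> (forall s', s' \in con s -> exists a,
        dec (QQ z) J b b' (word (QQ z) (cc z) (rr z) (tt z) x) s'.1.1 a /\ s'.2 = unlett a s'.1.2) -> (EE s).1 x,
      (forall x, (EE s).1 x -> avoid b (fp z) x) /\ (forall y, (EE s).2 y -> avoid b' (fp z) y) &
      forall y, (EE s).2 y -> forall s', s' \in con s -> (s'.1.1 < LL z)%N ->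
        rev (QQ z) J b' (s'.1.1 %% tl (QQ z) J) -> s'.1.2 \in QQ z ->
        y (cc z * nth 1 (rr z) (tt z + s'.1.1) * s'.1.2)%g = s'.2].
  pose d : set (Cfg b) * set (Cfg b') := (set0, set0).
  exists (fun s => if pselect (s \in ks) is left sk then projT1 (cid (tr_block s sk)) else d) => s sk.
  by case: pselect => // sk'; case: cid.
clear tr_block.
pose s0 := (1%g, 0%N) : G * nat; pose m := size ks.
pose Cs i := fp (rep (nth s0 ks i)); pose C := flatten [seq Cs i | i <- iota 0 m].
have nks i : (i < m)%N -> nth s0 ks i \in ks by move=> im; exact: mem_nth.
have isoC i : (i < m)%N -> isolated D (Cs i).
  by move=> /nks/repP[zT _]; have [_ ow _ _ _] := bP _ zT; exact: block_isolated ow (ttr _ zT).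
have isoF : isolated D C.
  by apply: isolated_flatten => c /mapP[i]; rewrite mem_iota => /andP[_ im] ->; exact: isoC.
have haloC : {subset halo C <= W}.
  move=> g hg; apply: mem_catr; apply: mem_catr; apply: halo_sub hg => h.
  move=> /flattenP[c /mapP[i]]; rewrite mem_iota => /andP[_ im] -> /mem_footprint[j jL].
  have [zT _] := repP _ (nks i im); have [cC ow _ _ _] := bP _ zT; set z := rep _ in zT cC ow jL *.
  move=> /mapP[q qQ ->]; rewrite -mulgA; apply/allpairsP.
  exists (cc z, nth 1 (rr z) (tt z + j) * q)%g; split=> //; apply/allpairsP.
  exists (nth 1 (rr z) (tt z + j), q)%g; split=> //.
    apply: (own_entries ow); apply: mem_nth; rewrite (leq_trans _ (ttr z zT))//.
    by rewrite ltn_add2l.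
  by apply/flattenP; exists (QQ z) => //; exact: own_type ow.
have disj i j g : (i < j)%N -> (j < m)%N -> g \in Cs i -> g \notin Cs j.
  move=> ij jm /mem_footprint[u uL gu]; apply/negP => /mem_footprint[v vL gv].
  have im := ltn_trans ij jm; have [zT zE] := repP _ (nks i im); have [yT yE] := repP _ (nks j jm).
  set z := rep _ in zT zE uL gu; set y := rep _ in yT yE vL gv.
  have [_ ow iz _ _] := bP _ zT; have [_ ow' iy _ _] := bP _ yT.
  have b1 : (tt z + u < size (rr z))%N by rewrite (leq_trans _ (ttr z zT))// ltn_add2l.
  have b2 : (tt y + v < size (rr y))%N by rewrite (leq_trans _ (ttr y yT))// ltn_add2l.
  have [cE tE] := own_uniq ow ow' b1 b2 gu gv.
  have QE : QQ z = QQ y by move: ow'; rewrite -cE ow => -[].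
  have LE : LL z = LL y by rewrite /LL QE.
  have L0 : (0 < LL z)%N by exact: tl_pos ow.
  have ttE : tt z = tt y.
    have vL' : (v < LL z)%N by rewrite LE.
    have : ((tt z + u) %/ LL z = (tt y + v) %/ LL z)%N by rewrite tE.
    by rewrite /tt -LE (divnMDl _ _ L0) (divnMDl _ _ L0) (divn_small uL) (divn_small vL') !addn0 => ->.
  have : nth s0 ks i = nth s0 ks j by rewrite -zE -yE /key cE ttE.
  by move/eqP; rewrite (nth_uniq _ im jm (undup_uniq _)) ltn_eqF.
pose Eb i := (EE (nth s0 ks i)).1; pose Eb' i := (EE (nth s0 ks i)).2.
have db i : (i < m)%N -> depends (Cs i) (Eb i) by move=> /nks/EEP[[]].
have db' i : (i < m)%N -> depends (Cs i) (Eb' i) by move=> /nks/EEP[[]].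
have [dB PB] := @Pr_indep_family _ _ S b m Eb Cs db disj.
have [dB' PB'] := @Pr_indep_family _ _ S b' m Eb' Cs db' disj.
(* The pattern is factored out once for the union of all segments, with the same constant on both
   sides; what remains is a product over segments. *)
have [a a0 aE] := cluster_factor isoF haloC.
have av_all x' (x : Cfg x') : avoid x' C x = all (fun i => avoid x' (Cs i) x) (iota 0 m).
  rewrite (@avoid_flatten _ _ _ D) ?all_map// => c /mapP[i]; rewrite mem_iota => /andP[_ im] ->.
  exact: isoC.
have redb : avoids b C `&` [set x | forall i, (i < m)%N -> Eb i x] = [set x | forall i, (i < m)%N -> Eb i x].
  apply/seteqP; split=> x; first by case.
  move=> h; split=> //; rewrite avoidsE av_all; apply/allP => i; rewrite mem_iota => /andP[_ im].
  by have [_ _ _ [hb _] _] := EEP _ (nks i im); apply: hb; exact: h.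
have redb' : avoids b' C `&` [set x | forall i, (i < m)%N -> Eb' i x] = [set x | forall i, (i < m)%N -> Eb' i x].
  apply/seteqP; split=> x; first by case.
  move=> h; split=> //; rewrite avoidsE av_all; apply/allP => i; rewrite mem_iota => /andP[_ im].
  by have [_ _ _ [_ hb] _] := EEP _ (nks i im); apply: hb; exact: h.
have mS x' : measurable (same_pattern x' D W) by exact: same_pattern_measurable.
apply: (@le_trans _ _ (Prb b (same_pattern b D W `&` [set x | forall i, (i < m)%N -> Eb i x]))).
  apply: Pr_le; [exact: measurableI|apply: measurableI => //; exact: (depends_measurable dB)|].
  move=> x [sx Ex]; split=> // i im; have := nks i im; set s := nth s0 ks i => sk.
  have [_ _ h _ _] := EEP _ sk; have [yT yE] := repP _ sk; apply: h.
    have : avoid b C x by exact: same_avoid isoF haloC sx.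
    by rewrite av_all => /allP/(_ i); rewrite mem_iota add0n im; apply.
  move=> s' /mapP[z]; rewrite mem_filter => /andP[/eqP zE zT] ->.
  have [cE QE rE LE tE] := same_key _ _ zT yT (etrans zE (esym yE)).
  have zT0 : z \in T by move: zT; rewrite mem_filter => /andP[].
  have [cC ow ir zi [Lr rv]] := bP _ zT.
  have [[f fF [of_ _]]|[c1 [Q1 [r1 [i1 [a1 [ow1 ir1 zi1 [Lr1 da] oE]]]]]]] := Ex z zT0.
    have [_ _ _ _ iso] := own_ok ow; have := iso _ ir; rewrite -isolated_tr => /isolatedP/(_ _ _ zi fF)[nD _].
    move: nD; rewrite -(sx (z * f^-1)%g) ?of_//; apply: mem_catl.
    by apply/allpairsP; exists (z, f).
  have ow2 := ow; rewrite -(sown b x _ cC sx) in ow2.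
  have [c1E i1E] := own_uniq ow2 ow1 ir ir1 zi zi1.
  move: ow1 ir1 zi1 Lr1 da oE; rewrite -c1E -i1E ow2 => -[Q1E r1E].
  move: a1; rewrite -Q1E -r1E => a1 _ _ _ da oE.
  move: a1 da oE; rewrite -/(LL z) -/(tt z) LE tE QE rE cE => a1 da oE.
  by exists a1; rewrite /= -?rE -?LE -?cE; split; rewrite ?rE ?LE ?cE.
apply: (@le_trans _ _ (Prb b' (same_pattern b' D W `&` [set x | forall i, (i < m)%N -> Eb' i x]))); last first.
  apply: Pr_le; [apply: measurableI => //; exact: (depends_measurable dB')|exact: measurableI|].
  move=> y [sy Ey]; split=> // z zT.
  have [zT2|nz] := boolP (z \in T2); last first.
    have [[f fF [Df ->]]|ib] := cases z zT; last by move: nz; rewrite mem_filter zT andbT; case/asboolP.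
    have of_ : occ b' y (z * f^-1)%g.
      by rewrite sy//; apply: mem_catl; apply/allpairsP; exists (z, f).
    by have /eqP := allP of_ _ fF; rewrite mulgVK.
  have sk : key z \in ks by rewrite mem_undup map_f.
  have [yT yE] := repP _ sk; have [cE QE rE LE tE] := same_key _ _ yT zT2 yE.
  have [cC ow ir zi [Lr rv]] := bP _ zT2.
  have im : (index (key z) ks < m)%N by rewrite index_mem.
  have := Ey _ im; rewrite /Eb' nth_index// => Eyz.
  have [_ _ _ _ h] := EEP _ sk; have L0 : (0 < LL z)%N by exact: tl_pos ow.
  have := h y Eyz ((ii z %% LL z)%N, ((cc z * nth 1 (rr z) (ii z))^-1 * z)%g, om z).
  rewrite cE QE rE LE tE /= -divn_eq mulVKg; apply.
  - by apply/mapP; exists z => //; rewrite mem_filter eqxx.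
  - by rewrite ltn_pmod.
  - exact: rv.
  - by rewrite -mem_shiftq.
rewrite (aE _ _ dB) (aE _ _ dB') redb redb' PB PB'; apply: ler_wpM2l => //.
apply: ler_prod => i _; rewrite Pr_ge0 /=.
by have [_ + _ _ _] := EEP _ (nks i (ltn_ord i)).
Qed.


End Law.

Section Isomorphism.
Context {R : realType} {G : groupType} {dL dK : measure_display}
  {L : measurableType dL} {K : measurableType dK}.

(** Finitariness in combinatorial form: from a point of [X0], each output letter depends, within
    [X0], on finitely many coordinates. Equivariance is required at every point, which makes
    composition easy. *)
Definition half_fiso (lambda : probability L R) (kappa : probability K R)
    (phi : config G L -> config G K) :=
  [/\ measurable_fun setT phi,
      forall B, measurable B ->
        product_probability G lambda (phi @^-1` B) = product_probability G kappa B,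
      forall g x, phi (tr g x) = tr g (phi x) &
      exists X0 : set (config G L), (product_probability G lambda).-negligible (~` X0) /\
        forall x g, X0 x -> exists s : seq G, forall y, X0 y ->
          (forall h, h \in s -> x h = y h) -> phi x g = phi y g].

End Isomorphism.

Definition fiso (R : realType) (G : groupType) (dL dK : measure_display)
    (L : measurableType dL) (K : measurableType dK)
    (lambda : probability L R) (kappa : probability K R) :=
  exists (phi : config G L -> config G K) (psi : config G K -> config G L),
  [/\ half_fiso lambda kappa phi, half_fiso kappa lambda psi,
      (product_probability G lambda).-negligible [set x | psi (phi x) <> x] &
      (product_probability G kappa).-negligible [set y | phi (psi y) <> y]].

(** * The two factor maps invert each other *)

Section Transfer.
Context {R : realType} {G : groupType} (S : pattern_pair R G).
Local Notation n := (psize S).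
Local Notation mu := (pmu S).
Local Notation F := (pshape S).
Local Notation w b := (@pword R G S b).
Local Notation countG := (p_countable S).
Local Notation Cfg b := (config G (letter (n b))).
Local Notation Prb b := (@Pr R G (n b) (mu b)).
Local Notation occ b := (@occ R G S b).
Local Notation avoid b := (@avoid R G S b).
Local Notation hit := (@hit R G S).
Local Notation own := (@owner R G S).
Local Notation tl := (tlen S).
Local Notation word Q := (@block_word R G S _ Q).
Local Notation resolves b b' := (@resolves R G S b b').
Hypothesis islands : forall b, null (mu b) (@island_failure R G S b).

Definition transfer b b' : Cfg b -> Cfg b' := coding (resolves b b').
Arguments transfer : clear implicits.

Lemma transferE b b' x z l : resolves b b' x z l -> transfer b b' x z = l.
Proof. exact: (codingE (@resolves_fun R G S b b')). Qed.

Lemma measurable_transfer b b' : measurable_fun setT (transfer b b').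
Proof.
exact: (measurable_coding countG (@resolves_local R G S b b') (@resolves_fun R G S b b')).
Qed.

HB.instance Definition _ b b' :=
  isMeasurableFun.Build _ _ (Cfg b) (Cfg b') (transfer b b') (@measurable_transfer b b').

Lemma transfer_tr b b' g x : transfer b b' (tr g x) = tr g (transfer b b' x).
Proof.
apply/funext => h; rewrite /transfer /coding [RHS]/tr; congr (xget _ _).
by apply/seteqP; split=> l; [exact: (resolves_tr x g h l).1|exact: (resolves_tr x g h l).2].
Qed.

(** Decoding is required at arbitrarily high levels because the inversion compares a return reading
    with a forward decoding of strictly higher level. *)
Definition regular b b' : set (Cfg b) := [set x | forall z J0, hit (occ b x) z \/
  exists J k, (J0 <= J)%N /\ exists l : letter (n b'), decodes k J x z l].
Arguments regular : clear implicits.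

Lemma regular_null b b' : null (mu b) (~` regular b b').
Proof.
have [code code_inj] := code_exists S.
pose N (t : G * nat) : set (Cfg b) := [set x | forall J k, (t.2 <= J)%N -> undecided b' J k x t.1].
apply: (@null_sub _ _ _ _ _ [set x | exists t, N t x]).
  move=> x nx; apply: contrapT => none; apply: nx => z J0.
  apply: contrapT => /not_orP[nh nd]; apply: none; exists (z, J0) => J k J0J.
  split; first exact/negP.
  by move=> [l d]; apply: nd; exists J, k; split=> //; exists l.
apply: (@null_exists _ _ _ _ _ (fun t => pickle (code t.1, t.2))).
  by move=> [g j] [g' j'] /(pcan_inj pickleK)[/code_inj -> ->].
move=> [g J0]; apply: (@null_sub _ _ _ _ _ [set x | N (1%g, J0) (tr g x)]).
  by move=> x Nx J k J0J; apply/undecided_tr; rewrite mulg1; exact: Nx.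
apply: (null_tr countG); apply: null_eps => e e0.
have [J [k [J0J le]]] := @undecided_vanish _ _ S b b' e J0 (@islands b) e0.
exists [set x | undecided b' J k x 1]; first exact: undecided_measurable.
by split=> // x /(_ J k J0J).
Qed.

Lemma regular_resolves b b' x z : regular b b' x -> exists l, resolves b b' x z l.
Proof.
move=> /(_ z 0%N)[/hasP[f fF Df]|[J [k [_ [l d]]]]].
  by exists (w b' f); left; exists f.
by exists l; right; exists k, J.
Qed.

Lemma transfer_resolves b b' x z : regular b b' x -> resolves b b' x z (transfer b b' x z).
Proof. by move=> /(regular_resolves z)[l rl]; rewrite (transferE rl). Qed.

(** At a suitable level and stage every site of [T] is decided outside an event of small
    probability, and on the decided part [law_bound] applies. *)
Lemma transfer_cylinder b b' (T : seq G) (om : G -> letter (n b')) :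
  Prb b [set x : Cfg b | forall z, z \in T -> transfer b b' x z = om z] <=
  Prb b' [set y : Cfg b' | forall z, z \in T -> y z = om z].
Proof.
set E := [set x | _]; set E' := [set y | _].
have mE : measurable E.
  rewrite (_ : E = transfer b b' @^-1` E')//.
  rewrite -[X in measurable X]setTI; apply: measurable_transfer => //.
  by apply: (@depends_measurable _ _ T) => x y xy Ex z zT; rewrite -xy// Ex.
apply/ler_addgt0Pr => e e0; have e1 : 0 < e / (size T).+1%:R by rewrite divr_gt0.
have [J [k [_ le]]] := @undecided_vanish _ _ S b b' _ 0 (@islands b) e1.
pose U z : set (Cfg b) := [set x | undecided b' J k x z].
pose V : set (Cfg b) := \big[setU/set0]_(z <- T) U z.
have mU z : measurable (U z) by exact: undecided_measurable.
have mV : measurable V by apply: bigsetU_measurable => z _; exact: mU.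
have PU z : Prb b (U z) <= e / (size T).+1%:R.
  rewrite (_ : U z = [set x | U 1%g (tr z x)]).
    by rewrite (Pr_tr countG).
  by apply/seteqP; split=> x; rewrite /U /= undecided_tr mulg1.
have mEV : measurable (E `\` V) by exact: measurableD.
have PV : Prb b (E `&` V) <= e.
  apply: (@le_trans _ _ (\sum_(z <- T) Prb b (U z))).
    apply: Pr_union => //; first exact: measurableI.
    by move=> x [_]; rewrite /V -bigcup_seq => -[z /= zT Ux]; exists z.
  apply: (@le_trans _ _ (\sum_(z <- T) (e / (size T).+1%:R))); first by apply: ler_sum => z _; exact: PU.
  rewrite big_const_seq count_predT iter_addr_0 -(mulr_natl (e / _)) mulrCA.
  by rewrite ler_piMr ?(ltW e0)// ler_pdivrMr// mul1r ler_nat.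
rewrite (_ : E = (E `&` V) `|` (E `\` V)); last by rewrite setUIDK.
rewrite Pr_setU//; [|exact: measurableI|by apply/seteqP; split=> // x [[_ h] [_]]].
rewrite addrC lerD//; apply: le_trans (@law_bound R G S b b' T om k J).
apply: Pr_le => //.
  rewrite (_ : [set x | _] = \big[setI/setT]_(z <- T) [set x : Cfg b |
      (exists2 f, f \in F & occ b x (z * f^-1)%g /\ om z = w b' f) \/ decodes k J x z (om z)]).
    apply: (@bigsetI_measurable _ (Cfg b)) => z _.
    apply: (open_measurable_config countG) => x [[f fF [of_ ee]]|/decodes_local[s h]].
      exists [seq (z * f^-1 * f')%g | f' <- F] => y xy; left; exists f => //; split=> //.
      by rewrite -(@occ_local R G S b x y)// => f' f'F; apply: xy; apply/mapP; exists f'.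
    by exists s => y /h d; right.
  elim: (T) => [|z s ih]; first by rewrite big_nil; apply/seteqP; split.
  rewrite big_cons -ih; apply/seteqP; split=> x /=.
    by move=> h; split=> [|z' z's]; apply: h; rewrite inE ?eqxx ?z's ?orbT.
  by move=> [h1 h2] z'; rewrite inE => /predU1P[->|/h2].
move=> x [Ex nV] z zT; have [/hasP[f fF Df]|nh] := boolP (hit (occ b x) z).
  left; exists f => //; split=> //; rewrite -Ex//; apply: transferE.
  by left; exists f.
right; have [[l d]|nd] := pselect (exists l : letter (n b'), decodes k J x z l).
  have <- : l = om z by rewrite -Ex//; apply/esym/transferE; right; exists k, J.
  exact: d.
by exfalso; apply: nV; rewrite /V -bigcup_seq; exists z.
Qed.

(** Domination of cylinders sums to domination of all events on the window; used for the complement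
    as well, it becomes equality. *)
Lemma transfer_window b b' (T : seq G) (E' : set (Cfg b')) : depends T E' ->
  Prb b (transfer b b' @^-1` E') = Prb b' E'.
Proof.
move=> dE; pose V := undup T; have uV : uniq V by exact: undup_uniq.
have le (D : set (Cfg b')) : depends V D -> Prb b (transfer b b' @^-1` D) <= Prb b' D.
  move=> dD; have mD := depends_measurable dD.
  pose f (y : Cfg b') : {ffun 'I_(size V) -> letter (n b')} := [ffun i : 'I_(size V) => y (nth 1%g V i)].
  pose om (t : {ffun 'I_(size V) -> letter (n b')}) z := if insub (index z V) is Some i then t i else ord0.
  have fE t : [set y | f y = t] = [set y | forall z, z \in V -> y z = om t z].
    apply/seteqP; split=> y /=.
      move=> <- z zV; rewrite /om; case: insubP => [i _ iE|]; last by rewrite index_mem zV.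
      by rewrite ffunE iE nth_index.
    move=> yt; apply/ffunP => i; rewrite ffunE yt ?mem_nth// /om index_uniq//.
    by rewrite insubT//= => ii; congr (t _); exact: val_inj.
  have df t : depends V [set y | f y = t].
    by rewrite fE => x y xy h z zV; rewrite -xy// h.
  have mf t := depends_measurable (df t).
  have mpre (B : set (Cfg b')) : measurable B -> measurable (transfer b b' @^-1` B).
    by move=> mB; rewrite -[X in measurable X]setTI; exact: measurable_transfer.
  rewrite (@Pr_partition_fin _ _ S b' _ f D)//.
  rewrite (@Pr_partition_fin _ _ S b _ (f \o transfer b b') (transfer b b' @^-1` D)); first last.
  - by move=> t; exact: (mpre _ (mf t)).
  - exact: mpre.
  apply: ler_sum => t _; have [[y0 [Dy0 y0t]]|none] := pselect (exists y, D y /\ f y = t); last first.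
    rewrite [X in Prb b X](_ : _ = set0) ?Pr_set0 ?Pr_ge0//.
    by apply/seteqP; split=> // x [Dx xt]; apply: none; exists (transfer b b' x).
  have -> : D `&` [set y | f y = t] = [set y | f y = t].
    apply/seteqP; split=> y; first by case.
    move=> yt; split=> //; apply: dD Dy0 => z zV.
    have h1 : [set y | f y = t] y0 by []. have h2 : [set y | f y = t] y by [].
    by move: h1 h2; rewrite fE => h1 h2; rewrite h1// h2.
  apply: (@le_trans _ _ (Prb b (transfer b b' @^-1` [set y | f y = t]))).
    apply: Pr_le; [by apply: measurableI; [exact: mpre|exact: (mpre _ (mf t))]|exact: mpre|].
    by move=> x [].
  by rewrite fE; exact: transfer_cylinder.
have dV : depends V E' by apply: depends_sub dE => z; rewrite mem_undup.
have mE := depends_measurable dV.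
have mpre : measurable (transfer b b' @^-1` E').
  by rewrite -[X in measurable X]setTI; exact: measurable_transfer.
apply/eqP; rewrite eq_le le//=.
have := le _ (dependsC dV); rewrite preimage_setC !Pr_setC// lerD2l lerN2.
exact.
Qed.

Lemma transfer_measure b b' (B : set (Cfg b')) : measurable B ->
  product_probability G (mu b) (transfer b b' @^-1` B) = product_probability G (mu b') B.
Proof.
move=> mB; have PP := product_probabilityP (mu b') countG (letter_finite _) (fun=> I).
apply: (@product_probability_unique _ _ _ _ (mu b')
  (distribution (product_probability G (mu b)) (transfer b b' : {mfun Cfg b >-> Cfg b'}))
  (product_probability G (mu b')) _ PP B mB).
move=> s A us mA; rewrite -(PP s A us mA) /distribution /pushforward.
set D := [set x | _]; have dD : depends s D.
  by move=> x y xy Dx i si; rewrite -xy//; exact: Dx.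
have mD := depends_measurable dD.
have mpre : measurable (transfer b b' @^-1` D).
  by rewrite -[X in measurable X]setTI; exact: measurable_transfer.
transitivity (Prb b (transfer b b' @^-1` D))%:E; first exact: (Pr_EFin (mu b) mpre).
by rewrite (@transfer_window b b' s D dD) -Pr_EFin.
Qed.

Lemma block_letters b b' (x : Cfg b) k J c Q r i a : regular b b' x ->
  own k (occ b x) c = Some (Q, r) -> (i < size r)%N ->
  @block_decodes R G S b b' Q c r i J x a ->
  lett Q (tr (c * nth 1%g r i)%g (transfer b b' x)) = a.
Proof.
move=> reg owc ir bd; have [uQ _ _ _ _] := own_ok owc.
rewrite -[RHS](unlettK a uQ); apply/lett_eq => q qQ; apply: transferE; right; exists k, J.
exists c, Q, r, i, a; split=> //; first by apply/mapP; exists q.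
by rewrite mulKg.
Qed.

(** Occurrences are copied. A new one could only use uncovered sites, hence by isolation it would
    lie inside one cluster; but the filling decoded there has positive mass under [alpha], so it
    avoids the word. *)
Lemma transfer_occ b b' (x : Cfg b) : regular b b' x -> occ b' (transfer b b' x) = occ b x.
Proof.
move=> reg; apply/funext => g; apply/idP/idP; last first.
  move=> og; apply/allP => f fF; apply/eqP/transferE; left; exists f => //.
  by rewrite mulgK.
move=> og; apply: contraT => ng.
have og_hit h : occ b x h -> occ b' (transfer b b' x) h.
  move=> oh; apply/allP => f fF; apply/eqP/transferE; left; exists f => //.
  by rewrite mulgK.
have nohit f : f \in F -> ~~ hit (occ b x) (g * f)%g.
  move=> fF; apply/negP => /hasP[f' f'F oh].
  have [ge|ne] := eqVneq g (g * f * f'^-1)%g; first by rewrite -ge (negbTE ng) in oh.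
  by have := occ_disjoint og (og_hit _ oh) ne fF f'F; rewrite mulgVK eqxx.
have [|[J [k [_ [l [c [Q [r [i [a [owc ir gi bd le]]]]]]]]]]] := reg g 0%N.
  by have := nohit _ (pshape1 S); rewrite mulg1 => /negbTE ->.
have [uQ _ _ _ iso] := own_ok owc; have Q0 := own_nonempty owc.
have := iso _ ir; rewrite -isolated_tr => /isolatedP/(_ _ _ gi (pshape1 S)).
rewrite invg1 mulg1 => -[_ [ins|[f fF hf]]]; last by rewrite (negbTE (nohit _ fF)) in hf.
have la := block_letters reg owc ir bd; have [_ da] := bd.
have apos := dec_pos (fun b => alpha_pmf S b uQ) (ent_alpha_gt0 S true uQ Q0) (ent_alpha_eq S uQ) da.
have := alpha_avoid uQ apos; rewrite -la avoid_lett -avoid_shift => /allP/(_ g).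
by rewrite mem_sites => /(_ ins); rewrite og.
Qed.

(** If the letter is returned at level [J], regularity provides a forward decoding of the same site
    at a level above [J], and [dec_inverse] identifies the returned letter with the original one. *)
Lemma transferK b b' (x : Cfg b) : regular b b' x -> regular b' b (transfer b b' x) ->
  transfer b' b (transfer b b' x) = x.
Proof.
move=> reg reg'; have oE := transfer_occ reg; apply/funext => z; apply: transferE.
have [[f fF [of_ lE]]|[k [J d]]] := transfer_resolves z reg'.
  left; exists f => //; split=> //; rewrite oE in of_.
  by have /eqP := allP of_ _ fF; rewrite mulgVK.
have [|[J' [k' [JJ [l' d']]]]] := reg z J.+1.
  by have := decodes_unhit d; rewrite oE => /negbTE ->.
right; exists k, J; suff <- : transfer b' b (transfer b b' x) z = x z by [].
have d1 := decodes_mono (leq_maxl k k') d; have d2 := decodes_mono (leq_maxr k k') d'.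
set K := maxn k k' in d1 d2; set y := transfer b b' x in d1 d oE reg' *.
have [c [Q [r [i [a [owc ir zi [Lr da] lE]]]]]] := d1.
have [c' [Q' [r' [i' [a' [ow' ir' zi' [Lr' da'] lE']]]]]] := d2.
rewrite oE in owc; have [cE iE] := own_uniq owc ow' ir ir' zi zi'.
move: ow' ir' zi' Lr' da' lE'; rewrite -cE -iE owc => -[QE rE].
move: a'; rewrite -QE -rE => a' _ _ Lr' da' _.
have [uQ _ _ _ _] := own_ok owc; have Q0 := own_nonempty owc.
have hpmf := fun b => alpha_pmf S b uQ; have hpos := ent_alpha_gt0 S true uQ Q0.
have heq := ent_alpha_eq S uQ; have L0 := tl_pos J.+1 owc; have L0' := tl_pos J'.+1 owc.
have LL : (tl Q J.+1 %| tl Q J'.+1)%N by apply: len_dvd; rewrite ltnS ltnW.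
have dL' := tl_dvd owc Lr'.
set L := tl Q J.+1 in Lr da L0 LL *; set L' := tl Q J'.+1 in Lr' da' L0' LL dL' *.
pose t := (i %% L' %/ L)%N.
have tE : (i %% L' = t * L + i %% L)%N by rewrite /t -(modn_dvdm i LL) -divn_eq.
have iLE : (i %/ L * L = i %/ L' * L' + t * L)%N.
  have := divn_eq i L; rewrite {1}(divn_eq i L') tE addnA => /eqP; rewrite eqn_add2r.
  by move=> /eqP ->.
have tL : (t.+1 * L <= L')%N.
  have := ltn_pmod i L0'; rewrite {1}tE; case/dvdnP: LL => q ->.
  have t1 : (t * L <= t * L + i %% L)%N by rewrite leq_addr.
  by move=> /(leq_ltn_trans t1); rewrite ltn_pmul2r// => tq; rewrite leq_mul2r tq orbT.
have [gv' _ _ _] := da'.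
have wP j a1 : @dec R _ (@alpha R G S Q) (letter0 S Q) J' b b' (word Q c r (i %/ L' * L') x) j a1 ->
    word Q c r (i %/ L' * L') y j = a1.
  move=> dj; have [_ jL _ _] := dj.
  have jr : (i %/ L' * L' + j < size r)%N by exact: mod_index.
  have bd : @block_decodes R G S b b' Q c r (i %/ L' * L' + j) J' x a1.
    split; first exact: Lr'.
    by rewrite -/L' (divnMDl _ _ L0') (divn_small jL) addn0 modnMDl (modn_small jL).
  exact: (block_letters reg owc jr bd).
have da2 : @dec R _ (@alpha R G S Q) (letter0 S Q) J b' b
    (fun i0 => word Q c r (i %/ L' * L') y (t * L + i0)%N) (i %% L) a.
  by apply: eq_dec da => j jL; rewrite /block_word iLE addnA.
have := dec_inverse hpmf hpos heq JJ tL gv' wP da2; rewrite -tE /block_word -divn_eq => xa.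
rewrite (transferE (l := unlett a ((c * nth 1%g r i)^-1 * z)%g)); last first.
  by right; exists K, J; exists c, Q, r, i, a; rewrite oE; split.
rewrite -xa lettK; last by rewrite -mem_shiftq.
by rewrite /tr mulVKg.
Qed.

Lemma transfer_half b b' : half_fiso (mu b) (mu b') (transfer b b').
Proof.
split; [exact: measurable_transfer|exact: transfer_measure|exact: transfer_tr|].
exists (regular b b'); split; first exact: regular_null.
move=> x g /(regular_resolves g)[l rl]; have [s h] := resolves_local rl.
by exists s => y _ xy; rewrite (transferE rl) (transferE (h y xy)).
Qed.

Lemma transferK_null b b' : null (mu b) [set x | transfer b' b (transfer b b' x) <> x].
Proof.
apply: (@null_sub _ _ _ _ _ (~` regular b b' `|` transfer b b' @^-1` (~` regular b' b))).
  move=> x; apply: contra_notP => /not_orP[/contrapT h1 /contrapT h2]; exact: transferK.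
apply: negligibleU; first exact: regular_null.
have [B [mB B0 NB]] := @regular_null b' b; exists (transfer b b' @^-1` B); split.
- by rewrite -[X in measurable X]setTI; exact: measurable_transfer.
- exact: (etrans (@transfer_measure b b' B mB) B0).
- by move=> x; exact: NB.
Qed.

Lemma pattern_fiso : @fiso R G _ _ _ _ (mu true) (mu false).
Proof.
exists (transfer true false), (transfer false true).
by split; [exact: transfer_half|exact: transfer_half|exact: transferK_null|exact: transferK_null].
Qed.

End Transfer.

(** * Shapes with finite clusters *)

Section Islands.
Context {R : realType} {G : groupType}.
Implicit Types (F Hs : seq G) (t g h z : G).

(** Two ways to confine clusters: all sites reached from the identity by moving within placements
    stay in a finite set, or the shape lies along an infinite cyclic group, where occurrences on
    either side cut the line. *)
Definition insular F := (exists Hs, 1%g \in Hs /\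
    forall h f f', h \in Hs -> f \in F -> f' \in F -> (h * f^-1 * f')%g \in Hs) \/
  (exists t, (forall m, (0 < m)%N -> (t ^+ m)%g != 1%g) /\ F = [:: 1%g; t; (t ^+ 2)%g]).

Context (S : pattern_pair R G).
Local Notation F := (pshape S).
Local Notation hit := (@hit R G S).
Local Notation isolated := (@isolated R G S).
Local Notation n := (psize S).
Local Notation mu := (pmu S).
Local Notation countG := (p_countable S).
Local Notation Cfg b := (config G (letter (n b))).
Local Notation Prb b := (@Pr R G (n b) (mu b)).
Local Notation occ b := (@occ R G S b).
Local Notation occ_at b := (@occ_at R G S b).

Lemma island_in (D : G -> bool) Hs : 1%g \in Hs -> ~~ hit D 1 ->
  (forall z f, z \in Hs -> ~~ hit D z -> f \in F ->
    (forall f', f' \in F -> ~~ hit D (z * f^-1 * f')) -> forall f', f' \in F -> (z * f^-1 * f')%g \in Hs) ->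
  exists Q, 1%g \in Q /\ isolated D Q.
Proof.
move=> H1 nh closed; exists [seq h <- Hs | ~~ hit D h]; rewrite mem_filter nh H1; split=> //.
apply/isolatedP => z f; rewrite mem_filter => /andP[nz zH] fF; split; first exact: (hasPn nz).
have [/hasP[f' f'F h]|/hasPn none] := boolP (has (fun f' => hit D (z * f^-1 * f')) F).
  by right; exists f'.
left; apply/allP => f' f'F; rewrite mem_filter none//=.
exact: closed.
Qed.

(** The placements are pairwise disjoint, so these are independent trials of fixed positive
    probability. *)
Lemma never_null b (g : nat -> G) :
  (forall i j f f', f \in F -> f' \in F -> (g i * f = g j * f')%g -> i = j) ->
  null (mu b) [set x : Cfg b | forall i, ~~ occ b x (g i)].
Proof.
move=> inj; pose Cs i := @cover R G S [:: g i]; pose E i : set (Cfg b) := ~` occ_at b [:: g i].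
have dE i : depends (Cs i) (E i) by apply: dependsC; exact: occ_at_depends.
have disj i j h : (i < j)%N -> h \in Cs i -> h \notin Cs j.
  move=> ij /allpairsP[[u f] [/= + fF ->]]; rewrite inE => /eqP ->.
  apply/negP => /allpairsP[[v f'] [/= + f'F e]]; rewrite inE => /eqP vE; rewrite vE in e.
  by have := inj _ _ _ _ fF f'F e; move: ij => /[swap] ->; rewrite ltnn.
have d0 := dens_gt0 S b; have d1 := dens_lt1 S b.
apply: null_eps => e e0.
have [m me] : exists m, (1 - dens S b) ^+ m <= e.
  (* Bernoulli's inequality in the form $(1-d)^m(1+md)\le 1$. *)
  have bern m : (1 - dens S b) ^+ m * (1 + m%:R * dens S b) <= 1.
    elim: m => [|m ih]; first by rewrite expr0 mul0r addr0 mul1r.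
    apply: le_trans ih; rewrite exprSr -mulrA; apply: ler_wpM2l; first by rewrite exprn_ge0// subr_ge0 ltW.
    have m0 : 0 <= m%:R * dens S b ^+ 2 by rewrite mulr_ge0// sqr_ge0.
    rewrite -natr1; move: (m%:R) (dens S b) d0 m0; clear => u v; nra.
  exists (Num.truncn (e^-1 / dens S b)).+1; set m := _.+1.
  have me : e^-1 <= 1 + m%:R * dens S b.
    apply: (@le_trans _ _ (m%:R * dens S b)); last by rewrite lerDr.
    by rewrite -ler_pdivrMr// ltW// /m truncnS_gt.
  have x0 : 0 <= (1 - dens S b) ^+ m by rewrite exprn_ge0// subr_ge0 ltW.
  have := le_trans (ler_wpM2l x0 me) (bern m).
  by rewrite ler_pdivrMr// mul1r.
have [dA PA] := @Pr_indep_family _ _ S b m E Cs (fun i _ => dE i) (fun i j h ij _ => disj i j h ij).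
exists [set x | forall i, (i < m)%N -> E i x]; first exact: (depends_measurable dA).
split; first by move=> x nx i _ /andP[oi _]; have := nx i; rewrite oi.
rewrite PA (eq_bigr (fun=> 1 - dens S b)) ?prodr_const ?card_ord// => i _.
rewrite /E Pr_setC ?Pr_occ1//; exact: (depends_measurable (@occ_at_depends R G S b [:: g i])).
Qed.

Lemma insular_null b : insular F -> null (mu b) (@island_failure R G S b).
Proof.
move=> [[Hs [H1 closed]]|[t [tinf FE]]].
  apply: (@null_sub _ _ _ _ _ set0); last exact: negligible_set0.
  move=> x [nh none]; have [|Q [Q1 iQ]] := @island_in (occ b x) Hs H1 nh.
    by move=> z f zH _ fF _ f' f'F; exact: closed.
  by have := none Q Q1; rewrite iQ.
have texp m m' : (t ^+ m = t ^+ m')%g -> m = m'.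
  wlog mm : m m' / (m <= m')%N.
    by move=> wl e; have [/wl|/ltnW/wl] := leqP m m'; [exact|move=> h; apply/esym/h].
  move=> e; apply/eqP; rewrite eqn_leq mm -subn_eq0 -leqn0 leqNgt; apply/negP.
  rewrite -subn_gt0 subn0 => /tinf/eqP; apply; apply: (@mulgI _ (t ^+ m)%g).
  by rewrite -expgnDr subnKC// mulg1.
have Fexp f : f \in F -> exists2 a, (a <= 2)%N & f = (t ^+ a)%g.
  rewrite FE !inE => /or3P[] /eqP ->; [by exists 0%N|by exists 1%N|by exists 2].
have expF a : (a <= 2)%N -> (t ^+ a)%g \in F.
  by rewrite FE !inE; case: a => [|[|[|]]]// _; rewrite ?eqxx ?orbT.
(* Exponents spaced by 3 make the translates of [[1, t, t ^+ 2]] disjoint. *)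
have n1 : null (mu b) [set x : Cfg b | forall i, ~~ occ b x (t ^+ (3 * i.+1))%g].
  apply: never_null => i j f f' /Fexp[a a2 ->] /Fexp[c c2 ->].
  by rewrite -!expgnDr => /texp; lia.
have n2 : null (mu b) [set x : Cfg b | forall i, ~~ occ b x (t ^+ (3 * i.+1))^-1%g].
  apply: never_null => i j f f' /Fexp[a a2 ->] /Fexp[c c2 ->] e.
  have : (t ^+ (3 * j.+1) * t ^+ a = t ^+ (3 * i.+1) * t ^+ c)%g.
    apply: (@mulgI _ (t ^+ (3 * i.+1))^-1%g); rewrite mulKg mulgA.
    have -> : ((t ^+ (3 * i.+1))^-1 * t ^+ (3 * j.+1) = t ^+ (3 * j.+1) * (t ^+ (3 * i.+1))^-1)%g.
      apply: (@mulgI _ (t ^+ (3 * i.+1))%g); rewrite mulVKg mulgA -expgnDr addnC expgnDr mulgK//.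
    by rewrite -mulgA e mulVKg.
  by rewrite -!expgnDr => /texp; lia.
apply: null_sub (negligibleU n1 n2) => x; apply: contraPP => /not_orP[m1 m2] [nh none].
have [i oi] : exists i, occ b x (t ^+ (3 * i.+1))%g.
  by apply: contrapT => no; apply: m1 => i; apply/negP => h; apply: no; exists i.
have [j oj] : exists j, occ b x (t ^+ (3 * j.+1))^-1%g.
  by apply: contrapT => no; apply: m2 => j; apply/negP => h; apply: no; exists j.
set A := (3 * j.+1)%N in oj; set B := (3 * i.+1)%N in oi; set p := (t ^+ A)^-1%g in oj.
have hitL m : (m <= 2)%N -> hit (occ b x) (p * t ^+ m).
  by move=> m2'; apply/hasP; exists (t ^+ m)%g; rewrite ?expF// mulgK.
have hitR : hit (occ b x) (p * t ^+ (A + B)).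
  by apply/hasP; exists 1%g; rewrite ?pshape1// invg1 mulg1 expgnDr mulKg.
(* The island consists of the uncovered points between the occurrences at [p] and at
   [p * t ^+ (A + B)]; the identity has exponent [A]. A placement leaving this range would meet a
   covered point, which the closure condition excludes. *)
have [||Q [Q1 iQ]] := @island_in (occ b x) [seq (p * t ^+ m)%g | m <- iota 0 (A + B)] _ nh.
- apply/mapP; exists A; rewrite ?mulVg// mem_iota /B; lia.
- move=> z f /mapP[m]; rewrite mem_iota add0n => /andP[_ mAB] -> nz /Fexp[a a2 ->] nhits.
  have m3 : (3 <= m)%N by rewrite leqNgt; apply/negP => m3; rewrite hitL in nz.
  have zE c : (p * t ^+ m * (t ^+ a)^-1 * t ^+ c = p * t ^+ (m - a + c))%g.
    by rewrite -{1}(subnK (leq_trans a2 (ltnW m3))) expgnDr mulgA mulgK expgnDr mulgA.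
  have bound : (m - a + 2 < A + B)%N.
    rewrite ltnNge; apply/negP => big; have := nhits _ (expF (A + B - (m - a))%N _).
    by rewrite zE subnKC ?hitR; lia.
  move=> f' /Fexp[c c2 ->]; rewrite zE; apply: (map_f (fun m => p * t ^+ m)%g).
  rewrite mem_iota; lia.
by have := none Q Q1; rewrite iQ.
Qed.

End Islands.

(** The condition on quotients will separate any word with one special letter at 1, and three
    elements are needed for the exponent [k.+2] of [two_letter_weights]. If all squares are trivial
    the group is abelian and contains a Klein four-group; otherwise any [t] with a nontrivial square
    works, of finite order or not. *)
Lemma shape_exists (G : groupType) : infinite_set [set: G] -> exists F : seq G,
  [/\ uniq F, 1%g \in F, (3 <= size F)%N,
      forall f f', f \in F -> f' \in F -> (f' * f^-1)%g \in F \/ (f * f'^-1)%g \in F & insular F].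
Proof.
move=> infG; have fresh (s : seq G) : exists g, g \notin s.
  apply: contrapT => h; apply: infG; apply: (sub_finite_set _ (finite_seq s)) => g _ /=.
  by apply: contrapT => gs; apply: h; exists g; apply/negP.
have [[t t2]|no] := pselect (exists t : G, (t ^+ 2)%g != 1%g).
  have t1 : t != 1%g by apply: contraNneq t2 => ->; rewrite expg1n.
  have tt2 : t != (t ^+ 2)%g.
    by apply: contra t1 => /eqP e; apply/eqP/(@mulgI _ t); rewrite mulg1 -expg2 -e.
  exists [:: 1%g; t; (t ^+ 2)%g]; split=> //=.
  - by rewrite !inE negb_or eq_sym t1 eq_sym t2 tt2.
  - by rewrite mem_head.
  - move=> f f'; have e : (t ^+ 2 * t^-1 = t)%g by rewrite expg2 mulgK.
    by rewrite !inE => /or3P[] /eqP-> /or3P[] /eqP->;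
      rewrite ?mulgV ?invg1 ?mulg1 ?mul1g ?e ?eqxx ?orbT; auto.
  have [[m [m0 tm]]|inf] := pselect (exists m, (0 < m)%N /\ (t ^+ m)%g = 1%g); last first.
    right; exists t; split=> // m m0; apply/eqP => e; apply: inf; by exists m.
  left; exists [seq (t ^+ i)%g | i <- iota 0 m].
  have mem i : (t ^+ i)%g \in [seq (t ^+ i)%g | i <- iota 0 m].
    have -> : (t ^+ i = t ^+ (i %% m))%g.
      by rewrite {1}(divn_eq i m) expgnDr mulnC expgnA tm expg1n mul1g.
    by apply: map_f; rewrite mem_iota ltn_pmod.
  split; first by rewrite -(expg0 t) mem.
  have inv a : ((t ^+ a)^-1 = t ^+ (a * m.-1))%g.
    apply: (@mulgI _ (t ^+ a)%g); rewrite mulgV -expgnDr -mulnS prednK// mulnC expgnA tm.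
    by rewrite expg1n.
  have Fexp f : f \in [:: 1%g; t; (t ^+ 2)%g] -> exists a, f = (t ^+ a)%g.
    rewrite !inE => /or3P[] /eqP ->; [by exists 0%N|by exists 1%N|by exists 2].
  move=> h f f' /mapP[i _ ->] /Fexp[a ->] /Fexp[c ->].
  by rewrite inv -!expgnDr.
have sq (t : G) : (t * t = 1)%g.
  by apply/eqP; rewrite -expg2; apply: contrapT => /negP h; apply: no; exists t.
have inv (t : G) : (t^-1 = t)%g by apply: (@mulgI _ t); rewrite mulgV sq.
have comm (a b : G) : (a * b = b * a)%g.
  by apply: (@mulgI _ (a * b)%g); rewrite sq mulgA -[(a * b * b)%g]mulgA sq mulg1 sq.
have [a na] := fresh [:: 1%g]; have [b nb] := fresh [:: 1%g; a].
rewrite !inE in na nb; have [b1 ba] := norP nb.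
pose F := [:: 1%g; a; b; (a * b)%g].
have mulF f f' : f \in F -> f' \in F -> (f * f')%g \in F.
  have e1 : (b * a = a * b)%g by exact: comm.
  have e2 : (a * (a * b) = b)%g by rewrite mulgA sq mul1g.
  have e3 : (b * (a * b) = a)%g by rewrite [(a * b)%g]comm mulgA sq mul1g.
  have e4 : (a * b * a = b)%g by rewrite -mulgA e1 e2.
  have e5 : (a * b * b = a)%g by rewrite -mulgA sq mulg1.
  by rewrite !inE => /or4P[] /eqP-> /or4P[] /eqP->;
    rewrite ?mul1g ?mulg1 ?sq ?e1 ?e2 ?e3 ?e4 ?e5 ?eqxx ?orbT.
exists F; split=> //=.
- rewrite !inE !negb_or; apply/and4P; split.
  + rewrite eq_sym na eq_sym b1 /=; apply: contra ba => /eqP e.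
    by apply/eqP/(@mulgI _ a); rewrite sq -e.
  + rewrite eq_sym ba /=; apply: contra b1 => /eqP e; apply/eqP/(@mulgI _ a).
    by rewrite mulg1 -e.
  + apply: contra na => /eqP e; apply/eqP/(@mulIg _ b); by rewrite mul1g -e.
  + by [].
- by rewrite mem_head.
- by move=> f f' fF f'F; left; rewrite inv mulF.
left; exists F; split; first exact: mem_head.
by move=> h f f' hF fF f'F; rewrite inv !mulF.
Qed.

(** * Intermediate alphabets *)

Section Entropy.
Import numFieldNormedType.Exports.
Context {R : realType}.
Implicit Types (x y a b s r u E : R) (ws : seq R).

Definition eta x : R := - (x * ln x).

Definition sent ws : R := \sum_(v <- ws) eta v.

Lemma ln_tangent x y : 0 < x -> 0 < y -> ln y - ln x <= y / x - 1.
Proof.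
move=> x0 y0; rewrite -ln_div ?posrE//.
have := @le_ln1Dx R (y / x - 1); rewrite addrCA subrr addr0; apply.
by rewrite ltrBrDr addrC subrr divr_gt0.
Qed.

Lemma eta_tangent x y : 0 < x -> 0 < y -> eta x <= eta y + (- ln y - 1) * (x - y).
Proof.
move=> x0 y0; have := ler_wpM2l (ltW x0) (ln_tangent x0 y0).
rewrite !mulrBr mulrCA divff ?gt_eqF// !mulr1 /eta; lra.
Qed.

Lemma eta_ge0 x : 0 < x -> x <= 1 -> 0 <= eta x.
Proof. by move=> x0 x1; rewrite /eta oppr_ge0 pmulr_rle0// ln_le0. Qed.

Lemma eta_add x y : 0 < x -> 0 < y -> eta (x + y) <= eta x + eta y.
Proof.
move=> x0 y0; have h1 : ln x <= ln (x + y) by rewrite ler_ln ?posrE ?addr_gt0// lerDl ltW.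
have h2 : ln y <= ln (x + y) by rewrite ler_ln ?posrE ?addr_gt0// lerDr ltW.
have := ler_wpM2l (ltW x0) h1; have := ler_wpM2l (ltW y0) h2; rewrite /eta; nra.
Qed.

Lemma sum_pos v ws : all (fun x => 0 < x) (v :: ws) -> 0 < \sum_(x <- v :: ws) x.
Proof.
move=> /andP[v0 /allP w0]; rewrite big_cons ltr_pwDl// big_seq sumr_ge0// => x /w0.
exact: ltW.
Qed.

Lemma eta_sum v ws : all (fun x => 0 < x) (v :: ws) -> eta (\sum_(x <- v :: ws) x) <= sent (v :: ws).
Proof.
elim: ws v => [|u ws ih] v; first by rewrite /sent !big_seq1.
move=> /andP[v0 h]; rewrite /sent [X in eta X]big_cons [leRHS]big_cons.
apply: le_trans (eta_add v0 (sum_pos h)) _.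
by rewrite lerD2l; exact: ih.
Qed.

(** From $-q\ln q\le 1-q$ at $q=\sqrt x$. *)
Lemma eta_sqr x (e : R) : 0 < x -> 0 < e -> x <= e ^+ 2 -> eta x <= 2 * e.
Proof.
move=> x0 e0 xe; have e20 : 0 < e ^+ 2 by rewrite exprn_gt0.
pose q := Num.sqrt x; have q0 : 0 < q by rewrite sqrtr_gt0.
have qx : q * q = x by rewrite -expr2 sqr_sqrtr// ltW.
have qe : q <= e.
  rewrite leNgt; apply/negP => eq; have : e * e < q * q by apply: ltr_pM => //; exact: ltW.
  by rewrite qx -expr2 ltNge xe.
have := ler_wpM2l (ltW q0) (ln_tangent q0 ltr01); rewrite ln1 sub0r mulrBr mulrCA mul1r divff ?gt_eqF// mulr1.
rewrite /eta -qx lnM ?posrE//; move: q q0 qe {qx}; clear => q; move: (ln q) => l; nra.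
Qed.

(** Concavity through the tangents at [y] and [s - y]; the last term measures the entropy gained
    when a pair of fixed sum is made more equal. *)
Lemma pair_gap a y s : 0 < a -> a <= y -> y <= s - y ->
  eta a + eta (s - a) <= eta y + eta (s - y) - (y - a) * (ln (s - y) - ln y).
Proof.
move=> a0 ay ys; have y0 : 0 < y by lra.
have s0 : 0 < s - y by lra.
have sa0 : 0 < s - a by lra.
have := eta_tangent a0 y0; have := eta_tangent sa0 s0; nra.
Qed.

Lemma pair_le a y s : 0 < a -> a <= y -> y <= s - a -> eta a + eta (s - a) <= eta y + eta (s - y).
Proof.
move=> a0 ay ys; have key z : a <= z -> z <= s - z -> eta a + eta (s - a) <= eta z + eta (s - z).
  move=> az zs; apply: le_trans (pair_gap a0 az zs) _; rewrite gerBl mulr_ge0 ?subr_ge0//.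
  by rewrite ler_ln ?posrE; lra.
have [h|h] := leP y (s - y); first exact: key.
have := key (s - y); rewrite opprB addrCA subrr addr0 [eta (s - y) + _]addrC; apply; lra.
Qed.

Lemma eta_cvg (h : R -> R) u : 0 < h u -> h v @[v --> u] --> h u -> eta (h v) @[v --> u] --> eta (h u).
Proof.
move=> hu ch; apply: cvgN; apply: cvgM => //.
by apply: cvg_comp ch _; exact: continuous_ln.
Qed.

(** Use [N] pieces of size [u] and one of size [r - N * u]. The entropy varies continuously from
    nearly [eta r] for small [u] to that of the equal division, which is at least [E] once
    [ln (N + 1) >= E / r]. *)
Lemma split_mass r E : 0 < r -> r <= 1 -> eta r <= E -> exists ws,
  [/\ ws != [::], all (fun x => 0 < x) ws, \sum_(x <- ws) x = r & sent ws = E].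
Proof.
move=> r0 r1; rewrite le_eqVlt => /predU1P[<-|rE].
  by exists [:: r]; rewrite /= r0 /sent !big_seq1.
have E0 : 0 <= E by rewrite (le_trans (eta_ge0 r0 r1))// ltW.
pose n := (Num.truncn (expR (E / r))).+1; pose N : R := n%:R.
have N0 : 0 < N by rewrite ltr0n.
have NE : E / r <= ln (N + 1).
  rewrite -ler_expR lnK ?posrE ?addr_gt0//; apply: le_trans (ltW (truncnS_gt _)) _.
  by rewrite lerDl.
pose g u := eta (r - N * u) + N * eta u.
(* The path starts at [u = e ^+ 2], where the entropy exceeds [eta r] by at most [3 * N * e]. *)
pose e := Num.min (Num.min 1 ((E - eta r) / (3 * N))) (r / (N + 1)).
have e0 : 0 < e by rewrite !lt_min ltr01 !divr_gt0 ?subr_gt0 ?mulr_gt0 ?addr_gt0.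
have [e1 [e2 e3]] : e <= 1 /\ e <= (E - eta r) / (3 * N) /\ e <= r / (N + 1).
  by rewrite /e !ge_min !lexx ?orbT.
have ee : e ^+ 2 <= e by rewrite expr2 ger_pMl.
have e20 : 0 < e ^+ 2 by rewrite exprn_gt0.
set u1 := r / (N + 1) in e3; have u1N : r - N * u1 = u1.
  by rewrite /u1; field; rewrite gt_eqF// addr_gt0.
have u10 : 0 < u1 by rewrite divr_gt0// addr_gt0.
have posu u : u <= u1 -> 0 < r - N * u.
  by move=> uu; rewrite (lt_le_trans u10)// -{1}u1N lerD2l lerN2 ler_pM2l.
have lo : g (e ^+ 2) <= E.
  have u0' := posu _ (le_trans ee e3).
  have h1 := eta_tangent u0' r0; have h2 := eta_sqr e20 e0 (lexx _).
  have lr : ln r <= 0 by rewrite ln_le0.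
  have h3 : (- ln r - 1) * (r - N * e ^+ 2 - r) <= N * e.
    have : 0 <= N * e ^+ 2 by rewrite mulr_ge0// ltW.
    have : N * e ^+ 2 <= N * e by rewrite ler_pM2l.
    move: (N * e ^+ 2) (N * e) lr; clear => p q; move: (ln r) => l; nra.
  have h4 : N * eta (e ^+ 2) <= N * (2 * e) by rewrite ler_pM2l.
  have h5 : 3 * N * e <= E - eta r by rewrite mulrC -ler_pdivlMr// mulr_gt0.
  rewrite /g; lra.
have hi : E <= g u1.
  have lu : ln u1 = ln r - ln (N + 1) by rewrite /u1 ln_div ?posrE// addr_gt0.
  have gE : g u1 = r * (ln (N + 1) - ln r).
    rewrite /g u1N /eta lu; have : (N + 1) * u1 = r by rewrite /u1; field; rewrite gt_eqF// addr_gt0.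
    move=> {3}<-; ring.
  have : r * ln r <= 0 by rewrite pmulr_rle0// ln_le0.
  by move: NE; rewrite ler_pdivrMr// gE => NE; lra.
have cg : {within `[e ^+ 2, u1], continuous g}.
  apply: continuous_in_subspaceT => u; rewrite inE /= in_itv /= => /andP[ue uu].
  have u0 : 0 < u by exact: lt_le_trans ue.
  apply: cvgD.
    apply: (@eta_cvg (fun v => r - N * v)); first exact: posu.
    by apply: cvgB; [exact: cvg_cst|apply: cvgM; [exact: cvg_cst|exact: cvg_id]].
  by apply: cvgM; [exact: cvg_cst|apply: (@eta_cvg id) => //; exact: cvg_id].
have [|u] := @IVT R g _ _ E (le_trans ee e3) cg.
  by rewrite ge_min lo le_max hi orbT.
rewrite in_itv /= => /andP[ue uu] gu; have u0 : 0 < u by exact: lt_le_trans ue.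
clearbody n; exists ((r - N * u) :: nseq n u); split=> //.
- by apply/allP => v; rewrite inE => /predU1P[->|/nseqP[-> _]]; [exact: posu|exact: u0].
- rewrite big_cons big_nseq iter_addr_0 -mulr_natl -/N; lra.
- by rewrite /sent big_cons big_nseq iter_addr_0 -mulr_natl -/N -/(g u).
Qed.

Definition weights ws := all (fun x => 0 < x) ws /\ \sum_(x <- ws) x = 1.

Lemma exists_min ws : ws != [::] -> exists2 a, a \in ws & forall x, x \in ws -> a <= x.
Proof.
elim: ws => // a [|b ws] ih _; first by exists a; rewrite ?mem_head// => x; rewrite inE => /eqP ->.
have [//|c cw cm] := ih; have [ac|ca] := leP a c.
  exists a; first exact: mem_head.
  by move=> x; rewrite inE => /predU1P[->//|/cm]; exact: le_trans.
exists c; first by rewrite inE cw orbT.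
by move=> x; rewrite inE => /predU1P[->|/cm//]; exact: ltW.
Qed.

(* The smallest weights of two vectors of equal entropy fit in a common vector. *)
Lemma common_weights ws vs : weights ws -> weights vs -> (2 < size ws)%N -> (2 < size vs)%N ->
  sent ws = sent vs -> exists a b us, [/\ a \in ws, b \in vs, us != [::],
    weights [:: a, b & us] & sent [:: a, b & us] = sent ws].
Proof.
(* With [b] minimal in [vs'] and [a <= b], the pair [a], [1 - a - b] is less equal than another
   weight [y] of [vs'] and the sum of the rest. So the mass left after [a] and [b] has entropy to
   spare, and [split_mass] uses it up. *)
have half ws' vs' a b : weights ws' -> weights vs' -> (2 < size vs')%N -> sent ws' = sent vs' ->
    a \in ws' -> b \in vs' -> (forall x, x \in vs' -> b <= x) -> a <= b ->
    exists us, [/\ us != [::], weights [:: a, b & us] & sent [:: a, b & us] = sent ws'].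
  move=> [w0 w1] [v0 v1] sv ent_eq aw bv bmin ab.
  have a0 : 0 < a by exact: (allP w0).
  have /perm_to_rem vp := bv; case ys: (rem b vs') vp => [|y [|z zs]] vp.
  - by move: sv; rewrite (perm_size vp).
  - by move: sv; rewrite (perm_size vp).
  have all0 : all (fun x => 0 < x) [:: b, y, z & zs] by rewrite -(perm_all _ vp).
  have sum1 : \sum_(x <- [:: b, y, z & zs]) x = 1 by rewrite -(perm_big _ vp).
  have ent1 : sent [:: b, y, z & zs] = sent vs' by rewrite /sent -(perm_big _ vp).
  have /andP[b0 /andP[y0 zs0']] := all0.
  have zs0 : all (fun x => 0 < x) (z :: zs) by exact: zs0'.
  have bz : b <= z by apply: bmin; rewrite (perm_mem vp) !inE eqxx !orbT.
  have by_ : b <= y by apply: bmin; rewrite (perm_mem vp) !inE eqxx !orbT.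
  have zsum : z <= \sum_(x <- z :: zs) x.
    rewrite big_cons lerDl big_seq sumr_ge0// => x xz; apply: ltW.
    by apply: (allP zs0); rewrite inE xz orbT.
  have h1 := eta_sum zs0; move: sum1 ent1; rewrite 2!big_cons => sum1.
  have -> : sent [:: b, y, z & zs] = eta b + (eta y + sent (z :: zs)) by rewrite /sent 2!big_cons.
  move=> ent1.
  set Z := \sum_(x <- z :: zs) x in zsum h1 sum1.
  have [|||us [us0 uspos uss use]] := @split_mass (1 - a - b) (sent ws' - eta a - eta b).
  - lra.
  - lra.
  - have := @pair_le a y (1 - b) a0 (le_trans ab by_); rewrite (_ : 1 - b - y = Z); last by lra.
    rewrite (_ : 1 - b - a = 1 - a - b); last by ring.
    move=> h2; have : y <= 1 - a - b by lra.
    move=> /h2; rewrite ent_eq -ent1; lra.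
  exists us; split=> //; last by rewrite /sent !big_cons -/(sent us) -/(sent ws') use; ring.
  by split; [rewrite /= a0 b0|rewrite !big_cons uss; ring].
move=> hw hv sw sv ent_eq.
have [|a aw amin] := @exists_min ws; first by case: (ws) sw.
have [|b bv bmin] := @exists_min vs; first by case: (vs) sv.
have [ab|/ltW ba] := leP a b.
  by have [us [h1 h2 h3]] := half ws vs a b hw hv sv ent_eq aw bv bmin ab; exists a, b, us.
have [us [h1 [h2 h2'] h3]] := half vs ws b a hv hw sw (esym ent_eq) bv aw amin ba.
exists a, b, us; split=> //.
  by split; [move: h2; rewrite /= andbCA|move: h2'; rewrite !big_cons addrCA].
by rewrite ent_eq -h3 /sent !big_cons addrCA.
Qed.

(* A small mass [r] is left when [m0] is close to a root of
   [x ^+ k.+2 * (1 - x) = p * q ^+ k.+2]; splitting it restores the entropy. *)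
Lemma two_letter_weights p q k : 0 < q -> q <= p -> p + q = 1 -> exists m0 m1 us,
  [/\ us != [::], weights [:: m0, m1 & us], m0 ^+ k.+2 * m1 = p * q ^+ k.+2 &
      sent [:: m0, m1 & us] = sent [:: p; q]].
Proof.
move=> q0 qp pq; have p0 : 0 < p by exact: lt_le_trans qp.
pose psi x : R := x ^+ k.+2 * (1 - x); pose P := p * q ^+ k.+2.
have P0 : 0 < P by rewrite mulr_gt0// exprn_gt0.
(* If [p > q] then [psi p] already exceeds [P]. If both are $1/2$ the two values coincide, and
   $2/3$, the maximiser of [psi] for [k = 0], works for every [k]. *)
have [y [py y1 psiy]] : exists y, [/\ p <= y, y < 1 & P < psi y].
  have [pq'|qp'] := eqVneq p q; last first.
    exists p; split=> //; first by lra.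
    have lqp : q < p by rewrite lt_neqAle eq_sym qp' qp.
    rewrite /psi /P (_ : 1 - p = q); last by lra.
    rewrite [p ^+ _]exprS -mulrA ltr_pM2l// [q ^+ _]exprSr ltr_pM2r//.
    by rewrite ltrXn2r// ?nnegrE ?ltW.
  have q2 : q = 2^-1 by lra.
  exists (2 / 3); split; [by lra|by lra|].
  rewrite /psi /P pq' q2 -exprS !exprSr.
  have h : (2^-1 : R) ^+ k <= (2 / 3) ^+ k by rewrite lerXn2r ?nnegrE//; lra.
  have h0 : (0 : R) < 2^-1 ^+ k by rewrite exprn_gt0.
  move: h h0; clear; move: (2^-1 ^+ k) ((2 / 3) ^+ k) => u v; lra.
have y0 : 0 < y by exact: lt_le_trans py.
have yk0 : 0 < y ^+ k.+2 by rewrite exprn_gt0.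
(* [B] bounds the coming [m1] and lies below [1 - y <= q]. The points [B' < c < q] inserted above it
   secure an entropy gain [gap], compared with which the remainder will be negligible. *)
pose B := P / y ^+ k.+2; have By : B < 1 - y by rewrite ltr_pdivrMr// mulrC.
have B0 : 0 < B by rewrite divr_gt0.
pose B' := (B + (1 - y)) / 2; pose c := (B' + q) / 2.
have [BB' [B'q B'c]] : B < B' /\ B' < q /\ B' < c by rewrite /c /B'; lra.
have cq : c < q by rewrite /c; lra.
pose gap := (c - B') * (ln (1 - c) - ln c).
have gap0 : 0 < gap.
  rewrite mulr_gt0 ?subr_gt0// ltr_ln ?posrE; lra.
pose e := Num.min (Num.min 1 (gap / 3)) ((1 - y - B) / 2).
have e0 : 0 < e by rewrite !lt_min ltr01 !divr_gt0// subr_gt0.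
have [e1 [e2 e3]] : e <= 1 /\ e <= gap / 3 /\ e <= (1 - y - B) / 2.
  by rewrite /e !ge_min !lexx ?orbT.
have ee : e ^+ 2 <= e by rewrite expr2 ger_pMl.
have e20 : 0 < e ^+ 2 by rewrite exprn_gt0.
(* [tau] is the excess of [psi m0] over [P]; divided by [m0 ^+ k.+2] it becomes the mass left after
   [m0] and [m1]. *)
pose tau := Num.min ((psi y - P) / 2) (e ^+ 2 * y ^+ k.+2).
have tau0 : 0 < tau by rewrite lt_min divr_gt0 ?subr_gt0//= mulr_gt0.
have [tau1 tau2] : tau <= (psi y - P) / 2 /\ tau <= e ^+ 2 * y ^+ k.+2.
  by rewrite /tau !ge_min !lexx ?orbT.
have cpsi : {within `[y, 1], continuous psi}.
  apply: continuous_in_subspaceT => x _; apply: cvgM; first exact: exprn_continuous.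
  by apply: cvgB; [exact: cvg_cst|exact: cvg_id].
have [|m0] := @IVT R psi _ _ (P + tau) (ltW y1) cpsi.
  rewrite ge_min le_max; apply/andP; split; apply/orP.
    by right; rewrite /psi subrr mulr0; lra.
  by left; lra.
rewrite in_itv /= => /andP[ym m1'] psim; have m00 : 0 < m0 by exact: lt_le_trans ym.
have mk0 : 0 < m0 ^+ k.+2 by rewrite exprn_gt0.
have yk : y ^+ k.+2 <= m0 ^+ k.+2 by rewrite lerXn2r ?nnegrE// ltW.
pose m1 := P / m0 ^+ k.+2; have m10 : 0 < m1 by rewrite divr_gt0.
pose r := tau / m0 ^+ k.+2; have r0 : 0 < r by rewrite divr_gt0.
have sum1 : m0 + m1 + r = 1.
  have : m1 + r = psi m0 / m0 ^+ k.+2 by rewrite psim /m1 /r -mulrDl.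
  by rewrite /psi mulrAC divff ?gt_eqF// mul1r; lra.
have m1B : m1 <= B by rewrite /m1 /B ler_pM2l// lef_pV2.
have re : r <= e ^+ 2.
  by rewrite /r ler_pdivrMr// (le_trans tau2)// ler_pM2l.
(* The three masses are compared in turn with the pairs [m1 + r, m0], then [B', 1 - B'], then
   [c, 1 - c], then [q, p]. The first comparison loses at most [r + eta r <= 3 * e], and [gap] pays
   for it. *)
have key : eta r <= eta p + eta q - eta m0 - eta m1.
  have h1 : eta m1 + eta r <= eta (m1 + r) + r + eta r.
    rewrite lerD2r /eta mulrDl.
    have x0 : 0 < m1 + r by rewrite addr_gt0.
    have g1 := ler_wpM2l (ltW m10) (ln_tangent m10 x0).
    have g2 : m1 * ((m1 + r) / m1 - 1) = r by field; rewrite gt_eqF.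
    have g3 : r * ln (m1 + r) <= 0 by rewrite pmulr_rle0// ln_le0//; lra.
    move: g1; rewrite g2 mulrBr; lra.
  have xB : m1 + r <= B' by rewrite /B'; lra.
  have h2 := @pair_le (m1 + r) B' 1 (addr_gt0 m10 r0) xB.
  have h3 : eta B' + eta (1 - B') <= eta c + eta (1 - c) - gap by apply: pair_gap; lra.
  have h4 := @pair_le c q 1.
  have h5 := eta_sqr r0 e0 re.
  have E1 : eta (1 - (m1 + r)) = eta m0 by congr eta; lra.
  have E2 : eta (1 - q) = eta p by congr eta; lra.
  rewrite E1 in h2; rewrite E2 in h4.
  have {}h2 : eta (m1 + r) + eta m0 <= eta B' + eta (1 - B') by apply: h2; lra.
  have {}h4 : eta c + eta (1 - c) <= eta q + eta p by apply: h4; lra.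
  lra.
have [|us [us0 uspos uss use]] := @split_mass r _ r0 _ key; first by lra.
exists m0, m1, us; split=> //.
- by split; [rewrite /= m00 m10|rewrite !big_cons uss addrA].
- by rewrite /m1 mulrCA divff ?gt_eqF// mulr1.
- by rewrite /sent !big_cons big_nil -/(sent us) use addr0; ring.
Qed.

End Entropy.

Section Realize.
Context {R : realType} (n : nat) (p : nat -> R).
Hypothesis p_ge0 : forall i, 0 <= p i.
Hypothesis p_sum : \sum_(i < n.+1) p i = 1.

Definition weighted := msum (fun i => mscale (NngNum (p_ge0 i))
  (@dirac _ (letter n) (inord i) R)) n.+1.

HB.instance Definition _ := Measure.on weighted.

Lemma weightedE (A : set (letter n)) : weighted A = (\sum_(i < n.+1) p i * \1_A (i : letter n))%:E.
Proof.
rewrite /weighted /msum -sumEFin; apply: eq_bigr => i _.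
by rewrite /mscale /dirac /= inord_val.
Qed.

Lemma weighted_setT : weighted setT = 1%E.
Proof.
rewrite (weightedE setT) -p_sum; congr _%:E; apply: eq_bigr => i _.
by rewrite indicT mulr1.
Qed.

Lemma weighted1 (l : letter n) : fine (weighted [set l]) = p l.
Proof.
rewrite (weightedE [set l]) /= (bigD1 l)//= big1 ?addr0.
  by rewrite indicE mem_set ?mulr1.
by move=> i /negPf il; rewrite indicE memNset ?mulr0//= => e; rewrite e eqxx in il.
Qed.

End Realize.

Lemma realize_weights (R : realType) (ws : seq R) : weights ws -> exists n (mu : probability (letter n) R),
  size ws = n.+1 /\ forall l, wt mu l = nth 0 ws l.
Proof.
move=> [/allP w0 w1]; have [n sn] : exists n, size ws = n.+1.
  by case: ws w0 w1 => [_|v vs]; [rewrite big_nil => /eqP; rewrite eq_sym oner_eq0|exists (size vs)].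
have p0 i : 0 <= nth 0 ws i.
  by have [iw|iw] := ltnP i (size ws); [exact/ltW/w0/mem_nth|rewrite nth_default].
have ps : \sum_(i < n.+1) nth 0 ws i = 1 by move: w1; rewrite (big_nth 0) big_mkord sn.
pose mu : probability (letter n) R := HB.pack_for (probability (letter n) R) (@weighted R n _ p0)
  (Measure_isProbability.Build _ _ _ (@weighted R n _ p0) (weighted_setT p0 ps)).
by exists n, mu; split=> // l; exact: (weighted1 p0 l).
Qed.

(** * Composition of isomorphisms *)

Section FisoTheory.
Context {R : realType} {G : groupType}.
Hypothesis countG : countable [set: G].

Lemma half_negligible d1 d2 (L : measurableType d1) (K : measurableType d2)
    (lambda : probability L R) (kappa : probability K R) phi E :
  @half_fiso R G _ _ L K lambda kappa phi -> (product_probability G kappa).-negligible E ->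
  (product_probability G lambda).-negligible (phi @^-1` E).
Proof.
move=> [mphi pphi _ _] [B [mB B0 EB]]; exists (phi @^-1` B); split.
- by rewrite -[X in measurable X]setTI; exact: mphi.
- by rewrite pphi.
- by move=> x; exact: EB.
Qed.

Lemma half_comp d1 d2 d3 (L : measurableType d1) (K : measurableType d2) (M : measurableType d3)
    (lambda : probability L R) (kappa : probability K R) (mu : probability M R) phi psi :
  @half_fiso R G _ _ L K lambda kappa phi -> @half_fiso R G _ _ K M kappa mu psi ->
  half_fiso lambda mu (psi \o phi).
Proof.
move=> hphi hpsi; have [m1 p1 e1 [X0 [nX X0l]]] := hphi; have [m2 p2 e2 [Y0 [nY Y0l]]] := hpsi.
split.
- exact: measurableT_comp.
- by move=> B mB; rewrite comp_preimage p1 ?p2// -[X in measurable X]setTI; exact: m2.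
- by move=> g x; rewrite /= e1 e2.
exists (X0 `&` phi @^-1` Y0); split.
  by rewrite setCI preimage_setC; apply: negligibleU => //; exact: half_negligible hphi _.
move=> x g [Xx Yx]; have [t ht] := Y0l _ g Yx.
(* The finitely many letters of [phi x] needed by [psi] depend together on finitely many coordinates
   of [x]. *)
have [s hs] : exists s : seq G, forall y, X0 y -> (forall h, h \in s -> x h = y h) ->
    forall h, h \in t -> phi x h = phi y h.
  elim: t {ht} => [|h t [s hs]]; first by exists [::].
  have [s' hs'] := X0l _ h Xx; exists (s' ++ s) => y Xy xy h'; rewrite inE => /predU1P[->|h't].
    by apply: hs' => // z zs; apply: xy; exact: mem_catl.
  by apply: (hs y) => // z zs; apply: xy; exact: mem_catr.
by exists s => y [Xy Yy] xy; apply: ht => //; exact: hs.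
Qed.

Lemma fiso_sym d1 d2 (L : measurableType d1) (K : measurableType d2)
    (lambda : probability L R) (kappa : probability K R) :
  @fiso R G _ _ L K lambda kappa -> fiso G kappa lambda.
Proof. by move=> [phi [psi [h1 h2 h3 h4]]]; exists psi, phi. Qed.

Lemma fiso_trans d1 d2 d3 (L : measurableType d1) (K : measurableType d2) (M : measurableType d3)
    (lambda : probability L R) (kappa : probability K R) (mu : probability M R) :
  @fiso R G _ _ L K lambda kappa -> @fiso R G _ _ K M kappa mu -> fiso G lambda mu.
Proof.
move=> [phi [psi [h1 h2 h3 h4]]] [phi' [psi' [k1 k2 k3 k4]]].
exists (phi' \o phi), (psi \o psi'); split; [exact: half_comp h1 k1|exact: half_comp k2 h2| |].
  apply: negligibleS (negligibleU h3 (half_negligible h1 k3)) => x /=.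
  apply: contra_notP => /not_orP[/contrapT a /contrapT c].
  by rewrite /= in c; rewrite c.
apply: negligibleS (negligibleU k4 (half_negligible k2 h4)) => x /=.
apply: contra_notP => /not_orP[/contrapT a /contrapT c].
by rewrite /= in c; rewrite c.
Qed.

Lemma half_pointwise d1 d2 (L : measurableType d1) (K : measurableType d2)
    (lambda : probability L R) (kappa : probability K R) (g : L -> K) :
  finite_set [set: L] -> (forall A : set L, measurable A) ->
  finite_set [set: K] -> (forall A : set K, measurable A) ->
  (forall B, lambda (g @^-1` B) = kappa B) ->
  @half_fiso R G _ _ L K lambda kappa (fun x i => g (x i)).
Proof.
move=> finL discL finK discK gE; set phi := fun _ => _.
have mphi : measurable_fun [set: config G L] (phi : config G L -> config G K).
  apply: (@measurability _ _ _ _ _ _ (coord_sets G K)) => //.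
  move=> _ [_ [i _ [B mB <-]] <-]; rewrite setTI; apply: sub_sigma_algebra.
  by exists i => //; exists (g @^-1` B).
have PL := product_probabilityP lambda countG finL discL.
have PK := product_probabilityP kappa countG finK discK.
pose phim : {mfun config G L >-> config G K} := HB.pack_for {mfun config G L >-> config G K}
  (phi : config G L -> config G K) (isMeasurableFun.Build _ _ _ _ _ mphi).
split=> //.
  move=> B mB; apply: (@product_probability_unique _ _ _ _ kappa
    (distribution (product_probability G lambda) phim) _ _ PK B mB).
  move=> s A us mA; rewrite /distribution /pushforward.
  rewrite (eq_bigr (fun i => fine (lambda (g @^-1` A i)))) => [|i _]; last by rewrite gE.
  by rewrite -(PL s (fun i => g @^-1` A i) us (fun i => discL _)).
exists setT; split; first by rewrite setCT; exact: negligible_set0.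
by move=> x h _; exists [:: h] => y _ xy; rewrite /phi xy// mem_head.
Qed.

Lemma coordinate_negligible d (L : measurableType d) (lambda : probability L R) (N : set L) :
  finite_set [set: L] -> (forall A : set L, measurable A) -> lambda N = 0%E ->
  (product_probability G lambda).-negligible [set x | exists i, N (x i)].
Proof.
move=> finL discL N0; have /countable_injP[code cinj] := countG.
have code_inj : injective code by move=> g h; apply: cinj; rewrite inE.
apply: (@negligible_exists R _ (config G L) (product_probability G lambda) G code
  (fun i => [set x : config G L | N (x i)]) code_inj) => i.
have PL := product_probabilityP lambda countG finL discL.
have := PL [:: i] (fun=> N) isT (fun=> discL _); rewrite big_seq1 N0 /= => h.
exists [set x | forall j, j \in [:: i] -> N (x j)]; split=> //.
  rewrite (_ : [set x | _] = (fun x : config G L => x i) @^-1` N).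
    by apply: sub_sigma_algebra; exists i => //; exists N.
  apply/seteqP; split=> x /=; first by apply; rewrite mem_head.
  by move=> Nx j; rewrite inE => /eqP ->.
by move=> x Nx j; rewrite inE => /eqP ->.
Qed.

Lemma measure_eq_off_null d (L : measurableType d) (lambda : probability L R) (N A B : set L) :
  (forall A : set L, measurable A) -> lambda N = 0%E -> A `<=` B `|` N -> B `<=` A `|` N ->
  lambda A = lambda B.
Proof.
move=> discL N0; have le C D : C `<=` D `|` N -> (lambda C <= lambda D)%E.
  move=> CD; apply: (@le_trans _ _ (lambda (D `|` N))); first by apply: le_measure; rewrite ?inE.
  apply: (@le_trans _ _ (lambda D + lambda N)%E); first by apply: measureU2; exact: discL.
  by rewrite [X in (_ + X)%E]N0 adde0.
by move=> AB BA; apply/eqP; rewrite eq_le !le.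
Qed.

(* Null atoms are discarded and the remaining ones are numbered. *)
Lemma relabel d (L : measurableType d) (lambda : probability L R) :
  finite_set [set: L] -> (forall A : set L, measurable A) ->
  exists n (mu : probability (letter n) R), [/\ fiso G lambda mu, forall l, 0 < wt mu l &
    ent (wt mu) = shannon_entropy lambda].
Proof.
move=> finL discL; pose w (l : L) : R := fine (lambda [set l]).
pose full := finmap.enum_fset (fset_set [set: L]).
have fullP l : l \in full by rewrite /full in_fset_set// inE.
pose A := [seq l <- full | 0 < w l].
have uA : uniq A by rewrite filter_uniq// finmap.fset_uniq.
pose N := [set l : L | l \notin A].
have w0 l : l \notin A -> lambda [set l] = 0%E.
  rewrite mem_filter fullP andbT -leNgt => wl.
  rewrite -(@fineK _ (lambda [set l])) ?fin_num_measure//; congr _%:E; apply/eqP.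
  by rewrite eq_le wl fine_ge0.
have N0 : lambda N = 0%E.
  have [B [mB B0 NB]] : lambda.-negligible N.
    have inj : injective (fun l => index l full).
      by move=> l l' e; rewrite -(nth_index l (fullP l)) e nth_index.
    apply: negligibleS (@negligible_exists _ _ _ lambda L _ (fun l => [set l' | l' = l /\ l \notin A]) inj _).
      by move=> l Nl; exists l.
    move=> l; have [lA|lA] := boolP (l \in A).
      apply: (@negligibleS _ _ _ lambda set0); last exact: negligible_set0.
      by move=> l' [_ /negP nA]; case: nA.
    by exists [set l]; split=> //; [exact: w0|move=> l' [->]].
  by apply/eqP; rewrite eq_le measure_ge0 andbT -B0; apply: le_measure; rewrite ?inE.
have [n sn] : exists n, size A = n.+1.
  case sA : (size A) => [|n]; last by exists n.
  have : lambda setT = 0%E.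
    rewrite -N0; congr (lambda _); apply/seteqP; split=> // l _.
    by rewrite /N /= (size0nil sA).
  by rewrite probability_setT => /eqP; rewrite eqe oner_eq0.
have [a0 _] : exists a, a \in A by case: (A) sn => // a l _; exists a; rewrite mem_head.
pose f (i : letter n) := nth a0 A i; pose g (l : L) : letter n := inord (index l A).
have gf i : g (f i) = i by rewrite /g /f index_uniq ?sn// inord_val.
have fg l : l \in A -> f (g l) = l.
  by move=> lA; rewrite /g /f inordK ?nth_index// -sn index_mem.
have mg : measurable_fun [set: L] g by move=> _ B _; exact: discL.
pose gm : {mfun L >-> letter n} := HB.pack_for {mfun L >-> letter n} g (isMeasurableFun.Build _ _ _ _ g mg).
pose mu : probability (letter n) R := distribution lambda gm.
have wtE i : wt mu i = w (f i).
  rewrite /wt /w; congr fine; apply: (measure_eq_off_null discL N0) => l /=.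
    move=> gl; have [lA|lA] := boolP (l \in A); [left|by right].
    by rewrite -gl -[LHS](fg l lA).
  by move=> ->; left; exact: gf.
have finK := letter_finite n; have discK : forall B : set (letter n), measurable B by [].
exists n, mu; split.
- exists (fun x i => g (x i)), (fun y i => f (y i)); split.
  + by apply: half_pointwise.
  + apply: half_pointwise => // C; apply: (measure_eq_off_null discL N0) => l /=.
      by move=> h; have [lA|lA] := boolP (l \in A); [left; rewrite -(fg l lA)|right].
    by move=> Cl; have [lA|lA] := boolP (l \in A); [left; rewrite fg|right].
  + apply: negligibleS (coordinate_negligible finL discL N0) => x; apply: contra_notP => none.
    apply/funext => i; apply: fg; apply: contrapT => ni; apply: none; exists i; exact/negP.
  + apply: (@negligibleS _ _ _ (product_probability G mu) set0); last exact: negligible_set0.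
    by move=> y; apply; apply/funext => i; exact: gf.
- move=> l; rewrite wtE; have : f l \in A by apply: mem_nth; rewrite sn.
  by rewrite mem_filter => /andP[].
rewrite /ent /shannon_entropy (eq_bigr (fun i : letter n => eta (w (f i)))) => [|i _]; last by rewrite wtE.
rewrite fsbig_finite//=; transitivity (\sum_(l <- A) eta (w l)).
  by rewrite [RHS](big_nth a0) big_mkord sn.
rewrite /A big_filter [RHS](bigID (fun l => 0 < w l))/= [X in _ = _ + X]big1 ?addr0//.
move=> l wl; have -> : fine (lambda [set l]) = 0.
  by rewrite w0// mem_filter (negbTE wl).
by rewrite mul0r oppr0.
Qed.

End FisoTheory.

(** * Linking two alphabets of equal entropy *)

Section Final.
Context {R : realType} {G : groupType}.
Hypothesis countG : countable [set: G].
Hypothesis infG : infinite_set [set: G].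

Lemma ent_sent n (mu : probability (letter n) R) :
  ent (wt mu) = sent [seq wt mu l | l <- enum 'I_n.+1].
Proof. by rewrite /sent big_map big_enum; apply: eq_bigl. Qed.

Lemma wt_sum n (mu : probability (letter n) R) : \sum_l wt mu l = 1.
Proof.
rewrite /wt -(@Pr_setT R G n mu) (@Pr_partition R G n mu 1%g setT)//.
apply: eq_bigr => l _; rewrite setIT.
have := @Pr_cylinder R G countG n mu [:: 1%g] (fun=> l) isT; rewrite big_seq1 /wt => <-.
congr (Pr _ _); apply/seteqP; split=> x h; first exact: (h 1%g (mem_head _ _)).
by move=> g; rewrite inE => /eqP ->.
Qed.

Lemma weights_of n (mu : probability (letter n) R) : (forall l, 0 < wt mu l) ->
  weights [seq wt mu l | l <- enum 'I_n.+1].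
Proof.
move=> mu0; split; last by rewrite big_map big_enum -(wt_sum mu); apply: eq_bigl.
by apply/allP => x /mapP[l _ ->].
Qed.

Lemma sent_realized n (mu : probability (letter n) R) ws : size ws = n.+1 ->
  (forall l, wt mu l = nth 0 ws l) -> ent (wt mu) = sent ws.
Proof.
move=> sn wE; rewrite /sent (big_nth 0) big_mkord sn /ent.
by apply: eq_bigr => l _; rewrite wE.
Qed.

(* Two words with one special letter at [1], on a shape all of whose overlaps move [1]. *)
Lemma delta_fiso (F : seq G) n m (mu : probability (letter n) R) (nu : probability (letter m) R)
    (c d : letter n) (c' d' : letter m) :
  uniq F -> 1%g \in F ->
  (forall f f', f \in F -> f' \in F -> (f' * f^-1)%g \in F \/ (f * f'^-1)%g \in F) ->
  insular F -> (forall l, 0 < wt mu l) -> (forall l, 0 < wt nu l) ->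
  \prod_(f <- F) wt mu (if f == 1%g then c else d) = \prod_(f <- F) wt nu (if f == 1%g then c' else d') ->
  ent (wt mu) = ent (wt nu) -> (F = [:: 1%g] \/ c != d /\ c' != d') ->
  (exists e e', [/\ e != e', has (fun f => (if f == 1%g then c else d) != e) F &
    has (fun f => (if f == 1%g then c else d) != e') F]) ->
  (exists e e', [/\ e != e', has (fun f => (if f == 1%g then c' else d') != e) F &
    has (fun f => (if f == 1%g then c' else d') != e') F]) ->
  fiso G mu nu.
Proof.
move=> uF F1 diff insF mu0 nu0 wE eE cd free1 free2.
pose sz b := if b then n else m.
pose P b : probability (letter (sz b)) R := match b with true => mu | false => nu end.
pose w b : G -> letter (sz b) := match b with
  true => fun f => if f == 1%g then c else d | false => fun f => if f == 1%g then c' else d' end.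
have pos b l : 0 < wt (P b) l by case: b l.
have sep b g f f' : g != 1%g -> f \in F -> f' \in F -> (g * f)%g = f' ->
    exists f1 f2, [/\ f1 \in F, f2 \in F, (g * f1)%g = f2 & w b f1 != w b f2].
  move=> g1 fF f'F e; have gE : g = (f' * f^-1)%g by rewrite -e mulgK.
  have [F1'|[ncd ncd']] := cd.
    by move: g1 fF f'F; rewrite gE F1' !inE => /[swap] /eqP -> /[swap] /eqP ->; rewrite mulgV eqxx.
  have gi1 : g^-1%g != 1%g by apply: contra g1 => /eqP h; rewrite -[g]invgK h invg1.
  have [gF|gF] := diff _ _ fF f'F.
    exists 1%g, g; rewrite mulg1 gE; split=> //; rewrite -gE.
    by case: (b); rewrite /w eqxx (negbTE g1).
  exists g^-1%g, 1%g; rewrite mulgV; split=> //.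
    suff -> : g^-1%g = (f * f'^-1)%g by [].
    by apply: (@mulgI _ g); rewrite mulgV gE mulgA mulgVK mulgV.
  by case: (b); rewrite /w eqxx (negbTE gi1) eq_sym.
have free b : exists e e', [/\ e != e', has (fun f => w b f != e) F & has (fun f => w b f != e') F].
  by case: b.
exact: (@pattern_fiso R G (@PatternPair R G sz P F w countG infG uF F1 pos sep wE eE free)
  (fun b => insular_null (S := @PatternPair R G sz P F w countG infG uF F1 pos sep wE eE free) b insF)).
Qed.

Lemma two_others n (l : letter n) : (1 < n)%N -> exists e e', [/\ e != e', l != e & l != e'].
Proof.
move=> n1; have mk (i j : nat) : (i < n.+1)%N -> (j < n.+1)%N -> i != j -> val l != i -> val l != j ->
    exists e e' : letter n, [/\ e != e', l != e & l != e'].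
  by move=> hi hj ij li lj; exists (Ordinal hi), (Ordinal hj).
case l0 : (val l) => [|[|k]].
- by apply: (mk 1%N 2); rewrite ?l0// ltnS// ltnW.
- by apply: (mk 0%N 2); rewrite ?l0// ltnS.
- by apply: (mk 0%N 1%N); rewrite ?l0// ltnS ltnW.
Qed.

(** A word of one letter has no overlaps, and every uncovered site is an island by itself. At least
    three letters on each side leave two different from the marked one, as [p_free] demands. *)
Lemma shared_letter n m (mu : probability (letter n) R) (nu : probability (letter m) R) l l' :
  (1 < n)%N -> (1 < m)%N -> (forall l, 0 < wt mu l) -> (forall l, 0 < wt nu l) ->
  ent (wt mu) = ent (wt nu) -> wt mu l = wt nu l' -> fiso G mu nu.
Proof.
move=> n1 m1 mu0 nu0 eE lE; have [e [e' [ee le le']]] := two_others l n1.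
have [d [d' [dd ld ld']]] := two_others l' m1.
apply: (@delta_fiso [:: 1%g] n m mu nu l l l' l'); rewrite ?mem_head//.
- by move=> f f'; rewrite !inE => /eqP -> /eqP ->; left; rewrite mulgV.
- left; exists [:: 1%g]; split; first exact: mem_head.
  by move=> h f f'; rewrite !inE => /eqP -> /eqP -> /eqP ->; rewrite mulgV mulg1.
- by rewrite !big_seq1 eqxx.
- by left.
- by exists e, e'; rewrite /= !orbF eqxx.
- by exists d, d'; rewrite /= !orbF eqxx.
Qed.

Lemma many_letters n m (mu : probability (letter n) R) (nu : probability (letter m) R) :
  (1 < n)%N -> (1 < m)%N -> (forall l, 0 < wt mu l) -> (forall l, 0 < wt nu l) ->
  ent (wt mu) = ent (wt nu) -> fiso G mu nu.
Proof.
move=> n1 m1 mu0 nu0 eE.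
have size_of k (ka : probability (letter k) R) : size [seq wt ka l | l <- enum 'I_k.+1] = k.+1.
  by rewrite size_map; exact: size_enum_ord.
have [|||a [b [us [aw bw us0 hw he]]]] := common_weights (weights_of mu0) (weights_of nu0).
- by rewrite size_of.
- by rewrite size_of.
- by rewrite -!ent_sent.
have [k [rho [sk wE]]] := realize_weights hw.
have k1 : (1 < k)%N by move: sk us0 => /= -[<-]; case: (us).
have rho0 l : 0 < wt rho l by rewrite wE; apply: (allP hw.1); rewrite mem_nth// sk.
have rE : ent (wt rho) = ent (wt mu) by rewrite (sent_realized sk wE) he -ent_sent.
have /mapP[l _ la] := aw; have /mapP[l' _ lb] := bw.
apply: (fiso_trans (mu := nu) (kappa := rho)).
  by apply: (@shared_letter n k mu rho l ord0) => //; rewrite wE.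
apply: (@shared_letter k m rho nu (inord 1) l') => //; first by rewrite rE.
by rewrite wE inordK// ltnS ltnW.
Qed.

Lemma two_letters (mu : probability (letter 1) R) : (forall l, 0 < wt mu l) ->
  exists m (nu : probability (letter m) R), [/\ (1 < m)%N, forall l, 0 < wt nu l,
    ent (wt mu) = ent (wt nu) & fiso G mu nu].
Proof.
move=> mu0; have [c [d [cd dc allE]]] : exists c d : letter 1, [/\ c != d, wt mu d <= wt mu c &
    forall (f : letter 1 -> R), \sum_l f l = f c + f d].
  have sumE (f : letter 1 -> R) : \sum_l f l = f ord0 + f ord_max.
    rewrite (big_ord_recl 1) big_ord1; congr (_ + f _); exact: val_inj.
  have [h|/ltW h] := leP (wt mu ord0) (wt mu ord_max).
    by exists ord_max, ord0; split=> // f; rewrite sumE addrC.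
  by exists ord0, ord_max; split=> // f; rewrite sumE.
have [F [uF F1 sF diff insF]] := shape_exists infG.
have /perm_to_rem Fp := F1; have [k kE] : exists k, size (rem 1%g F) = k.+2.
  by move: sF; rewrite (perm_size Fp)/=; case: (size _) => [|[|k]]// _; exists k.
have remN f : f \in rem 1%g F -> f != 1%g by rewrite mem_rem_uniq// inE => /andP[].
have prodF n (ka : probability (letter n) R) (u v : letter n) :
    \prod_(f <- F) wt ka (if f == 1%g then u else v) = wt ka u * wt ka v ^+ k.+2.
  rewrite (perm_big _ Fp) big_cons eqxx; congr (_ * _).
  rewrite big_seq (eq_bigr (fun=> wt ka v)) => [|f /remN /negbTE ->//].
  by rewrite -big_seq big_const_seq count_predT kE iter_mulr_1.
have pq : wt mu c + wt mu d = 1 by rewrite -(wt_sum mu) allE.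
have [m0 [m1 [us [us0 hw hp he]]]] := two_letter_weights k (mu0 d) dc pq.
have [m [nu [sm wE]]] := realize_weights hw.
have mgt1 : (1 < m)%N by move: sm us0 => /= -[<-]; case: (us).
have nu0 l : 0 < wt nu l by rewrite wE; apply: (allP hw.1); rewrite mem_nth// sm.
have eE : ent (wt mu) = ent (wt nu).
  by rewrite (sent_realized sm wE) he /sent 2!big_cons big_nil addr0 /ent allE.
exists m, nu; split=> //.
pose i1 : letter m := inord 1; have i1E : val i1 = 1%N by rewrite /= inordK// ltnS ltnW.
have i10 : i1 != ord0 by rewrite -val_eqE i1E.
have [f0 f0F f01] : exists2 f, f \in F & f != 1%g.
  case rE : (rem 1%g F) kE => [|f s]// _; have fr : f \in rem 1%g F by rewrite rE mem_head.
  by exists f; [exact: (mem_rem fr)|exact: remN].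
have free n (u v : letter n) : u != v -> exists e e',
    [/\ e != e', has (fun f => (if f == 1%g then u else v) != e) F &
      has (fun f => (if f == 1%g then u else v) != e') F].
  move=> uv; exists u, v; split=> //; apply/hasP.
    by exists f0; rewrite // (negbTE f01) eq_sym.
  by exists 1%g; rewrite // eqxx.
(* The special letter at 1 has weight [p] on one side and [m1] on the other, the repeated letters
   have weights [q] and [m0]; equality of the word probabilities is then [hp]. *)
apply: (@delta_fiso F 1 m mu nu c d i1 ord0) => //; [|by right|exact: free|exact: free].
by rewrite !prodF !wE i1E -hp mulrC.
Qed.

(** Zero entropy means a single letter on both sides, where the identity works. Otherwise each side
    is first joined to an alphabet with at least three letters. *)
Lemma letters_fiso n m (mu : probability (letter n) R) (nu : probability (letter m) R) :
  (forall l, 0 < wt mu l) -> (forall l, 0 < wt nu l) -> ent (wt mu) = ent (wt nu) -> fiso G mu nu.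
Proof.
have single (ka : probability (letter 0) R) : ent (wt ka) = 0.
  rewrite /ent big_ord1; have := wt_sum ka; rewrite big_ord1 => ->.
  by rewrite ln1 mulr0 oppr0.
have pos k (ka : probability (letter k.+1) R) : (forall l, 0 < wt ka l) -> 0 < ent (wt ka).
  move=> ka0; apply: (@ent_gt0 R (letter k.+1) (wt ka) ord0 ord_max) => //.
  by split; [move=> l; exact: ltW|exact: wt_sum].
have many k (ka : probability (letter k) R) : (0 < k)%N -> (forall l, 0 < wt ka l) ->
    exists m (nu : probability (letter m) R), [/\ (1 < m)%N, forall l, 0 < wt nu l,
      ent (wt ka) = ent (wt nu) & fiso G ka nu].
  case: k ka => [//|[|k]] ka _ ka0; first exact: two_letters.
  by exists k.+2, ka; split=> //; exact: many_letters.
case: n mu => [|n] mu mu0; case: m nu => [|m] nu nu0 eE.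
- have e (A : set (letter 0)) : mu A = nu A.
    have [[l Al]|none] := pselect (exists l, A l).
      have -> : A = setT by apply/seteqP; split=> // l' _; rewrite (ord1 l') -(ord1 l).
      by rewrite !probability_setT.
    have -> : A = set0 by apply/seteqP; split=> // l Al; apply: none; exists l.
    by rewrite !measure0.
  have fin0 := letter_finite 0; have disc0 : forall B : set (letter 0), measurable B by [].
  exists (fun x i => id (x i)), (fun x i => id (x i)); split.
  + by apply: (@half_pointwise R G countG _ _ _ _ mu nu id).
  + by apply: (@half_pointwise R G countG _ _ _ _ nu mu id) => // B; rewrite -e.
  + by apply: (@negligibleS _ _ _ (product_probability G mu) set0); [|exact: negligible_set0].
  + by apply: (@negligibleS _ _ _ (product_probability G nu) set0); [|exact: negligible_set0].
- by have := pos _ _ nu0; rewrite -eE single ltxx.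
- by have := pos _ _ mu0; rewrite eE single ltxx.
have [k1 [rho1 [h1 p1 e1 f1]]] := many _ mu isT mu0.
have [k2 [rho2 [h2 p2 e2 f2]]] := many _ nu isT nu0.
apply: (fiso_trans f1); apply: (fiso_trans _ (fiso_sym f2)).
by apply: many_letters => //; rewrite -e1 -e2.
Qed.

End Final.

(** * From finite windows to continuity in the product topology *)

Section Topology.
Context {G : choiceType} {dL dK : measure_display} {L : measurableType dL} {K : measurableType dK}.

Lemma cylinder_nbhs (x : config G L) (s : seq G) :
  nbhs x [set y | forall h, h \in s -> x h = y h].
Proof.
elim: s => [|h s ih]; first by apply: filterS (@filterT _ (nbhs x) _).
have c := @proj_continuous _ (fun=> discrete_topology L) h x _ (discrete_set1 (x h : discrete_topology L)).
apply: filterS2 ih c => y ys /= yh g; rewrite inE => /predU1P[->|]; [exact/esym|exact: ys].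
Qed.

Lemma local_continuous (X0 : set (config G L)) (phi : config G L -> config G K) :
  (forall x g, X0 x -> exists s : seq G, forall y, X0 y -> (forall h, h \in s -> x h = y h) ->
    phi x g = phi y g) ->
  {within X0, continuous phi}.
Proof.
(* The product topology is a supremum of topologies pulled back along coordinates, so one coordinate
   at a time suffices. *)
move=> loc; apply/subspace_continuousP => x X0x; apply/cvg_sup => g.
apply/cvg_image; first by rewrite -subTset => l _ /=; exists (fun=> l).
move=> U /= U0; have [s hs] := loc x g X0x.
exists [set y | U (y g)] => //=; last first.
  by apply/seteqP; split=> l /=; [move=> [y Uy <-]|move=> Ul; exists (fun=> l)].
apply: filterS (cylinder_nbhs x s) => y ys X0y.
have Ux : U (phi x g) by exact: nbhs_singleton U0.
by rewrite (hs y X0y ys) in Ux.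
Qed.

End Topology.

Theorem theorem1p3 (R : realType) (G : groupType)
    (Gcountable : countable [set: G]) (Ginfinite : infinite_set [set: G])
    (dL dK : measure_display)
    (L : measurableType dL) (K : measurableType dK)
    (Lfinite : finite_set [set: L]) (Lstandard : forall A : set L, measurable A)
    (Kfinite : finite_set [set: K]) (Kstandard : forall B : set K, measurable B)
    (lambda : probability L R) (kappa : probability K R)
    (sameH : shannon_entropy lambda = shannon_entropy kappa) :
  finitarily_isomorphic
    (@bernoulli_shift G L) (product_probability G lambda)
    (@bernoulli_shift G K) (product_probability G kappa).
Proof.
have [n [mu [f1 mu0 e1]]] := relabel Gcountable lambda Lfinite Lstandard.
have [m [nu [f2 nu0 e2]]] := relabel Gcountable kappa Kfinite Kstandard.
have eE : ent (wt mu) = ent (wt nu) by rewrite e1 e2.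
have [phi [psi [hphi hpsi k1 k2]]] : fiso G lambda kappa.
  apply: (fiso_trans f1); apply: (fiso_trans _ (fiso_sym f2)).
  exact: (@letters_fiso R G Gcountable Ginfinite n m mu nu mu0 nu0 eE).
have [m1 p1 e1' [X0 [nX X0l]]] := hphi; have [m2 p2 e2' [Y0 [nY Y0l]]] := hpsi.
pose phim : {mfun config G L >-> config G K} := HB.pack_for {mfun config G L >-> config G K}
  phi (isMeasurableFun.Build _ _ _ _ phi m1).
pose psim : {mfun config G K >-> config G L} := HB.pack_for {mfun config G K >-> config G L}
  psi (isMeasurableFun.Build _ _ _ _ psi m2).
exists phim, psim; split.
- by split=> [B mB|A mA]; [exact: p1|exact: p2].
- by split; [exact: negligibleS k1|exact: negligibleS k2].
(* [bernoulli_shift g] is [tr g^-1], hence the inverse. *)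
- move=> g; apply: (@aeW _ _ _ (product_probability G lambda)) => x; exact: (e1' g^-1%g x).
- by exists X0; split=> //; exact: local_continuous.
- by exists Y0; split=> //; exact: local_continuous.
Qed.
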